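(* Let $0<\delta<\frac12$. There is a constant $A=A(\delta)>0$, depending only on $\delta$, such that the following holds. Let $\chi$ be a non-principal Dirichlet character modulo $q$, and suppose that $L(s,\chi)\neq 0$ for every $s$ in the region $$\mathcal{R}''(\delta):=\{\sigma+it:\ 1-\delta<\sigma<1,\ t\in\mathbb{R}\}.$$ Then $$n(\chi)\le A\,(\log q)^{1/\delta}.$$
   Context: For a non-principal Dirichlet character $\chi$ modulo $q$, $n(\chi)$ denotes the least character non-residue of $\chi$: the least positive integer $n$ such that $\gcd(n,q)=1$ (so that $\chi(n)\neq 0$) and $\chi(n)\neq 1$. $L(s,\chi)$ denotes the Dirichlet $L$-function of $\chi$ (analytically continued to the whole complex plane), with $s=\sigma+it$. *)

(* Defs.v *)
From Stdlib Require Import Reals Lra Lia Arith Wf_nat Classical.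
From Coquelicot Require Import Coquelicot.

Open Scope R_scope.

(* A Dirichlet character modulo q as an arithmetic function extended by 0;
   chi 1 = 1 follows from the last two fields. *)
Record is_dirichlet_character (q : nat) (chi : nat -> C) : Prop := {
  dchar_modulus_pos : (1 <= q)%nat;
  dchar_periodic : forall n : nat, chi (n + q)%nat = chi n;
  dchar_mult : forall m n : nat, chi (m * n)%nat = (chi m * chi n)%C;
  dchar_support : forall n : nat, chi n <> RtoC 0 <-> Nat.gcd n q = 1%nat
}.

Definition is_principal (q : nat) (chi : nat -> C) : Prop :=
  forall n : nat, Nat.gcd n q = 1%nat -> chi n = RtoC 1.

Definition is_nonresidue (q : nat) (chi : nat -> C) (n : nat) : Prop :=
  (1 <= n)%nat /\ Nat.gcd n q = 1%nat /\ chi n <> RtoC 1.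

Definition is_least_nonresidue (q : nat) (chi : nat -> C) (n : nat) : Prop :=
  is_nonresidue q chi n /\
  forall m : nat, is_nonresidue q chi m -> (n <= m)%nat.

Definition Cexp (z : C) : C :=
  (RtoC (exp (Re z)) * (cos (Im z), sin (Im z)))%C.

(* n^{-s}, meant for n >= 1 *)
Definition nat_cpow_opp (n : nat) (s : C) : C :=
  Cexp (- s * RtoC (ln (INR n)))%C.

Definition entire (f : C -> C) : Prop :=
  forall s : C, ex_derive (K := C_AbsRing) (V := C_NormedModule) f s.

(* L(s, chi) for non-principal chi: the Dirichlet series on Re s > 1, continued
   analytically to the whole plane. By the identity theorem at most one L
   satisfies this; for principal chi there is none, because of the pole at 1. *)
Definition is_dirichlet_L (chi : nat -> C) (L : C -> C) : Prop :=
  entire L /\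
  forall s : C, 1 < Re s ->
    is_series (K := C_AbsRing) (V := C_NormedModule)
      (fun k : nat => (chi (S k) * nat_cpow_opp (S k) s)%C) (L s).

Lemma least_nonresidue_exists (q : nat) (chi : nat -> C) :
  is_dirichlet_character q chi -> ~ is_principal q chi ->
  exists! n : nat, is_least_nonresidue q chi n.
Proof.
intros Hchi Hnp.
assert (Hex : exists n, is_nonresidue q chi n).
{ destruct (not_all_ex_not _ _ Hnp) as [n Hn].
  apply imply_to_and in Hn as [Hg Hn1].
  exists (n + q)%nat; repeat split.
  - pose proof (dchar_modulus_pos _ _ Hchi); lia.
  - now rewrite Nat.gcd_comm, Nat.gcd_add_diag_r, Nat.gcd_comm.
  - now rewrite (dchar_periodic _ _ Hchi). }
destruct (dec_inh_nat_subset_has_unique_least_element _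
  (fun n => classic (is_nonresidue q chi n)) Hex) as [n [Hn Hu]].
exists n; split; [exact Hn | exact Hu].
Qed.

(* Main.v *)
Require Import Defs.
From Stdlib Require Import Reals Lra Lia Psatz Classical ClassicalEpsilon List Permutation FinFun Factorial.
From Coquelicot Require Import Coquelicot.
From mathcomp Require ssreflect ssrfun ssrbool eqtype ssrnat div seq prime bigop fintype path.

Open Scope R_scope.

(** Suppose that [chi n = 1] for every [n] coprime to [q] up to [X = exp (2 K + 24)], where [K] is a large
    integer.  Put [m = 2 K^2] and [s0 = K + 1].  The proof evaluates in two ways the Taylor coefficient [c]
    of order [m], at [s0], of the logarithmic derivative [L'/L].

    On the side of the Dirichlet series, [- c] is the sum of [Lambda n * chi n * w n] with the weight
    [w n = n^{-s0} (ln n)^m / m!] ([log_deriv_coefficient]).  As a function of [ln n], the product [n * w n]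
    peaks at [ln n = 2 K] and its width there is bounded, because [m] is of the order of [K^2].  So the sum
    lives on the integers within a bounded factor of [exp (2 K)], where [chi n = 1] unless [n] has a factor in
    common with [q], and Chebyshev's bounds show that it is at least a constant times the peak value; the
    integers beyond [X] and those not coprime to [q] weigh less ([main_term_lower]).  By Stirling,
    the peak value is at least a constant times [K^{-(m+1)}] ([peak_lower]).

    On the side of the zeros, the zeros of [z |-> L (s0 + z)] in the disc of radius [K + 7/10] are divided out
    by Blaschke factors of the disc of radius [K + 9/10] ([factor_zeros]).  A zero [rho] contributes
    [rho^{-(m+1)}] and a mirrored term to [- c].  By the Euler product, the 3-4-1 inequality and the
    hypothesis on the strip ([zero_location]), either [Re rho <= - (K + delta)], and the contribution is at most
    [(K + delta)^{-(m+1)}], with a decay in the ordinate ([zero_power_bound]); or [rho = - K], which is the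
    point [s = 1], and then the contribution is negative because [m + 1] is odd.  Jensen's inequality at the
    point [s = 3] bounds the number of zeros, weighted by the same decay, by a constant times [ln q + K]
    ([jensen_count]); the zero-free quotient is handled by the Borel-Caratheodory inequality
    ([log_deriv_coef_bound]).  In total [- c] is at most a constant times [(ln q + K) (K + delta)^{-(m+1)}]
    ([log_deriv_coef_upper]).

    Comparing, [(1 + delta / K)^{2 K^2 + 1}], hence [exp (2 delta K)], is at most a constant times [ln q + K]
    ([conductor_lower]).  Taking [K] to be [ln (ln q) / (2 delta)] plus a large constant contradicts this, so
    some [n] up to [X], which is a constant times [(ln q)^{1/delta}], is a non-residue.

    The complex analysis is built from Goursat's theorem.  In logarithmic coordinates a rectangle of height
    [2 PI] is an annulus, so Goursat's theorem says that the mean of a holomorphic function over a circle does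
    not depend on the radius ([circ_invariant]); Cauchy's formula, Taylor coefficients and the maximum modulus
    principle are all read off from such means. *)

(** * Complex derivatives and continuity *)

Definition cder (f : C -> C) (z l : C) : Prop :=
  forall eps, 0 < eps -> exists d, 0 < d /\ forall h, Cmod h < d ->
    Cmod (f (z + h) - f z - l * h)%C <= eps * Cmod h.

Definition ccont (f : C -> C) (z : C) : Prop :=
  forall eps, 0 < eps -> exists d, 0 < d /\ forall h, Cmod h < d ->
    Cmod (f (z + h) - f z)%C < eps.

Lemma Ceq_re_im (a b : C) : Re a = Re b -> Im a = Im b -> a = b.
Proof. destruct a, b; simpl; intros -> ->; reflexivity. Qed.

Lemma Cmod_minus_sym (a b : C) : Cmod (a - b)%C = Cmod (b - a)%C.
Proof. rewrite <- Cmod_opp. f_equal. ring. Qed.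

Lemma Cmod_triangle_sub (a b : C) : Cmod (a - b)%C <= Cmod a + Cmod b.
Proof. unfold Cminus. eapply Rle_trans; [apply Cmod_triangle|]. rewrite Cmod_opp. lra. Qed.

Lemma Cmod_triangle_rev (a b : C) : Cmod a - Cmod b <= Cmod (a + b)%C.
Proof.
  pose proof (Cmod_triangle_sub (a + b)%C b) as H.
  replace (a + b - b)%C with a in H by ring. lra.
Qed.

Lemma Cmod_triangle_rev_sub (a b : C) : Cmod a - Cmod b <= Cmod (a - b)%C.
Proof. pose proof (Cmod_triangle_rev a (- b)%C) as H. rewrite Cmod_opp in H. exact H. Qed.

Lemma im_le_Cmod (c : C) : Rabs (Im c) <= Cmod c.
Proof. eapply Rle_trans; [|apply Rmax_Cmod]. apply Rmax_r. Qed.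

Lemma Cmod_le_abs (c : C) : Cmod c <= Rabs (Re c) + Rabs (Im c).
Proof.
  unfold Cmod. apply Rsqr_incr_0_var.
  - rewrite Rsqr_sqrt by nra. unfold Rsqr. rewrite <- (pow2_abs (fst c)), <- (pow2_abs (snd c)).
    pose proof (Rabs_pos (fst c)); pose proof (Rabs_pos (snd c)). unfold Re, Im. nra.
  - unfold Re, Im. pose proof (Rabs_pos (fst c)); pose proof (Rabs_pos (snd c)); lra.
Qed.

(** The epsilon form is what estimates use; the equivalence gives access to the rules of differentiation of
    general normed modules. *)
Lemma cder_is_derive (f : C -> C) (z l : C) : cder f z l <-> is_derive (K := C_AbsRing) (V := AbsRing_NormedModule C_AbsRing) f z l.
Proof.
  split.
  - intros H. split; [apply is_linear_scal_l|]. intros y Hy.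
    replace y with z by exact (is_filter_lim_locally_unique (K := C_AbsRing) (V := AbsRing_NormedModule C_AbsRing) _ _ Hy).
    intros eps. destruct (H eps (cond_pos eps)) as [d [Hd Hb]]. exists (mkposreal d Hd). intros w Hw.
    specialize (Hb (w - z)%C Hw). assert (E : (z + (w - z))%C = w :> C) by ring; rewrite E in Hb.
    change (Cmod (f w - f z - (w - z) * l)%C <= eps * Cmod (w - z)%C). now rewrite (Cmult_comm (w - z)).
  - intros [_ H] eps He. destruct (H z (fun P Q => Q) (mkposreal eps He)) as [d Hd].
    exists d; split; [apply cond_pos|]. intros h Hh. specialize (Hd (z + h)%C).
    change (Cmod (z + h - z)%C < d -> Cmod (f (z + h) - f z - (z + h - z) * l)%C <= eps * Cmod (z + h - z)%C) in Hd.
    replace (z + h - z)%C with h in Hd by ring. rewrite (Cmult_comm l). now apply Hd.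
Qed.

Lemma ccont_continuous (f : C -> C) (z : C) : ccont f z <-> continuous (T := AbsRing_UniformSpace C_AbsRing) (U := AbsRing_UniformSpace C_AbsRing) f z.
Proof.
  split.
  - intros H. apply (filterlim_locally (T := AbsRing_UniformSpace C_AbsRing) (U := AbsRing_UniformSpace C_AbsRing)). intros eps. destruct (H eps (cond_pos eps)) as [d [Hd Hb]]. exists (mkposreal d Hd). intros w Hw.
    specialize (Hb (w - z)%C Hw). assert (E : (z + (w - z))%C = w :> C) by ring; rewrite E in Hb. exact Hb.
  - intros H eps He.
    destruct (proj1 (filterlim_locally (T := AbsRing_UniformSpace C_AbsRing) (U := AbsRing_UniformSpace C_AbsRing) _ _) H (mkposreal eps He)) as [d Hd].
    exists d; split; [apply cond_pos|]. intros h Hh. apply Hd. change (Cmod (z + h - z)%C < d). now replace (z + h - z)%C with h by ring.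
Qed.

Lemma cder_const (c z : C) : cder (fun _ => c) z 0.
Proof. apply cder_is_derive. exact (is_derive_const (K := C_AbsRing) (V := AbsRing_NormedModule C_AbsRing) c z). Qed.

Lemma cder_id (z : C) : cder (fun w => w) z 1.
Proof. apply cder_is_derive. exact (is_derive_id (K := C_AbsRing) z). Qed.

Lemma cder_ccont (f : C -> C) (z l : C) : cder f z l -> ccont f z.
Proof. rewrite cder_is_derive, ccont_continuous. intros H. apply (ex_derive_continuous (K := C_AbsRing) (V := AbsRing_NormedModule C_AbsRing)). now exists l. Qed.

Lemma cder_ext_loc (f g : C -> C) (z l : C) :
  (exists d, 0 < d /\ forall h, Cmod h < d -> f (z + h)%C = g (z + h)%C) ->
  cder f z l -> cder g z l.
Proof.
  rewrite !cder_is_derive. intros [d [Hd E]]. apply (is_derive_ext_loc (K := C_AbsRing) (V := AbsRing_NormedModule C_AbsRing) f g z l). exists (mkposreal d Hd).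
  intros w Hw. specialize (E (w - z)%C Hw). assert (E' : (z + (w - z))%C = w :> C) by ring; now rewrite E' in E.
Qed.

Lemma cder_ext (f g : C -> C) (z l : C) : (forall w, f w = g w) -> cder f z l -> cder g z l.
Proof. intros E. apply cder_ext_loc. exists 1; split; [lra|auto]. Qed.

Lemma cder_plus (f g : C -> C) (z a b : C) :
  cder f z a -> cder g z b -> cder (fun w => f w + g w)%C z (a + b)%C.
Proof. rewrite !cder_is_derive. exact (is_derive_plus (K := C_AbsRing) (V := AbsRing_NormedModule C_AbsRing) f g z a b). Qed.

Lemma cder_mult (f g : C -> C) (z a b : C) :
  cder f z a -> cder g z b -> cder (fun w => f w * g w)%C z (a * g z + f z * b)%C.
Proof. rewrite !cder_is_derive. intros Hf Hg. exact (is_derive_mult (K := C_AbsRing) f g z a b Hf Hg Cmult_comm). Qed.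

Lemma cder_comp (f g : C -> C) (z a b : C) :
  cder g z b -> cder f (g z) a -> cder (fun w => f (g w)) z (a * b)%C.
Proof. rewrite !cder_is_derive, Cmult_comm. intros Hg Hf. exact (is_derive_comp (K := C_AbsRing) (V := AbsRing_NormedModule C_AbsRing) f g z a b Hf Hg). Qed.

Lemma cder_Cinv (z : C) : z <> 0%C -> cder Cinv z (- / (z * z))%C.
Proof.
  intros Hz eps He.
  assert (Pz : 0 < Cmod z) by now apply Cmod_gt_0.
  set (m := Cmod z) in *.
  exists (Rmin (m / 2) (eps * m * m * m / 2)); split.
  { apply Rmin_glb_lt; [lra|]. assert (0 < m * m * m) by (repeat apply Rmult_lt_0_compat; lra). nra. }
  intros h Hh.
  assert (H1 : Cmod h < m / 2) by (eapply Rlt_le_trans; [exact Hh|apply Rmin_l]).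
  assert (H2 : Cmod h < eps * m * m * m / 2) by (eapply Rlt_le_trans; [exact Hh|apply Rmin_r]).
  assert (Hzh : m / 2 < Cmod (z + h)%C) by (pose proof (Cmod_triangle_rev z h); fold m in H; lra).
  assert (Nzh : (z + h)%C <> 0%C) by (intro E; rewrite E, Cmod_0 in Hzh; lra).
  replace (/ (z + h) - / z - - / (z * z) * h)%C with (h * h * (/ z * / z * / (z + h)))%C by (field; auto).
  rewrite !Cmod_mult, !Cmod_inv by auto. fold m.
  pose proof (Cmod_ge_0 h) as P4.
  replace (eps * Cmod h) with (Cmod h * eps) by ring. rewrite Rmult_assoc.
  apply Rmult_le_compat_l; [assumption|].
  assert (I : / Cmod (z + h)%C <= 2 / m).
  { replace (2 / m) with (/ (m / 2)) by (field; lra). apply Rinv_le_contravar; lra. }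
  apply Rle_trans with (eps * m * m * m / 2 * (/ m * / m * (2 / m))).
  - apply Rmult_le_compat; try lra.
    + apply Rmult_le_pos; [apply Rmult_le_pos|]; left; apply Rinv_0_lt_compat; lra.
    + apply Rmult_le_compat_l; [|exact I]. apply Rmult_le_pos; left; apply Rinv_0_lt_compat; lra.
  - right. field. lra.
Qed.

Lemma cder_inv (f : C -> C) (z l : C) : f z <> 0%C -> cder f z l ->
  cder (fun w => / f w)%C z (- / (f z * f z) * l)%C.
Proof. intros Hz H. apply (cder_comp Cinv f z _ _ H). now apply cder_Cinv. Qed.

Lemma cder_scal (c : C) (f : C -> C) (z l : C) : cder f z l -> cder (fun w => c * f w)%C z (c * l)%C.
Proof.
  intros H. pose proof (cder_mult _ _ _ _ _ (cder_const c z) H) as H1.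
  replace (c * l)%C with (0 * f z + c * l)%C by ring. exact H1.
Qed.

Lemma cder_opp (f : C -> C) (z l : C) : cder f z l -> cder (fun w => - f w)%C z (- l)%C.
Proof.
  intros H. replace (- l)%C with (-(1) * l)%C by ring.
  eapply cder_ext; [|apply cder_scal; exact H]. intros; simpl; ring.
Qed.

Lemma cder_minus (f g : C -> C) (z a b : C) :
  cder f z a -> cder g z b -> cder (fun w => f w - g w)%C z (a - b)%C.
Proof. intros Hf Hg. apply cder_plus; [exact Hf|]. now apply cder_opp. Qed.

Lemma cder_shift (f : C -> C) (c z l : C) : cder f (c + z)%C l -> cder (fun w => f (c + w)%C) z l.
Proof.
  intros H. replace l with (l * (0 + 1))%C by ring.
  apply (cder_comp f (fun w => c + w)%C); [|exact H].
  apply cder_plus; [apply cder_const|apply cder_id].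
Qed.

Lemma cder_pow (f : C -> C) (z l : C) (n : nat) : cder f z l ->
  exists l', cder (fun w => f w ^ n)%C z l'.
Proof.
  intros H. induction n as [|n [l' IH]].
  - exists 0%C. apply (cder_ext (fun _ => 1%C)); [reflexivity|apply cder_const].
  - eexists. eapply cder_ext; [|eapply cder_mult; [exact H|exact IH]]. intros w; reflexivity.
Qed.

Lemma cder_unique (f : C -> C) (z a b : C) : cder f z a -> cder f z b -> a = b.
Proof.
  intros Ha Hb. destruct (classic (a = b)) as [|N]; [assumption|exfalso].
  assert (P : 0 < Cmod (a - b)%C).
  { apply Cmod_gt_0. intro E. apply N. replace a with (a - b + b)%C by ring. rewrite E. ring. }
  set (e := Cmod (a - b)%C / 4).
  destruct (Ha e) as [d1 [Hd1 H1]]; [unfold e; lra|].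
  destruct (Hb e) as [d2 [Hd2 H2]]; [unfold e; lra|].
  set (t := Rmin d1 d2 / 2). assert (Ht : 0 < t) by (unfold t; pose proof (Rmin_glb_lt _ _ _ Hd1 Hd2); lra).
  assert (M : Cmod (RtoC t) = t) by (rewrite Cmod_R; apply Rabs_pos_eq; lra).
  pose proof (Rmin_l d1 d2); pose proof (Rmin_r d1 d2).
  specialize (H1 (RtoC t)); specialize (H2 (RtoC t)). rewrite M in H1, H2.
  specialize (H1 ltac:(unfold t in *; lra)); specialize (H2 ltac:(unfold t in *; lra)).
  assert (Cmod ((a - b) * t)%C <= e * t + e * t).
  { replace ((a - b) * t)%C with ((f (z + t) - f z - b * t) - (f (z + t) - f z - a * t))%C by ring.
    eapply Rle_trans; [apply Cmod_triangle_sub|]. lra. }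
  rewrite Cmod_mult, M in H3. unfold e in H3. nra.
Qed.

Lemma ccont_const c z : ccont (fun _ => c) z.
Proof. eapply cder_ccont, cder_const. Qed.

Lemma ccont_plus (f g : C -> C) z : ccont f z -> ccont g z -> ccont (fun w => f w + g w)%C z.
Proof. rewrite !ccont_continuous. apply (continuous_plus (U := AbsRing_UniformSpace C_AbsRing) (V := AbsRing_NormedModule C_AbsRing)). Qed.

Lemma ccont_mult (f g : C -> C) z : ccont f z -> ccont g z -> ccont (fun w => f w * g w)%C z.
Proof. rewrite !ccont_continuous. apply (continuous_mult (U := AbsRing_UniformSpace C_AbsRing) (K := C_AbsRing)). Qed.

Lemma ccont_comp (f g : C -> C) z : ccont g z -> ccont f (g z) -> ccont (fun w => f (g w)) z.
Proof. rewrite !ccont_continuous. apply (continuous_comp (U := AbsRing_UniformSpace C_AbsRing)). Qed.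

(** The derivative of an entire function is taken in the product normed module of the complex numbers, whose
    norm is the modulus, so that only the shapes of the two conditions differ. *)
Lemma entire_cder (f : C -> C) : entire f -> forall z, exists l, cder f z l.
Proof.
  intros H z. destruct (H z) as [l [_ Hl]]. exists l. intros eps He.
  specialize (Hl z (fun P H => H) (mkposreal eps He)).
  destruct Hl as [d Hd]. exists d; split; [apply cond_pos|]. intros h Hh.
  specialize (Hd (z + h)%C).
  match type of Hd with ?B -> _ => assert (HB : B) end.
  { unfold ball; simpl. unfold AbsRing_ball; simpl. unfold abs, minus, plus, opp; simpl.
    replace (z + h + - z)%C with h by ring. exact Hh. }
  specialize (Hd HB).
  change (Cmod ((f (z + h) + - f z) + - ((z + h + - z) * l))%C <= eps * Cmod (z + h + - z)%C) in Hd.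
  replace (f (z + h) - f z - l * h)%C with (f (z + h) + - f z + - ((z + h + - z) * l))%C by ring.
  eapply Rle_trans; [exact Hd|].
  replace (z + h + - z)%C with h by ring. lra.
Qed.

Lemma cder_eq (f : C -> C) (z a b : C) : cder f z a -> a = b -> cder f z b.
Proof. intros H <-. exact H. Qed.

(** * Integrals of complex functions along segments *)

Definition pcont (g : R -> C) (t : R) : Prop :=
  forall eps, 0 < eps -> exists d, 0 < d /\ forall s, Rabs (s - t) < d -> Cmod (g s - g t)%C < eps.

Definition cint (g : R -> C) (a b : R) : C :=
  (RInt (fun t => Re (g t)) a b, RInt (fun t => Im (g t)) a b).

Lemma continuous_eps (f : R -> R) (t : R) :
  (forall eps, 0 < eps -> exists d, 0 < d /\ forall s, Rabs (s - t) < d -> Rabs (f s - f t) < eps) ->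
  continuous f t.
Proof.
  intros H. apply filterlim_locally. intros eps.
  destruct (H eps (cond_pos eps)) as [d [Hd Hb]].
  exists (mkposreal d Hd). intros s Hs. exact (Hb s Hs).
Qed.

Lemma pcont_re g t : pcont g t -> continuous (fun t => Re (g t)) t.
Proof.
  intros H. apply continuous_eps. intros eps He. destruct (H eps He) as [d [Hd Hb]].
  exists d; split; [assumption|]. intros s Hs. specialize (Hb s Hs).
  eapply Rle_lt_trans; [|exact Hb]. exact (re_le_Cmod (g s - g t)%C).
Qed.

Lemma pcont_im g t : pcont g t -> continuous (fun t => Im (g t)) t.
Proof.
  intros H. apply continuous_eps. intros eps He. destruct (H eps He) as [d [Hd Hb]].
  exists d; split; [assumption|]. intros s Hs. specialize (Hb s Hs).
  eapply Rle_lt_trans; [|exact Hb]. exact (im_le_Cmod (g s - g t)%C).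
Qed.

Lemma pcont_comp (f : C -> C) (g : R -> C) t : pcont g t -> ccont f (g t) -> pcont (fun t => f (g t)) t.
Proof.
  intros Hg Hf eps He. destruct (Hf eps He) as [d [Hd Hb]].
  destruct (Hg d Hd) as [d' [Hd' Hb']]. exists d'; split; [assumption|].
  intros s Hs. specialize (Hb _ (Hb' s Hs)).
  now replace (g t + (g s - g t))%C with (g s) in Hb by ring.
Qed.

Lemma pcont_plus f g t : pcont f t -> pcont g t -> pcont (fun t => f t + g t)%C t.
Proof.
  intros Hf Hg eps He.
  destruct (Hf (eps / 2) ltac:(lra)) as [d1 [Hd1 H1]].
  destruct (Hg (eps / 2) ltac:(lra)) as [d2 [Hd2 H2]].
  exists (Rmin d1 d2); split; [now apply Rmin_glb_lt|]. intros s Hs.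
  specialize (H1 s ltac:(eapply Rlt_le_trans; [exact Hs|apply Rmin_l])).
  specialize (H2 s ltac:(eapply Rlt_le_trans; [exact Hs|apply Rmin_r])).
  replace (f s + g s - (f t + g t))%C with ((f s - f t) + (g s - g t))%C by ring.
  eapply Rle_lt_trans; [apply Cmod_triangle|lra].
Qed.

Lemma pcont_scal c g t : pcont g t -> pcont (fun t => c * g t)%C t.
Proof.
  intros H. apply (pcont_comp (fun w => c * w)%C g t H).
  eapply cder_ccont, cder_scal, cder_id.
Qed.

Lemma pcont_minus f g t : pcont f t -> pcont g t -> pcont (fun t => f t - g t)%C t.
Proof.
  intros Hf Hg. apply pcont_plus; [assumption|].
  apply (pcont_comp Copp g t Hg). eapply cder_ccont, cder_opp, cder_id.
Qed.

Lemma pcont_const c t : pcont (fun _ => c) t.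
Proof. intros eps He. exists 1; split; [lra|]. intros. replace (c - c)%C with (RtoC 0) by ring. rewrite Cmod_0. lra. Qed.

Lemma pcont_pair (a b : R -> R) t : continuous a t -> continuous b t -> pcont (fun t => (a t, b t)) t.
Proof.
  intros Ha Hb eps He.
  assert (He2 : 0 < eps / 2) by lra.
  apply filterlim_locally with (eps := mkposreal _ He2) in Ha.
  apply filterlim_locally with (eps := mkposreal _ He2) in Hb.
  destruct Ha as [d1 H1]. destruct Hb as [d2 H2].
  exists (Rmin d1 d2); split; [apply Rmin_glb_lt; apply cond_pos|].
  intros s Hs.
  specialize (H1 s ltac:(eapply Rlt_le_trans; [exact Hs|apply Rmin_l])).
  specialize (H2 s ltac:(eapply Rlt_le_trans; [exact Hs|apply Rmin_r])).
  change (Rabs (a s - a t) < eps / 2) in H1. change (Rabs (b s - b t) < eps / 2) in H2.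
  eapply Rle_lt_trans; [apply Cmod_le_abs|]. simpl. fold (a s - a t) (b s - b t).
  unfold Rminus in *. lra.
Qed.

Lemma pcont_h (c t : R) : pcont (fun t => (t, c)) t.
Proof. apply pcont_pair; [apply continuous_id|apply continuous_const]. Qed.
Lemma pcont_v (c t : R) : pcont (fun t => (c, t)) t.
Proof. apply pcont_pair; [apply continuous_const|apply continuous_id]. Qed.

Definition pcont_on (g : R -> C) a b := forall t, a <= t <= b -> pcont g t.

Lemma ex_RInt_re g a b : a <= b -> pcont_on g a b -> ex_RInt (fun t => Re (g t)) a b.
Proof.
  intros Hab H. apply (ex_RInt_continuous (V := R_CompleteNormedModule)). intros t Ht.
  rewrite Rmin_left, Rmax_right in Ht by assumption. now apply pcont_re, H.
Qed.
Lemma ex_RInt_im g a b : a <= b -> pcont_on g a b -> ex_RInt (fun t => Im (g t)) a b.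
Proof.
  intros Hab H. apply (ex_RInt_continuous (V := R_CompleteNormedModule)). intros t Ht.
  rewrite Rmin_left, Rmax_right in Ht by assumption. now apply pcont_im, H.
Qed.

Lemma cint_ext f g a b : a <= b -> (forall t, a <= t <= b -> f t = g t) -> cint f a b = cint g a b.
Proof.
  intros Hab E. unfold cint. f_equal; apply RInt_ext; intros t Ht;
  rewrite Rmin_left, Rmax_right in Ht by assumption; rewrite E; auto; lra.
Qed.

Lemma cint_plus f g a b : a <= b -> pcont_on f a b -> pcont_on g a b ->
  cint (fun t => f t + g t)%C a b = (cint f a b + cint g a b)%C.
Proof.
  intros Hab Hf Hg. unfold cint, Cplus; simpl. f_equal.
  - apply (RInt_plus (V := R_CompleteNormedModule)); apply ex_RInt_re; assumption.
  - apply (RInt_plus (V := R_CompleteNormedModule)); apply ex_RInt_im; assumption.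
Qed.

Lemma RInt_lin (f g : R -> R) (p q a b : R) : ex_RInt f a b -> ex_RInt g a b ->
  RInt (fun t => p * f t + q * g t) a b = p * RInt f a b + q * RInt g a b.
Proof.
  intros Hf Hg. rewrite (RInt_plus (V := R_CompleteNormedModule) (fun t => p * f t) (fun t => q * g t)).
  - unfold plus; simpl. f_equal; apply (RInt_scal (V := R_CompleteNormedModule)); assumption.
  - apply (ex_RInt_scal (V := R_NormedModule)); assumption.
  - apply (ex_RInt_scal (V := R_NormedModule)); assumption.
Qed.

Lemma cint_scal c f a b : a <= b -> pcont_on f a b ->
  cint (fun t => c * f t)%C a b = (c * cint f a b)%C.
Proof.
  intros Hab Hf. destruct c as [p q]. unfold cint.
  pose proof (ex_RInt_re _ _ _ Hab Hf). pose proof (ex_RInt_im _ _ _ Hab Hf).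
  apply Ceq_re_im; simpl.
  - transitivity (RInt (fun t => p * Re (f t) + (- q) * Im (f t)) a b).
    + apply RInt_ext; intros; unfold Re, Im; lra.
    + rewrite RInt_lin by assumption. lra.
  - transitivity (RInt (fun t => p * Im (f t) + q * Re (f t)) a b).
    + apply RInt_ext; intros; unfold Re, Im; lra.
    + rewrite RInt_lin by assumption. lra.
Qed.

Lemma cint_minus f g a b : a <= b -> pcont_on f a b -> pcont_on g a b ->
  cint (fun t => f t - g t)%C a b = (cint f a b - cint g a b)%C.
Proof.
  intros Hab Hf Hg.
  transitivity (cint (fun t => f t + (-(1)) * g t)%C a b).
  - apply cint_ext; [assumption|]; intros; ring.
  - rewrite cint_plus, cint_scal; try assumption; [ring|].
    intros t Ht. now apply pcont_scal, Hg.
Qed.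

Lemma cint_Chasles f a b c : a <= b -> b <= c -> pcont_on f a c ->
  (cint f a b + cint f b c)%C = cint f a c.
Proof.
  intros Hab Hbc H. assert (pcont_on f a b) by (intros t Ht; apply H; lra).
  assert (pcont_on f b c) by (intros t Ht; apply H; lra).
  unfold cint, Cplus; simpl. f_equal.
  - apply (RInt_Chasles (V := R_CompleteNormedModule)); apply ex_RInt_re; assumption.
  - apply (RInt_Chasles (V := R_CompleteNormedModule)); apply ex_RInt_im; assumption.
Qed.

Lemma cint_const c a b : cint (fun _ => c) a b = ((b - a)%R * c)%C.
Proof.
  unfold cint. destruct c as [p q].
  apply Ceq_re_im; simpl; rewrite (RInt_const (V := R_CompleteNormedModule)); unfold scal; simpl; unfold mult; simpl; ring.
Qed.

(** Multiplying by the conjugate of the integral makes the integral real and positive, and reduces the claim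
    to real integrals. *)
Lemma cint_bound f a b M : a <= b -> pcont_on f a b ->
  (forall t, a <= t <= b -> Cmod (f t) <= M) -> Cmod (cint f a b) <= M * (b - a).
Proof.
  intros Hab Hf HM.
  assert (M0 : 0 <= M) by (eapply Rle_trans; [apply Cmod_ge_0|apply (HM a); lra]).
  set (I := cint f a b).
  destruct (Req_dec (Cmod I) 0) as [->|N]; [apply Rmult_le_pos; lra|].
  pose proof (Cmod_ge_0 I) as P.

  assert (E : Cmod I ^ 2 = Re (cint (fun t => Cconj I * f t)%C a b)).
  { rewrite cint_scal by assumption. fold I.
    pose proof (Cmod2_conj I) as E. rewrite Cmult_comm in E. rewrite <- E. reflexivity. }
  assert (HI : Re (cint (fun t => Cconj I * f t)%C a b) <= (b - a) * (Cmod I * M)).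
  { assert (Hc : pcont_on (fun t => Cconj I * f t)%C a b) by (intros t Ht; now apply pcont_scal, Hf).
    pose proof (ex_RInt_re _ _ _ Hab Hc) as Ex.
    eapply Rle_trans; [apply Rle_abs|].
    apply abs_RInt_le_const; [assumption|exact Ex|].
    intros t Ht. eapply Rle_trans; [apply re_le_Cmod|]. rewrite Cmod_mult, Cmod_conj.
    apply Rmult_le_compat_l; [assumption|now apply HM]. }
  rewrite <- E in HI. nra.
Qed.

Lemma quotient_bound (u v l h e : R) : 0 < e -> h <> 0 ->
  Rabs (u - v - l * h) <= e / 2 * Rabs h -> Rabs ((u - v) / h - l) < e.
Proof.
  intros He Nh B. assert (P : 0 < Rabs h) by now apply Rabs_pos_lt.
  apply Rmult_lt_reg_r with (1 := P). rewrite <- Rabs_mult.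
  replace (((u - v) / h - l) * h) with (u - v - l * h) by (field; assumption).
  eapply Rle_lt_trans; [exact B|]. nra.
Qed.

Lemma cder_h (F : C -> C) (t c : R) (l : C) : cder F (t, c) l ->
  is_derive (fun t => Re (F (t, c))) t (Re l) /\ is_derive (fun t => Im (F (t, c))) t (Im l).
Proof.
  intros H. split; apply is_derive_Reals; intros eps He;
  destruct (H (eps / 2) ltac:(lra)) as [d [Hd Hb]]; exists (mkposreal d Hd); intros h Nh Hh;
  specialize (Hb (RtoC h)); rewrite Cmod_R in Hb; specialize (Hb Hh);
  change ((t, c) + RtoC h)%C with (t + h, c + 0) in Hb; rewrite Rplus_0_r in Hb;
  apply quotient_bound; try assumption.
  - eapply Rle_trans; [|exact Hb].
    pose proof (re_le_Cmod (F ((t + h)%R, c) - F (t, c) - l * RtoC h)%C) as B.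
    eapply Rle_trans; [|exact B]. right. f_equal. simpl. unfold Re. ring.
  - eapply Rle_trans; [|exact Hb].
    pose proof (im_le_Cmod (F ((t + h)%R, c) - F (t, c) - l * RtoC h)%C) as B.
    eapply Rle_trans; [|exact B]. right. f_equal. simpl. unfold Im. ring.
Qed.

Lemma RInt_FTC (f f' : R -> R) a b : a <= b ->
  (forall t, a <= t <= b -> is_derive f t (f' t)) -> (forall t, a <= t <= b -> continuous f' t) ->
  RInt f' a b = f b - f a.
Proof.
  intros Hab Hd Hc. apply is_RInt_unique.
  apply (is_RInt_derive (V := R_CompleteNormedModule) f f'); intros t Ht;
  rewrite Rmin_left, Rmax_right in Ht by assumption; auto.
Qed.

Lemma FTC_h (F F' : C -> C) (a b c : R) : a <= b ->
  (forall t, a <= t <= b -> cder F (t, c) (F' (t, c))) ->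
  pcont_on (fun t => F' (t, c)) a b ->
  cint (fun t => F' (t, c)) a b = (F (b, c) - F (a, c))%C.
Proof.
  intros Hab Hd Hc. apply Ceq_re_im; simpl.
  - rewrite (RInt_FTC (fun t => Re (F (t, c)))); [unfold Re; lra|assumption| |].
    + intros t Ht. now apply cder_h, Hd.
    + intros t Ht. now apply pcont_re, Hc.
  - rewrite (RInt_FTC (fun t => Im (F (t, c)))); [unfold Im; lra|assumption| |].
    + intros t Ht. now apply cder_h, Hd.
    + intros t Ht. now apply pcont_im, Hc.
Qed.

(** The vertical case is the horizontal one for the function composed with multiplication by [Ci]. *)
Lemma FTC_v (F F' : C -> C) (a b c : R) : a <= b ->
  (forall t, a <= t <= b -> cder F (c, t) (F' (c, t))) ->
  pcont_on (fun t => F' (c, t)) a b ->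
  (Ci * cint (fun t => F' (c, t)) a b)%C = (F (c, b) - F (c, a))%C.
Proof.
  intros Hab Hd Hc.
  assert (E : forall t, (Ci * (t, (- c)%R))%C = (c, t)) by (intros t; apply Ceq_re_im; simpl; ring).
  pose proof (FTC_h (fun w => F (Ci * w))%C (fun w => Ci * F' (Ci * w))%C a b (- c) Hab) as H.
  cbv beta in H. rewrite !E in H. rewrite <- H.
  - rewrite <- cint_scal by assumption. apply cint_ext; [assumption|]. intros t Ht. now rewrite E.
  - intros t Ht. rewrite Cmult_comm.
    apply (cder_comp F (fun w => Ci * w)%C).
    + pose proof (cder_scal Ci _ _ _ (cder_id (t, (- c)%R))) as X. rewrite Cmult_1_r in X. exact X.
    + rewrite E. now apply Hd.
  - intros t Ht. apply pcont_scal. intros eps He. destruct (Hc t Ht eps He) as [d [Hd' Hb]].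
    exists d; split; [assumption|]. intros s Hs. rewrite !E. now apply Hb.
Qed.

(** * Goursat's theorem for rectangles *)

Definition bdry (F : C -> C) (a b c d : R) : C :=
  (cint (fun t => F (t, c)) a b + Ci * cint (fun t => F (b, t)) c d
   - cint (fun t => F (t, d)) a b - Ci * cint (fun t => F (a, t)) c d)%C.

Definition on_rect (P : C -> Prop) (a b c d : R) : Prop :=
  forall x y, a <= x <= b -> c <= y <= d -> P (x, y).

Lemma pcont_hor F a b c d : on_rect (ccont F) a b c d -> forall y, c <= y <= d ->
  pcont_on (fun t => F (t, y)) a b.
Proof. intros H y Hy t Ht. apply (pcont_comp F (fun t => (t, y))); [apply pcont_h|now apply H]. Qed.

Lemma pcont_ver F a b c d : on_rect (ccont F) a b c d -> forall x, a <= x <= b ->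
  pcont_on (fun t => F (x, t)) c d.
Proof. intros H x Hx t Ht. apply (pcont_comp F (fun t => (x, t))); [apply pcont_v|now apply H]. Qed.

Lemma on_rect_sub P a b c d a' b' c' d' : a <= a' -> b' <= b -> c <= c' -> d' <= d ->
  on_rect P a b c d -> on_rect P a' b' c' d'.
Proof. intros ? ? ? ? H x y Hx Hy. apply H; lra. Qed.

Lemma bdry_split_h F a m b c d : a <= m <= b -> c <= d -> on_rect (ccont F) a b c d ->
  bdry F a b c d = (bdry F a m c d + bdry F m b c d)%C.
Proof.
  intros Hm Hcd H. unfold bdry.
  rewrite <- (cint_Chasles (fun t => F (t, c)) a m b), <- (cint_Chasles (fun t => F (t, d)) a m b).
  - ring.
  - lra.
  - lra.
  - apply (pcont_hor _ _ _ _ _ H); lra.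
  - lra.
  - lra.
  - apply (pcont_hor _ _ _ _ _ H); lra.
Qed.

Lemma bdry_split_v F a b c m d : a <= b -> c <= m <= d -> on_rect (ccont F) a b c d ->
  bdry F a b c d = (bdry F a b c m + bdry F a b m d)%C.
Proof.
  intros Hab Hm H. unfold bdry.
  rewrite <- (cint_Chasles (fun t => F (b, t)) c m d), <- (cint_Chasles (fun t => F (a, t)) c m d).
  - ring.
  - lra.
  - lra.
  - apply (pcont_ver _ _ _ _ _ H); lra.
  - lra.
  - lra.
  - apply (pcont_ver _ _ _ _ _ H); lra.
Qed.

Lemma bdry_minus F G a b c d : a <= b -> c <= d -> on_rect (ccont F) a b c d -> on_rect (ccont G) a b c d ->
  bdry (fun z => F z - G z)%C a b c d = (bdry F a b c d - bdry G a b c d)%C.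
Proof.
  intros Hab Hcd HF HG. unfold bdry.
  rewrite (cint_minus (fun t => F (t, c)) (fun t => G (t, c))),
    (cint_minus (fun t => F (t, d)) (fun t => G (t, d))),
    (cint_minus (fun t => F (a, t)) (fun t => G (a, t))),
    (cint_minus (fun t => F (b, t)) (fun t => G (b, t))); try assumption; try ring.
  all: first [eapply pcont_hor; [eassumption|lra] | eapply pcont_ver; [eassumption|lra]].
Qed.

Lemma bdry_primitive F G a b c d : a <= b -> c <= d ->
  on_rect (fun z => cder G z (F z)) a b c d -> on_rect (ccont F) a b c d -> bdry F a b c d = 0%C.
Proof.
  intros Hab Hcd HG HF. unfold bdry.
  rewrite (FTC_h G F a b c), (FTC_h G F a b d), (FTC_v G F c d a), (FTC_v G F c d b); try assumption; try ring.
  all: first [eapply pcont_hor; [eassumption|lra] | eapply pcont_ver; [eassumption|lra] |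
     intros t Ht; apply HG; lra].
Qed.

Lemma bdry_bound F a b c d M : a <= b -> c <= d -> on_rect (ccont F) a b c d ->
  on_rect (fun z => Cmod (F z) <= M) a b c d -> Cmod (bdry F a b c d) <= M * (2 * ((b - a) + (d - c))).
Proof.
  intros Hab Hcd HF HM. unfold bdry.
  eapply Rle_trans; [apply Cmod_triangle_sub|].
  eapply Rle_trans; [apply Rplus_le_compat_r, Cmod_triangle_sub|].
  eapply Rle_trans; [apply Rplus_le_compat_r, Rplus_le_compat_r, Cmod_triangle|].
  rewrite !Cmod_mult, Cmod_Ci.
  assert (H1 : Cmod (cint (fun t => F (t, c)) a b) <= M * (b - a)).
  { apply cint_bound; [assumption|eapply pcont_hor; [eassumption|lra]|intros; apply HM; lra]. }
  assert (H2 : Cmod (cint (fun t => F (t, d)) a b) <= M * (b - a)).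
  { apply cint_bound; [assumption|eapply pcont_hor; [eassumption|lra]|intros; apply HM; lra]. }
  assert (H3 : Cmod (cint (fun t => F (a, t)) c d) <= M * (d - c)).
  { apply cint_bound; [assumption|eapply pcont_ver; [eassumption|lra]|intros; apply HM; lra]. }
  assert (H4 : Cmod (cint (fun t => F (b, t)) c d) <= M * (d - c)).
  { apply cint_bound; [assumption|eapply pcont_ver; [eassumption|lra]|intros; apply HM; lra]. }
  lra.
Qed.

Lemma nested_point (a b : nat -> R) : (forall n, a n <= a (S n)) -> (forall n, b (S n) <= b n) ->
  (forall n, a n <= b n) -> exists x, forall n, a n <= x <= b n.
Proof.
  intros Ha Hb Hab.
  assert (Ma : forall n k, a n <= a (n + k)%nat).
  { intros n k; induction k; [rewrite Nat.add_0_r; lra|rewrite Nat.add_succ_r]. specialize (Ha (n + k)%nat); lra. }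
  assert (Mb : forall n k, b (n + k)%nat <= b n).
  { intros n k; induction k; [rewrite Nat.add_0_r; lra|rewrite Nat.add_succ_r]. specialize (Hb (n + k)%nat); lra. }
  assert (X : forall n k, a n <= b k).
  { intros n k. specialize (Ma n k). specialize (Mb k n). rewrite (Nat.add_comm k n) in Mb. specialize (Hab (n + k)%nat). lra. }
  destruct (completeness (fun x => exists n, x = a n)) as [x [Hx1 Hx2]].
  - exists (b 0%nat). intros y [n ->]. apply X.
  - exists (a 0%nat). now exists 0%nat.
  - exists x. intros n; split.
    + apply Hx1. now exists n.
    + apply Hx2. intros y [k ->]. apply X.
Qed.

(** Bisection principle: if [P] passes from the four quarters of a rectangle to the rectangle, and holds for
    all small rectangles around each point, then it holds. Otherwise nested rectangles without [P] shrink to a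
    point. It serves for Goursat's theorem and, on degenerate rectangles, for compactness arguments on
    segments. *)
Lemma rect_bisection (P : R -> R -> R -> R -> Prop) (a0 b0 c0 d0 : R) : a0 <= b0 -> c0 <= d0 ->
  (forall a b c d, a0 <= a -> a <= b -> b <= b0 -> c0 <= c -> c <= d -> d <= d0 ->
     P a ((a + b) / 2) c ((c + d) / 2) -> P a ((a + b) / 2) ((c + d) / 2) d ->
     P ((a + b) / 2) b c ((c + d) / 2) -> P ((a + b) / 2) b ((c + d) / 2) d -> P a b c d) ->
  (forall x y, a0 <= x <= b0 -> c0 <= y <= d0 -> exists r, 0 < r /\
     forall a b c d, a0 <= a -> b <= b0 -> c0 <= c -> d <= d0 -> a <= x <= b -> c <= y <= d -> b - a < r -> d - c < r -> P a b c d) ->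
  P a0 b0 c0 d0.
Proof.
  intros Hab Hcd Hsplit Hloc. apply NNPP. intros HP.
  pose (half := fun (i : bool) (a b : R) => if i then (a, (a + b) / 2) else ((a + b) / 2, b)).
  pose (Pq := fun s : (R * R) * (R * R) => P (fst (fst s)) (snd (fst s)) (fst (snd s)) (snd (snd s))).
  pose (sub := fun (i j : bool) (s : (R * R) * (R * R)) =>
     (half i (fst (fst s)) (snd (fst s)), half j (fst (snd s)) (snd (snd s)))).
  pose (step := fun s => if excluded_middle_informative (Pq (sub true true s)) then
     if excluded_middle_informative (Pq (sub true false s)) then
     if excluded_middle_informative (Pq (sub false true s)) then sub false false s
     else sub false true s else sub true false s else sub true true s).
  pose (st := fix st n := match n with O => ((a0, b0), (c0, d0)) | S n => step (st n) end).
  assert (Step : forall s, exists i j, step s = sub i j s).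
  { intros s. unfold step. repeat (destruct (excluded_middle_informative _)); eauto. }
  assert (Inv : forall n, let s := st n in
     a0 <= fst (fst s) /\ fst (fst s) <= snd (fst s) /\ snd (fst s) <= b0 /\
     c0 <= fst (snd s) /\ fst (snd s) <= snd (snd s) /\ snd (snd s) <= d0 /\
     snd (fst s) - fst (fst s) = (b0 - a0) * (/ 2) ^ n /\ snd (snd s) - fst (snd s) = (d0 - c0) * (/ 2) ^ n).
  { induction n as [|n IH]; [simpl; repeat split; lra|].
    cbv zeta in *. change (st (S n)) with (step (st n)).
    destruct (Step (st n)) as [i [j ->]]. destruct (st n) as [[a b] [c d]]. simpl in IH.
    destruct i, j; simpl; repeat split; lra. }
  assert (Neg : forall n, ~ Pq (st n)).
  { induction n as [|n IH]; [exact HP|]. change (st (S n)) with (step (st n)).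
    specialize (Inv n). cbv zeta in Inv. unfold step.
    repeat (destruct (excluded_middle_informative _)); try assumption.
    intros H4. apply IH. destruct (st n) as [[a b] [c d]]. simpl in Inv. unfold Pq in *; simpl in *.
    apply Hsplit; tauto. }
  destruct (nested_point (fun n => fst (fst (st n))) (fun n => snd (fst (st n)))) as [x Hx].
  { intros n. change (st (S n)) with (step (st n)). specialize (Inv n). cbv zeta in Inv.
    destruct (Step (st n)) as [i [j ->]]. destruct (st n) as [[a b] [c d]]. destruct i, j; simpl in *; lra. }
  { intros n. change (st (S n)) with (step (st n)). specialize (Inv n). cbv zeta in Inv.
    destruct (Step (st n)) as [i [j ->]]. destruct (st n) as [[a b] [c d]]. destruct i, j; simpl in *; lra. }
  { intros n. apply (Inv n). }
  destruct (nested_point (fun n => fst (snd (st n))) (fun n => snd (snd (st n)))) as [y Hy].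
  { intros n. change (st (S n)) with (step (st n)). specialize (Inv n). cbv zeta in Inv.
    destruct (Step (st n)) as [i [j ->]]. destruct (st n) as [[a b] [c d]]. destruct i, j; simpl in *; lra. }
  { intros n. change (st (S n)) with (step (st n)). specialize (Inv n). cbv zeta in Inv.
    destruct (Step (st n)) as [i [j ->]]. destruct (st n) as [[a b] [c d]]. destruct i, j; simpl in *; lra. }
  { intros n. apply (Inv n). }
  destruct (Hloc x y (Hx 0%nat) (Hy 0%nat)) as [r [Hr Hb]].
  assert (Hsm : exists n, ((b0 - a0) + (d0 - c0) + 1) * (/ 2) ^ n < r).
  { destruct (pow_lt_1_zero (/ 2)) with (y := r / ((b0 - a0) + (d0 - c0) + 1)) as [N HN].
    - rewrite Rabs_pos_eq; lra.
    - apply Rdiv_lt_0_compat; lra.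
    - exists N. specialize (HN N (le_n N)). rewrite Rabs_pos_eq in HN by (apply pow_le; lra).
      apply Rmult_lt_compat_r with (r := (b0 - a0) + (d0 - c0) + 1) in HN; [|lra].
      replace (r / (b0 - a0 + (d0 - c0) + 1) * (b0 - a0 + (d0 - c0) + 1)) with r in HN by (field; lra). lra. }
  destruct Hsm as [n Hn]. apply (Neg n). specialize (Inv n). cbv zeta in Inv.
  specialize (Hx n). specialize (Hy n). unfold Pq.
  assert (0 < (/ 2) ^ n) by (apply pow_lt; lra).
  apply Hb; try tauto; nra.
Qed.

(** Complex differentiability at one point; holomorphy in a region is this property at each of its points. *)
Definition holo (F : C -> C) (z : C) := exists l, cder F z l.
Lemma holo_ccont F z : holo F z -> ccont F z.
Proof. intros [l H]. eapply cder_ccont, H. Qed.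

(** The property propagated by bisection is that the boundary integral is at most [2 eps] times the squared
    half perimeter. It is additive enough, because quartering divides the square by exactly four, and it holds
    locally because the linear approximation of [F] has a primitive. *)
Theorem goursat F a b c d : a <= b -> c <= d -> on_rect (holo F) a b c d -> bdry F a b c d = 0%C.
Proof.
  intros Hab Hcd HF.
  assert (HC : on_rect (ccont F) a b c d) by (intros x y Hx Hy; now apply holo_ccont, HF).
  apply Cmod_eq_0. apply Rle_antisym; [|apply Cmod_ge_0].
  apply le_epsilon. intros eps0 He0.
  set (S := (b - a) + (d - c)).
  assert (HS : 0 <= S) by (unfold S; lra).
  set (eps := eps0 / (2 * (S + 1) ^ 2)).
  assert (HS2 : 0 < (S + 1) ^ 2) by (apply pow_lt; lra).
  assert (He : 0 < eps) by (apply Rdiv_lt_0_compat; lra).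
  apply Rle_trans with (2 * eps * S ^ 2).
  2: { unfold eps. rewrite Rplus_0_l. apply Rle_trans with (2 * (eps0 / (2 * (S + 1) ^ 2)) * (S + 1) ^ 2).
       - apply Rmult_le_compat_l; [fold eps; lra|]. nra.
       - right. field. lra. }
  apply (rect_bisection (fun a b c d => Cmod (bdry F a b c d) <= 2 * eps * ((b - a) + (d - c)) ^ 2) a b c d Hab Hcd).
  - intros a' b' c' d' H1 H2 H3 H4 H5 H6 B1 B2 B3 B4.
    assert (HC' : on_rect (ccont F) a' b' c' d') by (eapply on_rect_sub; [..|exact HC]; lra).
    rewrite (bdry_split_h F a' ((a' + b') / 2) b' c' d'); [|lra|lra|assumption].
    rewrite (bdry_split_v F a' ((a' + b') / 2) c' ((c' + d') / 2) d');
      [|lra|lra|eapply on_rect_sub; [..|exact HC']; lra].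
    rewrite (bdry_split_v F ((a' + b') / 2) b' c' ((c' + d') / 2) d');
      [|lra|lra|eapply on_rect_sub; [..|exact HC']; lra].
    eapply Rle_trans; [apply Cmod_triangle|].
    eapply Rle_trans; [apply Rplus_le_compat; apply Cmod_triangle|].
    eapply Rle_trans; [apply Rplus_le_compat; apply Rplus_le_compat; eassumption|].
    right. field.
  - intros x y Hx Hy. destruct (HF x y Hx Hy) as [l Hl].
    destruct (Hl eps He) as [r [Hr Hb]]. exists (r / 2); split; [lra|].
    intros a' b' c' d' H1 H2 H3 H4 H5 H6 H7 H8.
    assert (HC' : on_rect (ccont F) a' b' c' d') by (eapply on_rect_sub; [..|exact HC]; lra).
    set (z := (x, y)) in *.
    set (A := fun w : C => (F z + l * (w - z))%C).
    assert (DA : forall w, cder A w l).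
    { intros w. unfold A. eapply cder_eq.
      - apply cder_plus; [apply cder_const|]. apply cder_scal, cder_minus; [apply cder_id|apply cder_const].
      - ring. }
    assert (CA : on_rect (ccont A) a' b' c' d') by (intros ? ? _ _; eapply cder_ccont, DA).
    assert (EA : bdry A a' b' c' d' = 0%C).
    { apply (bdry_primitive A (fun w => (F z - l * z) * w + l / 2 * (w * w))%C); try lra; [|assumption].
      intros u v _ _. unfold A.
      replace (F z + l * ((u, v) - z))%C with ((F z - l * z) * 1 + l / 2 * (1 * (u, v) + (u, v) * 1))%C
        by (field; intro E; injection E; lra).
      apply cder_plus; apply cder_scal; [apply cder_id|]. apply cder_mult; apply cder_id. }
    assert (E : bdry F a' b' c' d' = bdry (fun w => F w - A w)%C a' b' c' d').
    { rewrite bdry_minus, EA; try assumption; try lra. ring. }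
    rewrite E.
    replace (2 * eps * (b' - a' + (d' - c')) ^ 2) with (eps * (b' - a' + (d' - c')) * (2 * (b' - a' + (d' - c')))) by ring.
    apply bdry_bound; try lra.
    + intros u v Hu Hv. apply (ccont_plus F (fun w => - A w)%C); [now apply HC'|].
      eapply cder_ccont, cder_opp, DA.
    + intros u v Hu Hv.
      assert (Hd : Cmod ((u, v) - z)%C <= (b' - a') + (d' - c')).
      { eapply Rle_trans; [apply Cmod_le_abs|]. unfold z; simpl.
        apply Rplus_le_compat; apply Rabs_le; lra. }
      specialize (Hb ((u, v) - z)%C ltac:(lra)).
      replace (z + ((u, v) - z))%C with (u, v) in Hb by (unfold z; apply Ceq_re_im; simpl; ring).
      unfold A. replace (F (u, v) - (F z + l * ((u, v) - z)))%C with (F (u, v) - F z - l * ((u, v) - z))%C by ring.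
      eapply Rle_trans; [exact Hb|]. nra.
Qed.

(** * The complex exponential and means over circles *)

Definition cis (t : R) : C := (cos t, sin t).

Lemma Cmod_cis t : Cmod (cis t) = 1.
Proof.
  unfold Cmod, cis; simpl fst; simpl snd. transitivity (sqrt 1); [f_equal|apply sqrt_1].
  pose proof (sin2_cos2 t) as H. unfold Rsqr in H. lra.
Qed.

Lemma Cmod_circ r t : 0 <= r -> Cmod (r * cis t)%C = r.
Proof. intros. rewrite Cmod_mult, Cmod_cis, Cmod_R, Rabs_pos_eq by assumption. ring. Qed.

Lemma cis_plus s t : cis (s + t) = (cis s * cis t)%C.
Proof. unfold cis. apply Ceq_re_im; simpl; [rewrite cos_plus|rewrite sin_plus]; ring. Qed.

Lemma Cexp_eq z : Cexp z = (exp (Re z) * cis (Im z))%C.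
Proof. reflexivity. Qed.

Lemma Cexp_plus a b : Cexp (a + b)%C = (Cexp a * Cexp b)%C.
Proof.
  rewrite !Cexp_eq. change (Re (a + b)%C) with (Re a + Re b). change (Im (a + b)%C) with (Im a + Im b).
  rewrite exp_plus, cis_plus, RtoC_mult. ring.
Qed.

Lemma Cmod_Cexp z : Cmod (Cexp z) = exp (Re z).
Proof. rewrite Cexp_eq, Cmod_circ; [reflexivity|left; apply exp_pos]. Qed.

Lemma Cexp_0 : Cexp 0%C = 1%C.
Proof. rewrite Cexp_eq. unfold cis. simpl. rewrite exp_0, cos_0, sin_0. apply Ceq_re_im; simpl; ring. Qed.

Lemma Cexp_real x : Cexp (RtoC x) = RtoC (exp x).
Proof. rewrite Cexp_eq. unfold cis. simpl. rewrite cos_0, sin_0. apply Ceq_re_im; simpl; ring. Qed.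

Lemma deriv_eps (f : R -> R) (x l : R) : derivable_pt_lim f x l ->
  forall eps, 0 < eps -> exists d, 0 < d /\ forall h, Rabs h < d -> Rabs (f (x + h) - f x - l * h) <= eps * Rabs h.
Proof.
  intros H eps He. destruct (H eps He) as [d Hd]. exists d; split; [apply cond_pos|]. intros h Hh.
  destruct (Req_dec h 0) as [->|N].
  - rewrite Rplus_0_r, Rabs_R0. replace (f x - f x - l * 0) with 0 by ring. rewrite Rabs_R0. lra.
  - specialize (Hd h N Hh).
    replace (f (x + h) - f x - l * h) with (((f (x + h) - f x) / h - l) * h) by (field; assumption).
    rewrite Rabs_mult. apply Rmult_le_compat_r; [apply Rabs_pos|lra].
Qed.

(** Real and imaginary parts reduce to the derivatives of the real exponential, sine and cosine at 0. *)
Lemma cder_Cexp_0 : cder Cexp 0%C 1%C.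
Proof.
  intros eps He.
  set (e := Rmin 1 (eps / 20)). assert (He' : 0 < e) by (apply Rmin_glb_lt; lra).
  assert (e1 : e <= 1) by apply Rmin_l. assert (e2 : e <= eps / 20) by apply Rmin_r.
  destruct (deriv_eps exp 0 1) with (eps := e) as [d1 [Hd1 H1]]; [pose proof (derivable_pt_lim_exp 0) as X; rewrite exp_0 in X; exact X|assumption|].
  destruct (deriv_eps sin 0 1) with (eps := e) as [d2 [Hd2 H2]]; [pose proof (derivable_pt_lim_sin 0) as X; rewrite cos_0 in X; exact X|assumption|].
  destruct (deriv_eps cos 0 0) with (eps := e) as [d3 [Hd3 H3]]; [pose proof (derivable_pt_lim_cos 0) as X; rewrite sin_0, Ropp_0 in X; exact X|assumption|].
  exists (Rmin (Rmin d1 d2) (Rmin d3 e)). split; [repeat apply Rmin_glb_lt; lra|].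
  intros h Hh.
  assert (L1 : Cmod h < d1) by (eapply Rlt_le_trans; [exact Hh|]; eapply Rle_trans; [apply Rmin_l|apply Rmin_l]).
  assert (L2 : Cmod h < d2) by (eapply Rlt_le_trans; [exact Hh|]; eapply Rle_trans; [apply Rmin_l|apply Rmin_r]).
  assert (L3 : Cmod h < d3) by (eapply Rlt_le_trans; [exact Hh|]; eapply Rle_trans; [apply Rmin_r|apply Rmin_l]).
  assert (L4 : Cmod h < e) by (eapply Rlt_le_trans; [exact Hh|]; eapply Rle_trans; [apply Rmin_r|apply Rmin_r]).
  pose proof (re_le_Cmod h) as Rx. pose proof (im_le_Cmod h) as Ry.
  rewrite Cplus_0_l, Cexp_0, Cexp_eq. unfold cis.
  destruct h as [x y]. simpl Re in *. simpl Im in *. set (m := Cmod (x, y)) in *.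
  specialize (H1 x ltac:(lra)). specialize (H2 y ltac:(lra)). specialize (H3 y ltac:(lra)).
  rewrite Rplus_0_l in H1, H2, H3. rewrite exp_0 in H1. rewrite sin_0 in H2. rewrite cos_0 in H3.
  eapply Rle_trans; [apply Cmod_le_abs|]. simpl.
  assert (m0 : 0 <= m) by apply Cmod_ge_0.
  assert (A1 : Rabs (exp x - 1 - 1 * x) <= e * m) by (eapply Rle_trans; [exact H1|nra]).
  assert (A2 : Rabs (sin y - 0 - 1 * y) <= e * m) by (eapply Rle_trans; [exact H2|nra]).
  assert (A3 : Rabs (cos y - 1 - 0 * y) <= e * m) by (eapply Rle_trans; [exact H3|nra]).
  assert (X1 : Rabs (exp x - 1) <= 2 * m).
  { replace (exp x - 1) with ((exp x - 1 - 1 * x) + x) by ring.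
    eapply Rle_trans; [apply Rabs_triang|]. nra. }
  assert (X2 : Rabs (exp x) <= 3).
  { replace (exp x) with ((exp x - 1) + 1) by ring. eapply Rle_trans; [apply Rabs_triang|]. rewrite Rabs_R1. lra. }
  set (E := exp x) in *. set (S := sin y) in *. set (K := cos y) in *.
  replace (E * K - 0 * S + - (1) + - (1 * x - 0 * y)) with (E * (K - 1 - 0 * y) + (E - 1 - 1 * x)) by ring.
  replace (E * S + 0 * K + - 0 + - (1 * y + 0 * x)) with (E * (S - 0 - 1 * y) + (E - 1) * y) by ring.
  assert (B1 : Rabs (E * (K - 1 - 0 * y) + (E - 1 - 1 * x)) <= 4 * (e * m)).
  { eapply Rle_trans; [apply Rabs_triang|]. rewrite Rabs_mult.
    assert (Rabs E * Rabs (K - 1 - 0 * y) <= 3 * (e * m)); [|lra].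
    apply Rmult_le_compat; try apply Rabs_pos; assumption. }
  assert (B2 : Rabs (E * (S - 0 - 1 * y) + (E - 1) * y) <= 5 * (e * m)).
  { eapply Rle_trans; [apply Rabs_triang|]. rewrite !Rabs_mult.
    assert (Rabs E * Rabs (S - 0 - 1 * y) <= 3 * (e * m)).
    { apply Rmult_le_compat; try apply Rabs_pos; assumption. }
    assert (Rabs (E - 1) * Rabs y <= (2 * m) * e).
    { apply Rmult_le_compat; try apply Rabs_pos; lra. }
    lra. }
  nra.
Qed.

Lemma cder_Cexp z : cder Cexp z (Cexp z).
Proof.
  apply (cder_ext (fun w => Cexp z * Cexp (- z + w))%C).
  { intros w. rewrite <- Cexp_plus. f_equal. ring. }
  eapply cder_eq.
  - apply cder_scal. apply (cder_shift Cexp (- z)%C z 1%C).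
    replace (- z + z)%C with (RtoC 0) by ring. apply cder_Cexp_0.
  - ring.
Qed.

(** Mean over the circle of radius [r] around 0; it makes sense for [r = 0] too, which gives the value at the
    centre as a limiting case. *)
Definition circ (F : C -> C) (r : R) : C := (/ RtoC (2 * PI) * cint (fun t => F (r * cis t)%C) 0 (2 * PI))%C.

Definition cont_circ (F : C -> C) (r : R) : Prop := forall z, Cmod z = r -> ccont F z.

Lemma pcont_cis r t : pcont (fun t => (r * cis t)%C) t.
Proof.
  apply pcont_scal. unfold cis. apply pcont_pair.
  - apply (continuous_comp (fun t => t) cos); [apply continuous_id|apply continuous_cos].
  - apply (continuous_comp (fun t => t) sin); [apply continuous_id|apply continuous_sin].
Qed.

Lemma cont_circ_pcont F r : 0 <= r -> cont_circ F r -> pcont_on (fun t => F (r * cis t)%C) 0 (2 * PI).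
Proof.
  intros Hr H t _. apply (pcont_comp F (fun t => r * cis t)%C); [apply pcont_cis|].
  apply H. now apply Cmod_circ.
Qed.

Lemma two_PI_pos : 0 < 2 * PI.
Proof. pose proof PI_RGT_0. lra. Qed.

Lemma RtoC_neq (a b : R) : a <> b -> RtoC a <> RtoC b.
Proof. intros H E. apply H. now injection E. Qed.

Lemma circ_ext F G r : 0 <= r -> (forall z, Cmod z = r -> F z = G z) -> circ F r = circ G r.
Proof.
  intros Hr E. unfold circ. f_equal. apply cint_ext; [left; apply two_PI_pos|]. intros t _.
  apply E. now apply Cmod_circ.
Qed.

Lemma circ_plus F G r : 0 <= r -> cont_circ F r -> cont_circ G r ->
  circ (fun z => F z + G z)%C r = (circ F r + circ G r)%C.
Proof.
  intros Hr HF HG. unfold circ.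
  rewrite (cint_plus (fun t => F (r * cis t)%C) (fun t => G (r * cis t)%C)).
  - ring.
  - left; apply two_PI_pos.
  - now apply cont_circ_pcont.
  - now apply cont_circ_pcont.
Qed.

Lemma circ_scal c F r : 0 <= r -> cont_circ F r -> circ (fun z => c * F z)%C r = (c * circ F r)%C.
Proof.
  intros Hr HF. unfold circ. rewrite (cint_scal c (fun t => F (r * cis t)%C)).
  - ring.
  - left; apply two_PI_pos.
  - now apply cont_circ_pcont.
Qed.

Lemma circ_minus F G r : 0 <= r -> cont_circ F r -> cont_circ G r ->
  circ (fun z => F z - G z)%C r = (circ F r - circ G r)%C.
Proof.
  intros Hr HF HG. unfold circ.
  rewrite (cint_minus (fun t => F (r * cis t)%C) (fun t => G (r * cis t)%C)).
  - ring.
  - left; apply two_PI_pos.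
  - now apply cont_circ_pcont.
  - now apply cont_circ_pcont.
Qed.

Lemma circ_const c r : circ (fun _ => c) r = c.
Proof.
  unfold circ. rewrite cint_const, Rminus_0_r. field. apply RtoC_neq. pose proof two_PI_pos; lra.
Qed.

Lemma circ_bound F r M : 0 <= r -> cont_circ F r -> (forall z, Cmod z = r -> Cmod (F z) <= M) ->
  Cmod (circ F r) <= M.
Proof.
  intros Hr HF HM. unfold circ. pose proof two_PI_pos.
  assert (RtoC (2 * PI) <> 0%C) by (apply RtoC_neq; lra).
  rewrite Cmod_mult, Cmod_inv by assumption.
  rewrite Cmod_R, Rabs_pos_eq by lra.
  apply Rmult_le_reg_l with (2 * PI); [lra|].
  rewrite <- Rmult_assoc, Rinv_r, Rmult_1_l by lra.
  eapply Rle_trans.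
  - apply (cint_bound _ _ _ M); [lra|now apply cont_circ_pcont|].
    intros t _. apply HM. now apply Cmod_circ.
  - lra.
Qed.

(** The exponential maps the rectangle from [ln r1] to [ln r2] of height [2 PI] onto the annulus. Its two
    horizontal sides carry the same integral by periodicity, so that Goursat's theorem equates the vertical
    ones. *)
Lemma circ_invariant F r1 r2 : 0 < r1 -> r1 <= r2 ->
  (forall z, r1 <= Cmod z <= r2 -> holo F z) -> circ F r1 = circ F r2.
Proof.
  intros Hr1 Hr HF. unfold circ. f_equal.
  pose proof two_PI_pos as HP.
  assert (Hln : ln r1 <= ln r2) by (destruct Hr as [Hr| ->]; [left; apply ln_increasing; lra|lra]).
  set (G := fun z => F (Cexp z)).
  assert (EG : forall r t, 0 < r -> G (ln r, t) = F (r * cis t)%C).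
  { intros r t H. unfold G. rewrite Cexp_eq. simpl. now rewrite exp_ln. }
  assert (H : bdry G (ln r1) (ln r2) 0 (2 * PI) = 0%C).
  { apply goursat; [assumption|lra|]. intros x y Hx _. unfold G.
    destruct (HF (Cexp (x, y))) as [l Hl].
    - rewrite Cmod_Cexp. simpl. rewrite <- (exp_ln r1), <- (exp_ln r2) by lra.
      split; [destruct (proj1 Hx) as [h| ->]|destruct (proj2 Hx) as [h| ->]]; try lra; left; now apply exp_increasing.
    - eexists. apply (cder_comp F Cexp); [apply cder_Cexp|exact Hl]. }
  unfold bdry in H.
  rewrite (cint_ext (fun t => G (t, 2 * PI)) (fun t => G (t, 0)) (ln r1)) in H.
  - rewrite (cint_ext (fun t => G (ln r2, t)) (fun t => F (r2 * cis t)%C)) in H by (intros; try apply EG; lra).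
    rewrite (cint_ext (fun t => G (ln r1, t)) (fun t => F (r1 * cis t)%C)) in H by (intros; try apply EG; lra).
    set (I1 := cint (fun t => F (r1 * cis t)%C) 0 (2 * PI)) in *.
    set (I2 := cint (fun t => F (r2 * cis t)%C) 0 (2 * PI)) in *.
    set (J := cint (fun t => G (t, 0)) (ln r1) (ln r2)) in *.
    assert (E : (Ci * (I2 - I1))%C = 0%C) by (rewrite <- H; ring).
    destruct (Ceq_dec (I2 - I1)%C 0%C) as [E0|N].
    + replace I2 with (I2 - I1 + I1)%C by ring. rewrite E0. ring.
    + exfalso. apply Cmult_neq_0 in E; [assumption|intro X; injection X; lra|assumption].
  - assumption.
  - intros t _. unfold G. rewrite !Cexp_eq. simpl. f_equal. f_equal. unfold cis.
    rewrite cos_2PI, sin_2PI, cos_0, sin_0. reflexivity.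
Qed.

(** Uniform continuity in the angle, by bisection of the interval of angles. *)
Lemma circ_continuous F R0 r0 : 0 <= r0 < R0 -> (forall z, Cmod z < R0 -> ccont F z) ->
  forall eps, 0 < eps -> exists d, 0 < d /\ forall r, 0 <= r < R0 -> Rabs (r - r0) < d -> Cmod (circ F r - circ F r0)%C <= eps.
Proof.
  intros Hr0 HF eps He.
  assert (U : exists d, 0 < d /\ forall t, 0 <= t <= 2 * PI -> forall r, 0 <= r -> Rabs (r - r0) < d ->
     Cmod (F (r * cis t) - F (r0 * cis t))%C <= eps).
  { pose proof two_PI_pos.
    apply (rect_bisection (fun a b c d => exists d, 0 < d /\ forall t, a <= t <= b -> forall r, 0 <= r -> Rabs (r - r0) < d ->
     Cmod (F (r * cis t) - F (r0 * cis t))%C <= eps) 0 (2 * PI) 0 0); [lra|lra| |].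
    - intros a b c d _ _ _ _ _ _ [d1 [P1 H1]] _ [d2 [P2 H2]] _.
      exists (Rmin d1 d2). split; [now apply Rmin_glb_lt|]. intros t Ht r Hr Hd.
      destruct (Rle_dec t ((a + b) / 2)).
      + apply H1; try lra. eapply Rlt_le_trans; [exact Hd|apply Rmin_l].
      + apply H2; try lra. eapply Rlt_le_trans; [exact Hd|apply Rmin_r].
    - intros x y _ _.
      destruct (HF (r0 * cis x)%C) with (eps := eps / 2) as [d [Hd Hb]]; [rewrite Cmod_circ; lra|lra|].
      destruct (pcont_cis r0 x (d / 2) ltac:(lra)) as [d' [Hd' Hb']].
      exists d'. split; [assumption|]. intros a b _ _ _ _ _ _ Hx _ Hab _. exists (d / 2); split; [lra|].
      intros t Ht r Hr Hrr.
      assert (T : Rabs (t - x) < d') by (apply Rabs_def1; lra).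
      specialize (Hb' t T).
      pose proof (Hb (r0 * cis t - r0 * cis x)%C ltac:(lra)) as B1.
      replace (r0 * cis x + (r0 * cis t - r0 * cis x))%C with (r0 * cis t)%C in B1 by ring.
      assert (B0 : Cmod (r * cis t - r0 * cis x)%C < d).
      { replace (r * cis t - r0 * cis x)%C with ((r - r0)%R * cis t + (r0 * cis t - r0 * cis x))%C
          by (rewrite RtoC_minus; ring).
        eapply Rle_lt_trans; [apply Cmod_triangle|]. rewrite Cmod_mult, Cmod_cis, Cmod_R. lra. }
      pose proof (Hb _ B0) as B2.
      replace (r0 * cis x + (r * cis t - r0 * cis x))%C with (r * cis t)%C in B2 by ring.
      replace (F (r * cis t) - F (r0 * cis t))%C with
        ((F (r * cis t) - F (r0 * cis x)) - (F (r0 * cis t) - F (r0 * cis x)))%C by ring.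
      eapply Rle_trans; [apply Cmod_triangle_sub|]. lra. }
  destruct U as [d [Hd Hb]]. exists d; split; [assumption|]. intros r Hr Hrd.
  unfold circ. pose proof two_PI_pos as HP.
  assert (N : RtoC (2 * PI) <> 0%C) by (apply RtoC_neq; lra).
  assert (C1 : pcont_on (fun t => F (r * cis t)%C) 0 (2 * PI)) by (apply cont_circ_pcont; [lra|intros z Hz; apply HF; lra]).
  assert (C2 : pcont_on (fun t => F (r0 * cis t)%C) 0 (2 * PI)) by (apply cont_circ_pcont; [lra|intros z Hz; apply HF; lra]).
  match goal with |- Cmod (?a * ?b - ?a * ?c)%C <= _ => replace (a * b - a * c)%C with (a * (b - c))%C by ring end.
  rewrite <- cint_minus by (try assumption; lra).
  rewrite Cmod_mult, Cmod_inv by assumption.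
  rewrite Cmod_R, Rabs_pos_eq by lra.
  apply Rmult_le_reg_l with (2 * PI); [lra|].
  rewrite <- Rmult_assoc, Rinv_r, Rmult_1_l by lra.
  eapply Rle_trans.
  - apply (cint_bound _ _ _ eps); [lra| |].
    + intros t Ht. apply pcont_minus; [now apply C1|now apply C2].
    + intros t Ht. apply Hb; lra.
  - lra.
Qed.

Lemma circ_limit_eq F R0 r0 c : 0 <= r0 < R0 -> (forall z, Cmod z < R0 -> ccont F z) ->
  (forall d, 0 < d -> exists r, 0 <= r < R0 /\ Rabs (r - r0) < d /\ circ F r = c) -> circ F r0 = c.
Proof.
  intros Hr HF H.
  assert (E : Cmod (circ F r0 - c)%C = 0).
  { apply Rle_antisym; [|apply Cmod_ge_0]. apply le_epsilon. intros eps He. rewrite Rplus_0_l.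
    destruct (circ_continuous F R0 r0 Hr HF eps He) as [d [Hd Hb]].
    destruct (H d Hd) as [r [H1 [H2 <-]]]. rewrite Cmod_minus_sym. now apply Hb. }
  apply Cmod_eq_0 in E. replace (circ F r0) with (circ F r0 - c + c)%C by ring. rewrite E. ring.
Qed.

Lemma circ_0 F : circ F 0 = F 0%C.
Proof.
  unfold circ. rewrite (cint_ext _ (fun _ => F 0%C)).
  - rewrite cint_const, Rminus_0_r. field. apply RtoC_neq. pose proof two_PI_pos; lra.
  - left; apply two_PI_pos.
  - intros t _. f_equal. ring.
Qed.

(** Holomorphy may fail on one circle, of radius [p], as long as continuity persists: this is the form needed
    for difference quotients, which are not known to be holomorphic at the point where they are completed by
    the derivative. *)
Theorem circ_mean F R0 p : 0 <= p -> (forall z, Cmod z < R0 -> ccont F z) ->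
  (forall z, Cmod z < R0 -> Cmod z <> p -> holo F z) ->
  forall r, 0 <= r < R0 -> circ F r = F 0%C.
Proof.
  intros Hp HC HF.
  assert (Low : forall r, 0 <= r -> r < p -> r < R0 -> circ F r = F 0%C).
  { intros r H1 H2 H3. destruct H1 as [H1| <-]; [|apply circ_0].
    rewrite <- circ_0. symmetry. apply circ_limit_eq with R0; [lra|assumption|].
    intros d Hd. exists (Rmin r (d / 2)).
    assert (0 < Rmin r (d / 2)) by (apply Rmin_glb_lt; lra).
    pose proof (Rmin_l r (d / 2)). pose proof (Rmin_r r (d / 2)).
    split; [lra|]. split; [rewrite Rminus_0_r, Rabs_pos_eq; lra|].
    apply circ_invariant; [assumption|assumption|]. intros z Hz. apply HF; lra. }
  assert (Mid : p < R0 -> circ F p = F 0%C).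
  { intros H. destruct Hp as [Hp| <-]; [|apply circ_0].
    apply circ_limit_eq with R0; [lra|assumption|]. intros d Hd. exists (Rmax 0 (p - d / 2)).
    assert (Rmax 0 (p - d / 2) < p) by (apply Rmax_lub_lt; lra).
    pose proof (Rmax_l 0 (p - d / 2)). pose proof (Rmax_r 0 (p - d / 2)).
    split; [lra|]. split; [apply Rabs_def1; lra|]. apply Low; lra. }
  intros r Hr. destruct (Rtotal_order r p) as [H|[->|H]]; [apply Low; lra|apply Mid; lra|].
  rewrite <- Mid by lra. symmetry. apply circ_limit_eq with R0; [lra|assumption|].
  intros d Hd. exists (Rmin r (p + d / 2)).
  assert (p < Rmin r (p + d / 2)) by (apply Rmin_glb_lt; lra).
  pose proof (Rmin_l r (p + d / 2)). pose proof (Rmin_r r (p + d / 2)).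
  split; [lra|]. split; [apply Rabs_def1; lra|].
  apply circ_invariant; [lra|assumption|]. intros z Hz. apply HF; lra.
Qed.

(** * Cauchy's formula and Taylor expansion *)

Lemma holo_const c z : holo (fun _ => c) z. Proof. eexists; apply cder_const. Qed.
Lemma holo_id z : holo (fun w => w) z. Proof. eexists; apply cder_id. Qed.
Lemma holo_plus (f g : C -> C) (z : C) : holo f z -> holo g z -> holo (fun w => f w + g w)%C z.
Proof. intros [a Ha] [b Hb]. eexists; apply cder_plus; eassumption. Qed.
Lemma holo_minus (f g : C -> C) (z : C) : holo f z -> holo g z -> holo (fun w => f w - g w)%C z.
Proof. intros [a Ha] [b Hb]. eexists; apply cder_minus; eassumption. Qed.
Lemma holo_opp (f : C -> C) (z : C) : holo f z -> holo (fun w => - f w)%C z.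
Proof. intros [a Ha]. eexists; apply cder_opp; eassumption. Qed.
Lemma holo_mult (f g : C -> C) (z : C) : holo f z -> holo g z -> holo (fun w => f w * g w)%C z.
Proof. intros [a Ha] [b Hb]. eexists; apply cder_mult; eassumption. Qed.
Lemma holo_inv (f : C -> C) (z : C) : f z <> 0%C -> holo f z -> holo (fun w => / f w)%C z.
Proof. intros N [a Ha]. eexists. exact (cder_inv f z a N Ha). Qed.
Lemma holo_div (f g : C -> C) (z : C) : g z <> 0%C -> holo f z -> holo g z -> holo (fun w => f w / g w)%C z.
Proof. intros N Hf Hg. apply holo_mult; [assumption|now apply holo_inv]. Qed.
Lemma holo_pow (f : C -> C) (z : C) (n : nat) : holo f z -> holo (fun w => f w ^ n)%C z.
Proof. intros [a Ha]. eapply cder_pow, Ha. Qed.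
Lemma holo_ext_loc (f g : C -> C) (z : C) :
  (exists d, 0 < d /\ forall h, Cmod h < d -> f (z + h)%C = g (z + h)%C) -> holo f z -> holo g z.
Proof. intros H [l Hl]. exists l. eapply cder_ext_loc; eassumption. Qed.
Lemma holo_ext (f g : C -> C) (z : C) : (forall w, f w = g w) -> holo f z -> holo g z.
Proof. intros H [l Hl]. exists l. eapply cder_ext; eassumption. Qed.

Lemma Cminus_neq (a b : C) : a <> b -> (a - b)%C <> 0%C.
Proof. intros N E. apply N. replace a with (a - b + b)%C by ring. rewrite E. ring. Qed.

Lemma Cmod_neq (a b : C) : Cmod a <> Cmod b -> a <> b.
Proof. intros N ->. now apply N. Qed.

Fixpoint csum (f : nat -> C) (n : nat) : C :=
  match n with O => 0%C | S n => (csum f n + f n)%C end.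

Fixpoint rsum (f : nat -> R) (n : nat) : R :=
  match n with O => 0 | S n => rsum f n + f n end.

Lemma csum_ext f g n : (forall k, (k < n)%nat -> f k = g k) -> csum f n = csum g n.
Proof. intros H; induction n as [|n IH]; [reflexivity|]. simpl. rewrite IH, H; auto. Qed.
Lemma rsum_ext f g n : (forall k, (k < n)%nat -> f k = g k) -> rsum f n = rsum g n.
Proof. intros H; induction n as [|n IH]; [reflexivity|]. simpl. rewrite IH, H; auto. Qed.
Lemma Cmod_csum f n : Cmod (csum f n) <= rsum (fun k => Cmod (f k)) n.
Proof. induction n; simpl; [rewrite Cmod_0; lra|]. eapply Rle_trans; [apply Cmod_triangle|lra]. Qed.
Lemma rsum_le f g n : (forall k, (k < n)%nat -> f k <= g k) -> rsum f n <= rsum g n.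
Proof. intros H; induction n as [|n IH]; simpl; [lra|]. apply Rplus_le_compat; auto. Qed.
Lemma rsum_scal c f n : rsum (fun k => c * f k) n = c * rsum f n.
Proof. induction n as [|n IH]; simpl; [ring|rewrite IH; ring]. Qed.
Lemma csum_scal c f n : csum (fun k => c * f k)%C n = (c * csum f n)%C.
Proof. induction n as [|n IH]; simpl; [ring|rewrite IH; ring]. Qed.
Lemma rsum_plus f g n : rsum (fun k => f k + g k) n = rsum f n + rsum g n.
Proof. induction n as [|n IH]; simpl; [ring|rewrite IH; ring]. Qed.
Lemma csum_plus f g n : csum (fun k => f k + g k)%C n = (csum f n + csum g n)%C.
Proof. induction n as [|n IH]; simpl; [ring|rewrite IH; ring]. Qed.
Lemma csum_minus f g n : csum (fun k => f k - g k)%C n = (csum f n - csum g n)%C.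
Proof. induction n as [|n IH]; simpl; [ring|rewrite IH; ring]. Qed.
Lemma rsum_nonneg f n : (forall k, (k < n)%nat -> 0 <= f k) -> 0 <= rsum f n.
Proof. intros H; induction n as [|n IH]; simpl; [lra|]. apply Rplus_le_le_0_compat; auto. Qed.

(** Turns a bound by the remainder of a convergent expansion into an exact statement. *)
Lemma geom_small (q : R) C0 : 0 <= q < 1 -> forall x, (forall n, x <= C0 * q ^ n) -> x <= 0.
Proof.
  intros Hq x H. apply le_epsilon. intros eps He. rewrite Rplus_0_l.
  destruct (pow_lt_1_zero q) with (y := eps / (Rabs C0 + 1)) as [N HN].
  - rewrite Rabs_pos_eq; lra.
  - apply Rdiv_lt_0_compat; [lra|]. pose proof (Rabs_pos C0); lra.
  - specialize (HN N (le_n N)). rewrite Rabs_pos_eq in HN by (apply pow_le; lra).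
    eapply Rle_trans; [apply (H N)|]. pose proof (Rabs_pos C0). pose proof (Rle_abs C0).
    assert (0 <= q ^ N) by (apply pow_le; lra).
    apply Rle_trans with ((Rabs C0 + 1) * (eps / (Rabs C0 + 1))); [|right; field; lra].
    apply Rle_trans with ((Rabs C0 + 1) * q ^ N); [nra|]. apply Rmult_le_compat_l; lra.
Qed.

(** The [k]-th Taylor coefficient when [h] is holomorphic in the disc, computed on the circle of radius [r]. *)
Definition coef (h : C -> C) (k : nat) (r : R) : C := circ (fun z => h z / z ^ k)%C r.

Lemma holo_cont_circ F r : (forall z, Cmod z = r -> holo F z) -> cont_circ F r.
Proof. intros H z Hz. now apply holo_ccont, H. Qed.

Lemma coef_invariant h k r1 r2 R0 : (forall z, 0 < Cmod z < R0 -> holo h z) -> 0 < r1 < R0 -> 0 < r2 < R0 ->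
  coef h k r1 = coef h k r2.
Proof.
  intros H. assert (X : forall r1 r2, 0 < r1 -> r1 <= r2 -> r2 < R0 -> coef h k r1 = coef h k r2).
  { intros r s H1 H2 H3. apply circ_invariant; [assumption|assumption|]. intros z Hz.
    assert (z <> 0%C) by (apply Cmod_gt_0; lra).
    apply holo_div; [now apply Cpow_nz|apply H; lra|apply holo_pow, holo_id]. }
  intros H1 H2. destruct (Rle_dec r1 r2); [apply X; lra|symmetry; apply X; lra].
Qed.

Lemma coef_bound h k r M : 0 < r -> (forall z, Cmod z = r -> holo h z) ->
  (forall z, Cmod z = r -> Cmod (h z) <= M) -> Cmod (coef h k r) <= M / r ^ k.
Proof.
  intros Hr Hh HM. apply circ_bound; [lra| |].
  - apply holo_cont_circ. intros z Hz. assert (z <> 0%C) by (apply Cmod_gt_0; lra).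
    apply holo_div; [now apply Cpow_nz|now apply Hh|apply holo_pow, holo_id].
  - intros z Hz. assert (z <> 0%C) by (apply Cmod_gt_0; lra).
    rewrite Cmod_div by now apply Cpow_nz. rewrite Cmod_pow, Hz.
    apply Rmult_le_compat_r; [|now apply HM]. left. apply Rinv_0_lt_compat, pow_lt, Hr.
Qed.

(** The coefficient is independent of the radius, yet homogeneous of degree [- k] in it. *)
Lemma coef_inv_pow k r : 0 < r -> (1 <= k)%nat -> coef (fun _ => 1%C) k r = 0%C.
Proof.
  intros Hr Hk.
  assert (E : coef (fun _ => 1%C) k r = coef (fun _ => 1%C) k (2 * r)).
  { apply (coef_invariant _ _ _ _ (3 * r)); [intros; apply holo_const|lra|lra]. }
  assert (E2 : coef (fun _ => 1%C) k (2 * r) = (/ 2 ^ k * coef (fun _ => 1%C) k r)%C).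
  { unfold coef. rewrite <- circ_scal; [|lra|].
    - unfold circ. f_equal. apply cint_ext; [left; apply two_PI_pos|]. intros t _.
      rewrite RtoC_mult, <- Cmult_assoc, Cpow_mult_l. field.
      assert (r * cis t <> 0)%C.
      { apply Cmod_gt_0. rewrite Cmod_circ; lra. }
      split; apply Cpow_nz; [assumption|apply RtoC_neq; lra].
    - apply holo_cont_circ. intros z Hz. assert (z <> 0%C) by (apply Cmod_gt_0; lra).
      apply holo_div; [now apply Cpow_nz|apply holo_const|apply holo_pow, holo_id]. }
  rewrite E2 in E. set (J := coef (fun _ => 1%C) k r) in *.
  assert (M : Cmod J = / 2 ^ k * Cmod J).
  { rewrite E at 1. rewrite Cmod_mult, <- RtoC_pow, Cmod_inv, Cmod_R, Rabs_pos_eq; [reflexivity| |].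
    - apply pow_le; lra.
    - apply RtoC_neq. apply pow_nonzero; lra. }
  apply Cmod_eq_0. destruct k as [|k]; [lia|].
  assert (1 < 2 ^ S k) by (apply Rlt_pow_R1; [lra|lia]).
  assert (/ 2 ^ S k < 1) by (rewrite <- Rinv_1; apply Rinv_lt_contravar; lra).
  pose proof (Cmod_ge_0 J). nra.
Qed.

Lemma cauchy_kernel_bound z w r : Cmod z = r -> Cmod w < r -> Cmod (z / (z - w))%C <= r / (r - Cmod w).
Proof.
  intros Hz Hw. pose proof (Cmod_triangle_rev_sub z w).
  rewrite Cmod_div; [|apply Cmod_gt_0; lra]. rewrite Hz in *.
  apply Rmult_le_compat_l; [pose proof (Cmod_ge_0 w); lra|]. apply Rinv_le_contravar; lra.
Qed.

Section Taylor.
Variables (h : C -> C) (r : R) (w : C).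
Hypothesis (Hw : Cmod w < r).
Hypothesis (Hh : forall z, Cmod z = r -> holo h z).

Let zn z : Cmod z = r -> z <> 0%C.
Proof. intros Hz. apply Cmod_gt_0. pose proof (Cmod_ge_0 w). lra. Qed.
Let zwn z : Cmod z = r -> (z - w)%C <> 0%C.
Proof. intros Hz. apply Cminus_neq, Cmod_neq. lra. Qed.

Lemma holo_taylor_term n z : Cmod z = r -> holo (fun z => h z / z ^ n * (z / (z - w)))%C z.
Proof.
  intros Hz. apply holo_mult; apply holo_div.
  - now apply Cpow_nz, zn.
  - now apply Hh.
  - apply holo_pow, holo_id.
  - now apply zwn.
  - apply holo_id.
  - apply holo_minus; [apply holo_id|apply holo_const].
Qed.

(** Iterating [1 / (z - w) = 1 / z + w / (z (z - w))] under the mean. *)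
Lemma taylor_expand n :
  circ (fun z => h z * (z / (z - w)))%C r =
  (csum (fun k => w ^ k * coef h k r) n + w ^ n * circ (fun z => h z / z ^ n * (z / (z - w))) r)%C.
Proof.
  pose proof (Cmod_ge_0 w) as Pw.
  induction n as [|n IH].
  - simpl. rewrite Cplus_0_l, Cmult_1_l. apply circ_ext; [lra|]. intros z Hz. pose proof (zwn z Hz).
    field. repeat split; try assumption; intro X; injection X; lra.
  - rewrite IH. simpl csum.
    assert (E : circ (fun z => h z / z ^ n * (z / (z - w)))%C r =
       (coef h n r + w * circ (fun z => h z / z ^ S n * (z / (z - w))) r)%C).
    { unfold coef. rewrite <- circ_scal; [|lra|].
      - rewrite <- circ_plus; [|lra| |].
        + apply circ_ext; [lra|]. intros z Hz. rewrite Cpow_S. pose proof (zwn z Hz). pose proof (zn z Hz).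
          pose proof (Cpow_nz z n (zn z Hz)). field. repeat split; assumption.
        + apply holo_cont_circ. intros z Hz. apply holo_div; [now apply Cpow_nz, zn|now apply Hh|apply holo_pow, holo_id].
        + apply holo_cont_circ. intros z Hz. apply holo_mult; [apply holo_const|now apply holo_taylor_term].
      - apply holo_cont_circ. intros z Hz. now apply holo_taylor_term. }
    rewrite E, Cpow_S. ring.
Qed.

Lemma taylor_rem_bound n M : (forall z, Cmod z = r -> Cmod (h z) <= M) ->
  Cmod (circ (fun z => h z / z ^ n * (z / (z - w)))%C r) <= M / r ^ n * (r / (r - Cmod w)).
Proof.
  intros HM. pose proof (Cmod_ge_0 w) as Pw. apply circ_bound; [lra| |].
  - apply holo_cont_circ. intros z Hz. now apply holo_taylor_term.
  - intros z Hz. rewrite Cmod_mult. apply Rmult_le_compat; try apply Cmod_ge_0.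
    + rewrite Cmod_div by now apply Cpow_nz, zn. rewrite Cmod_pow, Hz.
      apply Rmult_le_compat_r; [|now apply HM]. left. apply Rinv_0_lt_compat, pow_lt. lra.
    + now apply cauchy_kernel_bound.
Qed.
End Taylor.

(** The expansion of the kernel has all coefficients zero but the first, and its remainder tends to zero. *)
Lemma cauchy_one r w : Cmod w < r -> circ (fun z => z / (z - w))%C r = 1%C.
Proof.
  intros Hw. pose proof (Cmod_ge_0 w) as Pw.
  assert (E : forall n, circ (fun z => z / (z - w))%C r =
     (1 + w ^ S n * circ (fun z => 1 / z ^ S n * (z / (z - w))) r)%C).
  { intros n. transitivity (circ (fun z => 1 * (z / (z - w)))%C r).
    { apply circ_ext; [lra|]. intros; ring. }
    rewrite (taylor_expand (fun _ => 1%C) r w Hw (fun z _ => holo_const _ _) (S n)). f_equal.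
    induction n as [|n IH].
    - simpl. assert (E0 : coef (fun _ => 1%C) 0 r = 1%C).
      { transitivity (circ (fun _ => 1%C) r); [|apply circ_const].
        apply circ_ext; [lra|]. intros z _. simpl. field. }
      rewrite E0. ring.
    - change (csum (fun k : nat => w ^ k * coef (fun _ : C => 1) k r) (S (S n)))%C with
       (csum (fun k : nat => w ^ k * coef (fun _ : C => 1) k r) (S n) + w ^ S n * coef (fun _ : C => 1) (S n) r)%C.
      rewrite IH, coef_inv_pow by (lra || lia). ring. }
  set (x := circ (fun z => z / (z - w))%C r) in *.
  assert (D : Cmod (x - 1)%C <= 0).
  { apply (geom_small (Cmod w / r) (Cmod w / r * (r / (r - Cmod w)))).
    - split; [apply Rmult_le_pos; [assumption|left; apply Rinv_0_lt_compat; lra]|].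
      apply Rmult_lt_reg_r with r; [lra|]. unfold Rdiv. rewrite Rmult_assoc, Rinv_l; lra.
    - intros n. rewrite (E n).
      replace (1 + w ^ S n * circ (fun z => 1 / z ^ S n * (z / (z - w))) r - 1)%C with
        (w ^ S n * circ (fun z => 1 / z ^ S n * (z / (z - w))) r)%C by ring.
      rewrite Cmod_mult, Cmod_pow.
      eapply Rle_trans.
      + apply Rmult_le_compat_l; [apply pow_le, Cmod_ge_0|].
        apply (taylor_rem_bound (fun _ => 1%C) r w Hw (fun z _ => holo_const _ _) (S n) 1).
        intros; rewrite Cmod_1; lra.
      + right. simpl. unfold Rdiv. rewrite Rpow_mult_distr, pow_inv. field.
        split; [|split]; try lra. apply pow_nonzero; lra. }
  pose proof (Cmod_ge_0 (x - 1)%C).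
  assert (Z : Cmod (x - 1)%C = 0) by lra. apply Cmod_eq_0 in Z.
  replace x with (x - 1 + 1)%C by ring. rewrite Z. ring.
Qed.

(** The difference quotient at [w], completed by the derivative, is continuous, and holomorphic off the circle
    through [w]; multiplied by [z], it has mean zero. *)
Theorem cauchy_formula h R0 w r : (forall z, Cmod z < R0 -> holo h z) -> Cmod w < r < R0 ->
  h w = circ (fun z => h z * (z / (z - w)))%C r.
Proof.
  intros Hh Hr. pose proof (Cmod_ge_0 w) as Pw.
  destruct (Hh w ltac:(lra)) as [l Hl].
  set (phi := fun z => if Ceq_dec z w then l else ((h z - h w) / (z - w))%C).
  assert (Ho : forall z, Cmod z < R0 -> z <> w -> holo phi z).
  { intros z Hz N. apply (holo_ext_loc (fun z => (h z - h w) / (z - w))%C).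
    - exists (Cmod (z - w)%C). split; [apply Cmod_gt_0; now apply Cminus_neq|].
      intros d Hd. unfold phi. destruct (Ceq_dec (z + d)%C w) as [E|]; [|reflexivity].
      exfalso. subst w. replace (z - (z + d))%C with (- d)%C in Hd by ring. rewrite Cmod_opp in Hd. lra.
    - apply holo_div; [now apply Cminus_neq| |]; apply holo_minus; try apply holo_const; [now apply Hh|apply holo_id]. }
  assert (Hc : ccont phi w).
  { intros eps He. destruct (Hl (eps / 2) ltac:(lra)) as [d [Hd Hb]]. exists d; split; [assumption|].
    intros z Hz. unfold phi. destruct (Ceq_dec w w) as [_|X]; [|now contradiction X].
    destruct (Ceq_dec (w + z)%C w) as [E|N].
    - replace (l - l)%C with (RtoC 0) by ring. rewrite Cmod_0. lra.
    - assert (Nz : z <> 0%C) by (intro X; apply N; rewrite X; ring).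
      assert (P : 0 < Cmod z) by now apply Cmod_gt_0.
      specialize (Hb z Hz).
      replace ((h (w + z) - h w) / (w + z - w) - l)%C with ((h (w + z) - h w - l * z) / z)%C
        by (replace (w + z - w)%C with z by ring; field; assumption).
      rewrite Cmod_div by assumption.
      apply Rle_lt_trans with (eps / 2); [|lra].
      apply Rmult_le_reg_r with (Cmod z); [assumption|]. unfold Rdiv at 1. rewrite Rmult_assoc, Rinv_l by lra. lra. }
  assert (M : circ (fun z => z * phi z)%C r = 0%C).
  { rewrite (circ_mean _ R0 (Cmod w)).
    - ring.
    - assumption.
    - intros z Hz. apply ccont_mult; [eapply cder_ccont, cder_id|].
      destruct (Ceq_dec z w) as [->|N]; [assumption|apply holo_ccont, Ho; assumption].
    - intros z Hz N. apply holo_mult; [apply holo_id|]. apply Ho; [assumption|]. now apply Cmod_neq.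
    - lra. }
  assert (E : circ (fun z => z * phi z)%C r = (circ (fun z => h z * (z / (z - w))) r - h w * circ (fun z => z / (z - w)) r)%C).
  { rewrite <- circ_scal, <- circ_minus; try lra.
    - apply circ_ext; [lra|]. intros z Hz. unfold phi.
      assert (z <> w) by (apply Cmod_neq; lra).
      destruct (Ceq_dec z w) as [->|N]; [now contradiction H|]. field. now apply Cminus_neq.
    - apply holo_cont_circ. intros z Hz. apply holo_mult; [apply Hh; lra|].
      apply holo_div; [apply Cminus_neq, Cmod_neq; lra|apply holo_id|apply holo_minus; [apply holo_id|apply holo_const]].
    - apply holo_cont_circ. intros z Hz. apply holo_mult; [apply holo_const|].
      apply holo_div; [apply Cminus_neq, Cmod_neq; lra|apply holo_id|apply holo_minus; [apply holo_id|apply holo_const]].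
    - apply holo_cont_circ. intros z Hz.
      apply holo_div; [apply Cminus_neq, Cmod_neq; lra|apply holo_id|apply holo_minus; [apply holo_id|apply holo_const]]. }
  rewrite M, cauchy_one in E by lra.
  replace (h w) with (h w * 1)%C by ring. symmetry.
  match goal with |- ?a = ?b => replace a with (a - b + b)%C by ring end. rewrite <- E. ring.
Qed.

Lemma taylor h R0 w r n : (forall z, Cmod z < R0 -> holo h z) -> Cmod w < r < R0 ->
  h w = (csum (fun k => w ^ k * coef h k r) n + w ^ n * circ (fun z => h z / z ^ n * (z / (z - w))) r)%C.
Proof.
  intros Hh Hr. rewrite (cauchy_formula h R0 w r Hh Hr). apply taylor_expand; [lra|]. intros; apply Hh; lra.
Qed.

(** Cauchy's formula loses a factor depending on the distance of [w] to the circle. Applied to the powers of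
    [h], whose n-th roots make this factor tend to 1, it loses nothing. *)
Lemma max_modulus h R0 r B : 0 <= B -> (forall z, Cmod z < R0 -> holo h z) -> 0 < r < R0 ->
  (forall z, Cmod z = r -> Cmod (h z) <= B) -> forall w, Cmod w < r -> Cmod (h w) <= B.
Proof.
  intros HB Hh Hr HM w Hw. pose proof (Cmod_ge_0 w) as Pw.
  assert (P : forall n, Cmod (h w) ^ n <= B ^ n * (r / (r - Cmod w))).
  { intros n. rewrite <- Cmod_pow.
    assert (Hn : forall z, Cmod z < R0 -> holo (fun z => h z ^ n)%C z) by (intros z Hz; apply holo_pow; now apply Hh).
    rewrite (cauchy_formula (fun z => h z ^ n)%C R0 w r Hn) by lra.
    apply circ_bound; [lra| |].
    - apply holo_cont_circ. intros z Hz. apply holo_mult; [apply Hn; lra|].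
      apply holo_div; [apply Cminus_neq, Cmod_neq; lra|apply holo_id|apply holo_minus; [apply holo_id|apply holo_const]].
    - intros z Hz. rewrite Cmod_mult, Cmod_pow. apply Rmult_le_compat; try apply Cmod_ge_0.
      + apply pow_le, Cmod_ge_0.
      + apply pow_incr. split; [apply Cmod_ge_0|now apply HM].
      + now apply cauchy_kernel_bound. }
  destruct (Rle_dec (Cmod (h w)) B) as [|N]; [assumption|exfalso].
  set (x := Cmod (h w)) in *.
  assert (X : 1 <= 0); [|lra].
  apply (geom_small (B / x) (r / (r - Cmod w))).
  - split; [apply Rmult_le_pos; [assumption|left; apply Rinv_0_lt_compat; lra]|].
    apply Rmult_lt_reg_r with x; [lra|]. unfold Rdiv. rewrite Rmult_assoc, Rinv_l; lra.
  - intros n. specialize (P n). assert (0 < x ^ n) by (apply pow_lt; lra).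
    unfold Rdiv. rewrite Rpow_mult_distr, pow_inv.
    apply Rmult_le_reg_r with (x ^ n); [assumption|].
    replace (r * / (r - Cmod w) * (B ^ n * / x ^ n) * x ^ n) with (B ^ n * (r / (r - Cmod w))) by (field; split; lra). lra.
Qed.

(** * Holomorphy of derivatives and division by a zero *)

Lemma bounded_on_rect F a b c d : a <= b -> c <= d -> on_rect (ccont F) a b c d ->
  exists M, on_rect (fun z => Cmod (F z) <= M) a b c d.
Proof.
  intros Hab Hcd HF.
  apply (rect_bisection (fun a b c d => exists M, on_rect (fun z => Cmod (F z) <= M) a b c d)); try assumption.
  - intros a' b' c' d' _ _ _ _ _ _ [M1 H1] [M2 H2] [M3 H3] [M4 H4].
    exists (Rmax (Rmax M1 M2) (Rmax M3 M4)). intros x y Hx Hy.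
    pose proof (Rmax_l M1 M2). pose proof (Rmax_r M1 M2). pose proof (Rmax_l M3 M4). pose proof (Rmax_r M3 M4).
    pose proof (Rmax_l (Rmax M1 M2) (Rmax M3 M4)). pose proof (Rmax_r (Rmax M1 M2) (Rmax M3 M4)).
    destruct (Rle_dec x ((a' + b') / 2)), (Rle_dec y ((c' + d') / 2)).
    + specialize (H1 x y ltac:(lra) ltac:(lra)). simpl in H1. lra.
    + specialize (H2 x y ltac:(lra) ltac:(lra)). simpl in H2. lra.
    + specialize (H3 x y ltac:(lra) ltac:(lra)). simpl in H3. lra.
    + specialize (H4 x y ltac:(lra) ltac:(lra)). simpl in H4. lra.
  - intros x y Hx Hy. destruct (HF x y Hx Hy 1 ltac:(lra)) as [r [Hr Hb]].
    exists (r / 2); split; [lra|]. intros a' b' c' d' _ _ _ _ Hx' Hy' H1 H2.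
    exists (Cmod (F (x, y)) + 1). intros u v Hu Hv.
    assert (Hd : Cmod ((u, v) - (x, y))%C < r).
    { eapply Rle_lt_trans; [apply Cmod_le_abs|]. simpl.
      apply Rlt_le_trans with (r / 2 + r / 2); [|lra]. apply Rplus_lt_compat; apply Rabs_def1; lra. }
    specialize (Hb _ Hd). replace ((x, y) + ((u, v) - (x, y)))%C with ((u, v) : C) in Hb by (apply Ceq_re_im; simpl; ring).
    replace (F (u, v)) with (F (x, y) + (F (u, v) - F (x, y)))%C by ring.
    eapply Rle_trans; [apply Cmod_triangle|lra].
Qed.

(** The angle is found with [acos], on the upper or the lower half circle. *)
Lemma polar_form (z : C) : exists t, 0 <= t <= 2 * PI /\ z = (Cmod z * cis t)%C.
Proof.
  destruct (Ceq_dec z 0%C) as [->|N].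
  { exists 0. pose proof two_PI_pos. split; [lra|]. rewrite Cmod_0. ring. }
  assert (P : 0 < Cmod z) by now apply Cmod_gt_0.
  destruct z as [x y]. set (m := Cmod (x, y)) in *.
  assert (Hm : x * x + y * y = m * m).
  { unfold m, Cmod. rewrite sqrt_sqrt; simpl; nra. }
  assert (Hx : -1 <= x / m <= 1).
  { split; apply Rmult_le_reg_r with m; try lra; unfold Rdiv; rewrite Rmult_assoc, Rinv_l by lra; nra. }
  assert (S : sin (acos (x / m)) = Rabs y / m).
  { rewrite sin_acos by assumption. replace (1 - (x / m)²) with ((Rabs y / m)²).
    - apply sqrt_Rsqr. apply Rmult_le_pos; [apply Rabs_pos|left; apply Rinv_0_lt_compat; lra].
    - unfold Rsqr. replace (Rabs y / m * (Rabs y / m)) with ((Rabs y * Rabs y) / (m * m)) by (field; lra).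
      rewrite <- Rabs_mult, Rabs_pos_eq by nra. replace (y * y) with (m * m - x * x) by lra. field. lra. }
  pose proof (acos_bound (x / m)) as B. pose proof PI_RGT_0.
  destruct (Rle_dec 0 y) as [Hy|Hy].
  - exists (acos (x / m)). split; [lra|]. unfold cis. rewrite S, cos_acos, Rabs_pos_eq by assumption.
    apply Ceq_re_im; simpl; field; lra.
  - exists (2 * PI - acos (x / m)). split; [lra|]. unfold cis.
    rewrite cos_minus, sin_minus, cos_2PI, sin_2PI, S, cos_acos, Rabs_left by (assumption || lra).
    apply Ceq_re_im; simpl; field; lra.
Qed.

Lemma bounded_on_circle F r : 0 < r -> cont_circ F r ->
  exists M, 0 <= M /\ forall z, Cmod z = r -> Cmod (F z) <= M.
Proof.
  intros Hr HF. pose proof two_PI_pos.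
  destruct (bounded_on_rect (fun z => F (Cexp z)) (ln r) (ln r) 0 (2 * PI)) as [M HM]; [lra|lra| |].
  - intros x y Hx _. apply ccont_comp; [eapply cder_ccont, cder_Cexp|].
    apply HF. rewrite Cmod_Cexp. simpl. replace x with (ln r) by lra. now apply exp_ln.
  - assert (HM' : forall z, Cmod z = r -> Cmod (F z) <= M).
    { intros z Hz. destruct (polar_form z) as [t [Ht E]].
      specialize (HM (ln r) t ltac:(lra) Ht). simpl in HM. rewrite Cexp_eq in HM. simpl in HM.
      rewrite exp_ln, <- Hz, <- E in HM; assumption. }
    exists M; split; [|assumption]. eapply Rle_trans; [apply Cmod_ge_0|apply (HM' (RtoC r))].
    rewrite Cmod_R. apply Rabs_pos_eq. lra.
Qed.

Lemma holo_kernel (w z : C) (n : nat) : z <> w -> holo (fun z => / (z - w) ^ n)%C z.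
Proof.
  intros N. apply holo_inv; [now apply Cpow_nz, Cminus_neq|].
  apply (holo_pow (fun z => z - w)%C), holo_minus; [apply holo_id|apply holo_const].
Qed.

(** Differentiation under the integral sign, from a second-order estimate that is uniform on the circle. *)
Lemma circ_param_deriv (k : C -> C -> C) (k' : C -> C) r w d B : 0 <= r -> 0 < d -> 0 <= B ->
  (forall h, Cmod h < d -> cont_circ (k (w + h)%C) r) -> cont_circ k' r ->
  (forall z h, Cmod z = r -> Cmod h < d -> Cmod (k (w + h)%C z - k w z - h * k' z)%C <= B * Cmod h * Cmod h) ->
  cder (fun w => circ (k w) r) w (circ k' r).
Proof.
  intros Hr Hd HB Hk Hk' HE eps He.
  exists (Rmin d (eps / (B + 1))). split; [apply Rmin_glb_lt; [lra|apply Rdiv_lt_0_compat; lra]|].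
  intros h Hh. pose proof (Rmin_l d (eps / (B + 1))). pose proof (Rmin_r d (eps / (B + 1))).
  assert (Hk0 : cont_circ (k w) r) by (rewrite <- (Cplus_0_r w); apply Hk; rewrite Cmod_0; lra).
  specialize (Hk h ltac:(lra)).
  assert (Cs : forall c F, cont_circ F r -> cont_circ (fun z => c * F z)%C r).
  { intros c F HF z Hz. apply ccont_mult; [apply ccont_const|now apply HF]. }
  assert (Cm : forall F G, cont_circ F r -> cont_circ G r -> cont_circ (fun z => F z - G z)%C r).
  { intros F G HF HG z Hz. apply ccont_plus; [now apply HF|].
    apply (ccont_comp Copp G); [now apply HG|]. eapply cder_ccont, cder_opp, cder_id. }
  rewrite (Cmult_comm _ h), <- circ_scal, <- circ_minus, <- circ_minus by (lra || auto).
  apply Rle_trans with (B * Cmod h * Cmod h).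
  - apply circ_bound; [lra|now apply Cm; [apply Cm|apply Cs]|]. intros z Hz. apply HE; [assumption|lra].
  - pose proof (Cmod_ge_0 h). apply Rmult_le_compat_r; [assumption|].
    apply Rle_trans with ((B + 1) * (eps / (B + 1))); [|right; field; lra].
    apply Rle_trans with ((B + 1) * Cmod h); [nra|]. apply Rmult_le_compat_l; lra.
Qed.

Lemma cauchy_integral_cder phi r w : Cmod w < r -> cont_circ phi r ->
  cder (fun w => circ (fun z => phi z * / (z - w) ^ 1)%C r) w (circ (fun z => phi z * / (z - w) ^ 2)%C r) /\
  cder (fun w => circ (fun z => phi z * / (z - w) ^ 2)%C r) w (circ (fun z => 2 * (phi z * / (z - w) ^ 3))%C r).
Proof.
  intros Hw Hphi. pose proof (Cmod_ge_0 w).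
  destruct (bounded_on_circle phi r) as [M [M0 HM]]; [lra|assumption|].
  set (m := r - Cmod w). assert (Hm : 0 < m) by (unfold m; lra).
  assert (C1 : forall n h, Cmod h < m / 2 -> cont_circ (fun z => phi z * / (z - (w + h)) ^ n)%C r).
  { intros n h Hh z Hz. apply ccont_mult; [now apply Hphi|]. apply holo_ccont, holo_kernel, Cmod_neq.
    pose proof (Cmod_triangle w h). unfold m in *. lra. }
  assert (C0 : forall n, cont_circ (fun z => phi z * / (z - w) ^ n)%C r).
  { intros n. rewrite <- (Cplus_0_r w). apply C1. rewrite Cmod_0. lra. }
  assert (Den : forall z h, Cmod z = r -> Cmod h < m / 2 ->
    (z - (w + h) = z - w - h)%C /\ (z - w <> 0)%C /\ (z - w - h <> 0)%C /\
    0 < / Cmod (z - w)%C <= / m /\ 0 < / Cmod (z - w - h)%C <= / (m / 2)).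
  { intros z h Hz Hh. pose proof (Cmod_triangle_rev_sub z w) as T1. pose proof (Cmod_triangle_rev_sub (z - w)%C h) as T2.
    unfold m in *. repeat split; try ring; try (apply Cmod_gt_0; lra); try (apply Rinv_0_lt_compat; lra); apply Rinv_le_contravar; lra. }
  split.
  - apply (circ_param_deriv (fun w z => phi z * / (z - w) ^ 1)%C _ r w (m / 2) (M * (/ m * / m * / (m / 2)))); try lra; [|exact (C1 1%nat)|apply C0|].
    { assert (0 < / m) by now apply Rinv_0_lt_compat. assert (0 < / (m / 2)) by (apply Rinv_0_lt_compat; lra). repeat apply Rmult_le_pos; lra. }
    intros z h Hz Hh. destruct (Den z h Hz Hh) as (-> & Nu & Nuh & I1 & I2). set (u := (z - w)%C) in *.
    replace (phi z * / (u - h) ^ 1 - phi z * / u ^ 1 - h * (phi z * / u ^ 2))%C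
      with (phi z * (/ u * / u * / (u - h)) * h * h)%C by (simpl; field; split; assumption).
    rewrite !Cmod_mult, !Cmod_inv by assumption. pose proof (Cmod_ge_0 h).
    apply Rmult_le_compat_r; [assumption|]. apply Rmult_le_compat_r; [assumption|].
    apply Rmult_le_compat; [apply Cmod_ge_0|repeat apply Rmult_le_pos; lra|now apply HM|].
    repeat apply Rmult_le_compat; try lra; repeat apply Rmult_le_pos; lra.
  - apply (circ_param_deriv (fun w z => phi z * / (z - w) ^ 2)%C _ r w (m / 2) (M * (4 * (/ m * / m * (/ (m / 2) * / (m / 2)))))); try lra; [|exact (C1 2%nat)| |].
    { assert (0 < / m) by now apply Rinv_0_lt_compat. assert (0 < / (m / 2)) by (apply Rinv_0_lt_compat; lra). repeat apply Rmult_le_pos; lra. }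
    { intros z Hz. apply ccont_mult; [apply ccont_const|now apply C0]. }
    intros z h Hz Hh. destruct (Den z h Hz Hh) as (-> & Nu & Nuh & I1 & I2).
    assert (B3 : Cmod (3 * (z - w) - 2 * h)%C <= 4 * Cmod (z - w)%C).
    { eapply Rle_trans; [apply Cmod_triangle_sub|]. rewrite !Cmod_mult, !Cmod_R, !Rabs_pos_eq by lra.
      pose proof (Cmod_triangle_rev_sub z w). unfold m in Hh. lra. }
    assert (Pu : 0 < Cmod (z - w)%C) by now apply Cmod_gt_0. set (u := (z - w)%C) in *.
    replace (phi z * / (u - h) ^ 2 - phi z * / u ^ 2 - h * (2 * (phi z * / u ^ 3)))%C
      with (phi z * ((3 * u - 2 * h) * / u * (/ u * / u * (/ (u - h) * / (u - h)))) * h * h)%C by (simpl; field; split; assumption).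
    rewrite !Cmod_mult, !Cmod_inv by assumption. pose proof (Cmod_ge_0 h). pose proof (Cmod_ge_0 (3 * u - 2 * h)%C).
    apply Rmult_le_compat_r; [assumption|]. apply Rmult_le_compat_r; [assumption|].
    apply Rmult_le_compat; [apply Cmod_ge_0|repeat apply Rmult_le_pos; lra|now apply HM|].
    apply Rmult_le_compat; [apply Rmult_le_pos; lra|repeat apply Rmult_le_pos; lra| |].
    + apply Rmult_le_reg_r with (Cmod u); [assumption|]. rewrite Rmult_assoc, Rinv_l by lra. lra.
    + repeat apply Rmult_le_compat; try lra; repeat apply Rmult_le_pos; lra.
Qed.

(** Differentiating Cauchy's formula twice under the integral sign. *)
Lemma holo_deriv h h' R0 : (forall z, Cmod z < R0 -> cder h z (h' z)) -> forall z, Cmod z < R0 -> holo h' z.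
Proof.
  intros Hh w Hw. pose proof (Cmod_ge_0 w).
  set (r := (Cmod w + R0) / 2).
  assert (HC : cont_circ (fun z => h z * z)%C r).
  { apply holo_cont_circ. intros z Hz. apply holo_mult; [eexists; apply Hh; unfold r in Hz; lra|apply holo_id]. }
  apply (holo_ext_loc (fun w => circ (fun z => h z * z * / (z - w) ^ 2)%C r)).
  - exists (r - Cmod w). split; [unfold r; lra|]. intros d Hd.
    assert (Hwd : Cmod (w + d)%C < r) by (pose proof (Cmod_triangle w d); lra).
    apply (cder_unique h (w + d)%C); [|apply Hh; unfold r in *; lra].
    apply (cder_ext_loc (fun w => circ (fun z => h z * z * / (z - w) ^ 1)%C r)).
    + exists (r - Cmod (w + d)%C). split; [lra|]. intros e He.
      assert (Hwe : Cmod (w + d + e)%C < r) by (pose proof (Cmod_triangle (w + d) e); lra).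
      rewrite (cauchy_formula h R0 (w + d + e)%C r); [|intros; eexists; now apply Hh|unfold r in *; lra].
      apply circ_ext; [unfold r; lra|]. intros z Hz. simpl. field.
      apply Cminus_neq, Cmod_neq; lra.
    + exact (proj1 (cauchy_integral_cder (fun z => h z * z)%C r (w + d)%C Hwd HC)).
  - eexists. exact (proj2 (cauchy_integral_cder (fun z => h z * z)%C r w ltac:(unfold r; lra) HC)).
Qed.

(** Near [rho] the quotient is the Cauchy-type integral [G], which is holomorphic; elsewhere it is the plain
    quotient. *)
Lemma divide_zero f rho : (forall z, holo f z) -> f rho = 0%C ->
  exists g, (forall z, holo g z) /\ forall z, f z = ((z - rho) * g z)%C.
Proof.
  intros Hf H0.
  set (F := fun z => f (rho + z)%C).
  assert (HF : forall z, holo F z) by (intros z; destruct (Hf (rho + z)%C) as [l Hl]; exists l; now apply cder_shift).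
  assert (CF : cont_circ F 1) by (apply holo_cont_circ; auto).
  set (G := fun w => circ (fun z => F z * / (z - w) ^ 1)%C 1).
  set (k := fun w => if Ceq_dec w 0%C then G 0%C else (F w / w)%C).
  assert (E : forall w, Cmod w < 1 -> k w = G w).
  { intros w Hw. unfold k. destruct (Ceq_dec w 0%C) as [->|N]; [reflexivity|].
    pose proof (cauchy_formula F 2 w 1 (fun z _ => HF z) ltac:(lra)) as E1.
    pose proof (cauchy_formula F 2 0%C 1 (fun z _ => HF z) ltac:(rewrite Cmod_0; lra)) as E0.
    assert (F0 : F 0%C = 0%C) by (unfold F; now rewrite Cplus_0_r).
    replace (F w) with (F w - F 0%C)%C by (rewrite F0; ring). rewrite E1, E0, <- circ_minus; [|lra| |].
    - transitivity (circ (fun z => w * (F z * / (z - w) ^ 1))%C 1 / w)%C.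
      + f_equal. apply circ_ext; [lra|]. intros z Hz. simpl. field.
        split; [apply Cminus_neq, Cmod_neq; lra|]. apply Cmod_gt_0; lra.
      + rewrite circ_scal; [|lra|].
        * unfold G. field. assumption.
        * apply holo_cont_circ. intros z Hz. apply holo_mult; [apply HF|apply holo_kernel, Cmod_neq; lra].
    - apply holo_cont_circ. intros z Hz. apply holo_mult; [apply HF|].
      apply holo_div; [apply Cminus_neq, Cmod_neq; lra|apply holo_id|apply holo_minus; [apply holo_id|apply holo_const]].
    - apply holo_cont_circ. intros z Hz. apply holo_mult; [apply HF|].
      apply holo_div; [apply Cminus_neq, Cmod_neq; rewrite Cmod_0; lra|apply holo_id|apply holo_minus; [apply holo_id|apply holo_const]]. }
  assert (Hk : forall w, holo k w).
  { intros w. destruct (Rlt_dec (Cmod w) 1) as [Hw|Hw].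
    - apply (holo_ext_loc G).
      + exists (1 - Cmod w). split; [lra|]. intros d Hd. symmetry. apply E. pose proof (Cmod_triangle w d). lra.
      + eexists. exact (proj1 (cauchy_integral_cder F 1 w Hw CF)).
    - assert (N : w <> 0%C) by (apply Cmod_gt_0; lra).
      apply (holo_ext_loc (fun w => F w / w)%C).
      + exists 1. split; [lra|]. intros d Hd. unfold k. destruct (Ceq_dec (w + d)%C 0%C) as [X|]; [|reflexivity].
        exfalso. pose proof (Cmod_triangle_rev w d) as T. rewrite X, Cmod_0 in T. lra.
      + apply holo_div; [assumption|apply HF|apply holo_id]. }
  exists (fun z => k (- rho + z)%C). split.
  - intros z. destruct (Hk (- rho + z)%C) as [l Hl]. exists l. now apply cder_shift.
  - intros z. unfold k. destruct (Ceq_dec (- rho + z)%C 0%C) as [X|N].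
    + replace (z - rho)%C with (- rho + z)%C by ring. rewrite X.
      replace z with (rho + (- rho + z))%C by ring. rewrite X, Cplus_0_r, H0. ring.
    + unfold F. replace (rho + (- rho + z))%C with z by ring. field. assumption.
Qed.

(** * Primitives and logarithms on discs *)

Lemma pcont_ex_RInt f p q a b : pcont_on f p q -> p <= a <= q -> p <= b <= q ->
  ex_RInt (fun t => Re (f t)) a b /\ ex_RInt (fun t => Im (f t)) a b.
Proof.
  intros H Ha Hb.
  split; apply (ex_RInt_continuous (V := R_CompleteNormedModule)); intros t Ht;
  [apply pcont_re|apply pcont_im]; apply H; revert Ht; unfold Rmin, Rmax; destruct (Rle_dec a b); lra.
Qed.

Lemma cint_swap f p q a b : pcont_on f p q -> p <= a <= q -> p <= b <= q -> cint f b a = (- cint f a b)%C.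
Proof.
  intros H Ha Hb. destruct (pcont_ex_RInt f p q a b H Ha Hb) as [H1 H2].
  unfold cint, Copp; simpl. f_equal; symmetry.
  - exact (opp_RInt_swap (V := R_CompleteNormedModule) _ _ _ H1).
  - exact (opp_RInt_swap (V := R_CompleteNormedModule) _ _ _ H2).
Qed.

Lemma cint_Chasles_signed f p q a b c : pcont_on f p q -> p <= a <= q -> p <= b <= q -> p <= c <= q ->
  (cint f a b + cint f b c)%C = cint f a c.
Proof.
  intros H Ha Hb Hc.
  destruct (pcont_ex_RInt f p q a b H Ha Hb) as [H1 H2].
  destruct (pcont_ex_RInt f p q b c H Hb Hc) as [H3 H4].
  unfold cint, Cplus; simpl. f_equal.
  - exact (RInt_Chasles (V := R_CompleteNormedModule) _ _ _ _ H1 H3).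
  - exact (RInt_Chasles (V := R_CompleteNormedModule) _ _ _ _ H2 H4).
Qed.

Lemma cint_near_const f a b c e : pcont_on f (Rmin a b) (Rmax a b) ->
  (forall t, Rmin a b <= t <= Rmax a b -> Cmod (f t - c)%C <= e) ->
  Cmod (cint f a b - (b - a)%R * c)%C <= e * Rabs (b - a).
Proof.
  assert (X : forall a b, a <= b -> pcont_on f a b -> (forall t, a <= t <= b -> Cmod (f t - c)%C <= e) ->
     Cmod (cint f a b - (b - a)%R * c)%C <= e * (b - a)).
  { intros a' b' Hab Hf He. rewrite <- cint_const, <- cint_minus; try assumption.
    - apply cint_bound; try assumption. intros t Ht. apply pcont_minus; [now apply Hf|apply pcont_const].
    - intros t Ht. apply pcont_const. }
  intros Hf He. destruct (Rle_dec a b) as [H|H].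
  - rewrite Rmin_left, Rmax_right in * by assumption. rewrite Rabs_pos_eq by lra. now apply X.
  - rewrite Rmin_right, Rmax_left in * by lra. rewrite Rabs_left by lra.
    rewrite (cint_swap f b a b a) by (assumption || lra).
    replace (- cint f b a - (b - a)%R * c)%C with (- (cint f b a - (a - b)%R * c))%C
      by (rewrite !RtoC_minus; ring).
    rewrite Cmod_opp. replace (- (b - a)) with (a - b) by ring. apply X; [lra|assumption|assumption].
Qed.

(** Reversing a side of the rectangle changes the sign of its boundary integral, so the order of the endpoints
    does not matter. *)
Lemma goursat_signed F p q u v a b c d : p <= a <= q -> p <= b <= q -> u <= c <= v -> u <= d <= v ->
  on_rect (holo F) p q u v -> bdry F a b c d = 0%C.
Proof.
  intros Ha Hb Hc Hd HF.
  assert (CH : forall y, u <= y <= v -> pcont_on (fun t => F (t, y)) p q).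
  { intros y Hy t Ht. apply (pcont_comp F (fun t => (t, y))); [apply pcont_h|apply holo_ccont; now apply HF]. }
  assert (CV : forall x, p <= x <= q -> pcont_on (fun t => F (x, t)) u v).
  { intros x Hx t Ht. apply (pcont_comp F (fun t => (x, t))); [apply pcont_v|apply holo_ccont; now apply HF]. }
  assert (Sh : forall a b c d, p <= a <= q -> p <= b <= q -> u <= c <= v -> u <= d <= v -> bdry F b a c d = (- bdry F a b c d)%C).
  { intros a' b' c' d' H1 H2 H3 H4. unfold bdry.
    rewrite (cint_swap (fun t => F (t, c')) p q a' b'), (cint_swap (fun t => F (t, d')) p q a' b') by auto. ring. }
  assert (Sv : forall a b c d, p <= a <= q -> p <= b <= q -> u <= c <= v -> u <= d <= v -> bdry F a b d c = (- bdry F a b c d)%C).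
  { intros a' b' c' d' H1 H2 H3 H4. unfold bdry.
    rewrite (cint_swap (fun t => F (a', t)) u v c' d'), (cint_swap (fun t => F (b', t)) u v c' d') by auto. ring. }
  assert (G : forall a b c d, a <= b -> c <= d -> p <= a <= q -> p <= b <= q -> u <= c <= v -> u <= d <= v -> bdry F a b c d = 0%C).
  { intros a' b' c' d' H1 H2 H3 H4 H5 H6. apply goursat; try assumption. intros x y Hx Hy. apply HF; lra. }
  destruct (Rle_dec a b), (Rle_dec c d).
  - apply G; lra.
  - rewrite Sv, G by lra. ring.
  - rewrite Sh, G by lra. ring.
  - rewrite Sh, Sv, G by lra. ring.
Qed.

(** Keeps the corners of a small rectangle around a point of a disc within the disc. *)
Lemma Cmod_pair_le (s t x y a b : R) : Rabs s <= Rabs x + a -> Rabs t <= Rabs y + b -> 0 <= a -> 0 <= b ->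
  Cmod (s, t) <= Cmod (x, y) + a + b.
Proof.
  intros Hs Ht Ha Hb.
  apply Rle_trans with (Cmod ((Rabs x, Rabs y) + ((a, 0) + (0, b)))%C).
  - unfold Cmod. simpl. apply sqrt_le_1_alt. rewrite <- (Rabs_pos_eq (s * (s * 1))), <- (Rabs_pos_eq (t * (t * 1))) by nra.
    rewrite !Rmult_1_r, !Rabs_mult. pose proof (Rabs_pos s); pose proof (Rabs_pos t). nra.
  - eapply Rle_trans; [apply Cmod_triangle|]. rewrite Rplus_assoc. apply Rplus_le_compat.
    + right. unfold Cmod. simpl. f_equal. rewrite !Rmult_1_r, <- !Rabs_mult, !Rabs_pos_eq by nra. ring.
    + eapply Rle_trans; [apply Cmod_triangle|]. apply Rplus_le_compat.
      * change (a, 0) with (RtoC a). rewrite Cmod_R, Rabs_pos_eq; lra.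
      * eapply Rle_trans; [apply Cmod_le_abs|]. simpl. rewrite Rabs_R0, Rabs_pos_eq; lra.
Qed.

Lemma Rabs_between s x e : Rmin x (x + e) <= s <= Rmax x (x + e) -> Rabs (s - x) <= Rabs e /\ Rabs s <= Rabs x + Rabs e.
Proof.
  intros H. assert (H1 : Rabs (s - x) <= Rabs e).
  { revert H. unfold Rmin, Rmax. destruct (Rle_dec x (x + e)); intros H;
    unfold Rabs; repeat destruct (Rcase_abs _); lra. }
  split; [assumption|]. replace s with (x + (s - x)) by ring. eapply Rle_trans; [apply Rabs_triang|]. lra.
Qed.

(** The primitive integrates along the broken line from 0, horizontal then vertical. All these lines stay in
    the disc, and by Goursat's theorem the increment is the integral along a short broken line. *)
Theorem primitive_on_disc h R0 : (forall z, Cmod z < R0 -> holo h z) ->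
  exists G, forall z, Cmod z < R0 -> cder G z (h z).
Proof.
  intros Hh.
  set (G := fun z : C => (cint (fun t => h (t, 0)) 0 (Re z) + Ci * cint (fun t => h (Re z, t)) 0 (Im z))%C).
  exists G. intros [x y] Hz eps He.
  set (m := (R0 - Cmod (x, y)) / 2). assert (Hm : 0 < m) by (unfold m; lra).
  destruct (holo_ccont _ _ (Hh (x, y) Hz) (eps / 2) ltac:(lra)) as [d [Hd Hb]].
  exists (Rmin m (d / 2)). split; [apply Rmin_glb_lt; lra|]. intros [a b] Hab.
  assert (Hab1 : Cmod (a, b) < m) by (eapply Rlt_le_trans; [exact Hab|apply Rmin_l]).
  assert (Hab2 : Cmod (a, b) < d / 2) by (eapply Rlt_le_trans; [exact Hab|apply Rmin_r]).
  pose proof (re_le_Cmod (a, b)) as Ba. pose proof (im_le_Cmod (a, b)) as Bb. simpl in Ba, Bb.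
  pose proof (Rabs_pos a) as Pa. pose proof (Rabs_pos b) as Pb.
  pose proof (Rabs_pos x) as Px. pose proof (Rabs_pos y) as Py.
  set (X := Rabs x + Rabs a). set (Y := Rabs y + Rabs b).
  assert (HR : on_rect (holo h) (- X) X (- Y) Y).
  { intros s t Hs Ht. apply Hh. eapply Rle_lt_trans.
    - apply (Cmod_pair_le s t x y (Rabs a) (Rabs b)); try assumption; apply Rabs_le; unfold X, Y in *; lra.
    - unfold m in *. lra. }
  assert (CH : forall v, - Y <= v <= Y -> pcont_on (fun t => h (t, v)) (- X) X).
  { intros v Hv t Ht. apply (pcont_comp h (fun t => (t, v))); [apply pcont_h|apply holo_ccont; now apply HR]. }
  assert (CV : forall u, - X <= u <= X -> pcont_on (fun t => h (u, t)) (- Y) Y).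
  { intros u Hu t Ht. apply (pcont_comp h (fun t => (u, t))); [apply pcont_v|apply holo_ccont; now apply HR]. }
  assert (Ix : - X <= x <= X) by (unfold X; pose proof (Rle_abs x); pose proof (Rle_abs (- x)); rewrite Rabs_Ropp in *; lra).
  assert (Ixa : - X <= x + a <= X).
  { unfold X; pose proof (Rle_abs x); pose proof (Rle_abs (- x)); pose proof (Rle_abs a); pose proof (Rle_abs (- a));
    rewrite !Rabs_Ropp in *; lra. }
  assert (Iy : - Y <= y <= Y) by (unfold Y; pose proof (Rle_abs y); pose proof (Rle_abs (- y)); rewrite Rabs_Ropp in *; lra).
  assert (Iyb : - Y <= y + b <= Y).
  { unfold Y; pose proof (Rle_abs y); pose proof (Rle_abs (- y)); pose proof (Rle_abs b); pose proof (Rle_abs (- b));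
    rewrite !Rabs_Ropp in *; lra. }
  assert (I0 : - X <= 0 <= X) by (unfold X; lra). assert (J0 : - Y <= 0 <= Y) by (unfold Y; lra).
  assert (E : (G ((x, y) + (a, b)) - G (x, y))%C =
     (cint (fun t => h (t, y)) x (x + a) + Ci * cint (fun t => h ((x + a)%R, t)) y (y + b))%C).
  { unfold G. simpl.
    pose proof (goursat_signed h (- X) X (- Y) Y x (x + a) 0 y Ix Ixa J0 Iy HR) as Q. unfold bdry in Q.
    rewrite <- (cint_Chasles_signed (fun t => h (t, 0)) (- X) X 0 x (x + a)) by auto.
    rewrite <- (cint_Chasles_signed (fun t => h ((x + a)%R, t)) (- Y) Y 0 y (y + b)) by auto.
    match type of Q with ?q = _ => match goal with |- ?l = ?r => replace l with (r + q)%C by ring end end.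
    rewrite Q. ring. }
  rewrite E.
  assert (B1 : Cmod (cint (fun t => h (t, y)) x (x + a) - a * h (x, y))%C <= eps / 2 * Rabs a).
  { pose proof (cint_near_const (fun t => h (t, y)) x (x + a) (h (x, y)) (eps / 2)) as N.
    replace (x + a - x) with a in N by ring. apply N.
    - intros t Ht. apply (CH y Iy). revert Ht. unfold Rmin, Rmax; destruct (Rle_dec x (x + a)); lra.
    - intros t Ht. left. apply Rabs_between in Ht.
      assert (Hd' : Cmod ((t, y) - (x, y))%C < d).
      { eapply Rle_lt_trans; [apply Cmod_le_abs|]. simpl. replace (y + - y) with 0 by ring. rewrite Rabs_R0.
        unfold Rminus in Ht. lra. }
      specialize (Hb _ Hd'). replace ((x, y) + ((t, y) - (x, y)))%C with ((t, y) : C) in Hb by (apply Ceq_re_im; simpl; ring).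
      exact Hb. }
  assert (B2 : Cmod (cint (fun t => h ((x + a)%R, t)) y (y + b) - b * h (x, y))%C <= eps / 2 * Rabs b).
  { pose proof (cint_near_const (fun t => h ((x + a)%R, t)) y (y + b) (h (x, y)) (eps / 2)) as N.
    replace (y + b - y) with b in N by ring. apply N.
    - intros t Ht. apply (CV (x + a) Ixa). revert Ht. unfold Rmin, Rmax; destruct (Rle_dec y (y + b)); lra.
    - intros t Ht. left. apply Rabs_between in Ht.
      assert (Hd' : Cmod (((x + a)%R, t) - (x, y))%C < d).
      { eapply Rle_lt_trans; [apply Cmod_le_abs|]. simpl. replace (x + a + - x) with a by ring.
        unfold Rminus in Ht. lra. }
      specialize (Hb _ Hd'). replace ((x, y) + (((x + a)%R, t) - (x, y)))%C with (((x + a)%R, t) : C) in Hb by (apply Ceq_re_im; simpl; ring).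
      exact Hb. }
  replace (cint (fun t => h (t, y)) x (x + a) + Ci * cint (fun t => h ((x + a)%R, t)) y (y + b) - h (x, y) * (a, b))%C
    with ((cint (fun t => h (t, y)) x (x + a) - a * h (x, y)) + Ci * (cint (fun t => h ((x + a)%R, t)) y (y + b) - b * h (x, y)))%C.
  - eapply Rle_trans; [apply Cmod_triangle|]. rewrite Cmod_mult, Cmod_Ci. nra.
  - set (I1 := cint _ x _). set (I2 := cint _ y _). destruct (h (x, y)) as [h1 h2]. destruct I1, I2. apply Ceq_re_im; simpl; ring.
Qed.

Lemma zero_deriv_const F R0 : (forall z, Cmod z < R0 -> cder F z 0%C) -> forall z, Cmod z < R0 -> F z = F 0%C.
Proof.
  intros HF [x y] Hz.
  assert (H1 : F (x, y) = F (x, 0)).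
  { assert (Q : forall a b, a <= b -> (forall t, a <= t <= b -> Rabs t <= Rabs y) -> F (x, b) = F (x, a)).
    { intros a b Hab Ht.
      pose proof (FTC_v F (fun _ => 0%C) a b x Hab) as X. cbv beta in X. rewrite cint_const in X.
      assert (E : (F (x, b) - F (x, a))%C = 0%C).
      { rewrite <- X; [ring| |intros t _; apply pcont_const].
        intros t Ht'. apply HF. eapply Rle_lt_trans; [|exact Hz].
        pose proof (Cmod_pair_le x t x y 0 0). specialize (Ht t Ht'). lra. }
      replace (F (x, b)) with (F (x, b) - F (x, a) + F (x, a))%C by ring. rewrite E. ring. }
    destruct (Rle_dec 0 y).
    - apply Q; [assumption|]. intros t Ht. rewrite !Rabs_pos_eq; lra.
    - symmetry. apply Q; [lra|]. intros t Ht. rewrite !Rabs_left1; lra. }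
  rewrite H1.
  assert (Q : forall a b, a <= b -> (forall t, a <= t <= b -> Rabs t <= Rabs x) -> F (b, 0) = F (a, 0)).
  { intros a b Hab Ht.
    pose proof (FTC_h F (fun _ => 0%C) a b 0 Hab) as X. cbv beta in X. rewrite cint_const in X.
    assert (E : (F (b, 0%R) - F (a, 0%R))%C = 0%C).
    { rewrite <- X; [ring| |intros t _; apply pcont_const].
      intros t Ht'. apply HF. eapply Rle_lt_trans; [|exact Hz].
      pose proof (Cmod_pair_le t 0 x y 0 0). specialize (Ht t Ht'). rewrite Rabs_R0 in H. pose proof (Rabs_pos y). lra. }
    replace (F (b, 0)) with (F (b, 0%R) - F (a, 0%R) + F (a, 0%R))%C by ring. rewrite E. ring. }
  change (RtoC 0) with (0, 0).
  destruct (Rle_dec 0 x).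
  - apply Q; [assumption|]. intros t Ht. rewrite !Rabs_pos_eq; lra.
  - symmetry. apply Q; [lra|]. intros t Ht. rewrite !Rabs_left1; lra.
Qed.

(** The logarithm is a primitive of [g' / g]; the product [g Cexp (- G)] has derivative zero. *)
Theorem log_on_disc g g' R0 : 0 < R0 -> (forall z, Cmod z < R0 -> cder g z (g' z)) ->
  (forall z, Cmod z < R0 -> g z <> 0%C) ->
  exists G : C -> C, G 0%C = 0%C /\ (forall z, Cmod z < R0 -> cder G z (g' z / g z)%C) /\
    forall z, Cmod z < R0 -> g z = (g 0 * Cexp (G z))%C.
Proof.
  intros HR Hg Nz.
  destruct (primitive_on_disc (fun z => g' z / g z)%C R0) as [G0 HG0].
  { intros z Hz. apply holo_div; [now apply Nz|now apply (holo_deriv g g' R0)|eexists; now apply Hg]. }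
  set (G := fun z => (G0 z - G0 0)%C).
  assert (HG : forall z, Cmod z < R0 -> cder G z (g' z / g z)%C).
  { intros z Hz. unfold G. eapply cder_eq; [apply cder_minus; [now apply HG0|apply cder_const]|]. ring. }
  assert (G00 : G 0%C = 0%C) by (unfold G; ring).
  exists G. split; [assumption|]. split; [assumption|]. intros z Hz.
  assert (E : (g z * Cexp (- G z))%C = (g 0 * Cexp (- G 0))%C).
  { apply (zero_deriv_const (fun z => g z * Cexp (- G z))%C R0); [|assumption].
    intros w Hw. eapply cder_eq.
    - apply cder_mult; [now apply Hg|]. apply (cder_comp Cexp (fun w => - G w)%C); [apply cder_opp; now apply HG|apply cder_Cexp].
    - cbv beta. field. now apply Nz. }
  rewrite G00 in E. replace (- 0)%C with (RtoC 0) in E by ring. rewrite Cexp_0, Cmult_1_r in E.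
  rewrite <- E, <- Cmult_assoc, <- Cexp_plus. replace (- G z + G z)%C with (RtoC 0) by ring. rewrite Cexp_0. ring.
Qed.

(** * Taylor coefficients and the Borel-Caratheodory inequality *)

Lemma cder_powS (z : C) (n : nat) : cder (fun w => w ^ S n)%C z (INR (S n) * z ^ n)%C.
Proof.
  induction n as [|n IH].
  - apply (cder_ext (fun w => w)); [intros; simpl; ring|]. eapply cder_eq; [apply cder_id|]. simpl. ring.
  - apply (cder_ext (fun w => w * w ^ S n)%C); [reflexivity|].
    eapply cder_eq; [apply cder_mult; [apply cder_id|exact IH]|].
    rewrite (S_INR (S n)), RtoC_plus. simpl. ring.
Qed.

(** The mean of [z F'(z)] is the integral of the angular derivative of [F], which is periodic. *)
Lemma circ_deriv F F' r : 0 < r -> (forall z, Cmod z = r -> cder F z (F' z)) -> cont_circ F' r ->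
  circ (fun z => z * F' z)%C r = 0%C.
Proof.
  intros Hr HF HF'. pose proof two_PI_pos.
  assert (Er : forall t, Cexp (ln r, t) = (r * cis t)%C) by (intros t; rewrite Cexp_eq; simpl; now rewrite exp_ln).
  assert (Mr : forall t, Cmod (Cexp (ln r, t)) = r) by (intros t; rewrite Er; apply Cmod_circ; lra).
  pose proof (FTC_v (fun w => F (Cexp w)) (fun w => F' (Cexp w) * Cexp w)%C 0 (2 * PI) (ln r) ltac:(lra)) as X.
  cbv beta in X. rewrite !Er in X.
  assert (E0 : cis (2 * PI) = cis 0) by (unfold cis; now rewrite cos_2PI, sin_2PI, cos_0, sin_0).
  rewrite E0 in X.
  assert (Z : cint (fun t => F' (Cexp (ln r, t)) * Cexp (ln r, t))%C 0 (2 * PI) = 0%C).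
  { match type of X with _ -> _ -> (_ * ?J)%C = _ => set (J0 := J) in *; assert (Y : (Ci * J0)%C = 0%C) end.
    - rewrite X; [ring| |].
      + intros t _. apply (cder_comp F Cexp); [apply cder_Cexp|now apply HF].
      + intros t _. apply (pcont_comp (fun w => F' (Cexp w) * Cexp w)%C (fun t => (ln r, t))); [apply pcont_v|].
        apply ccont_mult; [|eapply cder_ccont, cder_Cexp].
        apply ccont_comp; [eapply cder_ccont, cder_Cexp|now apply HF'].
    - destruct (Ceq_dec J0 0%C) as [|N]; [assumption|]. exfalso. apply Cmult_neq_0 in Y; [assumption|intro Q; injection Q; lra|assumption]. }
  unfold circ. rewrite (cint_ext _ (fun t => F' (Cexp (ln r, t)) * Cexp (ln r, t))%C).
  - rewrite Z. ring.
  - lra.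
  - intros t _. rewrite Er. ring.
Qed.

Lemma holo_quot_pow h k r : 0 < r -> (forall z, Cmod z = r -> holo h z) -> forall z, Cmod z = r -> holo (fun z => h z / z ^ k)%C z.
Proof.
  intros Hr Hh z Hz. assert (z <> 0%C) by (apply Cmod_gt_0; lra).
  apply holo_div; [now apply Cpow_nz|now apply Hh|apply holo_pow, holo_id].
Qed.

(** Integration by parts on the circle: the derivative of [h / z^{k+1}] splits in two. *)
Lemma coef_deriv G h m r : 0 < r -> (forall z, Cmod z = r -> cder G z (h z)) -> (forall z, Cmod z = r -> holo h z) ->
  (INR (S m) * coef G (S m) r)%C = coef h m r.
Proof.
  intros Hr HG Hh.
  assert (HG' : forall z, Cmod z = r -> holo G z) by (intros z Hz; eexists; now apply HG).
  pose proof (circ_deriv (fun z => G z * / z ^ S m)%C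
     (fun z => h z * / z ^ S m + G z * (- / (z ^ S m * z ^ S m) * (INR (S m) * z ^ m)))%C r Hr) as X. cbv beta in X.
  assert (E : circ (fun z => z * (h z * / z ^ S m + G z * (- / (z ^ S m * z ^ S m) * (INR (S m) * z ^ m))))%C r
     = (coef h m r - INR (S m) * coef G (S m) r)%C).
  { unfold coef. rewrite <- circ_scal, <- circ_minus; try lra.
    - apply circ_ext; [lra|]. intros z Hz. assert (z <> 0%C) by (apply Cmod_gt_0; lra).
      assert (z ^ m <> 0)%C by now apply Cpow_nz. rewrite Cpow_S. field. split; assumption.
    - apply holo_cont_circ. now apply holo_quot_pow.
    - apply holo_cont_circ. intros z Hz. apply holo_mult; [apply holo_const|]. now apply (holo_quot_pow G (S m) r).
    - apply holo_cont_circ. now apply holo_quot_pow. }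
  rewrite X in E.
  - replace (coef h m r) with (coef h m r - INR (S m) * coef G (S m) r + INR (S m) * coef G (S m) r)%C by ring. rewrite <- E. ring.
  - intros z Hz. assert (z <> 0%C) by (apply Cmod_gt_0; lra).
    apply (cder_mult G (fun z => / z ^ S m)%C); [now apply HG|]. apply (cder_inv (fun z => z ^ S m)%C); [now apply Cpow_nz|apply cder_powS].
  - apply holo_cont_circ. intros z Hz. assert (z <> 0%C) by (apply Cmod_gt_0; lra).
    assert (P : forall n, holo (fun z => z ^ n)%C z) by (intros n; apply (holo_pow (fun z => z)), holo_id).
    apply holo_plus; apply holo_mult.
    + now apply Hh.
    + apply holo_inv; [now apply Cpow_nz|apply P].
    + now apply HG'.
    + apply holo_mult; [|apply holo_mult; [apply holo_const|apply P]].
      apply holo_opp, holo_inv; [|apply holo_mult; apply P]. now apply Cmult_neq_0; apply Cpow_nz.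
Qed.

Lemma coef_0 h R0 r : (forall z, Cmod z < R0 -> holo h z) -> 0 < r < R0 -> coef h 0 r = h 0%C.
Proof.
  intros Hh Hr. transitivity (circ h r).
  - apply circ_ext; [lra|]. intros z _. simpl. field.
  - apply (circ_mean h R0 0); [lra| | |lra].
    + intros z Hz. now apply holo_ccont, Hh.
    + intros z Hz _. now apply Hh.
Qed.

Lemma coef_ext f g k r : 0 <= r -> (forall z, Cmod z = r -> f z = g z) -> coef f k r = coef g k r.
Proof. intros Hr E. apply circ_ext; [assumption|]. intros z Hz. now rewrite E. Qed.

Lemma coef_plus f g k r : 0 < r -> (forall z, Cmod z = r -> holo f z) -> (forall z, Cmod z = r -> holo g z) ->
  coef (fun z => f z + g z)%C k r = (coef f k r + coef g k r)%C.
Proof.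
  intros Hr Hf Hg. unfold coef. rewrite <- circ_plus; [|lra| |].
  - apply circ_ext; [lra|]. intros z Hz. unfold Cdiv. ring.
  - apply holo_cont_circ. now apply holo_quot_pow.
  - apply holo_cont_circ. now apply holo_quot_pow.
Qed.

Lemma coef_scal c f k r : 0 < r -> (forall z, Cmod z = r -> holo f z) ->
  coef (fun z => c * f z)%C k r = (c * coef f k r)%C.
Proof.
  intros Hr Hf. unfold coef. rewrite <- circ_scal; [|lra|].
  - apply circ_ext; [lra|]. intros z Hz. unfold Cdiv. ring.
  - apply holo_cont_circ. now apply holo_quot_pow.
Qed.

Lemma coef_minus f g k r : 0 < r -> (forall z, Cmod z = r -> holo f z) -> (forall z, Cmod z = r -> holo g z) ->
  coef (fun z => f z - g z)%C k r = (coef f k r - coef g k r)%C.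
Proof.
  intros Hr Hf Hg. unfold coef. rewrite <- circ_minus; [|lra| |].
  - apply circ_ext; [lra|]. intros z Hz. unfold Cdiv. ring.
  - apply holo_cont_circ. now apply holo_quot_pow.
  - apply holo_cont_circ. now apply holo_quot_pow.
Qed.

Lemma coef_csum (f : nat -> C -> C) n k r : 0 < r -> (forall j z, Cmod z = r -> holo (f j) z) ->
  coef (fun z => csum (fun j => f j z) n) k r = csum (fun j => coef (f j) k r) n.
Proof.
  intros Hr Hf. induction n as [|n IH].
  - simpl. unfold coef. transitivity (circ (fun _ => 0%C) r); [|apply circ_const].
    apply circ_ext; [lra|]. intros z Hz. unfold Cdiv. ring.
  - simpl. rewrite coef_plus, IH; [reflexivity|assumption| |].
    + intros z Hz. clear IH. induction n as [|n IH]; [apply (holo_const 0%C)|]. simpl. apply holo_plus; [assumption|now apply Hf].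
    + intros z Hz. now apply Hf.
Qed.

Lemma coef_cexp (a : C) k r : 0 < r -> coef (fun z => Cexp (a * z))%C k r = (a ^ k / INR (fact k))%C.
Proof.
  intros Hr.
  assert (D : forall z, cder (fun z => Cexp (a * z))%C z (a * Cexp (a * z))%C).
  { intros z. eapply cder_eq; [apply (cder_comp Cexp (fun z => a * z)%C); [apply cder_scal, cder_id|apply cder_Cexp]|]. ring. }
  assert (D' : forall z, holo (fun z => Cexp (a * z))%C z) by (intros z; eexists; apply D).
  induction k as [|k IH].
  - rewrite (coef_0 _ (2 * r)); [|intros; apply D'|lra].
    replace (a * 0)%C with (RtoC 0) by ring. rewrite Cexp_0. simpl. field.
  - assert (E : (INR (S k) * coef (fun z => Cexp (a * z)) (S k) r)%C = (a * (a ^ k / INR (fact k)))%C).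
    { rewrite (coef_deriv _ (fun z => a * Cexp (a * z))%C), coef_scal, IH; try assumption; try reflexivity.
      - intros; apply D'.
      - intros; apply D.
      - intros; apply holo_mult; [apply holo_const|apply D']. }
    assert (N1 : RtoC (INR (S k)) <> 0%C) by (apply RtoC_neq, not_0_INR; lia).
    assert (N2 : RtoC (INR (fact k)) <> 0%C) by (apply RtoC_neq, not_0_INR, fact_neq_0).
    assert (E2 : coef (fun z => Cexp (a * z))%C (S k) r = (INR (S k) * coef (fun z => Cexp (a * z)) (S k) r / INR (S k))%C)
      by (field; assumption).
    rewrite E2, E. rewrite fact_simpl, mult_INR, RtoC_mult, Cpow_S. field. split; assumption.
Qed.

(** Recursion on [k]: [1 = (z - rho) / (z - rho)] has vanishing coefficients of positive order. *)
Lemma coef_simple_pole (rho : C) k r : 0 < r < Cmod rho ->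
  coef (fun z => / (z - rho))%C k r = (- / rho ^ S k)%C.
Proof.
  intros Hr. assert (Nr : rho <> 0%C) by (apply Cmod_gt_0; lra).
  assert (D : forall z, Cmod z < Cmod rho -> holo (fun z => / (z - rho))%C z).
  { intros z Hz. apply holo_inv; [apply Cminus_neq, Cmod_neq; lra|apply holo_minus; [apply holo_id|apply holo_const]]. }
  induction k as [|k IH].
  - rewrite (coef_0 _ (Cmod rho)); [|assumption|assumption]. simpl. field. assumption.
  - assert (E : coef (fun z => / (z - rho))%C k r = (rho * coef (fun z => / (z - rho)) (S k) r)%C).
    { rewrite <- coef_scal by (intros; try apply D; lra).
      transitivity (coef (fun _ => 1%C) (S k) r + coef (fun z => rho * / (z - rho)) (S k) r)%C.
      - rewrite <- coef_plus; try lra.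
        + unfold coef. apply circ_ext; [lra|]. intros z Hz. assert (z <> 0%C) by (apply Cmod_gt_0; lra).
          assert (z ^ k <> 0)%C by now apply Cpow_nz.
          assert (z - rho <> 0)%C by (apply Cminus_neq, Cmod_neq; lra).
          rewrite Cpow_S. field. repeat split; assumption.
        + intros; apply holo_const.
        + intros z Hz; apply holo_mult; [apply holo_const|apply D; lra].
      - rewrite coef_inv_pow by (lra || lia). ring. }
    assert (N2 : (rho ^ S k <> 0)%C) by now apply Cpow_nz.
    replace (coef (fun z => / (z - rho))%C (S k) r) with (rho * coef (fun z => / (z - rho)) (S k) r / rho)%C by (field; assumption).
    rewrite <- E, IH. rewrite (Cpow_S rho (S k)). field. split; assumption.
Qed.

(** The same recursion, for the geometric series of ratio [b z]. *)
Lemma coef_outer_pole (b : C) k r : 0 < r -> Cmod b * r < 1 ->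
  coef (fun z => b / (1 - b * z))%C k r = (b ^ S k)%C.
Proof.
  intros Hr Hb.
  assert (Q : exists R0, r < R0 /\ Cmod b * R0 <= 1).
  { pose proof (Cmod_ge_0 b). destruct (Req_dec (Cmod b) 0) as [->|N].
    - exists (r + 1); lra.
    - exists (/ Cmod b). split; [|right; field; assumption]. apply Rmult_lt_reg_l with (Cmod b); [lra|]. rewrite Rinv_r; lra. }
  destruct Q as [R0 [HR0 HbR]].
  assert (Nz : forall z, Cmod z < R0 -> (1 - b * z)%C <> 0%C).
  { intros z Hz. apply Cmod_gt_0. pose proof (Cmod_triangle_rev_sub 1 (b * z)%C) as T. rewrite Cmod_1, Cmod_mult in T.
    pose proof (Cmod_ge_0 b). pose proof (Cmod_ge_0 z). destruct (Req_dec (Cmod b) 0) as [E|N]; [rewrite E in T; lra|nra]. }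
  assert (D : forall z, Cmod z < R0 -> holo (fun z => b / (1 - b * z))%C z).
  { intros z Hz. apply holo_div; [now apply Nz|apply holo_const|].
    apply holo_minus; [apply holo_const|apply holo_mult; [apply holo_const|apply holo_id]]. }
  induction k as [|k IH].
  - rewrite (coef_0 _ R0); [|assumption|lra]. simpl. field.
  - transitivity (b * coef (fun z => b / (1 - b * z)) k r)%C; [|rewrite IH; reflexivity].
    rewrite <- coef_scal by (intros; try apply D; lra).
    transitivity (coef (fun _ => b * 1)%C (S k) r + coef (fun z => b * (b / (1 - b * z))) k r)%C.
    + unfold coef. rewrite <- circ_plus; try lra.
      * apply circ_ext; [lra|]. intros z Hz. assert (z <> 0%C) by (apply Cmod_gt_0; lra).
        assert (z ^ k <> 0)%C by now apply Cpow_nz.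
        assert (1 - b * z <> 0)%C by (apply Nz; lra).
        rewrite Cpow_S. field. repeat split; assumption.
      * apply holo_cont_circ, holo_quot_pow; [lra|intros; apply holo_const].
      * apply holo_cont_circ, (holo_quot_pow (fun z => b * (b / (1 - b * z)))%C); [lra|].
        intros z Hz; apply holo_mult; [apply holo_const|apply D; lra].
    + rewrite (coef_scal b (fun _ => 1%C)), coef_inv_pow by (try lra; try lia; intros; apply holo_const). ring.
Qed.

Lemma circ_re_nonneg F r : 0 <= r -> cont_circ F r -> (forall z, Cmod z = r -> 0 <= Re (F z)) -> 0 <= Re (circ F r).
Proof.
  intros Hr HF Hp. unfold circ. pose proof two_PI_pos.
  assert (E : (/ RtoC (2 * PI))%C = RtoC (/ (2 * PI))) by (apply Ceq_re_im; simpl; field; lra).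
  rewrite E. unfold cint. simpl. rewrite Rmult_0_l, Rminus_0_r.
  apply Rmult_le_pos; [left; apply Rinv_0_lt_compat; lra|].
  apply RInt_ge_0; [lra| |].
  - apply ex_RInt_re; [lra|]. now apply cont_circ_pcont.
  - intros t Ht. apply Hp. now apply Cmod_circ.
Qed.

Lemma Cconj_on_circle z r k : 0 < r -> Cmod z = r -> (Cconj (r ^ k / z ^ k))%C = (z ^ k / r ^ k)%C.
Proof.
  intros Hr Hz. assert (Nz : z <> 0%C) by (apply Cmod_gt_0; lra).
  assert (Nr : RtoC r <> 0%C) by (apply RtoC_neq; lra).
  unfold Cdiv. rewrite <- !Cpow_inv, <- !Cpow_mult_l by assumption. rewrite Cpow_conj. f_equal.
  pose proof (Cmod2_conj z) as E. rewrite Hz in E.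
  assert (Ec : Cconj z = (r * r / z)%C) by (replace (r * r)%C with (z * Cconj z)%C; [field; assumption|rewrite <- E; simpl; rewrite RtoC_mult, Rmult_1_r; reflexivity]).
  rewrite Cmult_conj, Cinv_conj by assumption.
  rewrite Ec. replace (Cconj r) with (RtoC r) by (apply Ceq_re_im; simpl; ring). field. split; assumption.
Qed.

(** Tests the nonnegative function [M - Re G] against the nonnegative kernel [W = 2 + 2 Re (al r^k / z^k)],
    where the unit [al] rotates the coefficient onto the positive axis. Expanding the product, the constant
    term gives [2 M] and the cross term the coefficient; the conjugate half of [W] pairs to zero with the
    holomorphic [G]. *)
Theorem caratheodory G R0 M k r : (forall z, Cmod z < R0 -> holo G z) -> G 0%C = 0%C -> 0 < r < R0 ->
  (forall z, Cmod z = r -> Re (G z) <= M) -> (1 <= k)%nat -> Cmod (coef G k r) <= 2 * M / r ^ k.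
Proof.
  intros HG G0 Hr HM Hk.
  set (c := coef G k r).
  assert (A : exists al : C, Cmod al = 1 /\ (al * c)%C = RtoC (Cmod c)).
  { destruct (Ceq_dec c 0%C) as [->|N].
    - exists 1%C. rewrite Cmod_1, Cmod_0. split; [reflexivity|ring].
    - assert (P : 0 < Cmod c) by now apply Cmod_gt_0.
      exists (Cconj c / Cmod c)%C. rewrite Cmod_div, Cmod_conj, Cmod_R, Rabs_pos_eq by (try apply RtoC_neq; lra).
      split; [field; lra|]. pose proof (Cmod2_conj c) as E.
      assert (Nc : RtoC (Cmod c) <> 0%C) by (apply RtoC_neq; lra).
      transitivity ((c * Cconj c) / Cmod c)%C; [field; assumption|]. rewrite <- E. simpl. rewrite Rmult_1_r, RtoC_mult. field. assumption. }
  destruct A as [al [Ha1 Ha2]].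
  assert (Nr : RtoC r <> 0%C) by (apply RtoC_neq; lra).
  set (W := fun z => (2 + (al * r ^ k) * / z ^ k + (Cconj al / r ^ k) * z ^ k)%C).
  assert (Nz : forall z, Cmod z = r -> z <> 0%C) by (intros z Hz; apply Cmod_gt_0; lra).
  assert (WE : forall z, Cmod z = r -> W z = RtoC (2 + 2 * Re (al * (r ^ k / z ^ k))%C)).
  { intros z Hz. unfold W.
    replace (al * r ^ k * / z ^ k)%C with (al * (r ^ k / z ^ k))%C by (unfold Cdiv; ring).
    replace (Cconj al / r ^ k * z ^ k)%C with (Cconj (al * (r ^ k / z ^ k)))%C.
    - apply Ceq_re_im; unfold Re, Im; simpl; ring.
    - rewrite Cmult_conj, Cconj_on_circle by lra. unfold Cdiv. ring. }
  assert (WP : forall z, Cmod z = r -> 0 <= 2 + 2 * Re (al * (r ^ k / z ^ k))%C).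
  { intros z Hz. pose proof (re_le_Cmod (al * (r ^ k / z ^ k))%C) as B.
    assert (Nk : (z ^ k <> 0)%C) by (apply Cpow_nz, Nz, Hz).
    rewrite Cmod_mult, Ha1, Cmod_div, !Cmod_pow, Hz, Cmod_R in B by exact Nk.
    rewrite (Rabs_pos_eq r) in B by lra.
    unfold Rdiv in B. rewrite Rinv_r in B by (apply pow_nonzero; lra).
    apply Rabs_le_between in B. lra. }
  assert (CP : forall z n, holo (fun z => z ^ n)%C z) by (intros; apply (holo_pow (fun z => z)), holo_id).
  assert (CI : forall z n, Cmod z = r -> holo (fun z => / z ^ n)%C z).
  { intros z n Hz. apply holo_inv; [now apply Cpow_nz, Nz|apply CP]. }
  assert (CW : forall z, Cmod z = r -> holo W z).
  { intros z Hz. unfold W. repeat apply holo_plus; try apply holo_const; apply holo_mult; try apply holo_const; auto. }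
  assert (CG : forall z, Cmod z = r -> holo G z) by (intros; apply HG; lra).
  assert (I1 : circ (fun z => / z ^ k)%C r = 0%C).
  { rewrite <- (coef_inv_pow k r) by (lra || lia). apply circ_ext; [lra|]. intros z Hz. unfold Cdiv. ring. }
  assert (I2 : circ (fun z => z ^ k)%C r = 0%C).
  { rewrite (circ_mean (fun z => z ^ k)%C R0 0); [|lra| | |lra].
    - destruct k; [lia|]. simpl. ring.
    - intros; apply holo_ccont, CP.
    - intros; apply CP. }
  assert (I3 : circ G r = 0%C).
  { rewrite (circ_mean G R0 0); [assumption|lra| | |lra]; intros; try apply holo_ccont; now apply HG. }
  assert (I4 : circ (fun z => G z * z ^ k)%C r = 0%C).
  { rewrite (circ_mean (fun z => G z * z ^ k)%C R0 0); [rewrite G0; ring|lra| | |lra]; intros; try apply holo_ccont;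
     (apply holo_mult; [now apply HG|apply CP]). }
  assert (E : circ (fun z => (M - G z) * W z)%C r = (2 * M - Cmod c * r ^ k)%C).
  { transitivity (circ (fun z => M * W z - G z * W z)%C r); [apply circ_ext; [lra|]; intros; ring|].
    assert (cW : cont_circ W r) by now apply holo_cont_circ.
    rewrite circ_minus, circ_scal; try lra; try assumption.
    2: { apply holo_cont_circ. intros; apply holo_mult; [apply holo_const|auto]. }
    2: { apply holo_cont_circ. intros; apply holo_mult; auto. }
    assert (E1 : circ W r = 2%C).
    { unfold W. rewrite circ_plus, circ_plus, circ_const, circ_scal, circ_scal, I1, I2; try lra; try ring;
        apply holo_cont_circ; intros; repeat apply holo_plus; try apply holo_const; try apply holo_mult; try apply holo_const; auto. }
    assert (E2 : circ (fun z => G z * W z)%C r = (Cmod c * r ^ k)%C).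
    { transitivity (circ (fun z => 2 * G z + (al * r ^ k) * (G z / z ^ k) + (Cconj al / r ^ k) * (G z * z ^ k))%C r).
      - apply circ_ext; [lra|]. intros z Hz. unfold W, Cdiv. ring.
      - assert (CQ : forall z, Cmod z = r -> holo (fun z => G z / z ^ k)%C z) by (apply holo_quot_pow; [lra|assumption]).
        rewrite circ_plus, circ_plus, !circ_scal, I3, I4; try lra;
        [|apply holo_cont_circ; intros; repeat apply holo_plus; repeat (apply holo_mult || apply holo_const); auto ..].
        change (circ (fun z => G z / z ^ k)%C r) with c. rewrite <- Ha2. ring. }
    rewrite E1, E2. ring. }
  assert (P : 0 <= Re (circ (fun z => (M - G z) * W z)%C r)).
  { apply circ_re_nonneg; [lra| |].
    - apply holo_cont_circ. intros; apply holo_mult; [apply holo_minus; [apply holo_const|auto]|auto].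
    - intros z Hz. rewrite (WE z Hz). specialize (WP z Hz). specialize (HM z Hz).
      set (v := 2 + _) in *. unfold Re in *. simpl. rewrite Rmult_0_r, Rminus_0_r. apply Rmult_le_pos; lra. }
  rewrite E in P.
  assert (P' : 0 <= 2 * M - Cmod c * r ^ k).
  { rewrite <- RtoC_pow, <- !RtoC_mult, <- RtoC_minus in P. exact P. }
  assert (0 < r ^ k) by (apply pow_lt; lra).
  apply Rmult_le_reg_r with (r ^ k); [assumption|]. unfold Rdiv. rewrite Rmult_assoc, Rinv_l by lra. lra.
Qed.

(** Apply the inequality to the logarithm of [g], normalised to vanish at 0, and differentiate. *)
Theorem log_deriv_coef_bound g g' R0 M m r : 0 < r < R0 -> (forall z, Cmod z < R0 -> cder g z (g' z)) ->
  (forall z, Cmod z < R0 -> g z <> 0%C) -> (forall z, Cmod z < R0 -> Cmod (g z) <= exp M * Cmod (g 0%C)) ->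
  Cmod (coef (fun z => g' z / g z)%C m r) <= 2 * INR (S m) * M / r ^ S m.
Proof.
  intros Hr Hg Nz HM.
  destruct (log_on_disc g g' R0 ltac:(lra) Hg Nz) as [G [G0 [HG Eg]]].
  assert (CG : forall z, Cmod z < R0 -> holo G z) by (intros z Hz; eexists; now apply HG).
  rewrite <- (coef_deriv G); [|lra|intros; apply HG; lra|].
  2: { intros z Hz. apply holo_div; [apply Nz; lra|apply (holo_deriv g g' R0); [assumption|lra]|eexists; apply Hg; lra]. }
  rewrite Cmod_mult, Cmod_R, Rabs_pos_eq by apply pos_INR.
  replace (2 * INR (S m) * M / r ^ S m) with (INR (S m) * (2 * M / r ^ S m)) by (unfold Rdiv; ring).
  apply Rmult_le_compat_l; [apply pos_INR|].
  apply caratheodory with R0; try assumption; [|lia].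
  intros z Hz. specialize (HM z ltac:(lra)). rewrite (Eg z) in HM by lra.
  rewrite Cmod_mult, Cmod_Cexp in HM.
  assert (P : 0 < Cmod (g 0%C)) by (apply Cmod_gt_0, Nz; rewrite Cmod_0; lra).
  assert (X : exp (Re (G z)) <= exp M) by nra.
  destruct (Rle_dec (Re (G z)) M) as [|N]; [assumption|].
  pose proof (exp_increasing M (Re (G z)) ltac:(lra)). lra.
Qed.

(** * Blaschke factors and Jensen's inequality *)

Fixpoint clsum (f : C -> C) (l : list C) : C :=
  match l with nil => 0%C | x :: l => (f x + clsum f l)%C end.
Fixpoint rlsum (f : C -> R) (l : list C) : R :=
  match l with nil => 0 | x :: l => f x + rlsum f l end.
Fixpoint rlprod (f : C -> R) (l : list C) : R :=
  match l with nil => 1 | x :: l => f x * rlprod f l end.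

(** Modulus at [z] of the Blaschke factor of the disc of radius [R0] with zero [rho]. *)
Definition blaschke (R0 : R) (rho z : C) : R := R0 * Cmod (z - rho)%C / Cmod (R0 * R0 - Cconj rho * z)%C.
(** The quantity [1 - blaschke^2]; it weighs zeros in Jensen's inequality. *)
Definition bdefect (R0 : R) (rho z : C) : R :=
  (R0 ^ 2 - Cmod z ^ 2) * (R0 ^ 2 - Cmod rho ^ 2) / Cmod (R0 * R0 - Cconj rho * z)%C ^ 2.

Lemma blaschke_identity (R0 : R) (rho z : C) :
  Cmod (R0 * R0 - Cconj rho * z)%C ^ 2 - R0 ^ 2 * Cmod (z - rho)%C ^ 2 = (R0 ^ 2 - Cmod z ^ 2) * (R0 ^ 2 - Cmod rho ^ 2).
Proof. rewrite !Cmod2_alt. destruct rho, z. simpl. ring. Qed.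

Lemma blaschke_den (R0 : R) (rho z : C) : Cmod rho < R0 -> Cmod z <= R0 -> 0 < Cmod (R0 * R0 - Cconj rho * z)%C.
Proof.
  intros H1 H2. pose proof (Cmod_ge_0 rho). pose proof (Cmod_ge_0 z).
  pose proof (Cmod_triangle_rev_sub (R0 * R0)%C (Cconj rho * z)%C) as T.
  rewrite !Cmod_mult, Cmod_conj, !Cmod_R, Rabs_pos_eq in T by lra. nra.
Qed.

Lemma blaschke_sq (R0 : R) (rho z : C) : Cmod rho < R0 -> Cmod z <= R0 -> blaschke R0 rho z ^ 2 = 1 - bdefect R0 rho z.
Proof.
  intros H1 H2. pose proof (blaschke_den R0 rho z H1 H2) as P.
  unfold blaschke, bdefect. rewrite <- blaschke_identity. field. lra.
Qed.

Lemma blaschke_nonneg (R0 : R) (rho z : C) : Cmod rho < R0 -> Cmod z <= R0 -> 0 <= blaschke R0 rho z.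
Proof.
  intros H1 H2. pose proof (blaschke_den R0 rho z H1 H2) as P. pose proof (Cmod_ge_0 rho).
  unfold blaschke. apply Rmult_le_pos; [|left; now apply Rinv_0_lt_compat].
  apply Rmult_le_pos; [lra|apply Cmod_ge_0].
Qed.

Lemma bdefect_nonneg (R0 : R) (rho z : C) : Cmod rho < R0 -> Cmod z <= R0 -> 0 <= bdefect R0 rho z.
Proof.
  intros H1 H2. pose proof (blaschke_den R0 rho z H1 H2) as P. pose proof (Cmod_ge_0 rho). pose proof (Cmod_ge_0 z).
  unfold bdefect. apply Rmult_le_pos; [apply Rmult_le_pos; nra|]. left. apply Rinv_0_lt_compat, pow_lt, P.
Qed.

Lemma blaschke_le1 (R0 : R) (rho z : C) : Cmod rho < R0 -> Cmod z <= R0 -> blaschke R0 rho z <= 1.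
Proof.
  intros H1 H2. pose proof (blaschke_sq R0 rho z H1 H2). pose proof (bdefect_nonneg R0 rho z H1 H2).
  pose proof (blaschke_nonneg R0 rho z H1 H2). nra.
Qed.

Lemma blaschke_boundary (R0 : R) (rho z : C) : Cmod rho < R0 -> Cmod z = R0 -> blaschke R0 rho z = 1.
Proof.
  intros H1 H2. pose proof (blaschke_sq R0 rho z H1 ltac:(lra)) as E. pose proof (blaschke_nonneg R0 rho z H1 ltac:(lra)).
  assert (D : bdefect R0 rho z = 0) by (unfold bdefect; rewrite H2; unfold Rdiv; ring).
  rewrite D in E. nra.
Qed.

(** Uniform in [rho], which makes the extraction of zeros terminate. *)
Lemma bdefect_lower (R0 r1 : R) (rho p : C) : 0 < r1 < R0 -> Cmod rho < r1 -> Cmod p < R0 ->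
  (R0 ^ 2 - Cmod p ^ 2) * (R0 ^ 2 - r1 ^ 2) / (4 * R0 ^ 4) <= bdefect R0 rho p.
Proof.
  intros H1 H2 H3. pose proof (blaschke_den R0 rho p ltac:(lra) ltac:(lra)) as P.
  pose proof (Cmod_ge_0 rho). pose proof (Cmod_ge_0 p).
  assert (U : Cmod (R0 * R0 - Cconj rho * p)%C <= 2 * R0 ^ 2).
  { eapply Rle_trans; [apply Cmod_triangle_sub|]. rewrite !Cmod_mult, Cmod_conj, !Cmod_R, Rabs_pos_eq by lra. nra. }
  unfold bdefect. apply Rmult_le_compat.
  - apply Rmult_le_pos; nra.
  - left. apply Rinv_0_lt_compat. assert (0 < R0 ^ 4) by (apply pow_lt; lra). lra.
  - apply Rmult_le_compat_l; nra.
  - apply Rinv_le_contravar; [now apply pow_lt|]. replace (4 * R0 ^ 4) with ((2 * R0 ^ 2) ^ 2) by ring.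
    apply pow_incr. lra.
Qed.

Lemma derivative_exists (g : C -> C) : (forall z, holo g z) -> exists g', forall z, cder g z (g' z).
Proof.
  intros H. exists (fun z => proj1_sig (constructive_indefinite_description _ (H z))).
  intros z. exact (proj2_sig (constructive_indefinite_description _ (H z))).
Qed.

(** Logarithmic derivative of the Blaschke factor: the pole at [rho] and its mirror image in the circle. *)
Definition pole_pair (R0 : R) (z rho : C) : C :=
  (/ (z - rho) + (Cconj rho / (R0 * R0)) / (1 - (Cconj rho / (R0 * R0)) * z))%C.

(** Divide by [z - rho] and multiply by the denominator of the Blaschke factor, so that the modulus on the
    circle of radius [R0] is unchanged. *)
Lemma factor_one (f f' : C -> C) (R0 : R) (rho : C) : (forall z, cder f z (f' z)) -> f rho = 0%C -> Cmod rho < R0 ->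
  exists g g' : C -> C, (forall z, cder g z (g' z)) /\
    (forall z, Cmod z <= R0 -> Cmod (f z) = Cmod (g z) * blaschke R0 rho z) /\
    (forall z, Cmod z < R0 -> g z = 0%C -> f z = 0%C) /\
    (forall z, Cmod z < R0 -> f z <> 0%C -> g z <> 0%C /\ (f' z / f z = pole_pair R0 z rho + g' z / g z)%C).
Proof.
  intros Hf H0 Hrho. pose proof (Cmod_ge_0 rho) as P0.
  assert (R00 : RtoC R0 <> 0%C) by (apply RtoC_neq; lra).
  destruct (divide_zero f rho) as [f1 [Hf1 E1]]; [intros z; eexists; apply Hf|assumption|].
  set (b := (Cconj rho / (R0 * R0))%C).
  set (g := fun z => (f1 z * (R0 * (1 - b * z)))%C).
  destruct (derivative_exists g) as [g' Hg'].
  { intros z. apply holo_mult; [apply Hf1|]. apply holo_mult; [apply holo_const|].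
    apply holo_minus; [apply holo_const|apply holo_mult; [apply holo_const|apply holo_id]]. }
  assert (Den : forall z, (R0 * R0 - Cconj rho * z)%C = (R0 * (R0 * (1 - b * z)))%C) by (intros z; unfold b; field; assumption).
  assert (Nd : forall z, Cmod z <= R0 -> (1 - b * z)%C <> 0%C).
  { intros z Hz E. pose proof (blaschke_den R0 rho z Hrho Hz) as P. rewrite Den, E, !Cmult_0_r, Cmod_0 in P. lra. }
  exists g, g'. split; [assumption|]. split; [|split].
  - intros z Hz. pose proof (blaschke_den R0 rho z Hrho Hz) as P. unfold blaschke. rewrite Den in *.
    unfold g. rewrite E1. rewrite !Cmod_mult in *. rewrite Cmod_R, Rabs_pos_eq in * by lra.
    assert (0 < Cmod (1 - b * z)%C) by (apply Cmod_gt_0; now apply Nd). field. lra.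
  - intros z Hz E. unfold g in E. rewrite E1.
    destruct (Ceq_dec (f1 z) 0%C) as [->|N]; [ring|exfalso].
    revert E. apply Cmult_neq_0; [assumption|]. apply Cmult_neq_0; [assumption|]. apply Nd. lra.
  - intros z Hz Nf.
    assert (N1 : f1 z <> 0%C) by (intro E; apply Nf; rewrite E1, E; ring).
    assert (N2 : (z - rho <> 0)%C) by (intro E; apply Nf; rewrite E1, E; ring).
    assert (N3 : (1 - b * z <> 0)%C) by (apply Nd; lra).
    assert (Ng : g z <> 0%C) by (unfold g; apply Cmult_neq_0; [assumption|]; now apply Cmult_neq_0).
    split; [assumption|].
    (* differentiate f (1 - b z) R = (z - rho) g *)
    assert (D : (f' z * (R0 * (1 - b * z)) + f z * (R0 * (0 - b * 1)) = (1 - 0) * g z + (z - rho) * g' z)%C).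
    { apply (cder_unique (fun z => f z * (R0 * (1 - b * z)))%C z).
      - apply (cder_mult f (fun z => R0 * (1 - b * z))%C); [apply Hf|]. apply cder_scal.
        apply cder_minus; [apply cder_const|]. apply cder_scal, cder_id.
      - apply (cder_ext (fun z => (z - rho) * g z)%C); [intros w; unfold g; rewrite E1; ring|].
        apply (cder_mult (fun z => z - rho)%C g); [|apply Hg'].
        apply cder_minus; [apply cder_id|apply cder_const]. }
    unfold pole_pair. fold b.
    assert (Ef : f z = ((z - rho) * g z / (R0 * (1 - b * z)))%C) by (rewrite E1; unfold g; field; split; assumption).
    assert (Ef' : f' z = ((g z + (z - rho) * g' z + f z * R0 * b) / (R0 * (1 - b * z)))%C).
    { transitivity ((f' z * (R0 * (1 - b * z)) + f z * (R0 * (0 - b * 1)) + f z * R0 * b) / (R0 * (1 - b * z)))%C;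
        [field; split; assumption|]. rewrite D. f_equal. ring. }
    rewrite Ef', Ef. field. repeat split; assumption.
Qed.

(** Each extraction keeps the bound [B] on the outer circle and multiplies the squared modulus at [p] by at
    least [1 / (1 - c0)]. As the modulus at [p] cannot exceed [B], the process stops. *)
Theorem factor_zeros (R0 r1 : R) (p : C) (B : R) : 0 < r1 < R0 -> Cmod p < R0 -> 0 <= B ->
  forall f f' : C -> C, (forall z, cder f z (f' z)) -> f p <> 0%C -> (forall z, Cmod z = R0 -> Cmod (f z) <= B) ->
  exists (zs : list C) (g g' : C -> C), (forall z, cder g z (g' z)) /\
    (forall z, Cmod z < r1 -> g z <> 0%C) /\
    (forall z, Cmod z = R0 -> Cmod (g z) <= B) /\
    (forall rho, In rho zs -> f rho = 0%C /\ Cmod rho < r1) /\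
    (forall z, Cmod z <= R0 -> Cmod (f z) = Cmod (g z) * rlprod (fun rho => blaschke R0 rho z) zs) /\
    (forall z, Cmod z < R0 -> f z <> 0%C -> g z <> 0%C /\ (f' z / f z = clsum (pole_pair R0 z) zs + g' z / g z)%C).
Proof.
  intros Hr Hp HB.
  set (c0 := (R0 ^ 2 - Cmod p ^ 2) * (R0 ^ 2 - r1 ^ 2) / (4 * R0 ^ 4)).
  pose proof (Cmod_ge_0 p) as Pp.
  assert (C0 : 0 < c0).
  { unfold c0. apply Rdiv_lt_0_compat; [|assert (0 < R0 ^ 4) by (apply pow_lt; lra); lra]. apply Rmult_lt_0_compat; nra. }
  (* The number [n] bounds how many zeros can still be extracted. *)
  assert (Ind : forall n f f', (forall z, cder f z (f' z)) -> f p <> 0%C -> (forall z, Cmod z = R0 -> Cmod (f z) <= B) ->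
    B ^ 2 * (1 - c0) ^ n < Cmod (f p) ^ 2 ->
    exists (zs : list C) (g g' : C -> C), (forall z, cder g z (g' z)) /\
    (forall z, Cmod z < r1 -> g z <> 0%C) /\
    (forall z, Cmod z = R0 -> Cmod (g z) <= B) /\
    (forall rho, In rho zs -> f rho = 0%C /\ Cmod rho < r1) /\
    (forall z, Cmod z <= R0 -> Cmod (f z) = Cmod (g z) * rlprod (fun rho => blaschke R0 rho z) zs) /\
    (forall z, Cmod z < R0 -> f z <> 0%C -> g z <> 0%C /\ (f' z / f z = clsum (pole_pair R0 z) zs + g' z / g z)%C)).
  { induction n as [|n IH]; intros f f' Hf Nfp HfB Hn.
    - exfalso. assert (X : Cmod (f p) <= B).
      { apply (max_modulus f (R0 + 1) R0); try assumption; [intros; eexists; apply Hf|lra]. }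
      pose proof (Cmod_ge_0 (f p)). simpl in Hn. nra.
    - destruct (classic (exists rho, Cmod rho < r1 /\ f rho = 0%C)) as [[rho [Hrho Frho]]|NZ].
      + destruct (factor_one f f' R0 rho Hf Frho ltac:(lra)) as [g [g' [Hg [Mg [Zg Lg]]]]].
        destruct (Lg p Hp Nfp) as [Ngp _].
        destruct (IH g g') as [zs [h [h' [Q1 [Q2 [Q3 [Q4 [Q5 Q6]]]]]]]]; try assumption.
        * intros z Hz. specialize (Mg z ltac:(lra)). rewrite blaschke_boundary, Rmult_1_r in Mg by lra.
          rewrite <- Mg. now apply HfB.
        * rewrite (Mg p ltac:(lra)) in Hn.
          pose proof (blaschke_sq R0 rho p ltac:(lra) ltac:(lra)) as Sq.
          pose proof (bdefect_lower R0 r1 rho p Hr Hrho Hp) as L. fold c0 in L.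
          rewrite Rpow_mult_distr, Sq in Hn. simpl (_ ^ S n) in Hn.
          assert (G2 : 0 < Cmod (g p) ^ 2) by (apply pow_lt; now apply Cmod_gt_0).
          pose proof (pow2_ge_0 (blaschke R0 rho p)).
          destruct (Rle_dec (1 - c0) 0); [|].
          -- exfalso. assert (bdefect R0 rho p = 1) by lra. rewrite H0 in Hn.
             assert (E : 1 - c0 = 0) by lra. rewrite E in Hn. lra.
          -- assert (Cmod (g p) ^ 2 * (1 - bdefect R0 rho p) <= Cmod (g p) ^ 2 * (1 - c0)) by (apply Rmult_le_compat_l; lra).
             apply Rmult_lt_reg_r with (1 - c0); [lra|]. lra.
        * exists (rho :: zs), h, h'. split; [exact Q1|]. split; [exact Q2|]. split; [exact Q3|]. split; [|split].
          -- intros rho0 [<-|H0]; [now split|]. destruct (Q4 rho0 H0) as [Z1 Z2]. split; [apply Zg; [lra|assumption]|assumption].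
          -- intros z Hz. simpl. rewrite Mg, Q5 by lra. ring.
          -- intros z Hz Nfz. destruct (Lg z Hz Nfz) as [Ng El]. destruct (Q6 z Hz Ng) as [Nh E2].
             split; [exact Nh|]. rewrite El, E2. simpl. ring.
      + exists nil, f, f'. split; [exact Hf|]. split; [|split; [exact HfB|split; [|split]]].
        * intros z Hz E. apply NZ. now exists z.
        * intros rho [].
        * intros z Hz. simpl. ring.
        * intros z Hz Nfz. split; [exact Nfz|]. simpl. ring. }
  intros f f' Hf Nfp HfB.
  assert (P : 0 < Cmod (f p) ^ 2) by (apply pow_lt; now apply Cmod_gt_0).
  assert (C1 : c0 <= 1 / 4).
  { unfold c0. assert (0 < R0 ^ 4) by (apply pow_lt; lra). apply Rmult_le_reg_r with (4 * R0 ^ 4); [lra|].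
    unfold Rdiv at 1. rewrite Rmult_assoc, Rinv_l by lra. rewrite Rmult_1_r.
    replace (1 / 4 * (4 * R0 ^ 4)) with (R0 ^ 2 * R0 ^ 2) by field. apply Rmult_le_compat; nra. }
  destruct (pow_lt_1_zero (1 - c0)) with (y := Cmod (f p) ^ 2 / (B ^ 2 + 1)) as [N HN].
  - rewrite Rabs_pos_eq; lra.
  - apply Rdiv_lt_0_compat; nra.
  - apply (Ind N f f' Hf Nfp HfB). specialize (HN N (le_n N)). rewrite Rabs_pos_eq in HN by (apply pow_le; lra).
    assert (0 <= (1 - c0) ^ N) by (apply pow_le; lra).
    apply Rmult_lt_compat_r with (r := B ^ 2 + 1) in HN; [|nra].
    unfold Rdiv in HN. rewrite Rmult_assoc, Rinv_l in HN by nra. nra.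
Qed.

(** Each squared factor is [1 - d <= exp (- d)], with [d] its defect. *)
Lemma blaschke_prod_bound (R0 : R) (z : C) (zs : list C) : (forall rho, In rho zs -> Cmod rho < R0) -> Cmod z <= R0 ->
  0 <= rlprod (fun rho => blaschke R0 rho z) zs <= 1 /\
  rlprod (fun rho => blaschke R0 rho z) zs ^ 2 <= exp (- rlsum (fun rho => bdefect R0 rho z) zs).
Proof.
  intros Hzs Hz. induction zs as [|rho zs IH]; simpl rlprod; simpl rlsum.
  - rewrite Ropp_0, exp_0. lra.
  - destruct IH as [[I1 I2] I3]; [intros; apply Hzs; now right|].
    assert (Hr : Cmod rho < R0) by (apply Hzs; now left).
    pose proof (blaschke_nonneg R0 rho z Hr Hz). pose proof (blaschke_le1 R0 rho z Hr Hz).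
    pose proof (blaschke_sq R0 rho z Hr Hz) as E.
    split; [nra|]. rewrite Rpow_mult_distr, E, Ropp_plus_distr, exp_plus.
    apply Rmult_le_compat; try assumption; try apply pow2_ge_0.
    + rewrite <- E. apply pow2_ge_0.
    + pose proof (exp_ineq1_le (- bdefect R0 rho z)). lra.
Qed.

Lemma jensen_count (R0 : R) (p : C) (zs : list C) (Fp Gp B : R) : (forall rho, In rho zs -> Cmod rho < R0) -> Cmod p <= R0 ->
  0 < Fp -> 0 <= Gp <= B -> Fp = Gp * rlprod (fun rho => blaschke R0 rho p) zs ->
  rlsum (fun rho => bdefect R0 rho p) zs <= 2 * ln (B / Fp).
Proof.
  intros Hzs Hp HF HG E. destruct (blaschke_prod_bound R0 p zs Hzs Hp) as [[P1 P2] P3].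
  set (Pr := rlprod _ _) in *. set (S := rlsum _ _) in *.
  assert (HB : 0 < B) by nra.
  rewrite <- (ln_exp S).
  replace (2 * ln (B / Fp)) with (ln ((B / Fp) * (B / Fp))) by (rewrite ln_mult by (now apply Rdiv_lt_0_compat); ring).
  assert (X : exp S <= B / Fp * (B / Fp)).
  { apply Rmult_le_reg_r with (Fp * Fp * exp (- S)); [repeat apply Rmult_lt_0_compat; try assumption; apply exp_pos|].
    replace (exp S * (Fp * Fp * exp (- S))) with (Fp * Fp * (exp (S + - S))) by (rewrite exp_plus; ring).
    rewrite Rplus_opp_r, exp_0, Rmult_1_r.
    replace (B / Fp * (B / Fp) * (Fp * Fp * exp (- S))) with (B * B * exp (- S)) by (field; lra).
    rewrite E. replace (Gp * Pr * (Gp * Pr)) with (Gp * Gp * Pr ^ 2) by ring.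
    apply Rmult_le_compat; nra. }
  destruct X as [X| ->]; [left; apply ln_increasing; [apply exp_pos|assumption]|lra].
Qed.

(** * The von Mangoldt function *)

Lemma rsum_zero f n : (forall k, (k < n)%nat -> f k = 0) -> rsum f n = 0.
Proof. intros H; induction n as [|n IH]; simpl; [reflexivity|]. rewrite IH, H; auto; lra. Qed.

Lemma rsum_exchange (f : nat -> nat -> R) n m :
  rsum (fun i => rsum (fun j => f i j) m) n = rsum (fun j => rsum (fun i => f i j) n) m.
Proof.
  induction n as [|n IH]; simpl.
  - symmetry. apply rsum_zero. reflexivity.
  - rewrite IH. symmetry. apply rsum_plus.
Qed.

Lemma rsum_extend f n m : (n <= m)%nat -> (forall k, (n <= k < m)%nat -> f k = 0) -> rsum f m = rsum f n.
Proof.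
  intros H. induction H as [|m H IH]; intros Hz; [reflexivity|]. simpl. rewrite IH, Hz; [lra|lia|]. intros; apply Hz; lia.
Qed.

Lemma rsum_single f n k : (k < n)%nat -> (forall j, (j < n)%nat -> j <> k -> f j = 0) -> rsum f n = f k.
Proof.
  induction n as [|n IH]; intros Hk Hz; [lia|]. simpl. destruct (Nat.eq_dec k n) as [->|N].
  - rewrite rsum_zero; [lra|]. intros; apply Hz; lia.
  - rewrite IH; [|lia|intros; apply Hz; lia]. rewrite (Hz n); [lra|lia|lia].
Qed.

Definition when (b : bool) (x : R) : R := if b then x else 0.

Module VonMangoldt.
Import ssreflect ssrfun ssrbool eqtype ssrnat div seq prime bigop fintype path.

(** The parameter [N] bounds the ranges of the sums, independently of [d], so that sums over [d] and over
    prime powers can be exchanged. *)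
Definition LambdaN (N d : nat) : R :=
  rsum (fun p => rsum (fun j => when [&& prime p, 0 < j & p ^ j == d]%N (ln (INR p))) N.+1) N.+1.
Definition Lambda (d : nat) : R := LambdaN d d.

Lemma ln_INR_nonneg n : 0 <= ln (INR n).
Proof.
  destruct n as [|[|n]].
  - simpl. rewrite /ln. case: Rlt_dec => [H|_]; [exfalso; lra|lra].
  - simpl. rewrite ln_1. lra.
  - rewrite -ln_1. left. apply: ln_increasing; [lra|]. rewrite S_INR S_INR. have := pos_INR n. lra.
Qed.

Lemma Lambda_nonneg d : 0 <= Lambda d.
Proof.
  apply: rsum_nonneg => p _. apply: rsum_nonneg => j _. rewrite /when. case: ifP => _; [exact: ln_INR_nonneg|lra].
Qed.

Lemma LambdaN_eq N d : (d <= N)%coq_nat -> LambdaN N d = Lambda d.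
Proof.
  move=> H. rewrite /Lambda /LambdaN.
  rewrite (rsum_extend _ d.+1 N.+1); [|lia|].
  - apply: rsum_ext => p Hp. apply: rsum_extend; [lia|] => j Hj. rewrite /when.
    case: ifP => // /and3P [Pp _ /eqP E]. exfalso.
    have B := ltn_expl j (prime_gt1 Pp). rewrite E in B. move/ltP: B. lia.
  - move=> p Hp. apply: rsum_zero => j _. rewrite /when.
    case: ifP => // /and3P [Pp J0 /eqP E]. exfalso.
    have B : (p <= d)%N by rewrite -E -{1}(expn1 p) leq_pexp2l // prime_gt0.
    move/leP: B. lia.
Qed.

Lemma rsum_count L n : rsum (fun j => when ((0 < j) && (j <= L))%N 1) n.+1 = INR (minn L n).
Proof.
  elim: n => [|n IH]; first by rewrite minn0 /=; lra.
  change (rsum (fun j => when ((0 < j) && (j <= L))%N 1) n.+1 + when ((0 < n.+1) && (n.+1 <= L))%N 1 = INR (minn L n.+1)).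
  rewrite IH /when /=. case H: (n < L)%N.
  - rewrite (minn_idPr H) (minn_idPr (ltnW H)) S_INR. lra.
  - move/negbT: H. rewrite -leqNgt => H. rewrite (minn_idPl H) (minn_idPl (leqW H)). lra.
Qed.

Lemma ln_prod (F : nat -> nat) n : (forall k, (0 < F k)%N) ->
  (0 < \prod_(0 <= p < n) F p)%N /\ ln (INR (\prod_(0 <= p < n) F p)) = rsum (fun p => ln (INR (F p))) n.
Proof.
  move=> HF. elim: n => [|n [IH1 IH2]].
  - rewrite big_nil /=. split=> //. exact: ln_1.
  - rewrite big_nat_recr //=. split; first by rewrite muln_gt0 IH1 HF.
    change (muln ?a ?b) with (Nat.mul a b). rewrite mult_INR ln_mult ?IH2 //.
    + apply: lt_0_INR. by apply/ltP.
    + apply: lt_0_INR. by apply/ltP.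
Qed.

Lemma INR_expn p j : INR (p ^ j)%N = (INR p) ^ j.
Proof. elim: j => [//|j IH]. rewrite expnS. change (muln ?a ?b) with (Nat.mul a b). by rewrite mult_INR IH. Qed.

Lemma ln_pow_nat x n : 0 < x -> ln (x ^ n) = INR n * ln x.
Proof.
  move=> Hx. elim: n => [|n IH]; first by rewrite /= ln_1; lra.
  rewrite S_INR /= ln_mult ?IH //; [lra|]. by apply: pow_lt.
Qed.

Lemma ln_factor n : (0 < n)%N -> ln (INR n) = rsum (fun p => INR (logn p n) * ln (INR p)) n.+1.
Proof.
  move=> Hn.
  have E : n = (\prod_(0 <= p < n.+1) p ^ logn p n)%N.
  { rewrite -[LHS](partnT Hn) /partn. apply: congr_big => //. }
  have HF : forall k, (0 < k ^ logn k n)%N.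
  { move=> k. rewrite expn_gt0. case: k => [|k] //=. }
  have [_ L] := ln_prod (fun p => p ^ logn p n)%N n.+1 HF.
  rewrite {1}E L. apply: rsum_ext => p _. rewrite INR_expn.
  case: p => [|p].
  - by rewrite /= Rmult_0_l ln_1.
  - apply: ln_pow_nat. apply: lt_0_INR. lia.
Qed.

Lemma Lambda_divisor_sum n : (0 < n)%N -> rsum (fun d => when (d %| n)%N (Lambda d)) n.+1 = ln (INR n).
Proof.
  move=> Hn. rewrite (ln_factor _ Hn).
  transitivity (rsum (fun d => rsum (fun p => rsum (fun j => when ([&& prime p, 0 < j & p ^ j == d] && (d %| n))%N (ln (INR p))) n.+1) n.+1) n.+1).
  { apply: rsum_ext => d Hd. rewrite -(LambdaN_eq n) ; [|lia]. rewrite /LambdaN /when. case: (d %| n)%N.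
    - apply: rsum_ext => p _. apply: rsum_ext => j _. by rewrite andbT.
    - symmetry. apply: rsum_zero => p _. apply: rsum_zero => j _. by rewrite andbF. }
  rewrite rsum_exchange. apply: rsum_ext => p _.
  transitivity (rsum (fun j => rsum (fun d => when ([&& prime p, 0 < j & p ^ j == d] && (d %| n))%N (ln (INR p))) n.+1) n.+1).
  { exact: rsum_exchange. }
  case Pp: (prime p); last first.
  { have -> : INR (logn p n) = 0 by rewrite /logn Pp. rewrite Rmult_0_l. apply: rsum_zero => j _. exact: rsum_zero. }
  have HL : (logn p n <= n)%N by apply: ltnW; apply: ltn_logl.
  rewrite -(minn_idPl HL) -rsum_count Rmult_comm -rsum_scal. apply: rsum_ext => j Hj. cbv beta.
  rewrite -(pfactor_dvdn _ Pp Hn).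
  case Dj: (p ^ j %| n)%N.
  - rewrite (rsum_single _ _ (p ^ j)%N).
    + rewrite eqxx Dj /when andbT. case: (0 < j)%N; rewrite /=; lra.
    + have := dvdn_leq Hn Dj. move/leP. lia.
    + move=> d Hd Nd. rewrite /when. case: ifP => // /andP [/and3P [_ _ /eqP E] _]. by rewrite E in Nd.
  - rewrite andbF /when Rmult_0_r. apply: rsum_zero => d Hd.
    case: ifP => // /andP [/and3P [_ _ /eqP E] D]. by rewrite -E Dj in D.
Qed.

(** Such a prime power [n = p^j <= 2^a] has [j <= a], and [p] divides [q]. *)
Lemma Lambda_gcd n q a : (n <= 2 ^ a)%N -> coprime n q = false -> Lambda n <> 0 -> (n %| q ^ a)%N.
Proof.
  move=> Ha Hc HL.
  have [p [j [Pp J0 E]]] : exists p j, [/\ prime p, (0 < j)%N & (p ^ j == n)%N].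
  { apply: NNPP => H. apply: HL. rewrite /Lambda /LambdaN. apply: rsum_zero => p _. apply: rsum_zero => j _.
    rewrite /when. case: ifP => // /and3P [H1 H2 H3]. exfalso. apply: H. by exists p, j. }
  move/eqP: E => E. subst n.
  rewrite coprime_pexpl // prime_coprime // in Hc. move/negbFE: Hc => Hc.
  apply: dvdn_trans (dvdn_exp2r a Hc). apply: dvdn_exp2l.
  have B : (2 ^ j <= 2 ^ a)%N by apply: leq_trans Ha; rewrite leq_exp2r // prime_gt1.
  by rewrite leq_exp2l in B.
Qed.

Lemma dvdn_divide d n : (d %| n)%N <-> Nat.divide d n.
Proof.
  split.
  - by move/dvdnP => [k ->]; exists k.
  - by move=> [k ->]; apply/dvdnP; exists k.
Qed.

Lemma coprime_gcd n q : coprime n q <-> Nat.gcd n q = 1%nat.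
Proof.
  split.
  - move=> H. have D1 := Nat.gcd_divide_l n q. have D2 := Nat.gcd_divide_r n q.
    move/dvdn_divide: D1 => D1. move/dvdn_divide: D2 => D2.
    have D : (Nat.gcd n q %| gcdn n q)%N by rewrite dvdn_gcd D1 D2.
    move/eqP: H => H. rewrite H dvdn1 in D. by apply/eqP.
  - move=> H. have D : (gcdn n q %| 1)%N.
    { apply/dvdn_divide. rewrite -H. apply: Nat.gcd_greatest; apply/dvdn_divide; [exact: dvdn_gcdl|exact: dvdn_gcdr]. }
    by rewrite dvdn1 in D.
Qed.

Lemma mod_dvdn (d n : nat) : (1 <= n)%coq_nat -> Nat.eqb (Nat.modulo n d) 0 = (d %| n)%N.
Proof.
  move=> Hn. apply/idP/idP.
  - move=> /PeanoNat.Nat.eqb_spec H. apply/dvdn_divide. case: d H => [|d] H; first by simpl in H; lia.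
    apply (proj1 (Nat.Lcm0.mod_divide n d.+1)). exact H.
  - move=> /dvdn_divide H. apply/PeanoNat.Nat.eqb_spec. exact/Nat.Lcm0.mod_divide.
Qed.

Lemma leq_ssr (a b : nat) : (a <= b)%coq_nat -> (a <= b)%N.
Proof. by move/leP. Qed.

Lemma expn_pow a b : (a ^ b)%N = Nat.pow a b.
Proof. elim: b => [//|b IH]. by rewrite expnS IH. Qed.

End VonMangoldt.

Definition Lambda : nat -> R := VonMangoldt.Lambda.

Lemma Lambda_nonneg d : 0 <= Lambda d.
Proof. apply VonMangoldt.Lambda_nonneg. Qed.

Lemma ln_INR_nonneg n : 0 <= ln (INR n).
Proof. apply VonMangoldt.ln_INR_nonneg. Qed.

Lemma Lambda_divisor_sum n : (1 <= n)%nat -> rsum (fun d => when (Nat.eqb (n mod d) 0) (Lambda d)) (S n) = ln (INR n).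
Proof.
  intros Hn. rewrite <- (VonMangoldt.Lambda_divisor_sum n); [|now apply VonMangoldt.leq_ssr].
  apply rsum_ext. intros d _. now rewrite VonMangoldt.mod_dvdn.
Qed.

Lemma rsum_term_le f n k : (k < n)%nat -> (forall j, (j < n)%nat -> 0 <= f j) -> f k <= rsum f n.
Proof.
  intros Hk Hf. induction n as [|n IH]; [lia|]. simpl. destruct (Nat.eq_dec k n) as [->|N].
  - assert (0 <= rsum f n) by (apply rsum_nonneg; intros; apply Hf; lia). lra.
  - assert (f k <= rsum f n) by (apply IH; [lia|intros; apply Hf; lia]). specialize (Hf n ltac:(lia)). lra.
Qed.

Lemma Lambda_0 : Lambda 0 = 0.
Proof. unfold Lambda, VonMangoldt.Lambda, VonMangoldt.LambdaN. simpl. unfold when. simpl. lra. Qed.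

Lemma Lambda_le_ln n : Lambda n <= ln (INR n).
Proof.
  destruct n as [|n].
  - rewrite Lambda_0. apply ln_INR_nonneg.
  - rewrite <- Lambda_divisor_sum by lia.
    pose proof (rsum_term_le (fun d => when (Nat.eqb (S n mod d) 0) (Lambda d)) (S (S n)) (S n) ltac:(lia)) as H.
    cbv beta in H. rewrite Nat.Div0.mod_same in H. simpl Nat.eqb in H. unfold when at 1 in H. cbv iota in H. apply H.
    intros j _. unfold when. destruct (Nat.eqb _ _); [apply Lambda_nonneg|lra].
Qed.

Lemma ln_le_self n : ln (INR n) <= INR n.
Proof.
  destruct n as [|n]; [simpl; unfold ln; destruct (Rlt_dec 0 0); [exfalso|]; lra|].
  assert (0 < INR (S n)) by (apply lt_0_INR; lia).
  rewrite <- (ln_exp (INR (S n))) at 2. left. apply ln_increasing; [assumption|].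
  pose proof (exp_ineq1 (INR (S n))). lra.
Qed.

Lemma rsum_widen f n m : (n <= m)%nat -> (forall k, 0 <= f k) -> rsum f n <= rsum f m.
Proof. intros H Hf. induction H as [|m H IH]; [lra|]. simpl. specialize (Hf m). lra. Qed.

(** All the prime powers in question divide [q^a], and their total weight is at most that of all divisors of
    [q^a], which is [ln (q^a)]. *)
Lemma Lambda_gcd_sum q a N : (1 <= q)%nat -> (N <= Nat.pow 2 a)%nat ->
  rsum (fun n => when (negb (Nat.eqb (Nat.gcd n q) 1)) (Lambda n)) (S N) <= INR a * ln (INR q).
Proof.
  intros Hq HN.
  assert (Hqa : (1 <= Nat.pow q a)%nat).
  { pose proof (Nat.pow_nonzero q a). lia. }
  assert (E : INR a * ln (INR q) = ln (INR (Nat.pow q a))).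
  { rewrite pow_INR. symmetry. apply VonMangoldt.ln_pow_nat. apply lt_0_INR. lia. }
  rewrite E, <- Lambda_divisor_sum by assumption.
  set (D := Nat.pow q a) in *. set (g := fun d => when (Nat.eqb (D mod d) 0) (Lambda d)).
  assert (Hg : forall k, 0 <= g k).
  { intros k. unfold g, when. destruct (Nat.eqb _ _); [apply Lambda_nonneg|lra]. }
  apply Rle_trans with (rsum g (S N)).
  - apply rsum_le. intros n Hn. unfold when. destruct (Nat.eqb (Nat.gcd n q) 1) eqn:Eg; simpl; [apply Hg|].
    destruct (Req_dec (Lambda n) 0) as [->|NL]; [apply Hg|].
    unfold g. rewrite VonMangoldt.mod_dvdn by assumption.
    replace (div.dvdn n D) with true; [simpl; lra|]. symmetry.
    unfold D. rewrite <- VonMangoldt.expn_pow. apply VonMangoldt.Lambda_gcd; [|  |exact NL].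
    + rewrite VonMangoldt.expn_pow. apply VonMangoldt.leq_ssr. lia.
    + apply Bool.not_true_is_false. intros C. apply Nat.eqb_neq in Eg. apply Eg.
      apply VonMangoldt.coprime_gcd. exact C.
  - destruct (Nat.le_ge_cases N D) as [H|H].
    + apply rsum_widen; [lia|assumption].
    + right. apply rsum_extend; [lia|]. intros k Hk. unfold g, when.
      destruct (Nat.eqb_spec (D mod k) 0) as [X|X]; [|reflexivity].
      exfalso. rewrite Nat.mod_small in X by lia. lia.
Qed.

(** * Chebyshev's bounds *)

Definition psi (N : nat) : R := rsum Lambda (S N).
Definition logfact (N : nat) : R := rsum (fun k => ln (INR (S k))) N.

Lemma when_nonneg b x : 0 <= x -> 0 <= when b x.
Proof. unfold when; destruct b; lra. Qed.

Lemma div_S (n d : nat) : (1 <= d)%nat -> INR (S n / d) = INR (n / d) + when (Nat.eqb (S n mod d) 0) 1.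
Proof.
  intros Hd. pose proof (Nat.div_mod_eq n d) as E. pose proof (Nat.mod_upper_bound n d ltac:(lia)) as B.
  destruct (Nat.eq_dec (n mod d) (d - 1)) as [X|X].
  - assert (Q : (S n / d = S (n / d))%nat) by (symmetry; apply (Nat.div_unique _ _ _ 0); [lia|rewrite Nat.mul_succ_r; lia]).
    assert (M : (S n mod d = 0)%nat) by (symmetry; apply (Nat.mod_unique _ _ (S (n / d))); [lia|rewrite Nat.mul_succ_r; lia]).
    rewrite Q, M, S_INR. simpl. lra.
  - assert (Q : (S n / d = n / d)%nat) by (symmetry; apply (Nat.div_unique _ _ _ (S (n mod d))); lia).
    assert (M : (S n mod d = S (n mod d))%nat) by (symmetry; apply (Nat.mod_unique _ _ (n / d)); lia).
    rewrite Q, M. simpl. lra.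
Qed.

(** Legendre's formula. *)
Lemma logfact_Lambda N : logfact N = rsum (fun d => Lambda d * INR (N / d)) (S N).
Proof.
  induction N as [|N IH].
  - simpl. rewrite Lambda_0. unfold logfact. simpl. lra.
  - change (logfact (S N)) with (logfact N + ln (INR (S N))).
    rewrite <- Lambda_divisor_sum by lia. rewrite IH.
    transitivity (rsum (fun d => Lambda d * INR (N / d)) (S (S N)) + rsum (fun d => when (Nat.eqb (S N mod d) 0) (Lambda d)) (S (S N))).
    + f_equal. symmetry. apply rsum_extend; [lia|]. intros k Hk. rewrite Nat.div_small by lia. simpl. lra.
    + rewrite <- rsum_plus. apply rsum_ext. intros d _. destruct d as [|d].
      * rewrite Lambda_0. unfold when. destruct (Nat.eqb _ _); lra.
      * rewrite div_S by lia. unfold when. destruct (Nat.eqb _ _); lra.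
Qed.

Lemma psi_nonneg N : 0 <= psi N.
Proof. apply rsum_nonneg. intros; apply Lambda_nonneg. Qed.

Lemma psi_mono m n : (m <= n)%nat -> psi m <= psi n.
Proof. intros H. apply rsum_widen; [lia|apply Lambda_nonneg]. Qed.

(** The factor [floor (2 m / d) - 2 floor (m / d)] is 0 or 1, and it is 1 for [m < d <= 2 m]. *)
Lemma central_psi m : psi (2 * m) - psi m <= logfact (2 * m) - 2 * logfact m /\
  logfact (2 * m) - 2 * logfact m <= psi (2 * m).
Proof.
  assert (E : logfact (2 * m) - 2 * logfact m = rsum (fun d => Lambda d * (INR (2 * m / d) - 2 * INR (m / d))) (S (2 * m))).
  { rewrite !logfact_Lambda.
    assert (X : rsum (fun d => Lambda d * INR (m / d)) (S m) = rsum (fun d => Lambda d * INR (m / d)) (S (2 * m))).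
    { symmetry. apply rsum_extend; [lia|]. intros k Hk. rewrite Nat.div_small by lia. simpl; lra. }
    rewrite X. unfold Rminus. rewrite <- rsum_scal.
    replace (rsum (fun d => Lambda d * INR (2 * m / d)) (S (2 * m))) with
     (rsum (fun d => Lambda d * (INR (2 * m / d) + - (2 * INR (m / d)))) (S (2 * m)) + rsum (fun k => 2 * (Lambda k * INR (m / k))) (S (2 * m))); [lra|].
    rewrite <- rsum_plus. apply rsum_ext. intros; lra. }
  rewrite E.
  assert (B : forall d, (1 <= d)%nat -> (2 * (m / d) <= 2 * m / d <= 2 * (m / d) + 1)%nat).
  { intros d Hd. pose proof (Nat.div_mod_eq m d) as E1. pose proof (Nat.mod_upper_bound m d ltac:(lia)) as B1. split.
    - apply Nat.div_le_lower_bound; [lia|]. nia.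
    - apply Nat.lt_succ_r. apply Nat.Div0.div_lt_upper_bound. nia. }
  assert (B2 : forall d, 0 <= Lambda d * (INR (2 * m / d) - 2 * INR (m / d)) <= Lambda d).
  { intros [|d]; [rewrite Lambda_0; lra|]. pose proof (Lambda_nonneg (S d)). specialize (B (S d) ltac:(lia)).
    destruct B as [L U]. apply le_INR in L, U. rewrite plus_INR in U. rewrite mult_INR in L, U.
    change (INR 2) with 2 in L, U. change (INR 1) with 1 in U. split; nra. }
  split.
  - apply Rle_trans with (rsum (fun d => when (Nat.ltb m d) (Lambda d)) (S (2 * m))).
    + right. unfold psi.
      assert (X : rsum Lambda (S m) = rsum (fun d => when (Nat.leb d m) (Lambda d)) (S (2 * m))).
      { symmetry. rewrite (rsum_extend _ (S m) (S (2 * m))).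
        - apply rsum_ext. intros k Hk. unfold when. destruct (Nat.leb_spec k m); [reflexivity|lia].
        - lia.
        - intros k Hk. unfold when. destruct (Nat.leb_spec k m); [lia|reflexivity]. }
      rewrite X. apply Rplus_eq_reg_r with (rsum (fun d => when (Nat.leb d m) (Lambda d)) (S (2 * m))).
      rewrite <- rsum_plus. unfold Rminus. rewrite Rplus_assoc, Rplus_opp_l, Rplus_0_r. apply rsum_ext. intros k _.
      unfold when. destruct (Nat.leb_spec k m), (Nat.ltb_spec m k); try lra; lia.
    + apply rsum_le. intros d Hd. unfold when. destruct (Nat.ltb_spec m d); [|apply B2].
      rewrite (Nat.div_small m d) by lia.
      assert (Q : (2 * m / d = 1)%nat) by (symmetry; apply (Nat.div_unique _ _ _ (2 * m - d)); lia).
      rewrite Q. simpl. lra.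
  - apply rsum_le. intros d Hd. apply B2.
Qed.

Lemma logfact_S N : logfact (S N) = logfact N + ln (INR (S N)).
Proof. reflexivity. Qed.

Lemma ln2_bounds : / 2 < ln 2 < 1.
Proof.
  split; [apply ln_lt_2|]. apply Rlt_le_trans with (ln (exp 1)); [|rewrite ln_exp; lra]. apply ln_increasing; [lra|].
  pose proof (exp_ineq1 1 ltac:(lra)). lra.
Qed.

(** Bounds for the central binomial coefficient, whose logarithm [D] is, by its recurrence in [m]. *)
Lemma central_bounds m : let D := logfact (2 * m) - 2 * logfact m in
  INR m * (2 * ln 2) - ln (2 * INR m + 1) <= D <= INR m * (2 * ln 2).
Proof.
  cbv zeta. induction m as [|m IH].
  - simpl. unfold logfact. simpl. rewrite Rmult_0_r, Rplus_0_l, ln_1. lra.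
  - replace (2 * S m)%nat with (S (S (2 * m))) by lia. rewrite !logfact_S.
    assert (P : 0 <= INR m) by apply pos_INR.
    assert (E1 : INR (S (S (2 * m))) = 2 * (INR m + 1)) by (rewrite !S_INR, mult_INR; simpl; lra).
    assert (E2 : INR (S (2 * m)) = 2 * INR m + 1) by (rewrite !S_INR, mult_INR; simpl; lra).
    rewrite E1, E2, S_INR. rewrite (ln_mult 2) by lra.
    set (L := logfact (2 * m) - 2 * logfact m) in *.
    assert (U : ln (2 * INR m + 1) <= ln 2 + ln (INR m + 1)).
    { rewrite <- ln_mult by lra. left. apply ln_increasing; lra. }
    assert (W : ln 2 + ln (INR m + 1) <= ln (2 * (INR m + 1) + 1)).
    { rewrite <- ln_mult by lra. left. apply ln_increasing; lra. }
    split; unfold L in *; lra.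
Qed.

(** Induction by halving, with [psi (2 m) - psi m <= 2 m ln 2]. *)
Lemma psi_upper N : psi N <= 4 * INR N.
Proof.
  induction N as [N IH] using (well_founded_induction Nat.lt_wf_0).
  destruct N as [|[|N]].
  - unfold psi. simpl. rewrite Lambda_0. lra.
  - unfold psi. simpl. rewrite Lambda_0. pose proof (Lambda_le_ln 1). simpl in H. rewrite ln_1 in H. lra.
  - set (n := S (S N)) in *. set (m := (n / 2)%nat).
    pose proof (Nat.div_mod_eq n 2) as E. fold m in E. pose proof (Nat.mod_upper_bound n 2 ltac:(lia)) as B.
    assert (Hm : (1 <= m < n)%nat) by (unfold n in *; lia).
    pose proof (IH m ltac:(lia)) as I. pose proof (central_psi m) as [C1 _]. pose proof (central_bounds m) as [_ C2].
    pose proof ln2_bounds. pose proof (pos_INR m).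
    assert (X : psi (2 * m) <= 6 * INR m) by nra.
    destruct (Nat.eq_dec (n mod 2) 0) as [Z|Z].
    + replace n with (2 * m)%nat by lia. rewrite mult_INR. simpl (INR 2). lra.
    + replace n with (S (2 * m))%nat by lia. change (psi (S (2 * m))) with (psi (2 * m) + Lambda (S (2 * m))).
      pose proof (Lambda_le_ln (S (2 * m))) as L1.
      assert (L2 : ln (INR (S (2 * m))) <= 2 * INR m).
      { rewrite S_INR, mult_INR. simpl (INR 2). assert (1 <= INR m) by (apply (le_INR 1); lia).
        apply Rle_trans with (ln (exp (2 * INR m))); [|rewrite ln_exp; lra]. left. apply ln_increasing; [lra|]. pose proof (exp_ineq1 (2 * INR m) ltac:(lra)). lra. }
      rewrite S_INR, mult_INR. simpl (INR 2). lra.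
Qed.

Lemma psi_lower m : INR m - ln (2 * INR m + 1) <= psi (2 * m).
Proof.
  pose proof (central_psi m) as [_ C1]. pose proof (central_bounds m) as [C2 _]. pose proof ln2_bounds. pose proof (pos_INR m). nra.
Qed.

(** * Dirichlet series *)

(** [n^{-a}] for a real exponent; the modulus of [nat_cpow_opp n s] is [npw n (Re s)]. *)
Definition npw (n : nat) (a : R) : R := exp (- a * ln (INR n)).

Lemma npw_pos n a : 0 < npw n a. Proof. apply exp_pos. Qed.

Lemma ncp_Cexp n s : nat_cpow_opp n s = Cexp (- ln (INR n) * s)%C.
Proof. unfold nat_cpow_opp. f_equal. rewrite <- RtoC_opp. rewrite RtoC_opp. ring. Qed.

Lemma Cmod_ncp n s : Cmod (nat_cpow_opp n s) = npw n (Re s).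
Proof. rewrite ncp_Cexp, Cmod_Cexp. unfold npw. f_equal. destruct s. simpl. ring. Qed.

Lemma ncp_mult m n s : (1 <= m)%nat -> (1 <= n)%nat -> nat_cpow_opp (m * n) s = (nat_cpow_opp m s * nat_cpow_opp n s)%C.
Proof.
  intros Hm Hn. rewrite !ncp_Cexp, <- Cexp_plus. f_equal.
  rewrite mult_INR, ln_mult by (apply lt_0_INR; lia). rewrite RtoC_plus. ring.
Qed.

Lemma ncp_1 s : nat_cpow_opp 1 s = 1%C.
Proof. rewrite ncp_Cexp. simpl. rewrite ln_1. replace (- 0 * s)%C with (RtoC 0) by ring. apply Cexp_0. Qed.

Lemma npw_1 a : npw 1 a = 1.
Proof. unfold npw. simpl. rewrite ln_1, Rmult_0_r. apply exp_0. Qed.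

Lemma npw_mult m n a : (1 <= m)%nat -> (1 <= n)%nat -> npw (m * n) a = npw m a * npw n a.
Proof.
  intros Hm Hn. unfold npw. rewrite mult_INR, ln_mult by (apply lt_0_INR; lia). rewrite <- exp_plus. f_equal. ring.
Qed.

Lemma npw_plus n a b : npw n (a + b) = npw n a * npw n b.
Proof. unfold npw. rewrite <- exp_plus. f_equal. ring. Qed.

Lemma INR_ge1 n : (1 <= n)%nat -> 1 <= INR n.
Proof. intros H. apply (le_INR 1) in H. exact H. Qed.

Lemma npw_one n : (1 <= n)%nat -> npw n 1 = / INR n.
Proof.
  intros Hn. apply INR_ge1 in Hn. unfold npw. replace (- (1) * ln (INR n)) with (- ln (INR n)) by ring.
  rewrite exp_Ropp, exp_ln; lra.
Qed.

Lemma npw_neg_one n : (1 <= n)%nat -> npw n (-1) = INR n.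
Proof.
  intros Hn. apply INR_ge1 in Hn. unfold npw. replace (- (-1) * ln (INR n)) with (ln (INR n)) by ring. apply exp_ln; lra.
Qed.

Lemma npw_antimono n a b : (1 <= n)%nat -> a <= b -> npw n b <= npw n a.
Proof.
  intros Hn Hab. unfold npw. apply INR_ge1 in Hn.
  assert (0 <= ln (INR n)) by apply ln_INR_nonneg.
  destruct (Req_dec (- b * ln (INR n)) (- a * ln (INR n))) as [->|N]; [lra|].
  left. apply exp_increasing. nra.
Qed.

Lemma npw_le_1 n a : (1 <= n)%nat -> 0 <= a -> npw n a <= 1.
Proof.
  intros Hn Ha. eapply Rle_trans; [apply (npw_antimono n 0 a); assumption|]. unfold npw. rewrite Ropp_0, Rmult_0_l, exp_0. lra.
Qed.

(** Comparison of a sum with an integral, in telescoping form. *)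
Lemma npw_telescope n a : (1 <= n)%nat -> 0 < a -> a * npw (S n) (1 + a) <= npw n a - npw (S n) a.
Proof.
  intros Hn Ha. pose proof (INR_ge1 n Hn). rewrite npw_plus, npw_one by lia.
  assert (E : npw n a = npw (S n) a * exp (a * (ln (INR (S n)) - ln (INR n)))).
  { unfold npw. rewrite <- exp_plus. f_equal. ring. }
  rewrite E. pose proof (npw_pos (S n) a) as P. pose proof (exp_ineq1_le (a * (ln (INR (S n)) - ln (INR n)))) as X.
  assert (L : / INR (S n) <= ln (INR (S n)) - ln (INR n)).
  { rewrite <- (Ropp_involutive (_ - _)). rewrite Ropp_minus_distr.
    rewrite <- ln_div by (rewrite ?S_INR; lra).
    assert (Y : ln (INR n / INR (S n)) <= INR n / INR (S n) - 1).
    { assert (Q : 0 < INR n / INR (S n)) by (apply Rdiv_lt_0_compat; rewrite ?S_INR; lra).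
      rewrite <- (exp_ln _ Q) at 2. pose proof (exp_ineq1_le (ln (INR n / INR (S n)))). lra. }
    replace (INR n / INR (S n) - 1) with (- / INR (S n)) in Y by (rewrite S_INR; field; lra). lra. }
  assert (a * / INR (S n) <= a * (ln (INR (S n)) - ln (INR n))) by (apply Rmult_le_compat_l; lra).
  nra.
Qed.

Lemma npw_tail a N M : (1 <= N)%nat -> 0 < a ->
  rsum (fun k => npw (S (N + k)) (1 + a)) M <= npw N a / a - npw (N + M) a / a.
Proof.
  intros HN Ha. induction M as [|M IH]; [rewrite Nat.add_0_r; simpl; lra|].
  simpl. rewrite Nat.add_succ_r.
  pose proof (npw_telescope (N + M) a ltac:(lia) Ha) as T.
  assert (npw (S (N + M)) (1 + a) <= npw (N + M) a / a - npw (S (N + M)) a / a).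
  { apply Rmult_le_reg_l with a; [assumption|]. replace (a * (npw (N + M) a / a - npw (S (N + M)) a / a)) with (npw (N + M) a - npw (S (N + M)) a) by (field; lra). exact T. }
  lra.
Qed.

Lemma npw_tail_bound a N M : (1 <= N)%nat -> 0 < a -> rsum (fun k => npw (S (N + k)) (1 + a)) M <= npw N a / a.
Proof.
  intros HN Ha. eapply Rle_trans; [now apply npw_tail|]. pose proof (npw_pos (N + M) a).
  assert (0 < npw (N + M) a / a) by now apply Rdiv_lt_0_compat. lra.
Qed.

Lemma rsum_split f n m : rsum f (n + m) = rsum f n + rsum (fun k => f (n + k)%nat) m.
Proof. induction m as [|m IH]; [rewrite Nat.add_0_r; simpl; lra|]. rewrite Nat.add_succ_r. simpl. rewrite IH. lra. Qed.
Lemma csum_split f n m : csum f (n + m) = (csum f n + csum (fun k => f (n + k)%nat) m)%C.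
Proof. induction m as [|m IH]; [rewrite Nat.add_0_r; simpl; ring|]. rewrite Nat.add_succ_r. simpl. rewrite IH. ring. Qed.

Lemma npw_sum a M : 0 < a -> rsum (fun k => npw (S k) (1 + a)) M <= 1 + / a.
Proof.
  intros Ha. assert (0 < / a) by now apply Rinv_0_lt_compat.
  destruct M as [|M]; [simpl; lra|].
  change (S M) with (1 + M)%nat. rewrite rsum_split. simpl rsum at 1. rewrite npw_1.
  pose proof (npw_tail_bound a 1 M ltac:(lia) Ha). rewrite npw_1 in H0. unfold Rdiv in H0. rewrite Rmult_1_l in H0.
  replace (fun k : nat => npw (S (1 + k)) (1 + a)) with (fun k : nat => npw (S (1 + k)) (1 + a)) by reflexivity. lra.
Qed.

Lemma npw_small a : 0 < a -> forall eps, 0 < eps -> exists N0, (1 <= N0)%nat /\ forall N, (N0 <= N)%nat -> npw N a <= eps.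
Proof.
  intros Ha eps He.
  destruct (INR_unbounded (exp (- ln eps / a))) as [N0 HN0].
  exists (S N0). split; [lia|]. intros N HN.
  assert (HN' : exp (- ln eps / a) < INR N) by (eapply Rlt_trans; [exact HN0|apply lt_INR; lia]).
  assert (L : - ln eps / a < ln (INR N)).
  { rewrite <- (ln_exp (- ln eps / a)). apply ln_increasing; [apply exp_pos|assumption]. }
  unfold npw. rewrite <- (exp_ln eps He). left. apply exp_increasing.
  apply Rmult_lt_compat_l with (r := a) in L; [|assumption].
  replace (a * (- ln eps / a)) with (- ln eps) in L by (field; lra). lra.
Qed.

(** The term of index [k] belongs to the integer [S k], so that [dpart a s N] is the sum over [1 <= n <= N]. *)
Definition dterm (a : nat -> C) (s : C) (k : nat) : C := (a (S k) * nat_cpow_opp (S k) s)%C.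
Definition dpart (a : nat -> C) (s : C) (N : nat) : C := csum (dterm a s) N.
Definition dlim (a : nat -> C) (s l : C) : Prop :=
  forall eps, 0 < eps -> exists N0, forall N, (N0 <= N)%nat -> Cmod (dpart a s N - l)%C <= eps.

Lemma sum_n_csum (f : nat -> C) N : sum_n (G := C_NormedModule) f N = csum f (S N).
Proof.
  induction N as [|N IH].
  - rewrite sum_O. simpl. rewrite Cplus_0_l. reflexivity.
  - rewrite sum_Sn, IH. reflexivity.
Qed.

Lemma dlim_of_series a s l : is_series (K := C_AbsRing) (V := C_NormedModule) (fun k => (a (S k) * nat_cpow_opp (S k) s)%C) l -> dlim a s l.
Proof.
  intros H eps He.
  assert (He2 : 0 < eps / sqrt 2) by (apply Rdiv_lt_0_compat; [assumption|apply sqrt_lt_R0; lra]).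
  pose proof (proj1 (filterlim_locally (U := C_UniformSpace) _ _) H (mkposreal _ He2)) as [N HN].
  exists (S N). intros M HM. destruct M as [|M]; [lia|].
  specialize (HN M ltac:(lia)). rewrite sum_n_csum in HN.
  apply C_NormedModule_mixin_compat2 in HN. simpl pos in HN.
  replace (sqrt 2 * (eps / sqrt 2)) with eps in HN.
  - left. exact HN.
  - field. apply Rgt_not_eq, sqrt_lt_R0. lra.
Qed.

Lemma dpart_diff a s N M : (forall n, Cmod (a n) <= 1) -> (1 <= N)%nat -> 1 < Re s -> (N <= M)%nat ->
  Cmod (dpart a s M - dpart a s N)%C <= npw N (Re s - 1) / (Re s - 1).
Proof.
  intros Ha HN Hs HM. replace M with (N + (M - N))%nat by lia. unfold dpart. rewrite csum_split.
  match goal with |- Cmod (?x + ?y - ?x)%C <= _ => replace (x + y - x)%C with y by ring end.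
  eapply Rle_trans; [apply Cmod_csum|].
  eapply Rle_trans; [|apply (npw_tail_bound (Re s - 1) N (M - N)); [assumption|lra]].
  apply rsum_le. intros k _. unfold dterm. rewrite Cmod_mult, Cmod_ncp.
  replace (1 + (Re s - 1)) with (Re s) by ring. pose proof (npw_pos (S (N + k)) (Re s)).
  specialize (Ha (S (N + k))). nra.
Qed.

Lemma dlim_tail a s l N : (forall n, Cmod (a n) <= 1) -> (1 <= N)%nat -> 1 < Re s -> dlim a s l ->
  Cmod (l - dpart a s N)%C <= npw N (Re s - 1) / (Re s - 1).
Proof.
  intros Ha HN Hs Hl. apply le_epsilon. intros eps He. destruct (Hl eps He) as [N0 H0].
  specialize (H0 (N + N0)%nat ltac:(lia)). pose proof (dpart_diff a s N (N + N0) Ha HN Hs ltac:(lia)) as D.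
  replace (l - dpart a s N)%C with ((dpart a s (N + N0) - dpart a s N) - (dpart a s (N + N0) - l))%C by ring.
  eapply Rle_trans; [apply Cmod_triangle_sub|]. lra.
Qed.

Lemma dlim_exists a s : (forall n, Cmod (a n) <= 1) -> 1 < Re s -> exists l, dlim a s l.
Proof.
  intros Ha Hs.
  assert (Cau : forall eps, 0 < eps -> exists N0, forall n m, (n >= N0)%nat -> (m >= N0)%nat -> Cmod (dpart a s n - dpart a s m)%C < eps).
  { intros eps He. destruct (npw_small (Re s - 1) ltac:(lra) (eps / 2 * (Re s - 1)) ltac:(apply Rmult_lt_0_compat; lra)) as [N0 [H1 H0]].
    assert (X : forall n m, (n >= N0)%nat -> (m >= n)%nat -> Cmod (dpart a s m - dpart a s n)%C < eps).
    { intros n m Hn Hm. eapply Rle_lt_trans; [apply dpart_diff; try assumption; lia|].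
      specialize (H0 n Hn). apply Rle_lt_trans with (eps / 2); [|lra].
      apply Rmult_le_reg_r with (Re s - 1); [lra|]. unfold Rdiv at 1. rewrite Rmult_assoc, Rinv_l by lra. lra. }
    exists N0. intros n m Hn Hm. destruct (Nat.le_ge_cases n m); [rewrite Cmod_minus_sym|]; apply X; lia. }
  destruct (Rcomplete.R_complete (fun n => Re (dpart a s n))) as [x Hx].
  { intros eps He. destruct (Cau eps He) as [N0 H0]. exists N0. intros n m Hn Hm.
    eapply Rle_lt_trans; [|apply (H0 n m Hn Hm)]. exact (re_le_Cmod (dpart a s n - dpart a s m)%C). }
  destruct (Rcomplete.R_complete (fun n => Im (dpart a s n))) as [y Hy].
  { intros eps He. destruct (Cau eps He) as [N0 H0]. exists N0. intros n m Hn Hm.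
    eapply Rle_lt_trans; [|apply (H0 n m Hn Hm)]. exact (im_le_Cmod (dpart a s n - dpart a s m)%C). }
  exists (x, y). intros eps He. destruct (Hx (eps / 2) ltac:(lra)) as [N1 H1]. destruct (Hy (eps / 2) ltac:(lra)) as [N2 H2].
  exists (N1 + N2)%nat. intros N HN. specialize (H1 N ltac:(lia)). specialize (H2 N ltac:(lia)).
  eapply Rle_trans; [apply Cmod_le_abs|]. unfold Rdist in *. simpl. unfold Rminus in *. unfold Re, Im in *. lra.
Qed.

Lemma dlim_ext a b s l : (forall n, (1 <= n)%nat -> a n = b n) -> dlim a s l -> dlim b s l.
Proof.
  intros E H eps He. destruct (H eps He) as [N0 H0]. exists N0. intros N HN.
  replace (dpart b s N) with (dpart a s N); [now apply H0|].
  apply csum_ext. intros k _. unfold dterm. rewrite E; [reflexivity|lia].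
Qed.

(** * Euler products and the 3-4-1 inequality *)

Definition cmult (a : nat -> C) : Prop :=
  (forall m n, a (m * n)%nat = (a m * a n)%C) /\ a 1%nat = 1%C /\ forall n, Cmod (a n) <= 1.

(** Removing the multiples of [p] from a completely multiplicative series divides out an Euler factor: the
    partial sums satisfy [b_M = a_M - x a_{M/p}] exactly. *)
Lemma sieve_step (a : nat -> C) p s l : (forall m n, a (m * n)%nat = (a m * a n)%C) -> (forall n, Cmod (a n) <= 1) ->
  (1 <= p)%nat -> 1 < Re s -> dlim a s l ->
  dlim (fun n => if Nat.eqb (n mod p) 0 then 0%C else a n) s (l * (1 - a p * nat_cpow_opp p s))%C.
Proof.
  intros Hm Hb Hp Hs Hl. set (b := (fun n => if Nat.eqb (n mod p) 0 then 0%C else a n) : nat -> C).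
  set (x := (a p * nat_cpow_opp p s)%C).
  assert (E : forall M, dpart b s M = (dpart a s M - x * dpart a s (M / p))%C).
  { induction M as [|M IH].
    - rewrite Nat.Div0.div_0_l. unfold dpart. simpl. ring.
    - change (dpart b s (S M)) with (dpart b s M + dterm b s M)%C. change (dpart a s (S M)) with (dpart a s M + dterm a s M)%C.
      rewrite IH. unfold dterm at 1, b at 1.
      pose proof (Nat.div_mod_eq M p) as E1. pose proof (Nat.mod_upper_bound M p ltac:(lia)) as B.
      destruct (Nat.eqb_spec (S M mod p) 0) as [Z|Z].
      + assert (Q : (S M / p = S (M / p))%nat).
        { pose proof (Nat.div_mod_eq (S M) p) as E2. rewrite Z in E2. nia. }
        assert (Q2 : (S M = p * S (M / p))%nat) by (rewrite <- Q; pose proof (Nat.div_mod_eq (S M) p); lia).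
        rewrite Q. change (dpart a s (S (M / p))) with (dpart a s (M / p) + dterm a s (M / p))%C.
        assert (T : dterm a s M = (x * dterm a s (M / p))%C).
        { unfold dterm, x. rewrite Q2, Hm, ncp_mult by lia. ring. }
        rewrite T. ring.
      + assert (Q : (S M / p = M / p)%nat).
        { pose proof (Nat.div_mod_eq (S M) p) as E2. pose proof (Nat.mod_upper_bound (S M) p ltac:(lia)). nia. }
        rewrite Q. fold (dterm a s M). ring. }
  assert (Hx : Cmod x <= 1).
  { unfold x. rewrite Cmod_mult, Cmod_ncp. pose proof (npw_le_1 p (Re s) Hp ltac:(lra)). pose proof (npw_pos p (Re s)).
    specialize (Hb p). pose proof (Cmod_ge_0 (a p)). nra. }
  intros eps He. destruct (Hl (eps / 2) ltac:(lra)) as [N0 H0].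
  exists (p * (N0 + 1))%nat. intros M HM.
  assert (M1 : (N0 <= M)%nat) by nia.
  assert (M2 : (N0 <= M / p)%nat) by (apply Nat.div_le_lower_bound; nia).
  pose proof (H0 M M1) as B1. pose proof (H0 _ M2) as B2. rewrite E.
  replace (dpart a s M - x * dpart a s (M / p) - l * (1 - x))%C with
    ((dpart a s M - l) - x * (dpart a s (M / p) - l))%C by ring.
  eapply Rle_trans; [apply Cmod_triangle_sub|]. rewrite Cmod_mult.
  pose proof (Cmod_ge_0 (dpart a s (M / p) - l)%C). nra.
Qed.

(** The integers without common factor with [d!] are those free of primes up to [d]. Sieving by all integers
    [2, 3, ...] in turn avoids any enumeration of the primes; composite integers remove nothing. *)
Definition sifted (a : nat -> C) (d n : nat) : C := if Nat.eqb (Nat.gcd n (fact d)) 1 then a n else 0%C.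

Lemma gcd_mul_one n a b : Nat.gcd n a = 1%nat -> Nat.gcd n b = 1%nat -> Nat.gcd n (a * b) = 1%nat.
Proof.
  intros Ha Hb. set (g := Nat.gcd n (a * b)).
  assert (G1 : Nat.divide g n) by apply Nat.gcd_divide_l.
  assert (G2 : Nat.divide g (a * b)) by apply Nat.gcd_divide_r.
  assert (G3 : Nat.gcd g a = 1%nat).
  { apply Nat.divide_1_r. rewrite <- Ha. apply Nat.gcd_greatest.
    - eapply Nat.divide_trans; [apply Nat.gcd_divide_l|exact G1].
    - apply Nat.gcd_divide_r. }
  pose proof (Nat.gauss _ _ _ G2 G3) as G4.
  apply Nat.divide_1_r. rewrite <- Hb. now apply Nat.gcd_greatest.
Qed.

Lemma gcd_one_divide n a b : Nat.divide a b -> Nat.gcd n b = 1%nat -> Nat.gcd n a = 1%nat.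
Proof.
  intros Hd Hb. apply Nat.divide_1_r. rewrite <- Hb. apply Nat.gcd_greatest; [apply Nat.gcd_divide_l|].
  eapply Nat.divide_trans; [apply Nat.gcd_divide_r|exact Hd].
Qed.

Lemma divide_fact g d : (1 <= g <= d)%nat -> Nat.divide g (fact d).
Proof.
  induction d as [|d IH]; intros H; [lia|]. destruct (Nat.eq_dec g (S d)) as [->|N].
  - exists (fact d). simpl. ring.
  - destruct (IH ltac:(lia)) as [k Hk]. exists (S d * k)%nat. simpl fact. rewrite Hk. ring.
Qed.

Lemma sifted_succ a d n : (1 <= d)%nat -> (1 <= n)%nat -> sifted a (S d) n = if Nat.eqb (n mod S d) 0 then 0%C else sifted a d n.
Proof.
  intros Hd Hn. unfold sifted. change (fact (S d)) with (S d * fact d)%nat.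
  destruct (Nat.eqb_spec (n mod S d) 0) as [Z|Z].
  - apply Nat.Lcm0.mod_divide in Z. destruct (Nat.eqb_spec (Nat.gcd n (S d * fact d)) 1) as [E|]; [|reflexivity].
    exfalso. apply (gcd_one_divide n (S d)) in E; [|exists (fact d); ring].
    assert (X : Nat.divide (S d) 1) by (rewrite <- E; now apply Nat.gcd_greatest; [|exists 1%nat; lia]).
    apply Nat.divide_1_r in X. lia.
  - destruct (Nat.eqb_spec (Nat.gcd n (fact d)) 1) as [E|E].
    + destruct (Nat.eqb_spec (Nat.gcd n (S d * fact d)) 1) as [|N]; [reflexivity|]. exfalso. apply N.
      apply gcd_mul_one; [|assumption]. set (g := Nat.gcd n (S d)).
      assert (G1 : Nat.divide g n) by apply Nat.gcd_divide_l.
      assert (G2 : Nat.divide g (S d)) by apply Nat.gcd_divide_r.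
      pose proof (Nat.divide_pos_le g (S d) ltac:(lia) G2).
      assert (g <> 0%nat) by (intro X; rewrite X in G1; apply Nat.divide_0_l in G1; lia).
      destruct (Nat.eq_dec g (S d)) as [X|X].
      * exfalso. apply Z. apply Nat.Lcm0.mod_divide. now rewrite <- X.
      * apply Nat.divide_1_r. rewrite <- E. apply Nat.gcd_greatest; [assumption|]. apply divide_fact. lia.
    + destruct (Nat.eqb_spec (Nat.gcd n (S d * fact d)) 1) as [X|]; [|reflexivity].
      exfalso. apply E. apply (gcd_one_divide n _ (S d * fact d)); [exists (S d); ring|assumption].
Qed.

Lemma sifted_le a d n : cmult a -> Cmod (sifted a d n) <= 1.
Proof. intros [_ [_ H]]. unfold sifted. destruct (Nat.eqb _ _); [apply H|rewrite Cmod_0; lra]. Qed.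

Lemma sifted_mult a d : cmult a -> forall m n, sifted a d (m * n) = (sifted a d m * sifted a d n)%C.
Proof.
  intros [H _] m n. unfold sifted.
  destruct (Nat.eqb_spec (Nat.gcd m (fact d)) 1) as [E1|E1], (Nat.eqb_spec (Nat.gcd n (fact d)) 1) as [E2|E2].
  - rewrite Nat.gcd_comm in E1, E2. rewrite (Nat.gcd_comm (m * n)), gcd_mul_one by assumption. simpl. apply H.
  - destruct (Nat.eqb_spec (Nat.gcd (m * n) (fact d)) 1) as [X|]; [|ring].
    exfalso. apply E2. rewrite Nat.gcd_comm in *. apply (gcd_one_divide _ n (m * n)); [exists m; ring|assumption].
  - destruct (Nat.eqb_spec (Nat.gcd (m * n) (fact d)) 1) as [X|]; [|ring].
    exfalso. apply E1. rewrite Nat.gcd_comm in *. apply (gcd_one_divide _ m (m * n)); [exists n; ring|assumption].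
  - destruct (Nat.eqb_spec (Nat.gcd (m * n) (fact d)) 1) as [X|]; [|ring].
    exfalso. apply E1. rewrite Nat.gcd_comm in *. apply (gcd_one_divide _ m (m * n)); [exists n; ring|assumption].
Qed.

(** It is zero for composite [S (S i)], whose multiples are already removed. *)
Definition euler_factor (a : nat -> C) (s : C) (i : nat) : C := (sifted a (S i) (S (S i)) * nat_cpow_opp (S (S i)) s)%C.
Fixpoint euler_partial (a : nat -> C) (s : C) (j : nat) : C :=
  match j with O => 1%C | S j => (euler_partial a s j * (1 - euler_factor a s j))%C end.

Lemma euler_dlim a s l j : cmult a -> 1 < Re s -> dlim a s l -> dlim (sifted a (S j)) s (l * euler_partial a s j)%C.
Proof.
  intros Ha Hs Hl. induction j as [|j IH].
  - simpl. rewrite Cmult_1_r. apply (dlim_ext a); [|assumption]. intros n Hn. unfold sifted.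
    change (fact 1) with 1%nat. replace (Nat.gcd n 1) with 1%nat by (symmetry; apply Nat.divide_1_r, Nat.gcd_divide_r). reflexivity.
  - simpl euler_partial. rewrite Cmult_assoc.
    apply (dlim_ext (fun n => if Nat.eqb (n mod S (S j)) 0 then 0%C else sifted a (S j) n)).
    + intros n Hn. symmetry. apply sifted_succ; lia.
    + apply sieve_step; try assumption; [now apply sifted_mult|intros; now apply sifted_le|lia].
Qed.

(** After sieving by everything up to [S j], the only term up to [S j] left is that of 1. *)
Theorem euler_product a s l j : cmult a -> 1 < Re s -> dlim a s l ->
  Cmod (l * euler_partial a s j - 1)%C <= npw (S j) (Re s - 1) / (Re s - 1).
Proof.
  intros Ha Hs Hl.
  pose proof (dlim_tail _ s _ (S j) (fun n => sifted_le a (S j) n Ha) ltac:(lia) Hs (euler_dlim a s l j Ha Hs Hl)) as T.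
  assert (E : dpart (sifted a (S j)) s (S j) = 1%C).
  { assert (X : forall k, (k <= j)%nat -> dpart (sifted a (S j)) s (S k) = 1%C).
    { induction k as [|k IHk]; intros Hk.
      - unfold dpart, dterm, sifted. simpl. rewrite ncp_1. destruct Ha as [_ [-> _]]. ring.
      - change (dpart (sifted a (S j)) s (S (S k))) with (dpart (sifted a (S j)) s (S k) + dterm (sifted a (S j)) s (S k))%C.
        rewrite IHk by lia. unfold dterm, sifted.
        destruct (Nat.eqb_spec (Nat.gcd (S (S k)) (fact (S j))) 1) as [E|]; [|ring].
        exfalso. assert (D : Nat.divide (S (S k)) 1).
        { rewrite <- E. apply Nat.gcd_greatest; [exists 1%nat; lia|apply divide_fact; lia]. }
        apply Nat.divide_1_r in D. lia. }
    now apply X. }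
  now rewrite E in T.
Qed.

Lemma euler_close a s l eps : cmult a -> 1 < Re s -> dlim a s l -> 0 < eps ->
  exists j0, forall j, (j0 <= j)%nat -> Cmod (l * euler_partial a s j - 1)%C <= eps.
Proof.
  intros Ha Hs Hl He.
  destruct (npw_small (Re s - 1) ltac:(lra) (eps * (Re s - 1)) ltac:(apply Rmult_lt_0_compat; lra)) as [N0 [H1 H0]].
  exists N0. intros j Hj. eapply Rle_trans; [now apply euler_product|].
  apply Rmult_le_reg_r with (Re s - 1); [lra|]. unfold Rdiv. rewrite Rmult_assoc, Rinv_l, Rmult_1_r by lra. apply H0. lia.
Qed.

Theorem dirichlet_nonzero a s l : cmult a -> 1 < Re s -> dlim a s l -> l <> 0%C.
Proof.
  intros Ha Hs Hl E. destruct (euler_close a s l (1 / 2) Ha Hs Hl ltac:(lra)) as [j H].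
  specialize (H j (le_n j)). rewrite E in H.
  replace (0 * euler_partial a s j - 1)%C with (- (1))%C in H by ring. rewrite Cmod_m1 in H. lra.
Qed.

(** Square and use [1 + x <= exp x]. *)
Lemma Cmod_one_minus_le z : Cmod (1 - z)%C <= exp (- Re z + Cmod z ^ 2 / 2).
Proof.
  apply Rsqr_incr_0_var; [|left; apply exp_pos]. unfold Rsqr. rewrite <- exp_plus.
  replace (Cmod (1 - z)%C * Cmod (1 - z)%C) with (1 + (- 2 * Re z + Cmod z ^ 2)).
  - replace (- Re z + Cmod z ^ 2 / 2 + (- Re z + Cmod z ^ 2 / 2)) with (- 2 * Re z + Cmod z ^ 2) by field.
    apply exp_ineq1_le.
  - transitivity (Cmod (1 - z)%C ^ 2); [|ring]. rewrite !Cmod2_alt. destruct z. simpl. ring.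
Qed.

(** The inequality [3 + 4 Re u + Re (u^2) >= 0] for [|u| <= 1], exponentiated. The quadratic error terms are
    harmless because they are summable over the Euler factors. *)
Lemma local_341 (x : R) (u : C) : 0 <= x -> Cmod u <= 1 ->
  Cmod (1 - x)%C ^ 3 * Cmod (1 - x * u)%C ^ 4 * Cmod (1 - x * (u * u))%C <= exp (4 * x ^ 2).
Proof.
  intros Hx Hu.
  pose proof (Cmod_one_minus_le (RtoC x)) as H0. pose proof (Cmod_one_minus_le (x * u)%C) as H1.
  pose proof (Cmod_one_minus_le (x * (u * u))%C) as H2.
  rewrite !Cmod_mult, Cmod_R, Rabs_pos_eq in * by assumption.
  set (r := Cmod u) in *. pose proof (Cmod_ge_0 u) as Pr. fold r in Pr.
  pose proof (Cmod2_alt u) as E. fold r in E. destruct u as [a b]. simpl Re in *. simpl Im in *.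
  eapply Rle_trans.
  { apply Rmult_le_compat; [| |apply Rmult_le_compat| exact H2].
    - apply Rmult_le_pos; apply pow_le, Cmod_ge_0.
    - apply Cmod_ge_0.
    - apply pow_le, Cmod_ge_0.
    - apply pow_le, Cmod_ge_0.
    - apply pow_incr; split; [apply Cmod_ge_0|exact H0].
    - apply pow_incr; split; [apply Cmod_ge_0|exact H1]. }
  assert (Ep : forall n y, exp y ^ n = exp (INR n * y)).
  { intros n y. induction n as [|n IH]; [simpl; now rewrite Rmult_0_l, exp_0|]. rewrite S_INR. simpl (exp y ^ S n). rewrite IH, <- exp_plus. f_equal. ring. }
  rewrite !Ep, <- !exp_plus. simpl INR.
  match goal with |- exp ?y <= _ => assert (Y : y <= 4 * x ^ 2) end.
  { assert (r ^ 2 <= 1) by nra. assert (r ^ 4 <= 1) by (replace (r ^ 4) with (r ^ 2 * r ^ 2) by ring; nra).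
    assert (K : 0 <= 3 + 4 * a + (a * a - b * b)) by nra.
    assert (x * (3 + 4 * a + (a * a - b * b)) >= 0) by nra.
    assert ((x * r) ^ 2 <= x ^ 2) by (replace ((x * r) ^ 2) with (x ^ 2 * r ^ 2) by ring; nra).
    assert ((x * (r * r)) ^ 2 <= x ^ 2) by (replace ((x * (r * r)) ^ 2) with (x ^ 2 * r ^ 4) by ring; nra).
    nra. }
  destruct Y as [Y| ->]; [left; now apply exp_increasing|lra].
Qed.

Lemma ncp_shift n (sg g : R) : nat_cpow_opp n (sg, g) = (npw n sg * nat_cpow_opp n (0, g)%R)%C.
Proof.
  rewrite !ncp_Cexp. unfold npw. rewrite <- Cexp_real, <- Cexp_plus. f_equal. apply Ceq_re_im; simpl; ring.
Qed.

Lemma inv_sq_sum j : rsum (fun i => npw (S (S i)) 2) j <= 1.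
Proof.
  pose proof (npw_tail_bound 1 1 j ltac:(lia) ltac:(lra)) as H. rewrite npw_1 in H.
  replace (1 + 1) with 2 in H by ring. simpl Nat.add in H. lra.
Qed.

Lemma prod341_nonneg (a b c : R) : 0 <= a -> 0 <= b -> 0 <= c -> 0 <= a ^ 3 * b ^ 4 * c.
Proof. intros. apply Rmult_le_pos; [|assumption]. apply Rmult_le_pos; apply pow_le; assumption. Qed.

(** The finite Euler products for the three series are compared factor by factor, then the products are
    replaced by the limits at the cost of a factor 2 for each. *)
Theorem three_four_one a (sg g : R) l0 l1 l2 : cmult a -> 1 < sg ->
  dlim (fun _ => 1%C) (sg, 0) l0 -> dlim a (sg, g) l1 -> dlim (fun n => a n * a n)%C (sg, 2 * g) l2 ->
  exp (-4) / 2 ^ 8 <= Cmod l0 ^ 3 * Cmod l1 ^ 4 * Cmod l2.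
Proof.
  intros Ha Hs H0 H1 H2.
  assert (C0 : cmult (fun _ => 1%C)).
  { split; [intros; ring|]. split; [reflexivity|]. intros; rewrite Cmod_1; lra. }
  assert (C2 : cmult (fun n => a n * a n)%C).
  { destruct Ha as [Q1 [Q2 Q3]]. split; [intros; rewrite Q1; ring|]. split; [rewrite Q2; ring|].
    intros n. rewrite Cmod_mult. specialize (Q3 n). pose proof (Cmod_ge_0 (a n)). nra. }
  destruct (euler_close _ (sg, 0) _ (1 / 2) C0 Hs H0 ltac:(lra)) as [j0 J0].
  destruct (euler_close _ (sg, g) _ (1 / 2) Ha Hs H1 ltac:(lra)) as [j1 J1].
  destruct (euler_close _ (sg, 2 * g) _ (1 / 2) C2 Hs H2 ltac:(lra)) as [j2 J2].
  set (j := (j0 + j1 + j2)%nat).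
  specialize (J0 j ltac:(unfold j; lia)). specialize (J1 j ltac:(unfold j; lia)). specialize (J2 j ltac:(unfold j; lia)).
  set (E0 := euler_partial (fun _ => 1%C) (sg, 0) j) in *. set (E1 := euler_partial a (sg, g) j) in *.
  set (E2 := euler_partial (fun n => a n * a n)%C (sg, 2 * g) j) in *.
  assert (L : forall z, Cmod (z - 1)%C <= 1 / 2 -> 1 / 2 <= Cmod z).
  { intros z Hz. pose proof (Cmod_triangle_rev_sub 1 (1 - z)%C) as T. rewrite Cmod_1 in T.
    replace (1 - (1 - z))%C with z in T by ring. rewrite Cmod_minus_sym in Hz. lra. }
  apply L in J0, J1, J2. rewrite Cmod_mult in J0, J1, J2.
  assert (P : Cmod E0 ^ 3 * Cmod E1 ^ 4 * Cmod E2 <= exp 4).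
  { assert (X : forall i, Cmod (euler_partial (fun _ => 1%C) (sg, 0) i) ^ 3 * Cmod (euler_partial a (sg, g) i) ^ 4 * Cmod (euler_partial (fun n => a n * a n)%C (sg, 2 * g) i)
        <= exp (4 * rsum (fun i => npw (S (S i)) 2) i)).
    { induction i as [|i IH].
      - simpl. rewrite !Cmod_1, Rmult_0_r, exp_0. lra.
      - simpl euler_partial. rewrite !Cmod_mult. simpl rsum. rewrite Rmult_plus_distr_l, exp_plus.
        set (n := S (S i)) in *.
        set (x := if Nat.eqb (Nat.gcd n (fact (S i))) 1 then npw n sg else 0).
        set (u := (a n * nat_cpow_opp n (0, g)%R)%C).
        assert (Hx : 0 <= x <= npw n 1).
        { unfold x. pose proof (npw_pos n sg). pose proof (npw_antimono n 1 sg ltac:(unfold n; lia) ltac:(lra)). pose proof (npw_pos n 1). destruct (Nat.eqb _ _); lra. }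
        assert (Hu : Cmod u <= 1).
        { unfold u. rewrite Cmod_mult, Cmod_ncp. simpl Re. unfold npw. rewrite Ropp_0, Rmult_0_l, exp_0, Rmult_1_r. apply Ha. }
        assert (F0 : euler_factor (fun _ => 1%C) (sg, 0) i = RtoC x).
        { unfold euler_factor, sifted, x. fold n. destruct (Nat.eqb _ _); [|ring].
          rewrite ncp_shift.
          assert (Q : nat_cpow_opp n (0, 0) = 1%C).
          { rewrite ncp_Cexp, <- Cexp_0. f_equal. apply Ceq_re_im; simpl; ring. }
          rewrite Q. ring. }
        assert (F1 : euler_factor a (sg, g) i = (x * u)%C).
        { unfold euler_factor, sifted, x, u. fold n. destruct (Nat.eqb _ _); [|ring]. rewrite ncp_shift. ring. }
        assert (F2 : euler_factor (fun n => a n * a n)%C (sg, 2 * g) i = (x * (u * u))%C).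
        { unfold euler_factor, sifted, x, u. fold n. destruct (Nat.eqb _ _); [|ring]. rewrite ncp_shift.
          assert (Q : nat_cpow_opp n (0, 2 * g) = (nat_cpow_opp n (0, g) * nat_cpow_opp n (0, g))%C).
          { rewrite !ncp_Cexp, <- Cexp_plus. f_equal. apply Ceq_re_im; simpl; ring. }
          rewrite Q. ring. }
        rewrite F0, F1, F2.
        pose proof (local_341 x u (proj1 Hx) Hu) as Lc.
        assert (Lc2 : exp (4 * x ^ 2) <= exp (4 * npw n 2)).
        { assert (x ^ 2 <= npw n 2).
          { replace 2 with (1 + 1) by ring. rewrite npw_plus. simpl. nra. }
          destruct (Req_dec (4 * x ^ 2) (4 * npw n 2)) as [->|N]; [lra|]. left. apply exp_increasing. lra. }
        match goal with |- ?l <= _ => replace l with ((Cmod (euler_partial (fun _ => 1%C) (sg, 0) i) ^ 3 * Cmod (euler_partial a (sg, g) i) ^ 4 * Cmod (euler_partial (fun n => a n * a n)%C (sg, 2 * g) i)) * (Cmod (1 - x)%C ^ 3 * Cmod (1 - x * u)%C ^ 4 * Cmod (1 - x * (u * u))%C)) by ring end.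
        apply Rmult_le_compat.
        + apply prod341_nonneg; apply Cmod_ge_0.
        + apply prod341_nonneg; apply Cmod_ge_0.
        + exact IH.
        + lra. }
    eapply Rle_trans; [apply X|]. pose proof (inv_sq_sum j).
    destruct (Req_dec (4 * rsum (fun i => npw (S (S i)) 2) j) 4) as [->|N]; [lra|]. left. apply exp_increasing. lra. }
  assert (Q : (1 / 2) ^ 3 * (1 / 2) ^ 4 * (1 / 2) <= (Cmod l0 * Cmod E0) ^ 3 * (Cmod l1 * Cmod E1) ^ 4 * (Cmod l2 * Cmod E2)).
  { apply Rmult_le_compat; [nra|lra| |assumption]. apply Rmult_le_compat; try (apply pow_le; lra); apply pow_incr; lra. }
  replace ((Cmod l0 * Cmod E0) ^ 3 * (Cmod l1 * Cmod E1) ^ 4 * (Cmod l2 * Cmod E2)) with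
    ((Cmod l0 ^ 3 * Cmod l1 ^ 4 * Cmod l2) * (Cmod E0 ^ 3 * Cmod E1 ^ 4 * Cmod E2)) in Q by ring.
  set (A := Cmod l0 ^ 3 * Cmod l1 ^ 4 * Cmod l2) in *.
  assert (PA : 0 <= A) by (apply prod341_nonneg; apply Cmod_ge_0).
  assert (Q2 : (1 / 2) ^ 8 <= A * exp 4) by nra.
  apply Rmult_le_reg_r with (exp 4); [apply exp_pos|].
  replace (exp (-4) / 2 ^ 8 * exp 4) with ((exp (-4) * exp 4) / 2 ^ 8) by field.
  rewrite <- exp_plus. replace (-4 + 4) with 0 by ring. rewrite exp_0. lra.
Qed.

(** * Abel summation and Dirichlet characters *)

(** From the fundamental theorem of calculus, along a real segment. *)
Lemma mean_value_ineq (F F' : C -> C) (a b M : R) : a <= b ->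
  (forall t, a <= t <= b -> cder F (RtoC t) (F' (RtoC t))) ->
  (forall t, a <= t <= b -> ccont F' (RtoC t)) ->
  (forall t, a <= t <= b -> Cmod (F' (RtoC t)) <= M) -> Cmod (F (RtoC b) - F (RtoC a))%C <= M * (b - a).
Proof.
  intros Hab HF Hc HM.
  assert (P : pcont_on (fun t => F' (t, 0)) a b).
  { intros t Ht. apply (pcont_comp F' (fun t => (t, 0))); [apply pcont_h|]. now apply Hc. }
  pose proof (FTC_h F F' a b 0 Hab HF P) as E.
  unfold RtoC. rewrite <- E. now apply cint_bound.
Qed.

Lemma cder_expmul (s : C) z : cder (fun w => Cexp (s * w))%C z (s * Cexp (s * z))%C.
Proof.
  eapply cder_eq; [apply (cder_comp Cexp (fun z => s * z)%C); [apply cder_scal, cder_id|apply cder_Cexp]|]. ring.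
Qed.

Lemma ncp_Cexp_opp n s : nat_cpow_opp n s = Cexp (- s * ln (INR n))%C.
Proof. rewrite ncp_Cexp. f_equal. ring. Qed.

Lemma ln_step n : (1 <= n)%nat -> ln (INR n) <= ln (INR (S n)) <= ln (INR n) + / INR n.
Proof.
  intros Hn. pose proof (INR_ge1 n Hn). split.
  - left. apply ln_increasing; rewrite ?S_INR; lra.
  - replace (INR (S n)) with (INR n * (1 + / INR n)) by (rewrite S_INR; field; lra).
    assert (0 < / INR n) by (apply Rinv_0_lt_compat; lra).
    rewrite ln_mult by lra. apply Rplus_le_compat_l.
    rewrite <- (ln_exp (/ INR n)) at 2.
    pose proof (exp_ineq1_le (/ INR n)) as X. destruct X as [X|X]; [left; apply ln_increasing; lra|rewrite X; lra].
Qed.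

Lemma ncp_variation n s t : (1 <= n)%nat -> 0 <= Re s -> ln (INR n) <= t <= ln (INR (S n)) ->
  Cmod (Cexp (- s * t) - nat_cpow_opp n s)%C <= Cmod s * npw n (1 + Re s).
Proof.
  intros Hn Hs Ht. rewrite ncp_Cexp_opp.
  pose proof (mean_value_ineq (fun w => Cexp (- s * w))%C (fun w => - s * Cexp (- s * w))%C (ln (INR n)) t (Cmod s * npw n (Re s))) as X.
  cbv beta in X. eapply Rle_trans; [apply X|].
  - lra.
  - intros u _. apply cder_expmul.
  - intros u _. apply ccont_mult; [apply ccont_const|]. eapply cder_ccont, cder_expmul.
  - intros u Hu. rewrite Cmod_mult, Cmod_opp, Cmod_Cexp. apply Rmult_le_compat_l; [apply Cmod_ge_0|].
    unfold npw. destruct s as [sg g]. simpl in *.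
    replace (- sg * u - - g * 0) with (- sg * u) by ring.
    destruct (Req_dec (- sg * u) (- sg * ln (INR n))) as [->|N]; [lra|]. left. apply exp_increasing.
    change (match n with 0%nat => 1 | S _ => INR n + 1 end) with (INR (S n)) in *. nra.
  - rewrite Rmult_assoc. apply Rmult_le_compat_l; [apply Cmod_ge_0|].
    rewrite npw_plus, (Rmult_comm (npw n 1)). apply Rmult_le_compat_l; [left; apply npw_pos|].
    rewrite npw_one by assumption. pose proof (ln_step n Hn). lra.
Qed.

Lemma ncp_diff n s : (1 <= n)%nat -> 0 <= Re s ->
  Cmod (nat_cpow_opp n s - nat_cpow_opp (S n) s)%C <= Cmod s * npw n (1 + Re s).
Proof.
  intros Hn Hs. rewrite Cmod_minus_sym. rewrite (ncp_Cexp_opp (S n)). apply ncp_variation; try assumption.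
  pose proof (ln_step n Hn). lra.
Qed.

(** Summation by parts. For [a = chi] the bound holds to the left of the line [Re s = 1] as well, uniformly in
    the number of terms. *)
Lemma abel_bound (a : nat -> C) (s : C) (B : R) M : 0 <= B -> 0 < Re s ->
  (forall n, Cmod (csum (fun k => a (S k)) n) <= B) ->
  Cmod (dpart a s M) <= B * (1 + Cmod s * (1 + / Re s)).
Proof.
  intros HB Hs HS. set (T := csum (fun k => a (S k))) in *.
  assert (E : dpart a s M = (T M * nat_cpow_opp (S M) s + csum (fun k => T (S k) * (nat_cpow_opp (S k) s - nat_cpow_opp (S (S k)) s)) M)%C).
  { induction M as [|M IH]; [unfold dpart, T; simpl; ring|].
    change (dpart a s (S M)) with (dpart a s M + dterm a s M)%C. rewrite IH. simpl csum. unfold dterm.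
    change (T (S M)) with (T M + a (S M))%C. ring. }
  rewrite E. eapply Rle_trans; [apply Cmod_triangle|]. rewrite Rmult_plus_distr_l. apply Rplus_le_compat.
  - rewrite Cmod_mult, Cmod_ncp. pose proof (npw_le_1 (S M) (Re s) ltac:(lia) ltac:(lra)). pose proof (npw_pos (S M) (Re s)).
    specialize (HS M). pose proof (Cmod_ge_0 (T M)). nra.
  - eapply Rle_trans; [apply Cmod_csum|].
    eapply Rle_trans; [apply (rsum_le _ (fun k => (B * Cmod s) * npw (S k) (1 + Re s)))|].
    + intros k _. rewrite Cmod_mult, Rmult_assoc. apply Rmult_le_compat; try apply Cmod_ge_0; [apply HS|].
      apply ncp_diff; [lia|lra].
    + rewrite rsum_scal, Rmult_assoc. apply Rmult_le_compat_l; [assumption|]. apply Rmult_le_compat_l; [apply Cmod_ge_0|].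
      now apply npw_sum.
Qed.

(** Each term [n^{-s}] is compared with the increment of [n^{1-s} / (1-s)]. The mean value inequality is
    applied to the function [w |-> e^{(1-s) w} / (1-s) - n^{-s} e^w], whose derivative is [e^w (e^{- s w} -
    n^{-s})], between [ln n] and [ln (n+1)]. *)
Lemma zeta_partial_bound s M : 1 <= Re s -> s <> 1%C ->
  Cmod (dpart (fun _ => 1%C) s M) <= 2 / Cmod (1 - s)%C + 4 * Cmod s.
Proof.
  intros Hs N1.
  assert (Nz : (1 - s)%C <> 0%C) by (apply Cminus_neq; congruence).
  set (E := fun n => Cexp ((1 - s) * ln (INR n))%C).
  assert (ME : forall n, (1 <= n)%nat -> Cmod (E n) <= 1).
  { intros n Hn. unfold E. rewrite Cmod_Cexp. pose proof (ln_INR_nonneg n) as Ln.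
    replace (Re ((1 - s) * ln (INR n))%C) with ((1 - Re s) * ln (INR n)) by (destruct s; simpl; ring).
    apply Rle_trans with (exp 0); [|rewrite exp_0; lra]. assert (Y : (1 - Re s) * ln (INR n) <= 0) by nra.
    destruct Y as [Y| ->]; [left; now apply exp_increasing|lra]. }
  assert (St : forall n, (1 <= n)%nat -> Cmod (nat_cpow_opp n s - (E (S n) - E n) / (1 - s))%C <= 2 * Cmod s * npw n (1 + Re s)).
  { intros n Hn. pose proof (INR_ge1 n Hn) as In. pose proof (ln_step n Hn) as Ls.
    assert (X : Cmod ((Cexp ((1 - s) * ln (INR (S n))) / (1 - s) - nat_cpow_opp n s * Cexp (ln (INR (S n)))) -
                (Cexp ((1 - s) * ln (INR n)) / (1 - s) - nat_cpow_opp n s * Cexp (ln (INR n))))%C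
       <= (2 * INR n * (Cmod s * npw n (1 + Re s))) * (ln (INR (S n)) - ln (INR n))).
    { pose proof (mean_value_ineq (fun w => Cexp ((1 - s) * w) / (1 - s) - nat_cpow_opp n s * Cexp w)%C
         (fun w => Cexp w * (Cexp (- s * w) - nat_cpow_opp n s))%C (ln (INR n)) (ln (INR (S n))) (2 * INR n * (Cmod s * npw n (1 + Re s)))) as X.
      cbv beta in X. apply X.
      - lra.
      - intros u _. eapply cder_eq.
        + apply cder_minus; [|apply cder_scal, cder_Cexp].
          apply (cder_mult (fun w => Cexp ((1 - s) * w))%C (fun _ => / (1 - s))%C); [apply cder_expmul|apply cder_const].
        + cbv beta. replace ((1 - s) * u)%C with (u + - s * u)%C by ring. rewrite Cexp_plus. field. assumption.
      - intros u _. apply ccont_mult; [eapply cder_ccont, cder_Cexp|].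
        apply (ccont_plus (fun w => Cexp (- s * w))%C (fun _ => - nat_cpow_opp n s)%C); [eapply cder_ccont, cder_expmul|apply ccont_const].
      - intros u Hu. rewrite Cmod_mult. apply Rmult_le_compat; try apply Cmod_ge_0.
        + rewrite Cmod_Cexp. simpl Re. apply Rle_trans with (INR (S n)).
          * rewrite <- (exp_ln (INR (S n))) by (rewrite S_INR; lra).
            destruct (proj2 Hu) as [Y| ->]; [left; now apply exp_increasing|lra].
          * rewrite S_INR. lra.
        + apply ncp_variation; [assumption|lra|assumption]. }
    replace (nat_cpow_opp n s - (E (S n) - E n) / (1 - s))%C with
      (- ((Cexp ((1 - s) * ln (INR (S n))) / (1 - s) - nat_cpow_opp n s * Cexp (ln (INR (S n)))) -
                (Cexp ((1 - s) * ln (INR n)) / (1 - s) - nat_cpow_opp n s * Cexp (ln (INR n)))))%C.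
    - rewrite Cmod_opp. eapply Rle_trans; [exact X|].
      replace (2 * Cmod s * npw n (1 + Re s)) with ((2 * INR n * (Cmod s * npw n (1 + Re s))) * / INR n) by (field; lra).
      apply Rmult_le_compat_l; [|lra]. pose proof (Cmod_ge_0 s). pose proof (npw_pos n (1 + Re s)).
      apply Rmult_le_pos; [lra|]. apply Rmult_le_pos; lra.
    - unfold E. rewrite !Cexp_real, !exp_ln by (rewrite ?S_INR; lra). rewrite S_INR, RtoC_plus. field. assumption. }
  assert (Su : forall M, Cmod (dpart (fun _ => 1%C) s M - (E (S M) - E 1%nat) / (1 - s))%C <= 2 * Cmod s * rsum (fun k => npw (S k) (1 + Re s)) M).
  { induction M0 as [|M0 IH].
    - unfold dpart. simpl csum. replace (0 - (E 1%nat - E 1%nat) / (1 - s))%C with (RtoC 0) by (field; assumption). rewrite Cmod_0. simpl. lra.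
    - change (dpart (fun _ => 1%C) s (S M0)) with (dpart (fun _ => 1%C) s M0 + dterm (fun _ => 1%C) s M0)%C. unfold dterm.
      replace (dpart (fun _ : nat => 1) s M0 + 1 * nat_cpow_opp (S M0) s - (E (S (S M0)) - E 1%nat) / (1 - s))%C with
        ((dpart (fun _ : nat => 1) s M0 - (E (S M0) - E 1%nat) / (1 - s)) + (nat_cpow_opp (S M0) s - (E (S (S M0)) - E (S M0)) / (1 - s)))%C
        by (field; assumption).
      eapply Rle_trans; [apply Cmod_triangle|]. simpl rsum. specialize (St (S M0) ltac:(lia)). lra. }
  specialize (Su M).
  replace (dpart (fun _ => 1%C) s M) with ((E (S M) - E 1%nat) / (1 - s) + (dpart (fun _ => 1%C) s M - (E (S M) - E 1%nat) / (1 - s)))%C by ring.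
  eapply Rle_trans; [apply Cmod_triangle|]. apply Rplus_le_compat.
  - rewrite Cmod_div by assumption. apply Rmult_le_compat_r; [left; apply Rinv_0_lt_compat; now apply Cmod_gt_0|].
    eapply Rle_trans; [apply Cmod_triangle_sub|]. pose proof (ME (S M) ltac:(lia)). pose proof (ME 1%nat ltac:(lia)). lra.
  - eapply Rle_trans; [exact Su|]. pose proof (npw_sum (Re s) M ltac:(lra)).
    assert (/ Re s <= 1) by (rewrite <- Rinv_1; apply Rinv_le_contravar; lra). pose proof (Cmod_ge_0 s). nra.
Qed.

Section Periodic.
Variables (a : nat -> C) (q : nat).
Hypothesis (Hq : (1 <= q)%nat).
Hypothesis (Hper : forall n, a (n + q)%nat = a n).
Hypothesis (Hb : forall n, Cmod (a n) <= 1).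

Let T n := csum (fun k => a (S k)) n.

Lemma periodic_partial_shift n : T (n + q) = (T n + T q)%C.
Proof.
  induction n as [|n IH]; [unfold T at 2; simpl; ring|].
  change (T (S n + q)) with (T (n + q) + a (S (n + q)))%C. rewrite IH.
  change (T (S n)) with (T n + a (S n))%C. replace (S (n + q)) with (S n + q)%nat by lia. rewrite Hper. ring.
Qed.

Lemma partial_trivial n : Cmod (T n) <= INR n.
Proof.
  induction n as [|n IH]; [unfold T; simpl; rewrite Cmod_0; lra|].
  change (T (S n)) with (T n + a (S n))%C. rewrite S_INR. eapply Rle_trans; [apply Cmod_triangle|]. specialize (Hb (S n)). lra.
Qed.

Lemma periodic_partial_dev n : Cmod (T n - INR n * (T q / INR q))%C <= 2 * INR q.
Proof.
  assert (Iq : 1 <= INR q) by now apply INR_ge1.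
  assert (Nq : RtoC (INR q) <> 0%C) by (apply RtoC_neq; lra).
  induction n as [n IH] using (well_founded_induction Nat.lt_wf_0).
  destruct (Nat.lt_ge_cases n q) as [H|H].
  - eapply Rle_trans; [apply Cmod_triangle_sub|]. rewrite Cmod_mult, Cmod_div by assumption.
    rewrite !Cmod_R, !Rabs_pos_eq by apply pos_INR. pose proof (partial_trivial n). pose proof (partial_trivial q).
    apply lt_INR in H. pose proof (pos_INR n).
    assert (Cmod (T q) / INR q <= 1).
    { apply Rmult_le_reg_r with (INR q); [lra|]. unfold Rdiv. rewrite Rmult_assoc, Rinv_l; lra. }
    assert (0 <= Cmod (T q) / INR q) by (apply Rmult_le_pos; [apply Cmod_ge_0|left; apply Rinv_0_lt_compat; lra]).
    nra.
  - replace n with (n - q + q)%nat by lia. rewrite periodic_partial_shift, plus_INR, RtoC_plus.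
    replace (T (n - q) + T q - (INR (n - q) + INR q) * (T q / INR q))%C with (T (n - q) - INR (n - q) * (T q / INR q))%C by (field; assumption).
    apply IH. lia.
Qed.

Lemma periodic_partial_bound n : T q = 0%C -> Cmod (T n) <= INR q.
Proof.
  intros HT. induction n as [n IH] using (well_founded_induction Nat.lt_wf_0).
  destruct (Nat.lt_ge_cases n q) as [H|H].
  - eapply Rle_trans; [apply partial_trivial|]. apply le_INR. lia.
  - replace n with (n - q + q)%nat by lia. rewrite periodic_partial_shift, HT, Cplus_0_r. apply IH. lia.
Qed.

(** Subtract the mean value [m] of the coefficients: the remaining partial sums are bounded, and the constant
    part is a partial sum of zeta. It applies to the square of a character, which may be principal. *)
Lemma periodic_dpart_bound s M : 1 <= Re s -> s <> 1%C ->
  Cmod (dpart a s M) <= 2 * INR q * (1 + 2 * Cmod s) + (2 / Cmod (1 - s)%C + 4 * Cmod s).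
Proof.
  intros Hs Ns. set (m := (T q / INR q)%C).
  assert (Iq : 1 <= INR q) by now apply INR_ge1.
  assert (Nq : RtoC (INR q) <> 0%C) by (apply RtoC_neq; lra).
  assert (Mm : Cmod m <= 1).
  { unfold m. rewrite Cmod_div, Cmod_R, Rabs_pos_eq by (assumption || lra). pose proof (partial_trivial q).
    apply Rmult_le_reg_r with (INR q); [lra|]. unfold Rdiv. rewrite Rmult_assoc, Rinv_l; lra. }
  assert (E : dpart a s M = (dpart (fun n => a n - m) s M + m * dpart (fun _ => 1) s M)%C).
  { unfold dpart. rewrite <- csum_scal, <- csum_plus. apply csum_ext. intros k _. unfold dterm. ring. }
  rewrite E. eapply Rle_trans; [apply Cmod_triangle|]. apply Rplus_le_compat.
  - eapply Rle_trans; [apply (abel_bound _ _ (2 * INR q)); [lra|lra|]|].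
    + intros n. replace (csum (fun k => a (S k) - m)%C n) with (T n - INR n * m)%C; [apply periodic_partial_dev|].
      induction n as [|n IH]; [unfold T; simpl; ring|]. simpl csum. rewrite <- IH, S_INR, RtoC_plus.
      change (T (S n)) with (T n + a (S n))%C. ring.
    + apply Rmult_le_compat_l; [lra|]. assert (/ Re s <= 1) by (rewrite <- Rinv_1; apply Rinv_le_contravar; lra). pose proof (Cmod_ge_0 s). nra.
  - rewrite Cmod_mult. pose proof (zeta_partial_bound s M Hs Ns). pose proof (Cmod_ge_0 (dpart (fun _ => 1%C) s M)). pose proof (Cmod_ge_0 m). nra.
Qed.
End Periodic.

Lemma dlim_bound a s l B : dlim a s l -> (forall M, Cmod (dpart a s M) <= B) -> Cmod l <= B.
Proof.
  intros Hl HB. apply le_epsilon. intros eps He. destruct (Hl eps He) as [N HN]. specialize (HN N (le_n N)). specialize (HB N).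
  rewrite Cmod_minus_sym in HN. replace l with (dpart a s N + (l - dpart a s N))%C by ring.
  eapply Rle_trans; [apply Cmod_triangle|]. lra.
Qed.

Section Character.
Variables (q : nat) (chi : nat -> C).
Hypothesis (Hchi : is_dirichlet_character q chi).

Lemma dchar_mod n : chi (n mod q)%nat = chi n.
Proof.
  assert (X : forall k m, chi (m + q * k)%nat = chi m).
  { induction k as [|k IH]; intros m; [f_equal; lia|]. replace (m + q * S k)%nat with ((m + q * k) + q)%nat by lia.
    rewrite (dchar_periodic _ _ Hchi). apply IH. }
  rewrite (Nat.div_mod_eq n q) at 2. rewrite Nat.add_comm. symmetry. apply X.
Qed.

Lemma dchar_1 : chi 1%nat = 1%C.
Proof.
  assert (N : chi 1%nat <> 0%C).
  { apply (dchar_support _ _ Hchi). apply Nat.divide_1_r, Nat.gcd_divide_l. }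
  pose proof (dchar_mult _ _ Hchi 1 1) as E. simpl in E.
  replace (chi 1%nat) with (chi 1%nat * chi 1%nat / chi 1%nat)%C by (field; assumption). rewrite <- E. field. assumption.
Qed.

(** If [|chi n| > 1] then the powers of [n] contradict the boundedness of the periodic function [chi]. *)
Lemma dchar_le_1 n : Cmod (chi n) <= 1.
Proof.
  pose proof (dchar_modulus_pos _ _ Hchi) as Hq.
  set (B := rsum (fun k => Cmod (chi k)) q).
  assert (HB : forall m, Cmod (chi m) <= B).
  { intros m. rewrite <- dchar_mod. apply (rsum_term_le (fun k => Cmod (chi k)) q (m mod q)).
    - apply Nat.mod_upper_bound. lia.
    - intros; apply Cmod_ge_0. }
  assert (P : forall k, Cmod (chi n) ^ k <= B).
  { intros k. replace (Cmod (chi n) ^ k) with (Cmod (chi (Nat.pow n k))); [apply HB|].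
    induction k as [|k IH]; [simpl; rewrite dchar_1; apply Cmod_1|]. simpl. rewrite (dchar_mult _ _ Hchi), Cmod_mult, IH. reflexivity. }
  destruct (Rle_dec (Cmod (chi n)) 1) as [|N]; [assumption|exfalso].
  set (x := Cmod (chi n)) in *.
  assert (X : 1 <= 0); [|lra].
  apply (geom_small (/ x) B).
  - split; [left; apply Rinv_0_lt_compat; lra|]. rewrite <- Rinv_1. apply Rinv_lt_contravar; lra.
  - intros k. specialize (P k). assert (0 < x ^ k) by (apply pow_lt; lra). rewrite pow_inv.
    apply Rmult_le_reg_r with (x ^ k); [assumption|]. rewrite Rmult_assoc, Rinv_l; lra.
Qed.

Lemma dchar_cmult : cmult chi.
Proof. split; [apply (dchar_mult _ _ Hchi)|]. split; [apply dchar_1|apply dchar_le_1]. Qed.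

(** Sums over lists of integers are invariant under permutation; used for the residues modulo [q]. *)
Fixpoint nlsum (f : nat -> C) (l : list nat) : C := match l with nil => 0%C | x :: l => (f x + nlsum f l)%C end.

Lemma nlsum_perm f l l' : Permutation l l' -> nlsum f l = nlsum f l'.
Proof. induction 1; simpl; try congruence; ring. Qed.

Lemma nlsum_seq f n m : nlsum f (seq m n) = csum (fun k => f (m + k)%nat) n.
Proof.
  revert m. induction n as [|n IH]; intros m; [reflexivity|].
  change (seq m (S n)) with (m :: seq (S m) n). simpl nlsum. rewrite IH. clear IH.
  change (S n) with (1 + n)%nat. rewrite csum_split. simpl csum at 2. rewrite Cplus_0_l, Nat.add_0_r. f_equal.
  apply csum_ext. intros k _. f_equal. lia.
Qed.

(** Multiplication by a residue [a] with [chi a <> 1] permutes the residues, so that the sum equals [chi a]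
    times itself. *)
Lemma dchar_sum_zero : ~ is_principal q chi -> csum (fun k => chi (S k)) q = 0%C.
Proof.
  intros Hnp. pose proof (dchar_modulus_pos _ _ Hchi) as Hq.
  destruct (not_all_ex_not _ _ Hnp) as [a Ha]. apply imply_to_and in Ha as [Hg Ha].
  set (g := fun n => (a * n mod q)%nat).
  assert (NDg : NoDup (map g (seq 0 q))).
  { apply Injective_map_NoDup_in; [|apply seq_NoDup].
    assert (X : forall x y, (x <= y)%nat -> (y < q)%nat -> g x = g y -> x = y).
    { intros x y Hxy Hy E. unfold g in E.
      assert (D : Nat.divide q (a * (y - x))).
      { exists (a * y / q - a * x / q)%nat.
        pose proof (Nat.div_mod_eq (a * x) q). pose proof (Nat.div_mod_eq (a * y) q).
        rewrite Nat.mul_sub_distr_r, Nat.mul_sub_distr_l. nia. }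
      apply Nat.gauss in D; [|now rewrite Nat.gcd_comm].
      destruct (Nat.eq_dec (y - x) 0) as [|N]; [lia|]. apply Nat.divide_pos_le in D; lia. }
    intros x y Hx Hy E. apply in_seq in Hx, Hy. destruct (Nat.le_ge_cases x y); [apply X|symmetry; apply X]; try lia; auto. }
  assert (Pm : Permutation (map g (seq 0 q)) (seq 0 q)).
  { apply NoDup_Permutation_bis; [assumption|rewrite length_map; lia|].
    intros x Hx. apply in_map_iff in Hx as [n [<- _]]. apply in_seq. unfold g. pose proof (Nat.mod_upper_bound (a * n) q ltac:(lia)). lia. }
  assert (E1 : nlsum chi (seq 0 q) = (chi a * nlsum chi (seq 0 q))%C).
  { rewrite <- (nlsum_perm _ _ _ Pm) at 1. generalize (seq 0 q). induction l as [|x l IH]; simpl; [ring|].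
    rewrite IH. unfold g at 1. rewrite dchar_mod, (dchar_mult _ _ Hchi). ring. }
  assert (E2 : csum (fun k => chi (S k)) q = nlsum chi (seq 0 q)).
  { rewrite nlsum_seq. destruct q as [|q']; [lia|].
    change (csum (fun k => chi (S k)) q' + chi (S q') = csum (fun k => chi (0 + k)%nat) (1 + q'))%C.
    rewrite csum_split. simpl csum at 2. pose proof (dchar_periodic _ _ Hchi 0) as P. simpl in P. rewrite P. simpl. ring. }
  rewrite E2. set (t := nlsum chi (seq 0 q)) in *.
  assert (Z : ((chi a - 1) * t)%C = 0%C) by (replace ((chi a - 1) * t)%C with (chi a * t - t)%C by ring; rewrite <- E1; ring).
  destruct (Ceq_dec t 0%C) as [|N]; [assumption|]. exfalso. revert Z. apply Cmult_neq_0; [|assumption]. now apply Cminus_neq.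
Qed.
End Character.

(** * The L-function on and to the right of the line Re s = 1 *)

Section Lfunction.
Variables (q : nat) (chi : nat -> C) (L : C -> C).
Hypothesis (Hchi : is_dirichlet_character q chi).
Hypothesis (HL : forall z, holo L z).
Hypothesis (Hser : forall s, 1 < Re s -> dlim chi s (L s)).

(** If [L] vanished at [1 + i g], then at [1 + eta + i g] it would be [O(eta)], the zeta factor would be [O(1
    / eta)], and the factor at [1 + eta + 2 i g] would be bounded since [g <> 0]. The product of the 3-4-1
    inequality would be [O(eta)]. *)
Lemma line_one_nonzero (g : R) : g <> 0 -> L (1, g) <> 0%C.
Proof.
  intros Hg Z. pose proof (dchar_modulus_pos _ _ Hchi) as Hq. pose proof (INR_ge1 q Hq) as Iq.
  destruct (HL (1, g)) as [l Hl]. destruct (Hl 1 ltac:(lra)) as [d [Hd Hb]].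
  set (C1 := Cmod l + 1). assert (HC1 : 1 <= C1) by (unfold C1; pose proof (Cmod_ge_0 l); lra).
  set (S := 2 + 2 * Rabs g). pose proof (Rabs_pos_lt g Hg) as Pg.
  set (C2 := 2 * INR q * (1 + 2 * S) + (/ Rabs g + 4 * S)).
  assert (HC2 : 0 < C2).
  { unfold C2, S. assert (0 < / Rabs g) by now apply Rinv_0_lt_compat. nra. }
  set (c := exp (-4) / 2 ^ 8). assert (Hc : 0 < c) by (unfold c; apply Rdiv_lt_0_compat; [apply exp_pos|lra]).
  set (Q := 8 * C1 ^ 4 * C2).
  assert (HQ : 0 < Q) by (unfold Q; apply Rmult_lt_0_compat; [apply Rmult_lt_0_compat; [lra|apply pow_lt; lra]|assumption]).
  set (eta := Rmin (Rmin (d / 2) 1) (c / (2 * Q))).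
  assert (He : 0 < eta) by (unfold eta; repeat apply Rmin_glb_lt; try lra; apply Rdiv_lt_0_compat; lra).
  assert (He1 : eta <= d / 2) by (unfold eta; eapply Rle_trans; [apply Rmin_l|apply Rmin_l]).
  assert (He2 : eta <= 1) by (unfold eta; eapply Rle_trans; [apply Rmin_l|apply Rmin_r]).
  assert (He3 : eta <= c / (2 * Q)) by (unfold eta; apply Rmin_r).
  destruct (dlim_exists (fun _ => 1%C) (1 + eta, 0)) as [l0 H0]; [intros; rewrite Cmod_1; lra|simpl; lra|].
  destruct (dlim_exists (fun n => chi n * chi n)%C (1 + eta, 2 * g)) as [l2 H2]; [|simpl; lra|].
  { intros n. rewrite Cmod_mult. pose proof (dchar_le_1 q chi Hchi n). pose proof (Cmod_ge_0 (chi n)). nra. }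
  pose proof (three_four_one chi (1 + eta) g l0 (L (1 + eta, g)) l2 (dchar_cmult q chi Hchi) ltac:(lra) H0 (Hser (1 + eta, g) ltac:(simpl; lra)) H2) as T.
  fold c in T.
  assert (B0 : Cmod l0 <= 2 / eta).
  { apply (dlim_bound _ _ _ _ H0). intros M. unfold dpart. eapply Rle_trans; [apply Cmod_csum|].
    apply Rle_trans with (1 + / eta).
    - eapply Rle_trans; [|apply (npw_sum eta M He)]. right. apply rsum_ext. intros k _. unfold dterm.
      rewrite Cmult_1_l, Cmod_ncp. reflexivity.
    - assert (1 <= / eta) by (rewrite <- Rinv_1; apply Rinv_le_contravar; lra). unfold Rdiv. lra. }
  assert (B1 : Cmod (L (1 + eta, g)) <= C1 * eta).
  { specialize (Hb (RtoC eta)). rewrite Cmod_R, Rabs_pos_eq in Hb by lra. specialize (Hb ltac:(lra)).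
    replace ((1, g) + eta)%C with ((1 + eta)%R, g) in Hb by (apply Ceq_re_im; simpl; ring). rewrite Z in Hb.
    replace (L ((1 + eta)%R, g)) with ((L ((1 + eta)%R, g) - 0 - l * eta) + l * eta)%C by ring.
    eapply Rle_trans; [apply Cmod_triangle|]. rewrite Cmod_mult, Cmod_R, Rabs_pos_eq by lra. unfold C1. lra. }
  assert (B2 : Cmod l2 <= C2).
  { apply (dlim_bound _ _ _ _ H2). intros M.
    eapply Rle_trans; [apply (periodic_dpart_bound _ q Hq)|].
    - intros n. now rewrite (dchar_periodic _ _ Hchi).
    - intros n. rewrite Cmod_mult. pose proof (dchar_le_1 q chi Hchi n). pose proof (Cmod_ge_0 (chi n)). nra.
    - simpl. lra.
    - intros E. injection E. intros. lra.
    - set (s := (1 + eta, 2 * g)).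
      assert (Ms : Cmod s <= S).
      { eapply Rle_trans; [apply Cmod_le_abs|]. unfold s, S. simpl. rewrite Rabs_pos_eq, Rabs_mult, (Rabs_pos_eq 2) by lra. lra. }
      assert (M1 : 2 / Cmod (1 - s)%C <= / Rabs g).
      { assert (X : 2 * Rabs g <= Cmod (1 - s)%C).
        { eapply Rle_trans; [|apply im_le_Cmod]. unfold s. simpl. replace (0 + - (2 * g)) with (- (2 * g)) by ring.
          rewrite Rabs_Ropp, Rabs_mult, (Rabs_pos_eq 2) by lra. lra. }
        apply Rle_trans with (2 / (2 * Rabs g)); [|right; field; lra].
        apply Rmult_le_compat_l; [lra|]. apply Rinv_le_contravar; lra. }
      unfold C2. nra. }
  assert (F : Cmod l0 ^ 3 * Cmod (L (1 + eta, g)) ^ 4 * Cmod l2 <= (2 / eta) ^ 3 * (C1 * eta) ^ 4 * C2).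
  { apply Rmult_le_compat; [|apply Cmod_ge_0| |assumption].
    - apply Rmult_le_pos; apply pow_le, Cmod_ge_0.
    - apply Rmult_le_compat; try (apply pow_le, Cmod_ge_0); apply pow_incr; split; try apply Cmod_ge_0; assumption. }
  replace ((2 / eta) ^ 3 * (C1 * eta) ^ 4 * C2) with (Q * eta) in F by (unfold Q; field; lra).
  assert (Q * eta <= c / 2).
  { apply Rle_trans with (Q * (c / (2 * Q))); [apply Rmult_le_compat_l; lra|right; field; lra]. }
  lra.
Qed.

Lemma L_right_bound s : 3 <= Re s -> 1 / 2 <= Cmod (L s).
Proof.
  intros Hs. pose proof (dlim_tail chi s (L s) 1 (dchar_le_1 q chi Hchi) ltac:(lia) ltac:(lra) (Hser s ltac:(lra))) as T.
  unfold dpart, dterm in T. simpl csum in T. rewrite ncp_1, (dchar_1 q chi Hchi) in T.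
  replace (0 + 1 * 1)%C with (RtoC 1) in T by ring. rewrite npw_1 in T.
  assert (/ (Re s - 1) <= / 2) by (apply Rinv_le_contravar; lra).
  pose proof (Cmod_triangle_rev 1 (L s - 1)%C) as X. rewrite Cmod_1 in X.
  replace (1 + (L s - 1))%C with (L s) in X by ring. unfold Rdiv in T. lra.
Qed.

Lemma holo_ncp n s : holo (fun s => nat_cpow_opp n s) s.
Proof.
  apply (holo_ext (fun s => Cexp (- ln (INR n) * s))%C); [intros; symmetry; apply ncp_Cexp|].
  eexists. apply cder_expmul.
Qed.

Lemma holo_csum (f : nat -> C -> C) n z : (forall k, holo (f k) z) -> holo (fun z => csum (fun k => f k z) n) z.
Proof.
  intros H. induction n as [|n IH]; [apply (holo_const 0%C)|]. simpl. apply holo_plus; [assumption|apply H].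
Qed.

Lemma holo_dpart a N s : holo (fun s => dpart a s N) s.
Proof. apply (holo_csum (fun k s => dterm a s k)). intros k. apply holo_mult; [apply holo_const|apply holo_ncp]. Qed.

Lemma holo_shift (f : C -> C) c z : holo f (c + z)%C -> holo (fun z => f (c + z)%C) z.
Proof. intros [l Hl]. exists l. now apply cder_shift. Qed.
End Lfunction.

(** * Transfer of bounds and the convolution identity *)

(** Uniform approximation on the unit circle only is enough: it determines the Taylor coefficients of [f], and
    Cauchy's inequality for the approximants on the large circle bounds them. This transports bounds for
    partial sums of a Dirichlet series to the analytic continuation, beyond the half-plane of convergence. *)
Lemma limit_bound_disc (f : C -> C) (fn : nat -> C -> C) (R0 B : R) : 1 < R0 -> 0 <= B ->
  (forall z, holo f z) -> (forall n z, holo (fn n) z) ->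
  (forall eps, 0 < eps -> exists n, forall z, Cmod z = 1 -> Cmod (f z - fn n z)%C <= eps) ->
  (forall n z, Cmod z = R0 -> Cmod (fn n z) <= B) ->
  forall w, Cmod w < R0 -> Cmod (f w) <= B * (R0 / (R0 - Cmod w)).
Proof.
  intros HR HB Hf Hfn Hlim HBn w Hw. pose proof (Cmod_ge_0 w) as Pw.
  assert (HRk : forall k, 0 < R0 ^ k) by (intros; apply pow_lt; lra).
  assert (Hc : forall k, Cmod (coef f k 1) <= B / R0 ^ k).
  { intros k. apply le_epsilon. intros eps He. destruct (Hlim eps He) as [n Hn].
    assert (E : (coef f k 1 - coef (fn n) k 1)%C = coef (fun z => f z - fn n z)%C k 1).
    { rewrite coef_minus; [reflexivity|lra|intros; apply Hf|intros; apply Hfn]. }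
    assert (B1 : Cmod (coef f k 1 - coef (fn n) k 1)%C <= eps).
    { rewrite E. pose proof (coef_bound (fun z => f z - fn n z)%C k 1 eps ltac:(lra)) as X. rewrite pow1 in X.
      unfold Rdiv in X. rewrite Rinv_1, Rmult_1_r in X. apply X; [|assumption]. intros; apply holo_minus; [apply Hf|apply Hfn]. }
    assert (B2 : Cmod (coef (fn n) k 1) <= B / R0 ^ k).
    { rewrite (coef_invariant (fn n) k 1 R0 (R0 + 1)); [|intros; apply Hfn|lra|lra].
      apply coef_bound; [lra|intros; apply Hfn|intros; now apply HBn]. }
    replace (coef f k 1) with ((coef f k 1 - coef (fn n) k 1) + coef (fn n) k 1)%C by ring.
    eapply Rle_trans; [apply Cmod_triangle|]. lra. }
  set (t := Cmod w / R0).
  assert (Ht : 0 <= t < 1).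
  { unfold t. split; [apply Rmult_le_pos; [assumption|left; apply Rinv_0_lt_compat; lra]|].
    apply Rmult_lt_reg_r with R0; [lra|]. unfold Rdiv. rewrite Rmult_assoc, Rinv_l; lra. }
  assert (G : forall n, rsum (fun k => B * t ^ k) n <= B * (R0 / (R0 - Cmod w))).
  { intros n. rewrite rsum_scal. apply Rmult_le_compat_l; [assumption|].
    assert (E : rsum (fun k => t ^ k) n * (1 - t) = 1 - t ^ n).
    { clear - t. induction n as [|n IH]; [simpl; ring|].
      change (rsum (fun k => t ^ k) (S n)) with (rsum (fun k => t ^ k) n + t ^ n).
      replace ((rsum (fun k => t ^ k) n + t ^ n) * (1 - t)) with (rsum (fun k => t ^ k) n * (1 - t) + t ^ n * (1 - t)) by ring.
      rewrite IH. simpl. ring. }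
    assert (0 <= t ^ n) by (apply pow_le; lra).
    replace (R0 / (R0 - Cmod w)) with (/ (1 - t)) by (unfold t; field; lra).
    apply Rmult_le_reg_r with (1 - t); [lra|]. change (rsum (fun k => t ^ k) n * (1 - t) <= / (1 - t) * (1 - t)). rewrite E, Rinv_l; lra. }
  destruct (bounded_on_circle f R0) as [M [M0 HM]]; [lra|intros z _; apply holo_ccont, Hf|].
  assert (X : Cmod (f w) - B * (R0 / (R0 - Cmod w)) <= 0); [|lra].
  apply (geom_small t (M * (R0 / (R0 - Cmod w)))); [assumption|]. intros n.
  rewrite (taylor f (R0 + 1) w R0 n (fun z _ => Hf z)) by lra.
  assert (T1 : Cmod (csum (fun k => w ^ k * coef f k R0)%C n) <= B * (R0 / (R0 - Cmod w))).
  { eapply Rle_trans; [apply Cmod_csum|]. eapply Rle_trans; [|apply (G n)]. apply rsum_le. intros k _.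
    rewrite Cmod_mult, Cmod_pow, <- (coef_invariant f k 1 R0 (R0 + 1)); [|intros; apply Hf|lra|lra].
    specialize (Hc k). specialize (HRk k). replace (B * t ^ k) with (Cmod w ^ k * (B / R0 ^ k)).
    - apply Rmult_le_compat_l; [apply pow_le; assumption|assumption].
    - unfold t, Rdiv. rewrite Rpow_mult_distr, pow_inv. ring. }
  assert (T2 : Cmod (w ^ n * circ (fun z => f z / z ^ n * (z / (z - w))) R0)%C <= M * (R0 / (R0 - Cmod w)) * t ^ n).
  { rewrite Cmod_mult, Cmod_pow.
    eapply Rle_trans; [apply Rmult_le_compat_l; [now apply pow_le|]; apply (taylor_rem_bound f R0 w Hw (fun z _ => Hf z) n M HM)|].
    right. unfold t, Rdiv. rewrite Rpow_mult_distr, pow_inv. ring. }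
  pose proof (Cmod_triangle (csum (fun k => w ^ k * coef f k R0)%C n) (w ^ n * circ (fun z => f z / z ^ n * (z / (z - w))) R0)%C). lra.
Qed.

Lemma csum_exchange (f : nat -> nat -> C) n m :
  csum (fun i => csum (fun j => f i j) m) n = csum (fun j => csum (fun i => f i j) n) m.
Proof.
  induction n as [|n IH]; simpl.
  - induction m; simpl; [reflexivity|]. rewrite <- IHm. ring.
  - rewrite IH. symmetry. apply csum_plus.
Qed.

Lemma csum_multiples (F : nat -> C) d N : (1 <= d)%nat ->
  csum (fun l => if Nat.eqb (S l mod d) 0 then F (S l) else 0%C) N = csum (fun j => F (d * S j)%nat) (N / d).
Proof.
  intros Hd. induction N as [|N IH].
  - rewrite Nat.Div0.div_0_l. reflexivity.
  - simpl csum at 1. rewrite IH.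
    pose proof (Nat.div_mod_eq N d) as E1. pose proof (Nat.mod_upper_bound N d ltac:(lia)) as B.
    pose proof (Nat.div_mod_eq (S N) d) as E2. pose proof (Nat.mod_upper_bound (S N) d ltac:(lia)) as B2.
    destruct (Nat.eqb_spec (S N mod d) 0) as [Z|Z].
    + assert (Q : (S N / d = S (N / d))%nat) by nia. rewrite Q. simpl csum at 2. f_equal. f_equal. rewrite <- Q. lia.
    + assert (Q : (S N / d = N / d)%nat) by nia. rewrite Q. ring.
Qed.

Lemma ln_as_csum l N : (1 <= l <= N)%nat ->
  RtoC (ln (INR l)) = csum (fun i => if Nat.eqb (l mod S i) 0 then RtoC (Lambda (S i)) else 0%C) N.
Proof.
  intros Hl. rewrite <- Lambda_divisor_sum by lia.
  assert (E : forall n, RtoC (rsum (fun d => when (Nat.eqb (l mod d) 0) (Lambda d)) (S n)) =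
    csum (fun i => if Nat.eqb (l mod S i) 0 then RtoC (Lambda (S i)) else 0%C) n).
  { induction n as [|n IH].
    - simpl. unfold when. rewrite Lambda_0. destruct (Nat.eqb _ _); rewrite Rplus_0_l; reflexivity.
    - change (rsum (fun d => when (Nat.eqb (l mod d) 0) (Lambda d)) (S (S n))) with
        (rsum (fun d => when (Nat.eqb (l mod d) 0) (Lambda d)) (S n) + when (Nat.eqb (l mod (S n)) 0) (Lambda (S n))).
      rewrite RtoC_plus, IH. simpl csum. f_equal. unfold when. destruct (Nat.eqb _ _); reflexivity. }
  rewrite <- E. f_equal. symmetry. apply rsum_extend; [lia|]. intros k Hk. unfold when.
  rewrite Nat.mod_small by lia. destruct (Nat.eqb_spec l 0); [lia|reflexivity].
Qed.

Definition Lambda_coef (chi : nat -> C) (n : nat) : C := (RtoC (Lambda n) * chi n)%C.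
Definition log_coef (chi : nat -> C) (n : nat) : C := (RtoC (ln (INR n)) * chi n)%C.

(** Finite form of the identity [L * sum (Lambda chi) = sum (log chi)]: the difference consists of the terms
    [d e] with [d <= N], [e <= N] and [d e > N]. *)
Lemma Lambda_convolution (chi : nat -> C) s N : cmult chi -> 4 <= Re s -> (1 <= N)%nat ->
  Cmod (dpart chi s N * dpart (Lambda_coef chi) s N - dpart (log_coef chi) s N)%C <= 4 / INR N.
Proof.
  intros [Hm [_ Hb]] Hs HN. pose proof (INR_ge1 N HN) as IN.
  set (F := fun n => (chi n * nat_cpow_opp n s)%C).
  assert (FM : forall m n, (1 <= m)%nat -> (1 <= n)%nat -> F (m * n)%nat = (F m * F n)%C).
  { intros m n H1 H2. unfold F. rewrite Hm, ncp_mult by assumption. ring. }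
  assert (FB : forall n, (1 <= n)%nat -> Cmod (F n) <= npw n 4).
  { intros n Hn. unfold F. rewrite Cmod_mult, Cmod_ncp. pose proof (npw_antimono n 4 (Re s) Hn Hs). pose proof (npw_pos n (Re s)).
    specialize (Hb n). pose proof (Cmod_ge_0 (chi n)). nra. }
  assert (E1 : dpart (log_coef chi) s N = csum (fun i => RtoC (Lambda (S i)) * F (S i) * csum (fun j => F (S j)) (N / S i))%C N).
  { transitivity (csum (fun l => csum (fun i => if Nat.eqb (S l mod S i) 0 then RtoC (Lambda (S i)) * F (S l) else 0)%C N) N).
    - apply csum_ext. intros l Hl. unfold dterm, log_coef. rewrite (ln_as_csum (S l) N) by lia.
      rewrite <- Cmult_assoc. fold (F (S l)). rewrite Cmult_comm, <- csum_scal. apply csum_ext. intros i _.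
      destruct (Nat.eqb _ _); ring.
    - rewrite csum_exchange. apply csum_ext. intros i _.
      transitivity (RtoC (Lambda (S i)) * csum (fun l => if Nat.eqb (S l mod S i) 0 then F (S l) else 0) N)%C.
      + rewrite <- csum_scal. apply csum_ext. intros l _. destruct (Nat.eqb _ _); ring.
      + rewrite csum_multiples by lia. rewrite <- Cmult_assoc. f_equal. rewrite <- csum_scal. apply csum_ext. intros j _. apply FM; lia. }
  assert (E2 : (dpart chi s N * dpart (Lambda_coef chi) s N)%C = csum (fun i => RtoC (Lambda (S i)) * F (S i) * csum (fun j => F (S j)) N)%C N).
  { unfold dpart at 2. rewrite <- csum_scal. apply csum_ext. intros i _. unfold dterm, Lambda_coef.
    change (dpart chi s N) with (csum (fun j => F (S j)) N). set (W := csum (fun j => F (S j)) N). unfold F. ring. }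
  rewrite E1, E2, <- csum_minus. eapply Rle_trans; [apply Cmod_csum|].
  set (Z := rsum (fun k => npw (S k) 2) N).
  assert (HZ : 0 <= Z <= 2).
  { split; [apply rsum_nonneg; intros; left; apply npw_pos|]. pose proof (npw_sum 1 N ltac:(lra)) as X. rewrite Rinv_1 in X.
    replace (1 + 1) with 2 in X by ring. exact X. }
  apply Rle_trans with (rsum (fun i => (/ INR N * Z) * npw (S i) 2) N).
  - apply rsum_le. intros i Hi. set (d := S i). set (k := (N / d)%nat).
    assert (Hk : (k <= N)%nat) by (apply Nat.Div0.div_le_upper_bound; unfold d; nia).
    replace N with (k + (N - k))%nat at 1 by lia. rewrite csum_split.
    replace (RtoC (Lambda d) * F d * (csum (fun j => F (S j)) k + csum (fun j => F (S (k + j))) (N - k)) - RtoC (Lambda d) * F d * csum (fun j => F (S j)) k)%C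
      with (RtoC (Lambda d) * F d * csum (fun j => F (S (k + j))) (N - k))%C by ring.
    rewrite !Cmod_mult, Cmod_R, Rabs_pos_eq by apply Lambda_nonneg.
    assert (LD : Lambda d * Cmod (F d) <= npw d 3).
    { replace 3 with (-1 + 4) by ring. rewrite npw_plus, npw_neg_one by (unfold d; lia).
      apply Rmult_le_compat; [apply Lambda_nonneg|apply Cmod_ge_0| |apply FB; unfold d; lia].
      eapply Rle_trans; [apply Lambda_le_ln|apply ln_le_self]. }
    eapply Rle_trans; [apply Rmult_le_compat_l; [apply Rmult_le_pos; [apply Lambda_nonneg|apply Cmod_ge_0]|apply Cmod_csum]|].
    eapply Rle_trans.
    { apply Rmult_le_compat_r; [|exact LD]. apply rsum_nonneg. intros; apply Cmod_ge_0. }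
    rewrite <- rsum_scal.
    apply Rle_trans with (rsum (fun j => (/ INR N * npw d 2) * npw (S (k + j)) 2) (N - k)).
    + apply rsum_le. intros j Hj. set (e := S (k + j)).
      assert (De : (N < d * e)%nat).
      { unfold e. pose proof (Nat.div_mod_eq N d). pose proof (Nat.mod_upper_bound N d ltac:(unfold d; lia)). fold k in H. nia. }
      eapply Rle_trans; [apply Rmult_le_compat_l; [left; apply npw_pos|apply FB; unfold e; lia]|].
      eapply Rle_trans; [apply Rmult_le_compat_l; [left; apply npw_pos|apply (npw_antimono e 3 4); [unfold e; lia|lra]]|].
      replace 3 with (1 + 2) by ring. rewrite !npw_plus.
      replace (npw d 1 * npw d 2 * (npw e 1 * npw e 2)) with ((npw d 1 * npw e 1) * (npw d 2 * npw e 2)) by ring.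
      replace (/ INR N * npw d 2 * npw e 2) with (/ INR N * (npw d 2 * npw e 2)) by ring.
      apply Rmult_le_compat_r; [left; apply Rmult_lt_0_compat; apply npw_pos|].
      rewrite <- npw_mult by (unfold d, e; lia). rewrite npw_one by (unfold d, e; lia).
      apply Rinv_le_contravar; [lra|]. left. now apply lt_INR.
    + rewrite rsum_scal.
      replace (/ INR N * Z * npw d 2) with (/ INR N * npw d 2 * Z) by ring.
      apply Rmult_le_compat_l.
      * apply Rmult_le_pos; [left; apply Rinv_0_lt_compat; lra|left; apply npw_pos].
      * unfold Z. replace N with (k + (N - k))%nat at 2 by lia. rewrite rsum_split.
        assert (0 <= rsum (fun k => npw (S k) 2) k) by (apply rsum_nonneg; intros; left; apply npw_pos). lra.
  - rewrite rsum_scal. fold Z. assert (P : 0 < / INR N) by (apply Rinv_0_lt_compat; lra). unfold Rdiv.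
    replace (/ INR N * Z * Z) with (Z * Z * / INR N) by ring. apply Rmult_le_compat_r; [lra|]. nra.
Qed.

(** * Taylor coefficients of the logarithmic derivative of L *)

Lemma cder_dpart chi N s : cder (fun s => dpart chi s N) s (- dpart (log_coef chi) s N)%C.
Proof.
  induction N as [|N IH].
  - eapply cder_eq; [apply (cder_const 0%C)|]. unfold dpart. simpl. ring.
  - eapply cder_eq.
    + apply (cder_plus (fun s => dpart chi s N) (fun s => dterm chi s N)); [exact IH|].
      apply (cder_ext (fun s => chi (S N) * Cexp (- ln (INR (S N)) * s))%C).
      * intros w. unfold dterm. now rewrite ncp_Cexp.
      * apply cder_scal, cder_expmul.
    + change (dpart (log_coef chi) s (S N)) with (dpart (log_coef chi) s N + dterm (log_coef chi) s N)%C.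
      unfold dterm, log_coef. rewrite ncp_Cexp. ring.
Qed.

Lemma coef_one_deriv h h' : (forall z, cder h z (h' z)) -> coef h 1 1 = h' 0%C.
Proof.
  intros Hh. assert (Hh' : forall z, holo h' z).
  { intros z. apply (holo_deriv h h' (Cmod z + 1)); [intros; apply Hh|lra]. }
  pose proof (coef_deriv h h' 0 1 ltac:(lra) (fun z _ => Hh z) (fun z _ => Hh' z)) as E.
  rewrite (coef_0 h' 2) in E; [|intros; apply Hh'|lra]. rewrite <- E. simpl. ring.
Qed.

Section Coefficients.
Variables (q : nat) (chi : nat -> C) (L L' : C -> C).
Hypothesis (Hchi : is_dirichlet_character q chi).
Hypothesis (HL : forall z, cder L z (L' z)).
Hypothesis (Hser : forall s, 1 < Re s -> dlim chi s (L s)).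

Lemma L_tail s N : 3 <= Re s -> (1 <= N)%nat -> Cmod (L s - dpart chi s N)%C <= / INR N.
Proof.
  intros Hs HN. eapply Rle_trans; [apply (dlim_tail chi s (L s) N (dchar_le_1 q chi Hchi) HN ltac:(lra) (Hser s ltac:(lra)))|].
  pose proof (npw_antimono N 1 (Re s - 1) HN ltac:(lra)) as X. rewrite npw_one in X by assumption.
  pose proof (npw_pos N (Re s - 1)).
  assert (/ (Re s - 1) <= 1) by (rewrite <- Rinv_1; apply Rinv_le_contravar; lra).
  assert (0 < / (Re s - 1)) by (apply Rinv_0_lt_compat; lra). unfold Rdiv. nra.
Qed.

(** Cauchy's inequality on a circle of radius 1 around [s]. *)
Lemma L_deriv_approx s N : 4 <= Re s -> (1 <= N)%nat -> Cmod (L' s + dpart (log_coef chi) s N)%C <= / INR N.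
Proof.
  intros Hs HN.
  set (h := fun z => (L (s + z) - dpart chi (s + z) N)%C).
  assert (Dh : forall z, cder h z (L' (s + z)%C - - dpart (log_coef chi) (s + z) N)%C).
  { intros z. apply (cder_minus (fun z => L (s + z)%C) (fun z => dpart chi (s + z)%C N)).
    - apply cder_shift, HL.
    - apply (cder_shift (fun s => dpart chi s N)), cder_dpart. }
  pose proof (coef_one_deriv h _ Dh) as E. cbv beta in E. rewrite Cplus_0_r in E.
  replace (L' s + dpart (log_coef chi) s N)%C with (L' s - - dpart (log_coef chi) s N)%C by ring. rewrite <- E.
  pose proof (coef_bound h 1 1 (/ INR N) ltac:(lra)) as X. unfold Rdiv in X. rewrite pow1, Rinv_1, Rmult_1_r in X. apply X.
  - intros z _. eexists; apply Dh.
  - intros z Hz. apply L_tail; [|assumption]. pose proof (re_le_Cmod z) as R. rewrite Hz in R. apply Rabs_le_between in R.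
    change (Re (s + z)%C) with (Re s + Re z). lra.
Qed.

Lemma V_bound s N : 4 <= Re s -> Cmod (dpart (Lambda_coef chi) s N) <= 2.
Proof.
  intros Hs. unfold dpart. eapply Rle_trans; [apply Cmod_csum|].
  pose proof (npw_sum 1 N ltac:(lra)) as X. rewrite Rinv_1 in X.
  eapply Rle_trans; [|eapply Rle_trans; [exact X|lra]]. apply rsum_le. intros k _. unfold dterm, Lambda_coef.
  rewrite !Cmod_mult, Cmod_ncp, Cmod_R, Rabs_pos_eq by apply Lambda_nonneg.
  pose proof (dchar_le_1 q chi Hchi (S k)). pose proof (Cmod_ge_0 (chi (S k))). pose proof (Lambda_nonneg (S k)).
  assert (Y : Lambda (S k) <= npw (S k) (-1)).
  { rewrite npw_neg_one by lia. eapply Rle_trans; [apply Lambda_le_ln|apply ln_le_self]. }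
  pose proof (npw_pos (S k) (Re s)).
  apply Rle_trans with (npw (S k) (-1) * npw (S k) (Re s)).
  - apply Rmult_le_compat_r; [lra|]. nra.
  - rewrite <- npw_plus. apply npw_antimono; [lia|lra].
Qed.

Lemma log_deriv_approx s N : 4 <= Re s -> (1 <= N)%nat -> Cmod (L' s / L s + dpart (Lambda_coef chi) s N)%C <= 14 / INR N.
Proof.
  intros Hs HN.
  pose proof (L_right_bound q chi L Hchi Hser s ltac:(lra)) as LB.
  assert (NL : L s <> 0%C) by (apply Cmod_gt_0; lra).
  pose proof (L_tail s N ltac:(lra) HN) as H1. pose proof (L_deriv_approx s N Hs HN) as H2.
  pose proof (Lambda_convolution chi s N (dchar_cmult q chi Hchi) Hs HN) as H3. pose proof (V_bound s N Hs) as H4.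
  set (V := dpart (Lambda_coef chi) s N) in *. set (W := dpart (log_coef chi) s N) in *. set (LN := dpart chi s N) in *.
  replace (L' s / L s + V)%C with (((L' s + W) + (LN * V - W) + (L s - LN) * V) / L s)%C by (field; assumption).
  rewrite Cmod_div by assumption.
  assert (IN : 0 < / INR N) by (apply Rinv_0_lt_compat; pose proof (INR_ge1 N HN); lra).
  assert (Num : Cmod ((L' s + W) + (LN * V - W) + (L s - LN) * V)%C <= 7 * / INR N).
  { eapply Rle_trans; [apply Cmod_triangle|]. eapply Rle_trans; [apply Rplus_le_compat_r, Cmod_triangle|]. rewrite Cmod_mult.
    unfold Rdiv in H3. pose proof (Cmod_ge_0 (L s - LN)%C). pose proof (Cmod_ge_0 V). nra. }
  apply Rmult_le_reg_r with (Cmod (L s)); [lra|]. unfold Rdiv. rewrite Rmult_assoc, Rinv_l, Rmult_1_r by lra. nra.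
Qed.

Lemma coef_ncp n (s0 : C) m r : 0 < r ->
  coef (fun z => nat_cpow_opp n (s0 + z)%C) m r = (nat_cpow_opp n s0 * ((- ln (INR n)) ^ m / INR (fact m)))%C.
Proof.
  intros Hr. transitivity (coef (fun z => nat_cpow_opp n s0 * Cexp (- ln (INR n) * z))%C m r).
  - apply coef_ext; [lra|]. intros z _. rewrite !ncp_Cexp, <- Cexp_plus. f_equal. ring.
  - rewrite coef_scal; [|assumption|intros; eexists; apply cder_expmul].
    rewrite coef_cexp by assumption. reflexivity.
Qed.

(** Take Taylor coefficients, on the circle of radius 1, of the uniform approximation of [L' / L] by partial
    sums of its Dirichlet series. *)
Theorem log_deriv_coefficient (s0 : R) m N : 5 <= s0 -> (1 <= N)%nat ->
  Cmod (coef (fun z => L' (s0 + z) / L (s0 + z))%C m 1 +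
    csum (fun k => Lambda_coef chi (S k) * (nat_cpow_opp (S k) s0 * ((- ln (INR (S k))) ^ m / INR (fact m))))%C N)%C <= 14 / INR N.
Proof.
  intros Hs HN.
  assert (Rs : forall z, Cmod z = 1 -> 4 <= Re (s0 + z)%C).
  { intros z Hz. pose proof (re_le_Cmod z) as R. rewrite Hz in R. apply Rabs_le_between in R.
    change (Re (s0 + z)%C) with (s0 + Re z). lra. }
  assert (E : csum (fun k => Lambda_coef chi (S k) * (nat_cpow_opp (S k) s0 * ((- ln (INR (S k))) ^ m / INR (fact m))))%C N =
     coef (fun z => dpart (Lambda_coef chi) (s0 + z)%C N) m 1).
  { unfold dpart. rewrite (coef_csum (fun k z => dterm (Lambda_coef chi) (s0 + z)%C k)).
    - apply csum_ext. intros k _. unfold dterm. rewrite coef_scal, coef_ncp by (try lra; intros; apply (holo_shift (fun s => nat_cpow_opp (S k) s)); apply holo_ncp). reflexivity.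
    - lra.
    - intros k z _. apply (holo_mult (fun _ => Lambda_coef chi (S k)) (fun z => nat_cpow_opp (S k) (s0 + z)%C)); [apply holo_const|].
      apply (holo_shift (fun s => nat_cpow_opp (S k) s)); apply holo_ncp. }
  assert (HL' : forall z, holo L' z).
  { intros z. apply (holo_deriv L L' (Cmod z + 1)); [intros; apply HL|lra]. }
  assert (CQ : forall z, Cmod z = 1 -> holo (fun z => L' (s0 + z) / L (s0 + z))%C z).
  { intros z Hz. pose proof (L_right_bound q chi L Hchi Hser (s0 + z)%C ltac:(specialize (Rs z Hz); lra)).
    apply holo_div; [apply Cmod_gt_0; lra|apply holo_shift, HL'|apply holo_shift; eexists; apply HL]. }
  assert (CV : forall z, Cmod z = 1 -> holo (fun z => dpart (Lambda_coef chi) (s0 + z)%C N) z).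
  { intros z _. apply (holo_shift (fun s => dpart (Lambda_coef chi) s N)), holo_dpart. }
  rewrite E, <- coef_plus by (assumption || lra).
  pose proof (coef_bound (fun z => L' (s0 + z) / L (s0 + z) + dpart (Lambda_coef chi) (s0 + z)%C N)%C m 1 (14 / INR N) ltac:(lra)) as X.
  rewrite pow1 in X. unfold Rdiv at 2 in X. rewrite Rinv_1, Rmult_1_r in X. apply X.
  - intros z Hz. apply holo_plus; [now apply CQ|now apply CV].
  - intros z Hz. apply log_deriv_approx; [now apply Rs|assumption].
Qed.
End Coefficients.

(** * The weights *)

Lemma exp_le (x y : R) : x <= y -> exp x <= exp y.
Proof. intros [H| ->]; [left; now apply exp_increasing|lra]. Qed.

Lemma ln_le (x y : R) : 0 < x -> x <= y -> ln x <= ln y.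
Proof. intros Hx [H| ->]; [left; now apply ln_increasing|lra]. Qed.

Lemma ln_le_sub1 x : 0 < x -> ln x <= x - 1.
Proof. intros Hx. rewrite <- (exp_ln x Hx) at 2. pose proof (exp_ineq1_le (ln x)). lra. Qed.

Lemma ln_ge_inv x : 0 < x -> 1 - / x <= ln x.
Proof.
  intros Hx. pose proof (ln_le_sub1 (/ x) ltac:(now apply Rinv_0_lt_compat)) as H. rewrite ln_Rinv in H by assumption. lra.
Qed.

Lemma ln1p_lower y : 0 <= y -> y - y ^ 2 <= ln (1 + y).
Proof.
  intros Hy. eapply Rle_trans; [|apply ln_ge_inv; lra].
  replace (1 - / (1 + y)) with (y / (1 + y)) by (field; lra).
  apply Rmult_le_reg_r with (1 + y); [lra|]. unfold Rdiv. rewrite Rmult_assoc, Rinv_l by lra. nra.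
Qed.

Lemma ln1p_upper y : 0 <= y <= 1 -> ln (1 + y) <= y - y ^ 2 / 6.
Proof.
  intros Hy. set (z := y - y ^ 2 / 6).
  assert (Hz : 1 + y <= exp z).
  { replace z with (z / 2 + z / 2) by field. rewrite exp_plus. pose proof (exp_ineq1_le (z / 2)) as X.
    assert (0 <= z) by (unfold z; nra).
    apply Rle_trans with ((1 + z / 2) * (1 + z / 2)); [|apply Rmult_le_compat; lra].
    unfold z. nra. }
  rewrite <- (ln_exp z). apply ln_le; [lra|assumption].
Qed.

Lemma ln1p_mid y : 0 <= y -> 2 * y / (2 + y) <= ln (1 + y).
Proof.
  intros Hy.
  assert (D : forall x, 0 <= x <= y -> is_derive (fun x => ln (1 + x) - 2 * x / (2 + x)) x (x ^ 2 / ((1 + x) * (2 + x) ^ 2))).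
  { intros x Hx. auto_derive; [repeat split; lra|]. field. lra. }
  destruct (MVT_gen (fun x => ln (1 + x) - 2 * x / (2 + x)) 0 y (fun x => x ^ 2 / ((1 + x) * (2 + x) ^ 2))) as [c [Hc E]].
  - intros x Hx. rewrite Rmin_left, Rmax_right in Hx by assumption. apply D. lra.
  - intros x Hx. rewrite Rmin_left, Rmax_right in Hx by assumption.
    apply continuity_pt_filterlim. apply (ex_derive_continuous (V := R_NormedModule) (fun x => ln (1 + x) - 2 * x / (2 + x))). eexists. apply D. lra.
  - rewrite Rmin_left, Rmax_right in Hc by assumption. rewrite Rplus_0_r, ln_1 in E.
    assert (0 <= c ^ 2 / ((1 + c) * (2 + c) ^ 2)).
    { apply Rmult_le_pos; [nra|]. left. apply Rinv_0_lt_compat. apply Rmult_lt_0_compat; [lra|apply pow_lt; lra]. }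
    nra.
Qed.

(** Induction; the step is the inequality [1 <= (n + 1/2) ln (1 + 1/n)]. *)
Lemma stirling_upper n : (1 <= n)%nat -> ln (INR (fact n)) <= 1 + ln (INR n) / 2 + INR n * ln (INR n) - INR n.
Proof.
  induction n as [|n IH]; [lia|]. intros _. destruct (Nat.eq_dec n 0) as [->|N].
  - simpl. rewrite ln_1. lra.
  - specialize (IH ltac:(lia)). pose proof (INR_ge1 n ltac:(lia)) as In.
    rewrite fact_simpl, mult_INR, ln_mult by (apply lt_0_INR; (lia || apply lt_O_fact)).
    rewrite !S_INR.
    pose proof (ln1p_mid (/ INR n) ltac:(left; apply Rinv_0_lt_compat; lra)) as X.
    replace (1 + / INR n) with ((INR n + 1) / INR n) in X by (field; lra).
    rewrite ln_div in X by lra.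
    replace (2 * / INR n / (2 + / INR n)) with (2 / (2 * INR n + 1)) in X by (field; lra).
    set (a := ln (INR n)) in *. set (b := ln (INR n + 1)) in *.
    assert (1 <= (INR n + / 2) * (b - a)).
    { replace 1 with ((INR n + / 2) * (2 / (2 * INR n + 1))) by (field; lra). apply Rmult_le_compat_l; lra. }
    lra.
Qed.

Section Weight.
Variable K : nat.
Hypothesis HK : (100 <= K)%nat.
Let kap := INR K.
Let m := (2 * K * K)%nat.

Lemma K_ge_100 : 100 <= kap.
Proof. unfold kap. apply le_INR in HK. simpl in HK. lra. Qed.

Lemma INR_order : INR m = 2 * kap ^ 2.
Proof. unfold m, kap. rewrite !mult_INR. simpl (INR 2). ring. Qed.

(** The coefficient of [Lambda n * chi n] in the Taylor expansion, of order [m], of the Dirichlet series of [-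
    L' / L] at [K + 1]. *)
Definition weight (n : nat) : R := npw n (kap + 1) * ln (INR n) ^ m / INR (fact m).
(** Maximum of [exp (- K u) u^m / m!] over [u >= 0], attained at [u = 2 K]; with [u = ln n] this bounds [n *
    weight n]. *)
Definition peak : R := exp (- INR m) * (2 * kap) ^ m / INR (fact m).

Lemma INR_fact_pos : 0 < INR (fact m).
Proof. apply lt_0_INR, lt_O_fact. Qed.

Lemma peak_pos : 0 < peak.
Proof.
  pose proof K_ge_100. apply Rdiv_lt_0_compat; [|apply INR_fact_pos].
  apply Rmult_lt_0_compat; [apply exp_pos|apply pow_lt; lra].
Qed.

Lemma weight_nonneg n : 0 <= weight n.
Proof.
  apply Rmult_le_pos; [|left; apply Rinv_0_lt_compat, INR_fact_pos].
  apply Rmult_le_pos; [left; apply npw_pos|]. apply pow_le, ln_INR_nonneg.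
Qed.

Lemma pow_exp_ln x j : 0 < x -> x ^ j = exp (INR j * ln x).
Proof. intros Hx. rewrite <- (exp_ln (x ^ j)) by now apply pow_lt. f_equal. now apply VonMangoldt.ln_pow_nat. Qed.

(** Writing [u = ln n = 2 K (1 + y)], the exponent is [- u + m (ln (1 + y) - y)]. *)
Lemma weight_formula n : (2 <= n)%nat ->
  weight n = peak * exp (2 * kap ^ 2 * ln (ln (INR n) / (2 * kap)) - (kap + 1) * ln (INR n) + 2 * kap ^ 2).
Proof.
  intros Hn. pose proof K_ge_100. pose proof INR_fact_pos.
  assert (Hu : 0 < ln (INR n)).
  { rewrite <- ln_1. apply ln_increasing; [lra|]. apply (lt_INR 1). lia. }
  unfold weight, peak, npw. rewrite (pow_exp_ln (ln (INR n)) m), (pow_exp_ln (2 * kap) m) by lra. rewrite INR_order, ln_div by lra.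
  assert (A : forall a b c d e, a * b = c * d * e -> a * b / INR (fact m) = c * d / INR (fact m) * e).
  { intros a b c d e E. rewrite E. field. apply Rgt_not_eq, INR_fact_pos. }
  apply A. rewrite <- !exp_plus. f_equal. ring.
Qed.

Lemma weight_one : weight 1 = 0.
Proof.
  unfold weight. simpl INR at 1. rewrite ln_1. rewrite pow_i; [unfold Rdiv; ring|]. unfold m. nia.
Qed.

(** Tangent bound for the logarithm at the maximum of [weight] itself, which lies at [ln n = 2 K^2 / (K + 1)],
    a bounded distance below [2 K]. *)
Lemma weight_max n : (1 <= n)%nat -> weight n <= peak * exp (2 - 2 * kap).
Proof.
  intros Hn. pose proof K_ge_100. pose proof peak_pos. destruct (Nat.eq_dec n 1) as [->|N].
  - rewrite weight_one. apply Rmult_le_pos; [lra|left; apply exp_pos].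
  - rewrite weight_formula by lia. apply Rmult_le_compat_l; [lra|]. apply exp_le.
    assert (Hu : 0 < ln (INR n)).
    { rewrite <- ln_1. apply ln_increasing; [lra|]. apply (lt_INR 1). lia. }
    set (u := ln (INR n)) in *.
    pose proof (ln_le_sub1 (u * (kap + 1) / (2 * kap ^ 2)) ltac:(apply Rdiv_lt_0_compat; nra)) as X.
    replace (u * (kap + 1) / (2 * kap ^ 2)) with ((u / (2 * kap)) * (1 + / kap)) in X at 1 by (field; lra).
    assert (0 < / kap) by (apply Rinv_0_lt_compat; lra).
    rewrite ln_mult in X by (try apply Rdiv_lt_0_compat; lra).
    pose proof (ln1p_lower (/ kap) ltac:(lra)) as Y.
    assert (Z : 2 * kap ^ 2 * ln (u / (2 * kap)) <= 2 * kap ^ 2 * (u * (kap + 1) / (2 * kap ^ 2) - 1 - (/ kap - (/ kap) ^ 2))).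
    { apply Rmult_le_compat_l; [nra|lra]. }
    replace (2 * kap ^ 2 * (u * (kap + 1) / (2 * kap ^ 2) - 1 - (/ kap - (/ kap) ^ 2))) with
     ((kap + 1) * u - 2 * kap ^ 2 - 2 * kap + 2) in Z by (field; lra). lra.
Qed.

(** Within distance 6 below the peak the relative deviation [y] is between [- 3 / K] and 0, so the quadratic
    loss, of the order of [m y^2], is bounded. *)
Lemma weight_lower n : exp (2 * kap - 6) <= INR n <= exp (2 * kap) -> peak * exp (-36 - 2 * kap) <= weight n.
Proof.
  intros Hn. pose proof K_ge_100. pose proof peak_pos.
  assert (En : 2 < INR n).
  { eapply Rlt_le_trans; [|apply Hn]. pose proof (exp_ineq1 (2 * kap - 6) ltac:(lra)). lra. }
  assert (Hn2 : (2 <= n)%nat) by (apply INR_le; simpl; lra).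
  rewrite weight_formula by assumption. apply Rmult_le_compat_l; [lra|]. apply exp_le.
  assert (U1 : 2 * kap - 6 <= ln (INR n)) by (rewrite <- (ln_exp (2 * kap - 6)); apply ln_le; [apply exp_pos|lra]).
  assert (U2 : ln (INR n) <= 2 * kap) by (rewrite <- (ln_exp (2 * kap)); apply ln_le; lra).
  set (u := ln (INR n)) in *.
  set (t := u / (2 * kap)).
  assert (Eu : u = 2 * kap * t) by (unfold t; field; lra).
  assert (T1 : 1 - 3 / kap <= t).
  { unfold t. apply Rmult_le_reg_r with (2 * kap); [lra|]. replace ((1 - 3 / kap) * (2 * kap)) with (2 * kap - 6) by (field; lra).
    unfold Rdiv. rewrite Rmult_assoc, Rinv_l; lra. }
  assert (T2 : t <= 1).
  { unfold t. apply Rmult_le_reg_r with (2 * kap); [lra|]. unfold Rdiv. rewrite Rmult_assoc, Rinv_l; lra. }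
  assert (K3 : 3 / kap <= 1 / 2).
  { apply Rmult_le_reg_r with kap; [lra|]. unfold Rdiv. rewrite Rmult_assoc, Rinv_l; lra. }
  pose proof (ln_ge_inv t ltac:(lra)) as L.
  assert (L2 : (t - 1) - 2 * (t - 1) ^ 2 <= ln t).
  { eapply Rle_trans; [|exact L]. apply Rmult_le_reg_r with t; [lra|]. replace ((1 - / t) * t) with (t - 1) by (field; lra). assert (0 <= (1 - t) ^ 2 * (1 - 2 * (1 - t))) by (apply Rmult_le_pos; [apply pow2_ge_0|lra]). nra. }
  assert (Q : 2 * kap ^ 2 * (2 * (t - 1) ^ 2) <= 36).
  { assert ((t - 1) ^ 2 <= (3 / kap) ^ 2) by nra.
    apply Rle_trans with (2 * kap ^ 2 * (2 * (3 / kap) ^ 2)); [apply Rmult_le_compat_l; nra|right; field; lra]. }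
  assert (M : 2 * kap ^ 2 * ((t - 1) - 2 * (t - 1) ^ 2) <= 2 * kap ^ 2 * ln t) by (apply Rmult_le_compat_l; nra).
  rewrite Eu in *. nra.
Qed.

(** Beyond the point [u1 = 2 K + 24] the exponent of [n * weight n] has slope at most [- 1], which yields the
    factor [1 / n^2]; its value at [u1] is at most [- 48]. *)
Lemma weight_tail n : exp (2 * kap + 24) <= INR n -> weight n <= peak * exp (-48) * exp (2 * kap + 24) / INR n ^ 2.
Proof.
  intros Hn. pose proof K_ge_100. pose proof peak_pos.
  assert (En : 2 < INR n).
  { eapply Rlt_le_trans; [|apply Hn]. pose proof (exp_ineq1 (2 * kap + 24) ltac:(lra)). lra. }
  assert (Hn2 : (2 <= n)%nat) by (apply INR_le; simpl; lra).
  rewrite weight_formula by assumption.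
  assert (E2 : / INR n ^ 2 = exp (- 2 * ln (INR n))).
  { replace (- 2 * ln (INR n)) with (- (ln (INR n) + ln (INR n))) by ring. rewrite exp_Ropp, exp_plus, exp_ln by lra. f_equal. ring. }
  unfold Rdiv at 2. rewrite E2, !Rmult_assoc, <- !exp_plus. apply Rmult_le_compat_l; [lra|]. apply exp_le.
  assert (U : 2 * kap + 24 <= ln (INR n)) by (rewrite <- (ln_exp (2 * kap + 24)); apply ln_le; [apply exp_pos|assumption]).
  set (u := ln (INR n)) in *. set (u1 := 2 * kap + 24) in *.
  assert (X1 : ln (u / (2 * kap)) <= ln (1 + 12 / kap) + (u / u1 - 1)).
  { replace (u / (2 * kap)) with ((1 + 12 / kap) * (u / u1)) by (unfold u1; field; lra).
    assert (0 < 12 / kap) by (apply Rdiv_lt_0_compat; lra).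
    assert (0 < u / u1) by (apply Rdiv_lt_0_compat; unfold u1 in *; lra).
    rewrite ln_mult by lra. pose proof (ln_le_sub1 (u / u1) ltac:(assumption)). lra. }
  assert (Y1 : 0 <= 12 / kap <= 1).
  { split; [apply Rmult_le_pos; [lra|left; apply Rinv_0_lt_compat; lra]|].
    apply Rmult_le_reg_r with kap; [lra|]. unfold Rdiv. rewrite Rmult_assoc, Rinv_l; lra. }
  pose proof (ln1p_upper _ Y1) as X2.
  assert (X3 : 2 * kap ^ 2 * ln (u / (2 * kap)) <= 2 * kap ^ 2 * (12 / kap - (12 / kap) ^ 2 / 6 + (u / u1 - 1))).
  { apply Rmult_le_compat_l; nra. }
  replace (2 * kap ^ 2 * (12 / kap - (12 / kap) ^ 2 / 6 + (u / u1 - 1))) with (24 * kap - 48 + 2 * kap ^ 2 / u1 * (u - u1)) in X3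
    by (unfold u1; field; lra).
  assert (X4 : 2 * kap ^ 2 / u1 <= kap - 1).
  { apply Rmult_le_reg_r with u1; [unfold u1; lra|]. unfold Rdiv. rewrite Rmult_assoc, Rinv_l by (unfold u1; lra). unfold u1. nra. }
  assert (X5 : 2 * kap ^ 2 / u1 * (u - u1) <= (kap - 1) * (u - u1)) by (apply Rmult_le_compat_r; lra).
  unfold u1 in *. nra.
Qed.

(** Stirling's formula; the powers of [2 K] combine with [m^m = (2 K^2)^m] to leave [K^{-m}]. *)
Lemma peak_lower : / (6 * kap ^ (m + 1)) <= peak.
Proof.
  pose proof K_ge_100. pose proof INR_fact_pos as F.
  assert (Hm : (1 <= m)%nat) by (unfold m; nia).
  pose proof (stirling_upper m Hm) as S.
  assert (F2 : INR (fact m) <= exp 1 * (2 * kap) * (exp (INR m * ln (INR m)) * exp (- INR m))).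
  { rewrite <- (exp_ln (INR (fact m))) by assumption. rewrite <- (exp_ln (2 * kap)) by lra. rewrite <- !exp_plus. apply exp_le.
    assert (ln (INR m) / 2 <= ln (2 * kap)).
    { rewrite INR_order. replace (2 * kap ^ 2) with ((2 * kap) * kap) by ring. rewrite ln_mult by lra.
      assert (ln kap <= ln (2 * kap)) by (apply ln_le; lra). lra. }
    lra. }
  unfold peak.
  assert (E : exp (INR m * ln (INR m)) = (2 * kap) ^ m * kap ^ m).
  { rewrite <- Rpow_mult_distr. rewrite <- pow_exp_ln by (rewrite INR_order; nra). f_equal. rewrite INR_order. ring. }
  rewrite E in F2.
  assert (Kp : 0 < kap ^ m) by (apply pow_lt; lra). assert (Kp2 : 0 < (2 * kap) ^ m) by (apply pow_lt; lra).
  pose proof (exp_pos (- INR m)) as Ep. pose proof exp_le_3 as E3.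
  apply Rmult_le_reg_r with (INR (fact m)); [assumption|].
  unfold Rdiv. rewrite Rmult_assoc, Rinv_l, Rmult_1_r by lra.
  apply Rle_trans with (/ (6 * kap ^ (m + 1)) * (3 * (2 * kap) * ((2 * kap) ^ m * kap ^ m * exp (- INR m)))).
  - apply Rmult_le_compat_l; [left; apply Rinv_0_lt_compat; rewrite pow_add; simpl; nra|].
    eapply Rle_trans; [exact F2|]. apply Rmult_le_compat_r; [left; repeat apply Rmult_lt_0_compat; assumption|]. nra.
  - right. rewrite pow_add. simpl. field. lra.
Qed.
End Weight.

Lemma psi_from_1 N : psi N = rsum (fun k => Lambda (S k)) N.
Proof.
  unfold psi. change (S N) with (1 + N)%nat. rewrite rsum_split. simpl rsum at 1. rewrite Lambda_0.
  rewrite !Rplus_0_l. reflexivity.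
Qed.

(** Abel summation against [psi n <= 4 n]. *)
Lemma Lambda_sq_tail a M : (1 <= a)%nat ->
  rsum (fun k => Lambda (a + k) / INR (a + k) ^ 2) M <= 12 / INR a.
Proof.
  intros Ha. pose proof (INR_ge1 a Ha) as Ia.
  assert (X : rsum (fun k => Lambda (a + k) / INR (a + k) ^ 2) M <= psi (a + M - 1) / INR (a + M) ^ 2 + 8 * (/ INR a - / INR (a + M))).
  { induction M as [|M IH].
    - rewrite Nat.add_0_r. simpl rsum. pose proof (psi_nonneg (a - 1)).
      assert (0 <= psi (a - 1) / INR a ^ 2) by (apply Rmult_le_pos; [assumption|left; apply Rinv_0_lt_compat, pow_lt; lra]). lra.
    - set (n := (a + M)%nat) in *. assert (In : 1 <= INR n) by (apply INR_ge1; unfold n; lia).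
      replace (a + S M)%nat with (S n) by (unfold n; lia).
      change (rsum (fun k => Lambda (a + k) / INR (a + k) ^ 2) (S M)) with (rsum (fun k => Lambda (a + k) / INR (a + k) ^ 2) M + Lambda n / INR n ^ 2).
      replace (S n - 1)%nat with n by lia.
      assert (P : psi (n - 1) = psi n - Lambda n).
      { replace n with (S (n - 1)) at 2 3 by (unfold n; lia). change (psi (S (n - 1))) with (psi (n - 1) + Lambda (S (n - 1))). lra. }
      rewrite P in IH. pose proof (psi_upper n) as U. rewrite S_INR. pose proof (psi_nonneg n) as U0.
      set (x := INR n) in *. set (p := psi n) in *.
      assert (D : p * (/ x ^ 2 - / (x + 1) ^ 2) <= 8 * (/ x - / (x + 1))).
      { replace (/ x ^ 2 - / (x + 1) ^ 2) with ((2 * x + 1) / (x ^ 2 * (x + 1) ^ 2)) by (field; lra).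
        apply Rle_trans with (4 * x * ((2 * x + 1) / (x ^ 2 * (x + 1) ^ 2))).
        - apply Rmult_le_compat_r; [|assumption]. apply Rmult_le_pos; [lra|]. left. apply Rinv_0_lt_compat, Rmult_lt_0_compat; apply pow_lt; lra.
        - replace (8 * (/ x - / (x + 1))) with (4 * x * ((2 * x + 2) / (x ^ 2 * (x + 1) ^ 2))) by (field; lra).
          apply Rmult_le_compat_l; [lra|]. apply Rmult_le_compat_r; [|lra]. left. apply Rinv_0_lt_compat, Rmult_lt_0_compat; apply pow_lt; lra. }
      unfold Rdiv in *. lra. }
  eapply Rle_trans; [exact X|]. set (n := (a + M)%nat).
  assert (Ian : INR a <= INR n) by (apply le_INR; unfold n; lia).
  pose proof (psi_upper (n - 1)) as U.
  assert (U2 : psi (n - 1) <= 4 * INR n).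
  { eapply Rle_trans; [exact U|]. apply Rmult_le_compat_l; [lra|]. apply le_INR. lia. }
  assert (U3 : psi (n - 1) / INR n ^ 2 <= 4 / INR n).
  { apply Rle_trans with (4 * INR n / INR n ^ 2); [|right; field; lra].
    apply Rmult_le_compat_r; [left; apply Rinv_0_lt_compat, pow_lt; lra|assumption]. }
  assert (/ INR n <= / INR a) by (apply Rinv_le_contravar; lra).
  assert (0 < / INR n) by (apply Rinv_0_lt_compat; lra). unfold Rdiv in *. lra.
Qed.

(** * The prime sum when chi is trivial on an initial segment *)

Lemma exp_nat_lower j : 2 ^ j <= exp (INR j).
Proof.
  induction j as [|j IH]; [simpl; rewrite exp_0; lra|]. rewrite S_INR, exp_plus. simpl (2 ^ S j).
  pose proof (exp_ineq1 1 ltac:(lra)). assert (0 < 2 ^ j) by (apply pow_lt; lra). nra.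
Qed.

Lemma exp_linear_bound (a b c : R) : 0 < c -> exists K0 : nat, forall K, (K0 <= K)%nat -> a + b * INR K <= exp (c * INR K).
Proof.
  intros Hc.
  destruct (INR_unbounded ((Rabs a + Rabs b) * 4 / c ^ 2 + 1)) as [K0 HK0].
  exists (S K0). intros K HK. apply le_INR in HK. rewrite S_INR in HK.
  pose proof (Rabs_pos a). pose proof (Rabs_pos b). pose proof (Rle_abs a). pose proof (Rle_abs b).
  assert (Pc : 0 < c ^ 2) by (apply pow_lt; lra).
  assert (Q : 0 <= (Rabs a + Rabs b) * 4 / c ^ 2) by (apply Rmult_le_pos; [lra|left; apply Rinv_0_lt_compat; lra]).
  set (x := INR K) in *.
  assert (E : (c * x / 2) * (c * x / 2) <= exp (c * x)).
  { replace (c * x) with (c * x / 2 + c * x / 2) at 3 by field. rewrite exp_plus.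
    pose proof (exp_ineq1_le (c * x / 2)). apply Rmult_le_compat; try lra; apply Rmult_le_pos; try lra; apply Rmult_le_pos; lra. }
  eapply Rle_trans; [|exact E].
  apply Rle_trans with ((Rabs a + Rabs b) * x); [nra|].
  replace (c * x / 2 * (c * x / 2)) with (c ^ 2 * x / 4 * x) by field. apply Rmult_le_compat_r; [lra|].
  assert (X : (Rabs a + Rabs b) * 4 / c ^ 2 <= x) by lra.
  apply Rmult_le_compat_l with (r := c ^ 2) in X; [|lra].
  replace (c ^ 2 * ((Rabs a + Rabs b) * 4 / c ^ 2)) with ((Rabs a + Rabs b) * 4) in X by (field; lra). lra.
Qed.

Lemma floor_exists x : 0 <= x -> exists n : nat, INR n <= x < INR n + 1.
Proof. intros Hx. destruct (nfloor_ex x Hx) as [n Hn]. now exists n. Qed.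

(** The upper bound [4 x] and the lower bound close to [x / 2] for [psi x] force primes between [exp (2 K -
    6)] and [exp (2 K)], since [exp 6] exceeds 64. *)
Lemma psi_window K : (100 <= K)%nat -> exists N1 N2 : nat, (N1 <= N2)%nat /\ INR N2 <= exp (2 * INR K) /\
  (forall n, (N1 < n)%nat -> exp (2 * INR K - 6) <= INR n) /\ 3 / 16 * exp (2 * INR K) <= psi N2 - psi N1.
Proof.
  intros HK. pose proof (K_ge_100 K HK) as Kp. set (kap := INR K) in *.
  set (X := exp (2 * kap)). pose proof (exp_pos (2 * kap)) as PX. fold X in PX.
  destruct (floor_exists (exp (2 * kap - 6))) as [N1 H1]; [left; apply exp_pos|].
  destruct (floor_exists X) as [N2 H2]; [unfold X; left; apply exp_pos|].
  exists N1, N2.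
  assert (E6 : exp (2 * kap - 6) <= X / 64).
  { unfold X. replace (2 * kap) with ((2 * kap - 6) + 6) at 2 by ring. rewrite exp_plus.
    pose proof (exp_nat_lower 6) as Y. simpl INR in Y. replace (1 + 1 + 1 + 1 + 1 + 1) with 6 in Y by ring.
    pose proof (exp_pos (2 * kap - 6)). simpl in Y. nra. }
  split; [|split; [lra|split]].
  - apply Nat.lt_succ_r. apply INR_lt. rewrite S_INR. lra.
  - intros n Hn. apply le_INR in Hn. rewrite S_INR in Hn. lra.
  - assert (P1 : psi N1 <= X / 16) by (pose proof (psi_upper N1); lra).
    assert (BX : 40 * kap + 100 <= X).
    { unfold X. replace (2 * kap) with (kap + kap) by ring. rewrite exp_plus. pose proof (exp_ineq1_le kap). nra. }
    destruct (Nat.Even_or_Odd N2) as [Ev|Od].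
    + destruct Ev as [h Eh]. pose proof (psi_lower h) as P2.
      assert (Ih : INR N2 = 2 * INR h) by (rewrite Eh, mult_INR; reflexivity).
      rewrite Eh. pose proof (pos_INR h).
      assert (Lh : ln (2 * INR h + 1) <= 2 * kap + 1).
      { rewrite <- (ln_exp (2 * kap + 1)). apply ln_le; [lra|]. rewrite exp_plus. fold X. pose proof (exp_ineq1 1 ltac:(lra)).
        assert (X * 2 <= X * exp 1) by (apply Rmult_le_compat_l; lra). lra. }
      lra.
    + destruct Od as [h Eh]. pose proof (psi_lower h) as P2.
      assert (Ih : INR N2 = 2 * INR h + 1) by (rewrite Eh, plus_INR, mult_INR; reflexivity).
      pose proof (psi_mono (2 * h) N2 ltac:(lia)). pose proof (pos_INR h).
      assert (Lh : ln (2 * INR h + 1) <= 2 * kap + 1).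
      { rewrite <- (ln_exp (2 * kap + 1)). apply ln_le; [lra|]. rewrite exp_plus. fold X. pose proof (exp_ineq1 1 ltac:(lra)).
        assert (X * 2 <= X * exp 1) by (apply Rmult_le_compat_l; lra). lra. }
      lra.
Qed.

Lemma rsum_window N1 N2 N : (N1 <= N2)%nat -> (N2 <= N)%nat ->
  rsum (fun k => when (andb (Nat.ltb N1 (S k)) (Nat.leb (S k) N2)) (Lambda (S k))) N = psi N2 - psi N1.
Proof.
  intros H1 H2. rewrite (rsum_extend _ N2 N H2).
  - rewrite !psi_from_1. replace N2 with (N1 + (N2 - N1))%nat by lia. rewrite !rsum_split.
    rewrite rsum_zero.
    + replace (rsum (fun k => when (andb (Nat.ltb N1 (S (N1 + k))) (Nat.leb (S (N1 + k)) (N1 + (N2 - N1)))) (Lambda (S (N1 + k)))) (N2 - N1))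
       with (rsum (fun k => Lambda (S (N1 + k))) (N2 - N1)); [lra|].
      apply rsum_ext. intros k Hk. destruct (Nat.ltb_spec N1 (S (N1 + k))); [|lia]. destruct (Nat.leb_spec (S (N1 + k)) (N1 + (N2 - N1))); [|lia]. reflexivity.
    + intros k Hk. destruct (Nat.ltb_spec N1 (S k)); [lia|]. reflexivity.
  - intros k Hk. destruct (Nat.leb_spec (S k) N2); [lia|]. now rewrite Bool.andb_false_r.
Qed.

(** The sum is split into the window of [psi_window], with gain [3/16], the prime powers not coprime to [q] up
    to [exp (2 K + 24)], and the tail. All remaining terms are nonnegative. The constants 6 and 24 are chosen
    so that the gain exceeds twice the loss [1/16] of each of the other two. *)
Theorem main_term_lower : exists K1 : nat, (100 <= K1)%nat /\ forall K, (K1 <= K)%nat ->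
  forall q chi, is_dirichlet_character q chi -> ln (INR q) <= exp (INR K) ->
  (forall n, (1 <= n)%nat -> INR n <= exp (2 * INR K + 24) -> Nat.gcd n q = 1%nat -> chi n = 1%C) ->
  forall N, exp (2 * INR K + 24) <= INR N ->
  peak K * (exp (-36) / 16) <= rsum (fun k => Lambda (S k) * Re (chi (S k)) * weight K (S k)) N.
Proof.
  (* The integers not coprime to [q] weigh at most [peak K * exp (2 - 2 K) * (4 K + 48) * exp K]; the choice of
     [K0] makes this at most [peak K * exp (-36) / 16]. *)
  destruct (exp_linear_bound (16 * exp 38 * 48) (16 * exp 38 * 4) 1 ltac:(lra)) as [K0 HK0].
  exists (K0 + 100)%nat. split; [lia|]. intros K HK q chi Hchi Hlq Hone N HN.
  specialize (HK0 K ltac:(lia)). rewrite Rmult_1_l in HK0.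
  assert (HK100 : (100 <= K)%nat) by lia.
  pose proof (K_ge_100 K HK100) as Kp. pose proof (peak_pos K HK100) as Pp. pose proof (dchar_modulus_pos _ _ Hchi) as Hq.
  destruct (psi_window K HK100) as [N1 [N2 [H12 [HN2 [HN1 HW]]]]].
  destruct (floor_exists (exp (2 * INR K + 24))) as [NX HX]; [left; apply exp_pos|].
  assert (M24 : exp (2 * INR K) <= exp (2 * INR K + 24)) by (apply exp_le; lra).
  assert (N2X : (N2 <= NX)%nat) by (apply Nat.lt_succ_r, INR_lt; rewrite S_INR; lra).
  assert (NXN : (NX <= N)%nat) by (apply INR_le; lra).
  set (w := weight K) in *. set (P := peak K) in *.
  assert (W0 : forall n, 0 <= w n) by (intros n; apply weight_nonneg).
  (* The gain from the window, the loss from integers not coprime to [q], and the loss from the tail. *)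
  set (g1 := fun k => P * exp (-36 - 2 * INR K) * when (andb (Nat.ltb N1 (S k)) (Nat.leb (S k) N2)) (Lambda (S k))).
  set (g2 := fun k => P * exp (2 - 2 * INR K) * when (andb (Nat.leb (S k) NX) (negb (Nat.eqb (Nat.gcd (S k) q) 1))) (Lambda (S k))).
  set (g3 := fun k => when (Nat.ltb NX (S k)) (Lambda (S k) * w (S k))).
  assert (A0 : 0 <= P * exp (-36 - 2 * INR K)) by (apply Rmult_le_pos; [lra|left; apply exp_pos]).
  assert (A2 : 0 <= P * exp (2 - 2 * INR K)) by (apply Rmult_le_pos; [lra|left; apply exp_pos]).
  assert (Pt : forall k, g1 k <= Lambda (S k) * Re (chi (S k)) * w (S k) + g2 k + g3 k).
  { intros k. set (n := S k). pose proof (Lambda_nonneg n) as Ln. specialize (W0 n).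
    assert (LW : 0 <= Lambda n * w n) by (apply Rmult_le_pos; assumption).
    assert (G1 : g1 k <= Lambda n * w n).
    { unfold g1. fold n. destruct (Nat.ltb_spec N1 n) as [X1|X1]; cbv [andb when]; [|rewrite Rmult_0_r; assumption].
      destruct (Nat.leb_spec n N2) as [X2|X2]; cbv [andb when]; [|rewrite Rmult_0_r; assumption].
      rewrite Rmult_comm. apply Rmult_le_compat_l; [assumption|]. apply weight_lower; [assumption|].
      split; [now apply HN1|]. apply le_INR in X2. lra. }
    assert (G2 : 0 <= g2 k).
    { unfold g2. apply Rmult_le_pos; [assumption|]. apply when_nonneg. apply Lambda_nonneg. }
    unfold g3. fold n. destruct (Nat.ltb_spec NX n) as [Y|Y]; cbv [when].
    - assert (Z : g1 k = 0).
      { unfold g1. fold n. destruct (Nat.leb_spec n N2); [lia|]. rewrite Bool.andb_false_r. cbv [when]. ring. }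
      rewrite Z. pose proof (re_le_Cmod (chi n)) as R1. pose proof (dchar_le_1 q chi Hchi n). apply Rabs_le_between in R1.
      assert (0 <= Lambda n * w n * (1 + Re (chi n))) by (apply Rmult_le_pos; lra). lra.
    - destruct (Nat.eqb_spec (Nat.gcd n q) 1) as [Eg|Eg].
      + rewrite (Hone n); [|unfold n; lia| |assumption].
        * simpl. lra.
        * apply le_INR in Y. lra.
      + assert (Z : chi n = 0%C).
        { apply NNPP. intros X. apply Eg. now apply (dchar_support _ _ Hchi). }
        rewrite Z. simpl.
        assert (G : Lambda n * w n <= g2 k).
        { unfold g2. fold n. destruct (Nat.leb_spec n NX); [|lia]. destruct (Nat.eqb_spec (Nat.gcd n q) 1); [lia|]. cbv [andb negb when].
          rewrite Rmult_comm. apply Rmult_le_compat_r; [assumption|]. apply weight_max; [assumption|unfold n; lia]. }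
        lra. }
  assert (S1 : P * exp (-36) * (3 / 16) <= rsum g1 N).
  { unfold g1. rewrite rsum_scal, rsum_window by lia.
    replace (P * exp (-36) * (3 / 16)) with (P * exp (-36 - 2 * INR K) * (3 / 16 * exp (2 * INR K))).
    - apply Rmult_le_compat_l; assumption.
    - replace (-36) with ((-36 - 2 * INR K) + 2 * INR K) at 2 by ring. rewrite exp_plus. ring. }
  assert (S2 : rsum g2 N <= P * exp (-36) / 16).
  { unfold g2. rewrite rsum_scal.
    set (a := (2 * (2 * K + 24))%nat).
    assert (Ha : (NX <= Nat.pow 2 a)%nat).
    { apply INR_le. rewrite pow_INR. simpl (INR 2). unfold a. rewrite pow_mult. replace ((1 + 1) ^ 2) with 4 by ring.
      eapply Rle_trans; [apply HX|].
      assert (E4 : forall j, exp (INR j) <= 4 ^ j).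
      { induction j as [|j IH]; [simpl; rewrite exp_0; lra|]. rewrite S_INR, exp_plus. simpl. pose proof exp_le_3. pose proof (exp_pos (INR j)). nra. }
      specialize (E4 (2 * K + 24)%nat). rewrite plus_INR, mult_INR in E4.
      replace (INR 2 * INR K + INR 24) with (2 * INR K + 24) in E4 by (simpl; ring). exact E4. }
    pose proof (Lambda_gcd_sum q a NX Hq Ha) as G.
    assert (G' : rsum (fun k => when (andb (Nat.leb (S k) NX) (negb (Nat.eqb (Nat.gcd (S k) q) 1))) (Lambda (S k))) N <= INR a * ln (INR q)).
    { eapply Rle_trans; [|exact G]. rewrite (rsum_extend _ NX N NXN).
      - change (S NX) with (1 + NX)%nat. rewrite rsum_split.
        assert (0 <= rsum (fun n => when (negb (Nat.eqb (Nat.gcd n q) 1)) (Lambda n)) 1).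
        { apply rsum_nonneg. intros; apply when_nonneg, Lambda_nonneg. }
        match goal with |- ?x <= _ + ?y => assert (x <= y); [|lra] end.
        apply rsum_le. intros k Hk. destruct (Nat.leb_spec (S k) NX); [|lia]. apply Rle_refl.
      - intros k Hk. destruct (Nat.leb_spec (S k) NX); [lia|reflexivity]. }
    assert (Ia : INR a = 4 * INR K + 48) by (unfold a; rewrite mult_INR, plus_INR, mult_INR; simpl; ring).
    assert (B : INR a * ln (INR q) <= (4 * INR K + 48) * exp (INR K)).
    { rewrite Ia. apply Rmult_le_compat_l; lra. }
    apply Rle_trans with (P * exp (2 - 2 * INR K) * ((4 * INR K + 48) * exp (INR K))).
    - apply Rmult_le_compat_l; [assumption|lra].
    - replace (P * exp (-36) / 16) with (P * exp (2 - 2 * INR K) * (exp (2 * INR K - 38) / 16)).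
      + apply Rmult_le_compat_l; [assumption|].
        replace (2 * INR K - 38) with (INR K + INR K + - 38) by ring. rewrite !exp_plus.
        assert (E38 : exp (-38) * exp 38 = 1) by (rewrite <- exp_plus; replace (-38 + 38) with 0 by ring; apply exp_0).
        pose proof (exp_pos (INR K)) as PK. pose proof (exp_pos (-38)) as P38.
        assert (T : (4 * INR K + 48) <= exp (INR K) * exp (-38) / 16).
        { apply Rmult_le_compat_r with (r := exp (-38) / 16) in HK0; [|lra].
          replace ((16 * exp 38 * 48 + 16 * exp 38 * 4 * INR K) * (exp (-38) / 16)) with ((4 * INR K + 48) * (exp (-38) * exp 38)) in HK0 by field.
          rewrite E38 in HK0. lra. }
        nra.
      + replace (-36) with ((2 - 2 * INR K) + (2 * INR K - 38)) by ring. rewrite exp_plus. field. }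
  assert (S3 : rsum g3 N <= P * exp (-36) / 16).
  { unfold g3. replace N with (NX + (N - NX))%nat by lia. rewrite rsum_split. rewrite rsum_zero.
    2: { intros k Hk. destruct (Nat.ltb_spec NX (S k)); [lia|reflexivity]. }
    rewrite Rplus_0_l.
    set (E := exp (2 * INR K + 24)) in *.
    assert (PE : 0 < E) by apply exp_pos.
    apply Rle_trans with (rsum (fun k => (P * exp (-48) * E) * (Lambda (S NX + k) / INR (S NX + k) ^ 2)) (N - NX)).
    - apply rsum_le. intros k _. change (S NX + k)%nat with (S (NX + k)). set (n := S (NX + k)).
      destruct (Nat.ltb_spec NX n); [|unfold n in *; lia]. simpl when.
      assert (In : E <= INR n).
      { apply le_INR in H. rewrite S_INR in H. lra. }
      pose proof (weight_tail K HK100 n In) as T. fold E P w in T.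
      replace (P * exp (-48) * E * (Lambda n / INR n ^ 2)) with (Lambda n * (P * exp (-48) * E / INR n ^ 2)) by (unfold Rdiv; ring).
      apply Rmult_le_compat_l; [apply Lambda_nonneg|exact T].
    - rewrite rsum_scal.
      pose proof (Lambda_sq_tail (S NX) (N - NX) ltac:(lia)) as T. rewrite S_INR in T.
      assert (P48 : 0 <= P * exp (-48) * E) by (apply Rmult_le_pos; [apply Rmult_le_pos; [lra|left; apply exp_pos]|lra]).
      apply Rle_trans with (P * exp (-48) * E * (12 / E)).
      + apply Rmult_le_compat_l; [assumption|]. eapply Rle_trans; [exact T|].
        apply Rmult_le_compat_l; [lra|]. apply Rinv_le_contravar; lra.
      + replace (P * exp (-48) * E * (12 / E)) with (P * (12 * exp (-48))) by (field; lra).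
        replace (P * exp (-36) / 16) with (P * (exp (-36) / 16)) by (unfold Rdiv; ring). apply Rmult_le_compat_l; [lra|].
        replace (-36) with (-48 + 12) by ring. rewrite exp_plus.
        pose proof (exp_nat_lower 12) as Y. replace (INR 12) with 12 in Y by (simpl; ring). simpl in Y. pose proof (exp_pos (-48)). nra. }
  assert (Fin : rsum g1 N <= rsum (fun k => Lambda (S k) * Re (chi (S k)) * w (S k)) N + rsum g2 N + rsum g3 N).
  { rewrite <- !rsum_plus. apply rsum_le. intros k _. apply Pt. }
  unfold Rdiv in *. lra.
Qed.

(** * The contribution of the zeros *)

Lemma clsum_re_ge (f : C -> C) (g : C -> R) zs : (forall r, In r zs -> - Re (f r) <= g r) -> - Re (clsum f zs) <= rlsum g zs.
Proof.
  intros H. induction zs as [|x zs IH]; [simpl; lra|]. simpl clsum. simpl rlsum.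
  change (Re (f x + clsum f zs)%C) with (Re (f x) + Re (clsum f zs)).
  pose proof (H x (or_introl eq_refl)). assert (- Re (clsum f zs) <= rlsum g zs) by (apply IH; intros; apply H; now right). lra.
Qed.

Lemma rlsum_scal c (g : C -> R) zs : rlsum (fun r => c * g r) zs = c * rlsum g zs.
Proof. induction zs as [|x zs IH]; simpl; [ring|rewrite IH; ring]. Qed.

Lemma holo_pole_pair R0 rho z : Cmod z <> Cmod rho -> Cmod rho < R0 -> Cmod z <= R0 -> holo (fun z => pole_pair R0 z rho) z.
Proof.
  intros H1 H2 H3. pose proof (Cmod_ge_0 rho).
  assert (NR : RtoC R0 <> 0%C) by (apply RtoC_neq; lra).
  apply holo_plus.
  - apply holo_inv; [apply Cminus_neq, Cmod_neq, H1|]. apply holo_minus; [apply holo_id|apply holo_const].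
  - apply holo_div; [|apply holo_const|apply holo_minus; [apply holo_const|apply holo_mult; [apply holo_const|apply holo_id]]].
    pose proof (blaschke_den R0 rho z H2 H3) as P. intros E.
    replace (R0 * R0 - Cconj rho * z)%C with (R0 * R0 * (1 - Cconj rho / (R0 * R0) * z))%C in P by (field; assumption).
    rewrite E, Cmult_0_r, Cmod_0 in P. lra.
Qed.

(** Both poles lie outside the unit circle. *)
Lemma coef_pole_pair R0 rho m : 1 < Cmod rho -> Cmod rho < R0 ->
  coef (fun z => pole_pair R0 z rho) m 1 = (- / rho ^ S m + (Cconj rho / (R0 * R0)) ^ S m)%C.
Proof.
  intros H1 H2. unfold pole_pair.
  assert (NR : RtoC R0 <> 0%C) by (apply RtoC_neq; lra).
  assert (Hb : Cmod (Cconj rho / (R0 * R0))%C * 1 < 1).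
  { rewrite Rmult_1_r, Cmod_div, Cmod_conj, Cmod_mult, Cmod_R, Rabs_pos_eq by (try lra; now apply Cmult_neq_0).
    apply Rmult_lt_reg_r with (R0 * R0); [nra|]. unfold Rdiv. rewrite Rmult_assoc, Rinv_l by nra. nra. }
  rewrite coef_plus; [|lra| |].
  - rewrite coef_simple_pole, coef_outer_pole by lra. reflexivity.
  - intros z Hz. apply holo_inv; [apply Cminus_neq, Cmod_neq; lra|]. apply holo_minus; [apply holo_id|apply holo_const].
  - intros z Hz. apply holo_div; [|apply holo_const|apply holo_minus; [apply holo_const|apply holo_mult; [apply holo_const|apply holo_id]]].
    apply Cmod_gt_0. pose proof (Cmod_triangle_rev_sub 1 (Cconj rho / (R0 * R0) * z)%C) as T.
    rewrite Cmod_1, Cmod_mult, Hz in T. lra.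
Qed.

Lemma coef_clsum R0 zs m : (forall rho, In rho zs -> 1 < Cmod rho < R0) ->
  coef (fun z => clsum (pole_pair R0 z) zs) m 1 = clsum (fun rho => - / rho ^ S m + (Cconj rho / (R0 * R0)) ^ S m)%C zs /\
  forall z, Cmod z = 1 -> holo (fun z => clsum (pole_pair R0 z) zs) z.
Proof.
  intros H. induction zs as [|rho zs IH].
  - simpl. split; [|intros; apply (holo_const 0%C)]. unfold coef.
    transitivity (circ (fun _ => 0%C) 1); [|apply circ_const]. apply circ_ext; [lra|]. intros z _. unfold Cdiv. ring.
  - destruct IH as [I1 I2]; [intros; apply H; now right|].
    pose proof (H rho (or_introl eq_refl)) as Hr.
    assert (D : forall z, Cmod z = 1 -> holo (fun z => pole_pair R0 z rho) z) by (intros z Hz; apply holo_pole_pair; lra).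
    split.
    + simpl. rewrite coef_plus, coef_pole_pair, I1 by (assumption || lra). reflexivity.
    + intros z Hz. simpl. apply holo_plus; [now apply D|now apply I2].
Qed.

Lemma bernoulli y n : 0 <= y -> 1 + INR n * y <= (1 + y) ^ n.
Proof.
  intros Hy. induction n as [|n IH]; [simpl; lra|]. rewrite S_INR. simpl. pose proof (pos_INR n).
  assert (0 <= INR n * y) by (apply Rmult_le_pos; lra). nra.
Qed.

Section ZeroEstimates.
Variables (K : nat) (delta : R).
Hypothesis (HK : (100 <= K)%nat) (Hdel : 0 < delta < 1 / 2).
Let kap := INR K.
Let m := (2 * K * K)%nat.
Let R1 := kap + 9 / 10.

(** The square of the modulus is raised to the power [K^2], and Bernoulli's inequality turns the ordinate [g]
    into a factor [1 + g^2 / 4]. This uniform decay is what Jensen's inequality can sum. *)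
Lemma zero_power_bound (x g : R) : 0 < x -> (kap + delta) ^ 2 + g ^ 2 <= x ^ 2 ->
  / x ^ S m <= / (kap + delta) ^ S m * / (1 + g ^ 2 / 4).
Proof.
  intros Hx H. pose proof (K_ge_100 K HK) as Kp. fold kap in Kp.
  set (D := kap + delta) in *. assert (HD : 100 < D) by (unfold D; lra).
  assert (Xd : D <= x) by nra.
  assert (E : (x ^ 2) ^ (K * K) = x ^ m) by (rewrite <- pow_mult; f_equal; unfold m; lia).
  assert (E' : (D ^ 2) ^ (K * K) = D ^ m) by (rewrite <- pow_mult; f_equal; unfold m; lia).
  assert (D2 : 0 < D ^ 2) by (apply pow_lt; lra).
  assert (G0 : 0 <= g ^ 2) by apply pow2_ge_0.
  assert (Y : 0 <= g ^ 2 / D ^ 2) by (apply Rmult_le_pos; [assumption|left; now apply Rinv_0_lt_compat]).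
  assert (P1 : D ^ m * (1 + g ^ 2 / 4) <= x ^ m).
  { rewrite <- E, <- E'. apply Rle_trans with ((D ^ 2) ^ (K * K) * (1 + g ^ 2 / D ^ 2) ^ (K * K)).
    - apply Rmult_le_compat_l; [apply pow_le; lra|].
      eapply Rle_trans; [|apply bernoulli; assumption]. apply Rplus_le_compat_l. rewrite mult_INR. fold kap.
      replace (kap * kap * (g ^ 2 / D ^ 2)) with (g ^ 2 * (kap ^ 2 / D ^ 2)) by (field; lra).
      apply Rmult_le_compat_l; [assumption|]. apply Rmult_le_reg_r with (D ^ 2); [assumption|].
      replace (kap ^ 2 / D ^ 2 * D ^ 2) with (kap ^ 2) by (field; lra). unfold D. nra.
    - rewrite <- Rpow_mult_distr. apply pow_incr. split; [nra|].
      replace (D ^ 2 * (1 + g ^ 2 / D ^ 2)) with (D ^ 2 + g ^ 2) by (field; lra). assumption. }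
  rewrite <- Rinv_mult. apply Rinv_le_contravar.
  - apply Rmult_lt_0_compat; [apply pow_lt; lra|lra].
  - simpl. rewrite Rmult_assoc. assert (0 < D ^ m) by (apply pow_lt; lra).
    apply Rmult_le_compat; try lra. apply Rmult_le_pos; lra.
Qed.

(** The point [p = 2 - K] corresponds to [s = 3]. Both [R1^2 - |p|^2] and [R1^2 - |rho|^2] are of the order of
    [K], and the denominator has modulus [O(K (1 + |g|))], because the conjugate of [rho] is within [O(1 +
    |g|)] of [p]. *)
Lemma bdefect_at_three (rho : C) : Cmod rho < kap + 7 / 10 -> Re rho <= - kap ->
  / (1 + Im rho ^ 2 / 4) <= 145 * bdefect R1 rho (RtoC (2 - kap)).
Proof.
  intros H1 H2. pose proof (K_ge_100 K HK) as Kp. fold kap in Kp.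
  set (g := Im rho) in *. set (p := 2 - kap).
  assert (Mp : Cmod (RtoC p) = kap - 2) by (rewrite Cmod_R, Rabs_left by (unfold p; lra); unfold p; ring).
  pose proof (Cmod_ge_0 rho) as P0. pose proof (Rabs_pos g) as Pg.
  pose proof (blaschke_den R1 rho (RtoC p) ltac:(unfold R1; lra) ltac:(unfold R1; lra)) as Dp.
  assert (Du : Cmod (R1 * R1 - Cconj rho * p)%C <= kap * (17 / 2 + Rabs g)).
  { replace (R1 * R1 - Cconj rho * p)%C with (RtoC (R1 * R1 - p * p) - p * (Cconj rho - p))%C
      by (rewrite RtoC_minus, !RtoC_mult; ring).
    eapply Rle_trans; [apply Cmod_triangle_sub|]. rewrite Cmod_mult, Mp, Cmod_R.
    assert (A1 : Rabs (R1 * R1 - p * p) <= kap * (58 / 10)).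
    { rewrite Rabs_pos_eq; unfold R1, p; nra. }
    assert (A2 : Cmod (Cconj rho - p)%C <= 27 / 10 + Rabs g).
    { eapply Rle_trans; [apply Cmod_le_abs|]. pose proof (re_le_Cmod rho) as Rr. apply Rabs_le_between in Rr.
      change (Re (Cconj rho - p)%C) with (Re rho - p). change (Im (Cconj rho - p)%C) with (- Im rho - 0).
      fold g. replace (- g - 0) with (- g) by ring. rewrite Rabs_Ropp. apply Rplus_le_compat_r.
      apply Rabs_le. unfold p. lra. }
    assert ((kap - 2) * Cmod (Cconj rho - p)%C <= kap * (27 / 10 + Rabs g)) by (apply Rmult_le_compat; try lra; apply Cmod_ge_0).
    lra. }
  assert (N : kap ^ 2 <= (R1 ^ 2 - Cmod (RtoC p) ^ 2) * (R1 ^ 2 - Cmod rho ^ 2)).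
  { rewrite Mp.
    assert (B1 : 5 / 2 * kap <= R1 ^ 2 - (kap - 2) ^ 2) by (unfold R1; nra).
    assert (B2 : 2 / 5 * kap <= R1 ^ 2 - Cmod rho ^ 2).
    { assert (Cmod rho ^ 2 <= (kap + 7 / 10) ^ 2) by nra. unfold R1. nra. }
    replace (kap ^ 2) with ((5 / 2 * kap) * (2 / 5 * kap)) by field. apply Rmult_le_compat; nra. }
  unfold bdefect. set (Dn := Cmod (R1 * R1 - Cconj rho * p)%C) in *.
  assert (Q : Dn ^ 2 <= kap ^ 2 * (145 * (1 + g ^ 2 / 4))).
  { apply Rle_trans with ((kap * (17 / 2 + Rabs g)) ^ 2); [nra|]. rewrite Rpow_mult_distr.
    apply Rmult_le_compat_l; [nra|]. rewrite <- (pow2_abs g). nra. }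
  assert (G4 : 0 < 1 + g ^ 2 / 4) by (pose proof (pow2_ge_0 g); lra).
  apply Rmult_le_reg_r with (Dn ^ 2 * (1 + g ^ 2 / 4)); [apply Rmult_lt_0_compat; [apply pow_lt|]; lra|].
  replace (/ (1 + g ^ 2 / 4) * (Dn ^ 2 * (1 + g ^ 2 / 4))) with (Dn ^ 2) by (field; lra).
  set (NN := (R1 ^ 2 - Cmod (RtoC p) ^ 2) * (R1 ^ 2 - Cmod rho ^ 2)) in *.
  replace (145 * (NN / Dn ^ 2) * (Dn ^ 2 * (1 + g ^ 2 / 4))) with (NN * (145 * (1 + g ^ 2 / 4))) by (field; lra).
  eapply Rle_trans; [exact Q|]. apply Rmult_le_compat_r; lra.
Qed.

(** The mirrored pole lies at distance at least [R1] from 0, so it is bounded like the zero itself; the real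
    zero [- K], which would be too close, has the good sign. *)
Lemma zero_term_bound (rho : C) : Cmod rho < kap + 7 / 10 ->
  Re rho <= - (kap + delta) \/ rho = RtoC (- kap) ->
  Re (/ rho ^ S m - (Cconj rho / (R1 * R1)) ^ S m)%C <= (290 / (kap + delta) ^ S m) * bdefect R1 rho (RtoC (2 - kap)).
Proof.
  intros H1 H2. pose proof (K_ge_100 K HK) as Kp. fold kap in Kp.
  set (D := kap + delta) in *. assert (HD : 0 < D) by (unfold D; lra).
  assert (PD : 0 < D ^ S m) by now apply pow_lt.
  pose proof (Cmod_ge_0 rho) as P0.
  assert (HR1 : 0 < R1) by (unfold R1; lra).
  assert (NR : RtoC R1 <> 0%C) by (apply RtoC_neq; lra).
  set (g := Im rho).
  assert (Rk : Re rho <= - kap).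
  { destruct H2 as [H2| ->]; [unfold D in H2; lra|simpl; lra]. }
  pose proof (bdefect_at_three rho H1 Rk) as BD. fold g in BD.
  pose proof (Cmod2_alt rho) as M2. fold g in M2.
  assert (Nz : rho <> 0%C) by (intros E; rewrite E in Rk; simpl in Rk; lra).
  assert (Mpos : 0 < Cmod rho) by now apply Cmod_gt_0.
  set (beta := / D ^ S m * / (1 + g ^ 2 / 4)).
  assert (Hbeta : 2 * beta <= 290 / D ^ S m * bdefect R1 rho (RtoC (2 - kap))).
  { unfold beta. replace (290 / D ^ S m * bdefect R1 rho (RtoC (2 - kap))) with (2 * (/ D ^ S m * (145 * bdefect R1 rho (RtoC (2 - kap))))) by (field; lra).
    apply Rmult_le_compat_l; [lra|]. apply Rmult_le_compat_l; [left; now apply Rinv_0_lt_compat|assumption]. }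
  assert (R2 : D ^ 2 + g ^ 2 <= R1 ^ 2).
  { destruct H2 as [H2|H2].
    - assert (Cmod rho ^ 2 <= R1 ^ 2) by (unfold R1; nra).
      assert (D ^ 2 <= Re rho ^ 2) by nra. lra.
    - assert (Z : g = 0) by (unfold g; rewrite H2; reflexivity). rewrite Z. unfold D, R1. nra. }
  assert (Tb : Rabs (Re ((Cconj rho / (R1 * R1)) ^ S m)%C) <= beta).
  { eapply Rle_trans; [apply re_le_Cmod|]. rewrite Cmod_pow, Cmod_div, Cmod_conj, Cmod_mult, Cmod_R, Rabs_pos_eq by (try lra; now apply Cmult_neq_0).
    eapply Rle_trans; [|apply (zero_power_bound R1 g HR1 R2)]. rewrite <- pow_inv. apply pow_incr. split.
    - apply Rmult_le_pos; [lra|]. left. apply Rinv_0_lt_compat. nra.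
    - apply Rmult_le_reg_r with (R1 * R1); [nra|]. unfold Rdiv. rewrite Rmult_assoc, Rinv_l by nra.
      replace (/ R1 * (R1 * R1)) with R1 by (field; lra). unfold R1. lra. }
  assert (Ta : Re (/ rho ^ S m)%C <= beta).
  { destruct H2 as [H2|H2].
    - eapply Rle_trans; [apply Rle_abs|]. eapply Rle_trans; [apply re_le_Cmod|].
      rewrite Cmod_inv, Cmod_pow by now apply Cpow_nz.
      apply zero_power_bound; [assumption|]. fold D. assert (D ^ 2 <= Re rho ^ 2) by nra. lra.
    - assert (E : (/ rho ^ S m)%C = RtoC (- / kap ^ S m)).
      { rewrite H2. rewrite <- RtoC_pow, <- RtoC_inv by (apply pow_nonzero; lra). f_equal.
        replace (- kap) with (-1 * kap) by ring. rewrite Rpow_mult_distr.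
        replace ((-1) ^ S m) with (-1).
        - field. apply pow_nonzero; lra.
        - simpl. unfold m. replace (2 * K * K)%nat with (2 * (K * K))%nat by lia. rewrite pow_1_even. ring. }
      rewrite E. change (- / kap ^ S m <= beta).
      assert (0 < / kap ^ S m) by (apply Rinv_0_lt_compat, pow_lt; lra).
      assert (0 < beta) by (unfold beta; apply Rmult_lt_0_compat; [now apply Rinv_0_lt_compat|apply Rinv_0_lt_compat; pose proof (pow2_ge_0 g); lra]).
      clear - H H0. lra. }
  apply Rabs_le_between in Tb.
  change (Re (/ rho ^ S m - (Cconj rho / (R1 * R1)) ^ S m)%C) with (Re (/ rho ^ S m)%C - Re ((Cconj rho / (R1 * R1)) ^ S m)%C). lra.
Qed.

(** The ratio of the two radii is [1 - c / K] with exponent [2 K^2], which beats the factor [S m]. *)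
Lemma regular_part_bound Lg : 0 <= Lg -> 2 * INR (S m) * Lg / (kap + 6 / 10) ^ S m <= 2400 * Lg / (kap + delta) ^ S m.
Proof.
  intros HL. pose proof (K_ge_100 K HK) as Kp. fold kap in Kp.
  set (D := kap + delta). assert (HD : 0 < D) by (unfold D; lra).
  assert (PD : 0 < D ^ S m) by now apply pow_lt.
  assert (P6 : 0 < (kap + 6 / 10) ^ S m) by (apply pow_lt; lra).
  assert (Ik : INR (S m) = 2 * kap ^ 2 + 1) by (rewrite S_INR; unfold m; rewrite (INR_order K); reflexivity).
  assert (Rt : (D / (kap + 6 / 10)) ^ S m <= exp (- (kap / 10))).
  { assert (Q : 0 < D / (kap + 6 / 10)) by (apply Rdiv_lt_0_compat; lra).
    rewrite (pow_exp_ln _ _ Q). apply exp_le. rewrite Ik.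
    pose proof (ln_le_sub1 _ Q) as X.
    assert (X2 : D / (kap + 6 / 10) - 1 <= - (/ 10 / (kap + 6 / 10))).
    { apply Rmult_le_reg_r with (kap + 6 / 10); [lra|]. field_simplify; [|lra|lra]. unfold D. lra. }
    apply Rle_trans with ((2 * kap ^ 2 + 1) * - (/ 10 / (kap + 6 / 10))); [apply Rmult_le_compat_l; nra|].
    replace ((2 * kap ^ 2 + 1) * - (/ 10 / (kap + 6 / 10))) with (- ((2 * kap ^ 2 + 1) / (kap + 6 / 10)) / 10) by (field; lra).
    assert (kap <= (2 * kap ^ 2 + 1) / (kap + 6 / 10)).
    { apply Rmult_le_reg_r with (kap + 6 / 10); [lra|]. unfold Rdiv. rewrite Rmult_assoc, Rinv_l by lra. nra. }
    lra. }
  assert (Ek : INR (S m) * exp (- (kap / 10)) <= 1200).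
  { rewrite Ik, exp_Ropp. pose proof (exp_pos (kap / 10)) as Pe.
    apply Rmult_le_reg_r with (exp (kap / 10)); [assumption|]. rewrite Rmult_assoc, Rinv_l by lra.
    replace (kap / 10) with (kap / 20 + kap / 20) by field. rewrite exp_plus.
    pose proof (exp_ineq1_le (kap / 20)) as Y.
    assert ((1 + kap / 20) * (1 + kap / 20) <= exp (kap / 20) * exp (kap / 20)) by (apply Rmult_le_compat; lra). nra. }
  assert (Z : INR (S m) * (D / (kap + 6 / 10)) ^ S m <= 1200).
  { eapply Rle_trans; [apply Rmult_le_compat_l; [apply pos_INR|exact Rt]|exact Ek]. }
  unfold Rdiv in Z. rewrite Rpow_mult_distr, pow_inv in Z.
  apply Rmult_le_reg_r with (D ^ S m); [assumption|].
  replace (2400 * Lg / D ^ S m * D ^ S m) with (2 * Lg * 1200) by (field; lra).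
  replace (2 * INR (S m) * Lg / (kap + 6 / 10) ^ S m * D ^ S m) with (2 * Lg * (INR (S m) * (D ^ S m * / (kap + 6 / 10) ^ S m))) by (field; lra).
  apply Rmult_le_compat_l; lra.
Qed.

Lemma growth_lower : exp (2 * delta * kap - 1) <= ((kap + delta) / kap) ^ S m.
Proof.
  pose proof (K_ge_100 K HK) as Kp. fold kap in Kp.
  replace ((kap + delta) / kap) with (1 + delta / kap) by (field; lra).
  assert (Hy : 0 < delta / kap) by (apply Rdiv_lt_0_compat; lra).
  apply Rle_trans with ((1 + delta / kap) ^ m).
  - rewrite (pow_exp_ln (1 + delta / kap)) by lra. apply exp_le. unfold m. rewrite (INR_order K). fold kap.
    pose proof (ln1p_lower (delta / kap) ltac:(lra)) as X.
    apply Rle_trans with (2 * kap ^ 2 * (delta / kap - (delta / kap) ^ 2)); [|apply Rmult_le_compat_l; nra].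
    replace (2 * kap ^ 2 * (delta / kap - (delta / kap) ^ 2)) with (2 * delta * kap - 2 * delta ^ 2) by (field; lra). nra.
  - simpl. assert (0 < (1 + delta / kap) ^ m) by (apply pow_lt; lra). nra.
Qed.
End ZeroEstimates.

(** * The Taylor coefficient bounded through the zeros *)

Section ShiftedL.
Variables (q : nat) (chi : nat -> C) (L L' : C -> C) (K : nat) (delta : R).
Hypothesis (Hchi : is_dirichlet_character q chi) (Hnp : ~ is_principal q chi).
Hypothesis HL : forall z, cder L z (L' z).
Hypothesis Hser : forall s, 1 < Re s -> dlim chi s (L s).
Hypothesis Hzf : forall s, 1 - delta < Re s < 1 -> L s <> 0%C.
Hypothesis (HK : (100 <= K)%nat) (Hdel : 0 < delta < 1 / 2).
Let kap := INR K.
Let m := (2 * K * K)%nat.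
Let s0 := kap + 1.
(* [860 = 43 * 20]: the bound on the circle of radius [K + 95/100], times the loss in passing to the disc. *)
Let B := 860 * INR q * (kap + 1) ^ 2.
Let Lg := ln (2 * B).

(** By the Euler product no zero [s] has real part above 1, by the 3-4-1 inequality none but [s = 1] has real
    part 1, and the strip is excluded by hypothesis. *)
Lemma zero_location rho : L (RtoC s0 + rho)%C = 0%C -> Re rho <= - (kap + delta) \/ rho = RtoC (- kap).
Proof.
  intros Z. set (s := (s0 + rho)%C) in *. assert (Es : Re s = kap + 1 + Re rho) by reflexivity.
  assert (Ei : Im s = Im rho) by (change (0 + Im rho = Im rho); ring).
  destruct (Rlt_dec 1 (Re s)) as [H|H].
  - exfalso. exact (dirichlet_nonzero chi s (L s) (dchar_cmult q chi Hchi) H (Hser s H) Z).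
  - destruct (Req_dec (Re s) 1) as [E|E].
    + destruct (Req_dec (Im rho) 0) as [F|F].
      * right. apply Ceq_re_im; simpl; lra.
      * exfalso. apply (line_one_nonzero q chi L Hchi (fun z => ex_intro _ _ (HL z)) Hser (Im rho) F).
        rewrite <- Z. f_equal. apply Ceq_re_im; [rewrite E; reflexivity|rewrite Ei; reflexivity].
    + left. destruct (Rlt_dec (1 - delta) (Re s)) as [G|G].
      * exfalso. apply (Hzf s); [lra|assumption].
      * lra.
Qed.

Lemma modulus_ge_1 : 1 <= INR q.
Proof. apply INR_ge1, (dchar_modulus_pos _ _ Hchi). Qed.

(** On this circle [Re s] is at least [1/20] and [|s|] at most [2 (K + 1)], and [1 + 2 (K + 1) 21 <= 43 (K +
    1)]. *)
Lemma dpart_bound_circle N z : Cmod z = kap + 95 / 100 -> Cmod (dpart chi (RtoC s0 + z)%C N) <= 43 * INR q * (kap + 1).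
Proof.
  intros Hz. pose proof (K_ge_100 K HK) as Kp. fold kap in Kp. pose proof modulus_ge_1 as Hq.
  pose proof (re_le_Cmod z) as R. rewrite Hz in R. apply Rabs_le_between in R.
  assert (Rs : 5 / 100 <= Re (RtoC s0 + z)%C) by (change (Re (RtoC s0 + z)%C) with (s0 + Re z); unfold s0; lra).
  eapply Rle_trans; [apply (abel_bound chi _ (INR q)); [lra|lra|]|].
  - intros n. apply (periodic_partial_bound chi q (dchar_modulus_pos _ _ Hchi) (dchar_periodic _ _ Hchi) (dchar_le_1 q chi Hchi)).
    exact (dchar_sum_zero q chi Hchi Hnp).
  - assert (A1 : Cmod (RtoC s0 + z)%C <= 2 * (kap + 1)).
    { eapply Rle_trans; [apply Cmod_triangle|]. rewrite Hz, Cmod_R, Rabs_pos_eq; unfold s0; lra. }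
    assert (A2 : / Re (RtoC s0 + z)%C <= 20).
    { replace 20 with (/ (5 / 100)) by field. apply Rinv_le_contravar; lra. }
    assert (A3 : 0 < / Re (RtoC s0 + z)%C) by (apply Rinv_0_lt_compat; lra).
    assert (A4 : Cmod (RtoC s0 + z)%C * (1 + / Re (RtoC s0 + z)%C) <= 2 * (kap + 1) * 21).
    { apply Rmult_le_compat; try lra. apply Cmod_ge_0. }
    replace (43 * INR q * (kap + 1)) with (INR q * (43 * (kap + 1))) by ring. apply Rmult_le_compat_l; lra.
Qed.

(** The circle of radius [K + 95/100] leaves a margin [1/20] to the disc, whence the factor [20 (K + 1)]. *)
Lemma L_disc_bound w : Cmod w <= kap + 9 / 10 -> Cmod (L (RtoC s0 + w)%C) <= B.
Proof.
  intros Hw. pose proof (K_ge_100 K HK) as Kp. fold kap in Kp. pose proof modulus_ge_1 as Hq.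
  assert (P : 0 <= 43 * INR q * (kap + 1)) by (apply Rmult_le_pos; lra).
  eapply Rle_trans.
  - apply (limit_bound_disc (fun z => L (RtoC s0 + z)%C) (fun n z => dpart chi (RtoC s0 + z)%C (S n)) (kap + 95 / 100) (43 * INR q * (kap + 1))).
    + lra.
    + exact P.
    + intros z. apply holo_shift. eexists. apply HL.
    + intros n z. apply (holo_shift (fun s => dpart chi s (S n))), holo_dpart.
    + intros eps He. destruct (INR_unbounded (/ eps)) as [n Hn]. exists n. intros z Hz.
      assert (3 <= Re (RtoC s0 + z)%C).
      { change (Re (RtoC s0 + z)%C) with (s0 + Re z). pose proof (re_le_Cmod z) as R. rewrite Hz in R. apply Rabs_le_between in R. unfold s0; lra. }
      eapply Rle_trans; [apply (L_tail q chi L Hchi Hser); [assumption|lia]|].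
      rewrite S_INR. rewrite <- (Rinv_inv eps). pose proof (Rinv_0_lt_compat _ He). apply Rinv_le_contravar; lra.
    + intros n z Hz. now apply dpart_bound_circle.
    + lra.
  - unfold B. replace (860 * INR q * (kap + 1) ^ 2) with (43 * INR q * (kap + 1) * (20 * (kap + 1))) by ring.
    apply Rmult_le_compat_l; [exact P|].
    apply Rmult_le_reg_r with (kap + 95 / 100 - Cmod w); [lra|]. unfold Rdiv at 1. rewrite Rmult_assoc, Rinv_l by lra. nra.
Qed.

Lemma B_large : 1 <= B.
Proof.
  pose proof (K_ge_100 K HK) as Kp. fold kap in Kp. pose proof modulus_ge_1 as Hq. unfold B.
  assert (1 <= (kap + 1) ^ 2) by nra. nra.
Qed.

Lemma Lg_nonneg : 0 <= Lg.
Proof. pose proof B_large. unfold Lg. rewrite <- ln_1. apply ln_le; lra. Qed.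

(** Zeros below [K + 7/10] are removed with Blaschke factors of radius [K + 9/10]; the quotient is then
    zero-free on a disc larger than that of radius [K + 6/10], which still exceeds [K + delta] by a constant. *)
Lemma log_deriv_coef_upper :
  - Re (coef (fun z => L' (RtoC s0 + z) / L (RtoC s0 + z))%C m 1) <= 3000 * Lg / (kap + delta) ^ S m.
Proof.
  pose proof (K_ge_100 K HK) as Kp. fold kap in Kp. pose proof B_large as HB. pose proof Lg_nonneg as HLg.
  set (R1 := kap + 9 / 10). set (r1 := kap + 7 / 10). set (p := RtoC (2 - kap)).
  assert (Mp : Cmod p = kap - 2) by (unfold p; rewrite Cmod_R, Rabs_left; lra).
  assert (Df : forall z, cder (fun z => L (RtoC s0 + z)%C) z (L' (RtoC s0 + z)%C)) by (intros z; apply cder_shift, HL).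
  assert (Right : forall z, 2 - kap <= Re z -> 1 / 2 <= Cmod (L (RtoC s0 + z)%C)).
  { intros z Hz. apply (L_right_bound q chi L Hchi Hser). change (Re (RtoC s0 + z)%C) with (s0 + Re z). unfold s0. lra. }
  assert (Fp : 1 / 2 <= Cmod (L (RtoC s0 + p)%C)) by (apply Right; unfold p; simpl; lra).
  destruct (factor_zeros R1 r1 p B ltac:(unfold R1, r1; lra) ltac:(unfold R1; lra) ltac:(lra)
    (fun z => L (RtoC s0 + z)%C) (fun z => L' (RtoC s0 + z)%C) Df) as (zs & g & g' & Dg & Ng & Bg & Hzs & Pf & Lf).
  { apply Cmod_gt_0. lra. }
  { intros z Hz. apply L_disc_bound. unfold R1 in Hz. lra. }
  assert (Loc : forall rho, In rho zs -> Re rho <= - (kap + delta) \/ rho = RtoC (- kap)).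
  { intros rho Hr. apply zero_location. exact (proj1 (Hzs rho Hr)). }
  assert (Big : forall rho, In rho zs -> 1 < Cmod rho < R1).
  { intros rho Hr. destruct (Hzs rho Hr) as [_ U]. pose proof (re_le_Cmod rho) as R. apply Rabs_le_between in R.
    split; [|unfold R1, r1 in *; lra].
    destruct (Loc rho Hr) as [H|H]; [lra|]. rewrite H in R |- *. simpl in R. lra. }
  assert (In1 : forall z, Cmod z < R1 -> Cmod (g z) <= B).
  { intros z Hz. apply (max_modulus g (R1 + 1) R1 B); try assumption; try (unfold R1; lra). intros y _. eexists; apply Dg. }
  assert (J : rlsum (fun rho => bdefect R1 rho p) zs <= 2 * Lg).
  { eapply Rle_trans; [apply (jensen_count R1 p zs (Cmod (L (RtoC s0 + p)%C)) (Cmod (g p)) B)|].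
    - intros rho Hr. apply (Big rho Hr).
    - unfold R1; lra.
    - lra.
    - split; [apply Cmod_ge_0|]. apply In1. unfold R1; lra.
    - apply Pf. unfold R1; lra.
    - apply Rmult_le_compat_l; [lra|]. unfold Lg. apply ln_le; [apply Rdiv_lt_0_compat; lra|].
      unfold Rdiv. rewrite (Rmult_comm 2). apply Rmult_le_compat_l; [lra|].
      replace 2 with (/ (1 / 2)) by field. apply Rinv_le_contravar; lra. }
  assert (G0 : 1 / 2 <= Cmod (g 0%C)).
  { assert (C0 : Cmod 0%C <= R1) by (rewrite Cmod_0; unfold R1; lra).
    pose proof (Pf 0%C C0) as E. cbv beta in E.
    pose proof (Right 0%C ltac:(simpl; lra)) as F0.
    destruct (blaschke_prod_bound R1 0%C zs (fun r H => proj2 (Big r H)) C0) as [[P1 P2] _].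
    pose proof (Cmod_ge_0 (g 0%C)). nra. }
  assert (Reg : Cmod (coef (fun z => g' z / g z)%C m (kap + 6 / 10)) <= 2400 * Lg / (kap + delta) ^ S m).
  { eapply Rle_trans; [apply (log_deriv_coef_bound g g' r1 Lg m (kap + 6 / 10))|].
    - unfold r1; lra.
    - intros; apply Dg.
    - exact Ng.
    - intros z Hz. unfold Lg. rewrite exp_ln by lra. pose proof (In1 z ltac:(unfold R1, r1 in *; lra)). nra.
    - exact (regular_part_bound K delta HK Hdel Lg HLg). }
  assert (Cg : forall z, Cmod z < r1 -> holo (fun z => g' z / g z)%C z).
  { intros z Hz. apply holo_div; [now apply Ng| |eexists; apply Dg].
    apply (holo_deriv g g' r1); [intros; apply Dg|assumption]. }
  assert (Ecoef : coef (fun z => L' (RtoC s0 + z) / L (RtoC s0 + z))%C m 1 =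
    (clsum (fun rho => - / rho ^ S m + (Cconj rho / (R1 * R1)) ^ S m)%C zs + coef (fun z => g' z / g z)%C m (kap + 6 / 10))%C).
  { destruct (coef_clsum R1 zs m Big) as [E1 E2].
    rewrite <- E1. rewrite <- (coef_invariant (fun z => g' z / g z)%C m 1 (kap + 6 / 10) r1); try (unfold r1; lra).
    2: { intros z Hz. apply Cg. lra. }
    rewrite <- coef_plus; [|lra|exact E2|intros z Hz; apply Cg; unfold r1; lra].
    apply coef_ext; [lra|]. intros z Hz. apply Lf; [unfold R1; lra|].
    apply Cmod_gt_0. pose proof (re_le_Cmod z) as R. rewrite Hz in R. apply Rabs_le_between in R.
    pose proof (Right z ltac:(lra)). lra. }
  rewrite Ecoef.
  match goal with |- - Re (?a + ?b)%C <= _ => change (Re (a + b)%C) with (Re a + Re b) end.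
  pose proof (re_le_Cmod (coef (fun z => g' z / g z)%C m (kap + 6 / 10))) as RR. apply Rabs_le_between in RR.
  assert (PD : 0 < / (kap + delta) ^ S m) by (apply Rinv_0_lt_compat, pow_lt; lra).
  pose proof (clsum_re_ge (fun rho => - / rho ^ S m + (Cconj rho / (R1 * R1)) ^ S m)%C
    (fun rho => (290 / (kap + delta) ^ S m) * bdefect R1 rho p) zs) as Z.
  rewrite rlsum_scal in Z.
  assert (Z' : - Re (clsum (fun rho => - / rho ^ S m + (Cconj rho / (R1 * R1)) ^ S m)%C zs) <=
     290 / (kap + delta) ^ S m * rlsum (fun rho => bdefect R1 rho p) zs).
  { apply Z. intros rho Hr.
    eapply Rle_trans; [|exact (zero_term_bound K delta HK Hdel rho (proj2 (Hzs rho Hr)) (Loc rho Hr))]. right.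
    fold kap m R1.
    match goal with |- - Re (- ?a + ?b)%C = _ => change (- (- Re a + Re b) = Re a + - Re b) end. ring. }
  assert (Z2 : 290 / (kap + delta) ^ S m * rlsum (fun rho => bdefect R1 rho p) zs <= 290 / (kap + delta) ^ S m * (2 * Lg)).
  { apply Rmult_le_compat_l; [unfold Rdiv; nra|assumption]. }
  assert (0 <= Lg * / (kap + delta) ^ S m) by (apply Rmult_le_pos; lra).
  unfold Rdiv in *. lra.
Qed.
End ShiftedL.

(** * The least character non-residue *)

Lemma ncp_real n x : nat_cpow_opp n (RtoC x) = RtoC (npw n x).
Proof. rewrite ncp_Cexp. unfold npw. rewrite <- Cexp_real. f_equal. apply Ceq_re_im; simpl; ring. Qed.

Lemma Re_csum f n : Re (csum f n) = rsum (fun k => Re (f k)) n.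
Proof. induction n as [|n IH]; [reflexivity|]. simpl csum. simpl rsum. rewrite <- IH. reflexivity. Qed.

Lemma weighted_prime_sum_le q chi L L' K N : is_dirichlet_character q chi ->
  (forall z, cder L z (L' z)) -> (forall s, 1 < Re s -> dlim chi s (L s)) -> (100 <= K)%nat -> (1 <= N)%nat ->
  rsum (fun k => Lambda (S k) * Re (chi (S k)) * weight K (S k)) N <=
  - Re (coef (fun z => L' (RtoC (INR K + 1) + z) / L (RtoC (INR K + 1) + z))%C (2 * K * K) 1) + 14 / INR N.
Proof.
  intros Hchi HL Hser HK HN. pose proof (K_ge_100 K HK) as Kp.
  pose proof (log_deriv_coefficient q chi L L' Hchi HL Hser (INR K + 1) (2 * K * K) N ltac:(lra) HN) as H.
  match type of H with Cmod (?a + ?b)%C <= _ => set (X := a) in *; set (Y := b) in * end.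
  assert (E : rsum (fun k => Lambda (S k) * Re (chi (S k)) * weight K (S k)) N = Re Y).
  { unfold Y. rewrite Re_csum. apply rsum_ext. intros k _. rewrite ncp_real.
    set (n := S k). unfold Lambda_coef, weight.
    assert (Ev : ((- RtoC (ln (INR n))) ^ (2 * K * K))%C = RtoC (ln (INR n) ^ (2 * K * K))).
    { rewrite <- RtoC_opp, <- RtoC_pow. f_equal. replace (2 * K * K)%nat with (2 * (K * K))%nat by lia.
      rewrite (pow_mult (- _) 2), (pow_mult (ln _) 2). f_equal. ring. }
    rewrite Ev.
    assert (NF : INR (fact (2 * K * K)) <> 0) by (apply not_0_INR, fact_neq_0).
    rewrite <- RtoC_div by assumption. rewrite <- RtoC_mult. rewrite (Cmult_comm (Lambda n)), <- Cmult_assoc, <- RtoC_mult.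
    rewrite re_scal_r. unfold Rdiv. ring. }
  pose proof (re_le_Cmod (X + Y)%C) as R. apply Rabs_le_between in R. change (Re (X + Y)%C) with (Re X + Re Y) in R. lra.
Qed.

(** Cancelling [K^{-(m+1)}] between the lower and the upper bound for [- c] leaves [(1 + delta / K)^{m+1}],
    which is about [exp (2 delta K)]. *)
Lemma conductor_lower : exists K1 : nat, (100 <= K1)%nat /\ forall (K q : nat) chi L L' delta, (K1 <= K)%nat ->
  is_dirichlet_character q chi -> ~ is_principal q chi ->
  (forall z, cder L z (L' z)) -> (forall s, 1 < Re s -> dlim chi s (L s)) ->
  0 < delta < 1 / 2 -> (forall s, 1 - delta < Re s < 1 -> L s <> 0%C) ->
  ln (INR q) <= exp (INR K) ->
  (forall n, (1 <= n)%nat -> INR n <= exp (2 * INR K + 24) -> Nat.gcd n q = 1%nat -> chi n = 1%C) ->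
  exp (2 * delta * INR K) <= 288000 * exp 37 * (ln (INR q) + 11 + 2 * INR K).
Proof.
  destruct main_term_lower as (K1 & HK1 & Main). exists K1. split; [assumption|].
  intros K q chi L L' delta HK Hchi Hnp HL Hser Hdel Hzf Hq Hone.
  assert (HK100 : (100 <= K)%nat) by lia. pose proof (K_ge_100 K HK100) as Kp.
  pose proof (log_deriv_coef_upper q chi L L' K delta Hchi Hnp HL Hser Hzf HK100 Hdel) as Up.
  set (Lg := ln (2 * (860 * INR q * (INR K + 1) ^ 2))) in *.
  set (c := coef (fun z => L' (RtoC (INR K + 1) + z) / L (RtoC (INR K + 1) + z))%C (2 * K * K) 1) in *.
  assert (Low : peak K * (exp (-36) / 16) <= - Re c).
  { apply le_epsilon. intros eps He.
    destruct (INR_unbounded (exp (2 * INR K + 24) + 14 / eps + 1)) as [N HN].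
    pose proof (exp_pos (2 * INR K + 24)). assert (0 < 14 / eps) by (apply Rdiv_lt_0_compat; lra).
    assert (HN1 : (1 <= N)%nat) by (apply INR_le; simpl; lra).
    pose proof (Main K HK q chi Hchi Hq Hone N ltac:(lra)) as M.
    pose proof (weighted_prime_sum_le q chi L L' K N Hchi HL Hser HK100 HN1) as W. fold c in W.
    assert (14 / INR N <= eps).
    { apply Rmult_le_reg_r with (INR N); [lra|]. unfold Rdiv. rewrite Rmult_assoc, Rinv_l by lra.
      apply Rle_trans with (eps * (14 / eps)); [right; field; lra|]. apply Rmult_le_compat_l; lra. }
    lra. }
  pose proof (peak_lower K HK100) as PL. pose proof (growth_lower K delta HK100 Hdel) as G.
  replace (2 * K * K + 1)%nat with (S (2 * K * K)) in PL by lia.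
  set (k := S (2 * K * K)) in *.
  assert (P1 : 0 < INR K ^ k) by (apply pow_lt; lra).
  assert (P2 : 0 < (INR K + delta) ^ k) by (apply pow_lt; lra).
  assert (X : / (6 * INR K ^ k) * (exp (-36) / 16) <= 3000 * Lg / (INR K + delta) ^ k).
  { eapply Rle_trans; [|exact Up]. eapply Rle_trans; [|exact Low]. apply Rmult_le_compat_r; [|assumption].
    pose proof (exp_pos (-36)). lra. }
  unfold Rdiv in G. rewrite Rpow_mult_distr, pow_inv in G.
  assert (Y : (INR K + delta) ^ k * / INR K ^ k <= 288000 * exp 36 * Lg).
  { apply Rmult_le_compat_r with (r := 96 * exp 36 * (INR K + delta) ^ k) in X.
    - replace (3000 * Lg / (INR K + delta) ^ k * (96 * exp 36 * (INR K + delta) ^ k)) with (288000 * exp 36 * Lg) in X by (field; lra).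
      replace (/ (6 * INR K ^ k) * (exp (-36) / 16) * (96 * exp 36 * (INR K + delta) ^ k)) with
        ((INR K + delta) ^ k * / INR K ^ k * (exp (-36) * exp 36)) in X by (field; lra).
      rewrite <- exp_plus in X. replace (-36 + 36) with 0 in X by ring. rewrite exp_0, Rmult_1_r in X. exact X.
    - pose proof (exp_pos 36). apply Rmult_le_pos; lra. }
  assert (Iq : 1 <= INR q) by (apply INR_ge1, (dchar_modulus_pos _ _ Hchi)).
  assert (LgU : Lg <= ln (INR q) + 11 + 2 * INR K).
  { unfold Lg. replace (2 * (860 * INR q * (INR K + 1) ^ 2)) with (INR q * (1720 * ((INR K + 1) * (INR K + 1)))) by ring.
    rewrite !ln_mult by (try lra; apply Rmult_lt_0_compat; nra).
    assert (T : ln 1720 <= 11).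
    { rewrite <- (ln_exp 11). apply ln_le; [lra|]. pose proof (exp_nat_lower 11) as Y11. replace (INR 11) with 11 in Y11 by (simpl; ring).
      simpl in Y11. lra. }
    pose proof (ln_le_sub1 (INR K + 1) ltac:(lra)). lra. }
  replace (2 * delta * INR K) with ((2 * delta * INR K - 1) + 1) by ring. rewrite exp_plus.
  replace 37 with (36 + 1) at 1 by ring. rewrite exp_plus.
  pose proof (exp_pos 1). pose proof (exp_pos 36).
  apply Rle_trans with (288000 * exp 36 * Lg * exp 1).
  - apply Rmult_le_compat_r; lra.
  - replace (288000 * (exp 36 * exp 1) * (ln (INR q) + 11 + 2 * INR K)) with (288000 * exp 36 * (ln (INR q) + 11 + 2 * INR K) * exp 1) by ring.
    apply Rmult_le_compat_r; [lra|]. apply Rmult_le_compat_l; lra.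
Qed.

(** Modulo 1 and 2 there is a single reduced residue class. *)
Lemma modulus_ge_3 q chi : is_dirichlet_character q chi -> ~ is_principal q chi -> (3 <= q)%nat.
Proof.
  intros Hchi Hnp. destruct (Nat.le_gt_cases 3 q) as [H|H]; [assumption|]. exfalso. apply Hnp.
  pose proof (dchar_modulus_pos _ _ Hchi) as Hq.
  intros n Hn. rewrite <- (dchar_mod q chi Hchi n).
  assert (Q : q = 1%nat \/ q = 2%nat) by lia. destruct Q as [-> | ->].
  - rewrite Nat.mod_1_r. rewrite <- (dchar_periodic _ _ Hchi 0). exact (dchar_1 _ _ Hchi).
  - pose proof (Nat.mod_upper_bound n 2 ltac:(lia)) as U. destruct (n mod 2) as [|[|r]] eqn:E.
    + exfalso. apply Nat.Div0.mod_divides in E. destruct E as [c ->].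
      assert (D : Nat.divide 2 (Nat.gcd (2 * c) 2)) by (apply Nat.gcd_greatest; [exists c; lia|exists 1%nat; lia]).
      rewrite Hn in D. destruct D as [d D]. lia.
    + exact (dchar_1 _ _ Hchi).
    + lia.
Qed.

Theorem theorem2 :
  forall delta : R, 0 < delta < 1 / 2 ->
  exists A : R, 0 < A /\
    forall (q : nat) (chi : nat -> C) (L : C -> C) (n : nat),
      is_dirichlet_character q chi ->
      ~ is_principal q chi ->
      is_dirichlet_L chi L ->
      (forall s : C, 1 - delta < Re s < 1 -> L s <> RtoC 0) ->
      is_least_nonresidue q chi n ->
      INR n <= A * Rpower (ln (INR q)) (1 / delta).
Proof.
  intros delta Hdel. destruct conductor_lower as (K1 & HK1 & Core).
  set (c := 288000 * exp 37). assert (Hc : 1 <= c) by (unfold c; pose proof (exp_ineq1_le 37); lra).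
  destruct (exp_linear_bound (4 * c * 11) (4 * c * 2) (2 * delta) ltac:(lra)) as [K2 HK2].
  set (b := 4 * c). set (K0 := (K1 + K2)%nat).
  (* The bound is [exp (2 K + 24)] with [K <= K0 + y + 1], and [exp (2 y)] is [(b ln q)^{1/delta}]. *)
  exists (exp (26 + 2 * INR K0) * Rpower b (1 / delta)).
  split; [apply Rmult_lt_0_compat; apply exp_pos|].
  intros q chi L n Hchi Hnp [HL Hser] Hzf [[Hn1 [Hng Hn]] Hleast].
  pose proof (modulus_ge_3 q chi Hchi Hnp) as Hq3.
  assert (Hlq : 1 <= ln (INR q)).
  { rewrite <- (ln_exp 1) at 1. apply ln_le; [apply exp_pos|]. apply le_INR in Hq3. simpl INR in Hq3. pose proof exp_le_3. lra. }
  set (l := ln (INR q)) in *.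
  assert (Hbl : 1 <= b * l) by (unfold b; nra).
  (* As [exp (2 delta y) = 4 c ln q], for [K >= y] the [ln q] term in the upper bound for [exp (2 delta K)] is at
     most a quarter of [exp (2 delta K)]; for [K >= K0] so is the rest of that bound. *)
  set (y := ln (b * l) / (2 * delta)).
  assert (Hy : 0 <= y).
  { unfold y. apply Rmult_le_pos; [|left; apply Rinv_0_lt_compat; lra]. rewrite <- ln_1. apply ln_le; lra. }
  destruct (floor_exists y Hy) as [j Hj].
  set (K := (K0 + S j)%nat).
  assert (IK : INR K = INR K0 + INR j + 1) by (unfold K; rewrite plus_INR, S_INR; ring).
  assert (Ey : exp (2 * delta * y) = b * l).
  { unfold y. replace (2 * delta * (ln (b * l) / (2 * delta))) with (ln (b * l)) by (field; lra). apply exp_ln; lra. }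
  assert (Gr : b * l <= exp (2 * delta * INR K)).
  { rewrite <- Ey. apply exp_le. apply Rmult_le_compat_l; [lra|]. pose proof (pos_INR K0). lra. }
  assert (Bound : INR n <= exp (2 * INR K + 24)).
  { destruct (Rle_dec (INR n) (exp (2 * INR K + 24))) as [H|H]; [assumption|]. exfalso.
    assert (Hcd : exists L', forall z, cder L z (L' z)) by (apply derivative_exists; exact (entire_cder L HL)).
    destruct Hcd as [L' HL'].
    assert (X : exp (2 * delta * INR K) <= c * (l + 11 + 2 * INR K)).
    { apply (Core K q chi L L' delta); try assumption.
      - unfold K, K0. lia.
      - intros s Hs. apply dlim_of_series. apply Hser, Hs.
      - apply Rle_trans with (exp (2 * delta * INR K)).
        + fold l. eapply Rle_trans; [|exact Gr]. unfold b. clear - Hc Hlq. nra.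
        + apply exp_le. pose proof (pos_INR K) as PK. clear - PK Hdel. nra.
      - intros k Hk1 Hk2 Hk3. destruct (classic (chi k = 1%C)) as [E|E]; [assumption|]. exfalso.
        specialize (Hleast k (conj Hk1 (conj Hk3 E))). apply le_INR in Hleast. lra. }
    specialize (HK2 K ltac:(unfold K, K0; lia)).
    pose proof (exp_pos (2 * delta * INR K)) as PE. unfold b in Gr. clear - X HK2 Gr PE.
    set (E := exp (2 * delta * INR K)) in *. nra. }
  eapply Rle_trans; [exact Bound|].
  assert (E1 : Rpower b (1 / delta) * Rpower l (1 / delta) = exp (2 * y)).
  { rewrite Rpower_mult_distr by (unfold b; lra). unfold Rpower. f_equal. unfold y. field. lra. }
  rewrite Rmult_assoc, E1, <- exp_plus. apply exp_le. lra.
Qed.
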